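(* Let $Q\in\mathcal{N}_{\kappa}(\mathcal{H})$ and $\hat Q(z):=-Q(z)^{-1}$. (i) $Q$ is holomorphic at $\infty$ and $Q'(\infty):=\lim_{z\to\infty}zQ(z)$ is boundedly invertible if and only if $$\hat Q(z)=\tilde\Gamma^{+}(\tilde A-z)^{-1}\tilde\Gamma+\hat S+\hat G z\qquad\text{for all } z\in\mathcal{D}(Q)\cap\mathcal{D}(\hat Q),$$ where $\tilde A$ is a self-adjoint bounded operator in the Pontryagin space $(I-P)\mathcal{K}$, $\tilde\Gamma:\mathcal{H}\to(I-P)\mathcal{K}$ is a bounded operator, $\hat S$ and $\hat G$ are self-adjoint bounded operators in the Hilbert space $\mathcal{H}$, and $\hat G$ is boundedly invertible. (ii) In that case the function $Q\in\mathcal{N}_\kappa(\mathcal{H})$ is regular.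
   Context: $(\mathcal{H},(\cdot,\cdot))$ is a Hilbert space and $\mathcal{L}(\mathcal{H})$ is the space of bounded operators on it. For an integer $\kappa\ge 0$, $\mathcal{N}_\kappa(\mathcal{H})$ is the class of functions $Q:\mathcal{D}(Q)\to\mathcal{L}(\mathcal{H})$ that are meromorphic in $\mathbb{C}\setminus\mathbb{R}$, satisfy $Q(z)^*=Q(\bar z)$, and whose kernel $\mathcal{N}_Q(z,w)=\frac{Q(z)-Q(w)^*}{z-\bar w}$, $z,w\in\mathcal{D}(Q)\cap\mathbb{C}^+$ (with $\mathcal{N}_Q(z,\bar z):=Q'(z)$), has $\kappa$ negative squares: every Hermitian matrix $((\mathcal{N}_Q(z_i,z_j)h_i,h_j))_{i,j=1}^n$ has at most $\kappa$ negative eigenvalues, and for at least one choice of $n,z_i,h_i$ it has exactly $\kappa$. $\mathcal{D}(Q)$ is the domain of $Q$, and $\mathcal{D}(\hat Q)$ is the domain of $\hat Q$. ''$Q$ is holomorphic at $\infty$'' means that $Q$ is holomorphic in a neighbourhood of $\infty$ and the limit $Q'(\infty)=\lim_{z\to\infty}zQ(z)$ exists in the operator norm. This is equivalent to $Q$ having a minimal representation $Q(z)=\Gamma^{+}(A-z)^{-1}\Gamma$, $z\in\mathcal{D}(Q)$, with $A$ a bounded self-adjoint operator in a Pontryagin space $(\mathcal{K},[\cdot,\cdot])$ and $\Gamma:\mathcal{H}\to\mathcal{K}$ bounded, where minimal means that $\mathcal{K}$ is the closed linear span of $\{(A-z)^{-1}\Gamma h: z\in\rho(A),\,h\in\mathcal{H}\}$;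 then $Q'(\infty)=-\Gamma^{+}\Gamma$. Notation $\mathcal{K}$ and $P$: $\mathcal{K}$ and $\Gamma$ are those of this representation of $Q$, and $P:=\Gamma(\Gamma^{+}\Gamma)^{-1}\Gamma^{+}$ (where $\Gamma^{+}\Gamma$ is boundedly invertible) is an orthogonal projection in $\mathcal{K}$, and $(I-P)\mathcal{K}$ is a Pontryagin space with the inner product of $\mathcal{K}$. For a bounded operator $T$ from $\mathcal{H}$ to a Pontryagin space with inner product $[\cdot,\cdot]$, the adjoint $T^{+}$ is defined by $(T^{+}k,h)=[k,Th]$. $Q\in\mathcal{N}_\kappa(\mathcal{H})$ is called regular if there is a point $w_0\in\mathcal{D}(Q)\cap\mathbb{C}^+$ such that $Q(w_0)$ is boundedly invertible. *)

(* Defs.v *)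
From HB Require Import structures.
From mathcomp Require Import all_boot all_order all_algebra.
From mathcomp Require Import sesquilinear.
From mathcomp Require Import boolp classical_sets reals topology normedtype.
From mathcomp Require Import complex.

Set Implicit Arguments.
Unset Strict Implicit.
Unset Printing Implicit Defensive.

Import Order.TTheory GRing.Theory Num.Theory Num.Def.
Import numFieldNormedType.Exports.

Local Open Scope classical_set_scope.
Local Open Scope ring_scope.

(* The complex numbers over R, typed as a numClosedFieldType so that the
   library finds their topology.  A comparison [x < y] or [x <= y] in this type
   implies that y - x is real. *)
Definition Cplx (R : realType) : numClosedFieldType := R[i].

(** * The range of a linear endomorphism, as a vector space *)

Section RangeSpace.
Context (C : numClosedFieldType) (V : lmodType C) (T : {linear V -> V}).

Definition range_pred : {pred V} := [pred x | `[< exists y, x = T y >]].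

Fact range_pred_submod_closed : submod_closed range_pred.
Proof.
split; first by apply/asboolP; exists 0; rewrite linear0.
move=> a x y /asboolP[x' ->] /asboolP[y' ->].
by apply/asboolP; exists (a *: x' + y'); rewrite linearP.
Qed.

HB.instance Definition _ :=
  GRing.isSubmodClosed.Build C V range_pred range_pred_submod_closed.

Definition range_space : Type := {x : V | x \in range_pred}.
HB.instance Definition _ := SubChoice.on range_space.
HB.instance Definition _ := [SubChoice_isSubLmodule of range_space by <:].

Context (f : {hermitian V for false & conjC}).

Definition range_form (x y : range_space) : C := f (\val x) (\val y).

Fact range_form_linearl y : GRing.linear_for *%R (range_form ^~ y).
Proof. by move=> a x x'; exact: linearPl. Qed.

Fact range_form_linearr x :
  GRing.linear_for (conjC \; *%R) (range_form x).
Proof. by move=> a y y'; exact: linearPr. Qed.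

HB.instance Definition _ :=
  bilinear_isBilinear.Build C range_space range_space C *%R (conjC \; *%R)
    range_form (range_form_linearl, range_form_linearr).

Fact range_form_herm x y :
  range_form x y = (-1) ^+ false * conjC (range_form y x).
Proof. exact: hermitian_subproof. Qed.

HB.instance Definition _ :=
  isHermitianSesquilinear.Build C range_space false conjC
    range_form range_form_herm.
End RangeSpace.
Arguments range_form {C V} T f x y.

(** * Bounded operators *)

Section Operators.
Context (C : numClosedFieldType).

Definition fnorm (V : lmodType C) (f : V -> V -> C) (x : V) : C :=
  sqrtC (f x x).

Definition fcomplete (V : lmodType C) (f : V -> V -> C) :=
  forall u : nat -> V,
    (forall e : C, 0 < e -> exists N, forall m n,
      (N <= m)%N -> (N <= n)%N -> fnorm f (u m - u n) < e) ->
  exists l, forall e : C, 0 < e -> exists N, forall n,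
      (N <= n)%N -> fnorm f (u n - l) < e.

Definition bounded_op (V W : lmodType C) (nV : V -> C) (nW : W -> C)
    (T : V -> W) :=
  exists M : C, forall x, nW (T x) <= M * nV x.

(* S = T^-1 as a bounded operator *)
Definition bounded_inverse (V W : lmodType C) (nV : V -> C) (nW : W -> C)
    (T : V -> W) (S : {linear W -> V}) :=
  [/\ bounded_op nW nV S, cancel T S & cancel S T].

Definition boundedly_invertible (V W : lmodType C) (nV : V -> C)
    (nW : W -> C) (T : V -> W) :=
  exists S : {linear W -> V}, bounded_inverse nV nW T S.

(* S is the adjoint of T: (S k, h) = [k, T h] *)
Definition adjoint (V W : lmodType C) (fV : V -> V -> C) (fW : W -> W -> C)
    (T : V -> W) (S : W -> V) :=
  forall k h, fV (S k) h = fW k (T h).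

Definition bounded_selfadjoint (V : lmodType C) (f : V -> V -> C)
    (n : V -> C) (T : V -> V) :=
  bounded_op n n T /\ adjoint f f T T.

(* S = (A - z)^-1 as a bounded operator; such an S exists iff z \in rho(A) *)
Definition resolvent (V : lmodType C) (n : V -> C) (A : V -> V) (z : C)
    (S : {linear V -> V}) :=
  bounded_inverse n n (fun x => A x - z *: x) S.

(* the operator norm of T is at most e *)
Definition opnorm_le (V : lmodType C) (n : V -> C) (T : V -> V) (e : C) :=
  forall x, n (T x) <= e * n x.

End Operators.

(** * Pontryagin spaces *)

Section Pontryagin.
Context (C : numClosedFieldType) (K : lmodType C).
Context (f : {hermitian K for false & conjC}).

(* J is a fundamental symmetry of (K, f): with K+ and K- the eigenspaces of J
   for 1 and -1, K = K+ [+] K- is a fundamental decomposition.  The Pontryagin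
   space carries the topology of the Hilbert space norm [jnorm J]; the norms of
   any two fundamental symmetries are equivalent. *)
Definition jform (J : K -> K) (x y : K) : C := f (J x) y.
Definition jnorm (J : K -> K) : K -> C := fnorm (jform J).

Record pontryagin (J : {linear K -> K}) : Prop := Pontryagin {
  J_invol : forall x, J (J x) = x;
  J_sym : forall x y, f (J x) y = f x (J y);
  J_pos : forall x, x != 0 -> 0 < jform J x x;
  J_complete : fcomplete (jform J);
  J_findim : exists n (e : 'I_n -> K), forall x, J x = - x ->
    exists c : 'I_n -> C, x = \sum_(i < n) c i *: e i
}.

End Pontryagin.

(** * Operator functions on a Hilbert space *)

Section OperatorFunctions.
Context (R : realType).
Notation C := (Cplx R).
Context (H : lmodType C) (dot : {dot H for conjC}).
Notation nH := (fnorm dot).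

Definition hilbert := fcomplete dot.

Implicit Types (D U : set C) (Q F : C -> {linear H -> H}).

(* U is open and F has a complex derivative in operator norm on U *)
Definition holomorphic_on U F :=
  open U /\ forall z, U z ->
    bounded_op nH nH (F z) /\
    exists2 F' : {linear H -> H}, bounded_op nH nH F' &
      forall e : C, 0 < e -> \forall w \near z,
        opnorm_le nH (fun h => F w h - F z h - (w - z) *: F' h)
                  (e * `|w - z|).

(* Outside of the real line Q, with domain D, has only isolated singularities,
   and these are poles (or removable). *)
Definition meromorphic_off_reals D Q :=
  forall z : C, 'Im z != 0 ->
    exists (m : nat) (U : set C) (F : C -> {linear H -> H}),
      [/\ U z, holomorphic_on U F &
          forall w, U w -> w != z ->
            D w /\ forall h, F w h = (w - z) ^+ m *: Q w h].

(* number of negative eigenvalues, counted with multiplicity *)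
Definition neg_eigenvalues n (A : 'M[C]_n) : nat :=
  count (fun a => a < 0) (sval (closed_field_poly_normal (char_poly A))).

(* The matrix of the (N_Q (z_i, z_j) h_i, h_j), where N_Q (z, w) is
   (Q z - Q w ^* ) / (z - w ^* ): the adjoint of Q w has been moved to the other
   side of the inner product.  For z and w in the upper half-plane the
   denominator does not vanish. *)
Definition kernel_matrix Q n (z : 'I_n -> C) (h : 'I_n -> H) : 'M[C]_n :=
  \matrix_(i, j) ((dot (Q (z i) (h i)) (h j) - dot (h i) (Q (z j) (h j)))
                  / (z i - (z j)^*)).

(* The class N_kappa(H).  The domain D may contain real points, but always as
   interior points: Q is holomorphic on D. *)
Record Nclass (kappa : nat) D Q : Prop := NClass {
  N_holomorphic : holomorphic_on D Q;
  N_meromorphic : meromorphic_off_reals D Q;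
  N_symmetric : forall z, D z -> D z^* /\ adjoint dot dot (Q z) (Q z^*);
  N_neg_le : forall n (z : 'I_n -> C) (h : 'I_n -> H),
    (forall i, D (z i) /\ 0 < 'Im (z i)) ->
    (neg_eigenvalues (kernel_matrix Q z h) <= kappa)%N;
  N_neg_eq : exists n (z : 'I_n -> C) (h : 'I_n -> H),
    (forall i, D (z i) /\ 0 < 'Im (z i)) /\
    neg_eigenvalues (kernel_matrix Q z h) = kappa
}.

(* Q is holomorphic at infinity, with Q'(oo) = lim z Q z = L in operator norm.
   As D need not be the maximal domain of holomorphy of Q (it may omit real
   points near infinity), this is expressed through a holomorphic F which
   extends Q to a neighbourhood of infinity. *)
Definition holomorphic_at_infinity D Q (L : {linear H -> H}) :=
  exists (r : C) (F : C -> {linear H -> H}),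
    [/\ 0 < r,
        holomorphic_on [set z | r < `|z|] F,
        forall z, D z -> r < `|z| -> forall h, F z h = Q z h,
        bounded_op nH nH L &
        forall e : C, 0 < e -> exists2 r' : C, r < r' &
          forall z, r' < `|z| ->
            opnorm_le nH (fun h => z *: F z h - L h) e].

Definition invertible_derivative_at_infinity D Q :=
  exists2 L : {linear H -> H},
    holomorphic_at_infinity D Q L & boundedly_invertible nH nH L.

Definition regular D Q :=
  exists2 w, D w /\ 0 < 'Im w & boundedly_invertible nH nH (Q w).

(* Q z = Gp (A - z)^-1 Gam for z \in D is a minimal representation of Q, where
   Gp is the adjoint of Gam *)
Definition minimal_representation D Q (K : lmodType C)
    (f : {hermitian K for false & conjC}) (A : {linear K -> K})
    (Gam : {linear H -> K}) (Gp : {linear K -> H}) :=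
  exists J : {linear K -> K}, let nK := jnorm f J in
  [/\ pontryagin f J,
      bounded_selfadjoint f nK A,
      bounded_op nH nK Gam /\ adjoint dot f Gam Gp,
      forall z, D z -> exists2 S : {linear K -> K}, resolvent nK A z S &
        forall h, Q z h = Gp (S (Gam h)) &
      forall (x : K) (e : C), 0 < e ->
        exists n (z : 'I_n -> C) (S : 'I_n -> {linear K -> K})
               (h : 'I_n -> H),
          (forall i, resolvent nK A (z i) (S i)) /\
          nK (x - \sum_(i < n) S i (Gam (h i))) < e].

(* The function Qhat = - Q^-1 has a non-empty domain, namely the set of the
   z \in D with Q z boundedly invertible, and on it
   Qhat z = Gp (A - z)^-1 Gam + S + z G,  with Gp the adjoint of Gam. *)
Definition inverse_representation D Q (K : lmodType C)
    (f : {hermitian K for false & conjC}) :=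
  (exists2 z, D z & boundedly_invertible nH nH (Q z)) /\
  exists (J A : {linear K -> K}) (Gam : {linear H -> K}) (Gp : {linear K -> H})
         (S G : {linear H -> H}), let nK := jnorm f J in
  [/\ pontryagin f J,
      bounded_selfadjoint f nK A,
      bounded_op nH nK Gam /\ adjoint dot f Gam Gp,
      [/\ bounded_selfadjoint dot nH S, bounded_selfadjoint dot nH G
        & boundedly_invertible nH nH G] &
      forall z (Qinv : {linear H -> H}), D z ->
        bounded_inverse nH nH (Q z) Qinv ->
        exists2 Rz : {linear K -> K}, resolvent nK A z Rz &
          forall h, - Qinv h = Gp (Rz (Gam h)) + S h + z *: G h].

(* P = Gam (Gp Gam)^-1 Gp, where GG is the inverse of Gp Gam *)
Definition proj (K : lmodType C) (Gam : {linear H -> K})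
    (Gp : {linear K -> H}) (GG : {linear H -> H}) : {linear K -> K} :=
  Gam \o GG \o Gp.

(* I - P *)
Definition coproj (K : lmodType C) (Gam : {linear H -> K})
    (Gp : {linear K -> H}) (GG : {linear H -> H}) : {linear K -> K} :=
  idfun \- proj Gam Gp GG.

End OperatorFunctions.

(* Main.v *)
Require Import Defs.
From HB Require Import structures.
From mathcomp Require Import all_boot all_order all_algebra.
From mathcomp Require Import sesquilinear spectral.
From mathcomp Require Import boolp classical_sets functions reals topology normedtype.
From mathcomp Require Import complex.
From mathcomp Require Import ring lra.
From mathcomp Require multinomials.freeg.

Set Implicit Arguments.
Unset Strict Implicit.
Unset Printing Implicit Defensive.

Import Order.TTheory GRing.Theory Num.Theory Num.Def.

Local Open Scope classical_set_scope.
Local Open Scope ring_scope.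

(** The Pontryagin space is generated by the kernel of Q. On the free module over the pairs (z, h)
    the kernel defines a Hermitian form, and by [neg_eigenvalues_ge] it has at most kappa negative
    squares. Reversing its sign on a maximal negative orthonormal family leaves a positive
    semidefinite form. Completion in that form gives a Pontryagin space K with a total family
    [ep z h] ([kernel_space]), which later turns out to be (A - z)^-1 Gam h.

    Forward direction. Put zeta = -1/z. The Gram kernel of zeta^-1 [ep z h] extends analytically to
    zeta = 0, and this alone forces these vectors to have a power series in zeta along the imaginary
    axis. They converge because their inner products and their finitely many negative components
    converge, and the difference quotient has a Gram kernel of the same type, so the argument
    repeats ([local_expansion]). The Gram matrix of the coefficients is of Hankel type, so the shift
    of the coefficients is symmetric. Its orbits grow at most exponentially, and log-convexity of
    the norms along an orbit turns this into boundedness ([symmetric_bound], [op_extension]). The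
    negative of the shift is A and the zeroth coefficient is Gam h ([minimal_of_infinity]). For
    nonreal z in D the operator A - z is injective and differs by finite rank from J A - z, which is
    invertible by self-adjointness of J A in the Hilbert space, so A - z is invertible
    ([resolvent_of_injective]). At a real point x0 of D the expansion argument, applied at x0,
    produces the inverse of A - x0 ([rsv_real]).

    Comparison at large z in any minimal representation shows that Gp Gam is minus the derivative at
    infinity, hence invertible. Eliminating the range of Gam, a Schur complement for K = P K + (I -
    P) K, gives the formula for - Q^-1 ([schur_inverse], [inverse_of_minimal]). Regularity holds
    because z Q(z) is close to an invertible operator at large points iy of D.

    Converse. For large |z| the right-hand side T(z) of the representation is dominated by z G, so
    it is invertible, and F = - T^-1 is holomorphic with z F(z) tending to - G^-1. That F agrees
    with Q on D requires Q(z) to be invertible at every large z in D, while one such point at an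
    unspecified place is given. Invertibility of Q is an open condition. Where A - z is invertible
    it is also a closed one, because the representation bounds the inverses uniformly nearby. As A
    has finitely many eigenvalues in the upper half-plane, invertibility spreads over the rest of it
    ([continuation], [invertible_upper]); adjoints and closedness reach the lower half-plane and the
    real points ([infinity_of_inverse]).

    The complex analysis needed is Taylor expansion with a remainder estimate ([taylor0]) and
    isolation of zeros ([tayl_dichotomy]). Both are derived from midpoint sums over dyadic squares,
    without integrals. *)

(** * Real-valued coordinates and modulus of complex numbers *)

Section Modulus.
Context (R : realType).
Local Notation C := (Cplx R).
Implicit Types (x y : R) (z w : C).

(** Coordinates and modulus take values in R, so that estimates become inequalities in a real field
    instead of the partially ordered C. *)
Definition re z : R := complex.Re z.
Definition im z : R := complex.Im z.
Definition rc x : C := real_complex R x.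
Definition mkc x y : C := Complex x y.
Definition cn z : R := Num.sqrt (re z ^+ 2 + im z ^+ 2).

Lemma normE z : `|z| = rc (cn z).
Proof. exact: normc_def. Qed.

Lemma c_ext z w : re z = re w -> im z = im w -> z = w.
Proof. by case: z => a b; case: w => c d; rewrite /re /im /= => -> ->. Qed.

Lemma re_mkc x y : re (mkc x y) = x. Proof. by []. Qed.
Lemma im_mkc x y : im (mkc x y) = y. Proof. by []. Qed.
Lemma re_rc x : re (rc x) = x. Proof. by []. Qed.
Lemma im_rc x : im (rc x) = 0. Proof. by []. Qed.
Lemma re0 : re 0 = 0. Proof. by []. Qed.
Lemma im0 : im 0 = 0. Proof. by []. Qed.
Lemma re1 : re 1 = 1. Proof. by []. Qed.
Lemma im1 : im 1 = 0. Proof. by []. Qed.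
Lemma reD z w : re (z + w) = re z + re w.
Proof. by case: z => a b; case: w. Qed.
Lemma imD z w : im (z + w) = im z + im w.
Proof. by case: z => a b; case: w. Qed.
Lemma reN z : re (- z) = - re z. Proof. by case: z. Qed.
Lemma imN z : im (- z) = - im z. Proof. by case: z. Qed.
Lemma reB z w : re (z - w) = re z - re w. Proof. by rewrite reD reN. Qed.
Lemma imB z w : im (z - w) = im z - im w. Proof. by rewrite imD imN. Qed.
Lemma reM z w : re (z * w) = re z * re w - im z * im w.
Proof. by case: z => a b; case: w. Qed.
Lemma imM z w : im (z * w) = re z * im w + im z * re w.
Proof. by case: z => a b; case: w => c d; rewrite /im /re /= [b * c]mulrC. Qed.

Lemma ImE_rc z : 'Im z = rc (im z). Proof. exact/esym/complexIm. Qed.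
Lemma reJ z : re z^* = re z. Proof. by case: z. Qed.
Lemma imJ z : im z^* = - im z. Proof. by case: z. Qed.
Lemma conj_rc x : (rc x)^* = rc x.
Proof. by apply: c_ext; rewrite ?reJ ?imJ ?im_rc ?oppr0. Qed.

Lemma conjD z w : (z + w)^* = z^* + w^*. Proof. exact: rmorphD. Qed.
Lemma conjB z w : (z - w)^* = z^* - w^*. Proof. exact: rmorphB. Qed.
Lemma conjN z : (- z)^* = - z^*. Proof. exact: rmorphN. Qed.
Lemma conjM z w : (z * w)^* = z^* * w^*. Proof. exact: rmorphM. Qed.
Lemma conjX z n : (z ^+ n)^* = z^* ^+ n. Proof. exact: rmorphXn. Qed.
Lemma conjV z : (z^-1)^* = (z^*)^-1. Proof. exact: fmorphV. Qed.
Lemma conj0 : (0 : C)^* = 0. Proof. exact: rmorph0. Qed.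
Lemma conj1 : (1 : C)^* = 1. Proof. exact: rmorph1. Qed.
Lemma conj_sum (I : Type) (r : seq I) (P : pred I) (F : I -> C) :
  (\sum_(i <- r | P i) F i)^* = \sum_(i <- r | P i) (F i)^*.
Proof. exact: rmorph_sum. Qed.

Lemma rcD x y : rc (x + y) = rc x + rc y. Proof. exact: rmorphD. Qed.
Lemma rcB x y : rc (x - y) = rc x - rc y. Proof. exact: rmorphB. Qed.
Lemma rcN x : rc (- x) = - rc x. Proof. exact: rmorphN. Qed.
Lemma rcM x y : rc (x * y) = rc x * rc y. Proof. exact: rmorphM. Qed.
Lemma rcX x n : rc (x ^+ n) = rc x ^+ n. Proof. exact: rmorphXn. Qed.
Lemma rcV x : rc x^-1 = (rc x)^-1. Proof. exact: fmorphV. Qed.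
Lemma rc0 : rc 0 = 0. Proof. by []. Qed.
Lemma rc1 : rc 1 = 1. Proof. by []. Qed.
Lemma rc_nat n : rc n%:R = n%:R. Proof. exact: rmorph_nat. Qed.
Lemma rc_inj : injective rc. Proof. by move=> x y []. Qed.
Lemma rc_eq0 x : (rc x == 0) = (x == 0). Proof. exact: fmorph_eq0. Qed.
Lemma le_rc x y : (rc x <= rc y) = (x <= y). Proof. exact: lecR. Qed.
Lemma lt_rc x y : (rc x < rc y) = (x < y). Proof. exact: ltcR. Qed.

Lemma rc_re z : im z = 0 -> z = rc (re z).
Proof. by move=> h; apply: c_ext; rewrite ?im_rc. Qed.
Lemma le_cE z w : (z <= w) = (im w == im z) && (re z <= re w).
Proof. exact: lecE. Qed.
Lemma lt_cE z w : (z < w) = (im w == im z) && (re z < re w).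
Proof. exact: ltcE. Qed.
Lemma ge0_rc z : 0 <= z -> z = rc (re z).
Proof. by rewrite le_cE => /andP[/eqP h _]; apply: rc_re. Qed.

Lemma re_rcM x z : re (rc x * z) = x * re z.
Proof. by rewrite reM im_rc mul0r subr0. Qed.
Lemma im_rcM x z : im (rc x * z) = x * im z.
Proof. by rewrite imM im_rc mul0r addr0. Qed.

Lemma cn_ge0 z : 0 <= cn z. Proof. exact: sqrtr_ge0. Qed.
Lemma cn2 z : cn z ^+ 2 = re z ^+ 2 + im z ^+ 2.
Proof. by rewrite sqr_sqrtr // addr_ge0 // sqr_ge0. Qed.
Lemma cnM z w : cn (z * w) = cn z * cn w.
Proof. by apply: rc_inj; rewrite -normE normrM !normE rcM. Qed.
Lemma cnV z : cn z^-1 = (cn z)^-1.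
Proof. by apply: rc_inj; rewrite -normE normfV normE rcV. Qed.
Lemma cnN z : cn (- z) = cn z.
Proof. by apply: rc_inj; rewrite -!normE normrN. Qed.
Lemma cnJ z : cn z^* = cn z. Proof. by rewrite /cn reJ imJ sqrrN. Qed.
Lemma cnD z w : cn (z + w) <= cn z + cn w.
Proof. by rewrite -le_rc rcD -!normE ler_normD. Qed.
Lemma cnB z w : cn (z - w) <= cn z + cn w.
Proof. by rewrite -(cnN w) cnD. Qed.
Lemma cnBC z w : cn (z - w) = cn (w - z).
Proof. by rewrite -cnN opprB. Qed.
Lemma cnX z n : cn (z ^+ n) = cn z ^+ n.
Proof. by apply: rc_inj; rewrite -normE normrX normE rcX. Qed.
Lemma cn_rc x : cn (rc x) = `|x|.
Proof. by rewrite /cn im_rc expr0n addr0 sqrtr_sqr. Qed.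
Lemma cn0 : cn 0 = 0. Proof. by rewrite -rc0 cn_rc normr0. Qed.
Lemma cn1 : cn 1 = 1. Proof. by rewrite -rc1 cn_rc normr1. Qed.
Lemma cn_eq0 z : (cn z == 0) = (z == 0).
Proof. by rewrite -rc_eq0 -normE normr_eq0. Qed.
Lemma cn_gt0 z : (0 < cn z) = (z != 0).
Proof. by rewrite lt0r cn_ge0 andbT cn_eq0. Qed.
Lemma cn_le0 z : cn z <= 0 -> z = 0.
Proof. by move=> h; apply/eqP; rewrite -cn_eq0 eq_le h cn_ge0. Qed.
Lemma cn_re z : `|re z| <= cn z.
Proof. by rewrite -sqrtr_sqr ler_wsqrtr // lerDl sqr_ge0. Qed.
Lemma cn_im z : `|im z| <= cn z.
Proof. by rewrite -sqrtr_sqr ler_wsqrtr // lerDr sqr_ge0. Qed.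
Lemma re_le_cn z : re z <= cn z.
Proof. exact: le_trans (ler_norm _) (cn_re z). Qed.
Lemma cn_le_reim z : cn z <= `|re z| + `|im z|.
Proof.
have h : re z ^+ 2 + im z ^+ 2 <= (`|re z| + `|im z|) ^+ 2.
  rewrite sqrrD !real_normK ?num_real //.
  by have := mulr_ge0 (normr_ge0 (re z)) (normr_ge0 (im z)); lra.
apply: le_trans (ler_wsqrtr h) _.
by rewrite sqrtr_sqr ger0_norm // addr_ge0.
Qed.
Lemma mulcJ z : z * z^* = rc (cn z ^+ 2).
Proof. by rewrite rcX -normE normCK. Qed.
Lemma cn_sum (I : Type) (r : seq I) (P : pred I) (F : I -> C) :
  cn (\sum_(i <- r | P i) F i) <= \sum_(i <- r | P i) cn (F i).
Proof.
elim/big_rec2: _ => [|i y x _ h]; first by rewrite cn0.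
by apply: le_trans (cnD _ _) _; rewrite lerD2l.
Qed.
Lemma re_sum (I : Type) (r : seq I) (P : pred I) (F : I -> C) :
  re (\sum_(i <- r | P i) F i) = \sum_(i <- r | P i) re (F i).
Proof. by elim/big_rec2: _ => [|i y x _ <-]; rewrite ?reD. Qed.
Lemma im_sum (I : Type) (r : seq I) (P : pred I) (F : I -> C) :
  im (\sum_(i <- r | P i) F i) = \sum_(i <- r | P i) im (F i).
Proof. by elim/big_rec2: _ => [|i y x _ <-]; rewrite ?imD. Qed.
Lemma rc_sum (I : Type) (r : seq I) (P : pred I) (F : I -> R) :
  rc (\sum_(i <- r | P i) F i) = \sum_(i <- r | P i) rc (F i).
Proof. by elim/big_rec2: _ => [|i y x _ <-]; rewrite ?rcD. Qed.
Lemma sqrtC_rc x : 0 <= x -> sqrtC (rc x) = rc (Num.sqrt x).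
Proof.
move=> h; rewrite -[in LHS](sqr_sqrtr h) rcX sqrCK //.
by rewrite -rc0 le_rc sqrtr_ge0.
Qed.
Lemma cnDl z w : cn z - cn w <= cn (z - w).
Proof. by rewrite lerBlDr; have := cnD (z - w) w; rewrite subrK. Qed.
End Modulus.
Arguments rc {R} x : simpl never.
Arguments mkc {R} x y : simpl never.
Arguments re {R} z : simpl never.
Arguments im {R} z : simpl never.
Arguments cn {R} z : simpl never.

(** * Hermitian forms *)

Section Forms.
Context (R : realType).
Local Notation C := (Cplx R).
Context (V : lmodType C).
Implicit Types (x y z : V) (a : C) (s : V -> V -> C).

Record is_herm s : Prop := IsHerm {
  hermL : forall a x y z, s (a *: x + y) z = a * s x z + s y z;
  hermJ : forall x y, s x y = (s y x)^*
}.

(** Meant for semidefinite s. Since [Num.sqrt] is 0 on negative numbers, it makes sense for any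
    form. *)
Definition nrm s x : R := Num.sqrt (re (s x x)).

Section OneForm.
Context (s : V -> V -> C) (hs : is_herm s).

Lemma sDl x y z : s (x + y) z = s x z + s y z.
Proof. by rewrite -{1}[x]scale1r (hermL hs) mul1r. Qed.
Lemma s0l z : s 0 z = 0.
Proof. by apply: (@addrI _ (s 0 z)); rewrite -sDl !addr0. Qed.
Lemma sZl a x z : s (a *: x) z = a * s x z.
Proof. by rewrite -[a *: x]addr0 (hermL hs) s0l addr0. Qed.
Lemma sNl x z : s (- x) z = - s x z.
Proof. by rewrite -scaleN1r sZl mulN1r. Qed.
Lemma sBl x y z : s (x - y) z = s x z - s y z.
Proof. by rewrite sDl sNl. Qed.
Lemma sDr x y z : s z (x + y) = s z x + s z y.
Proof. by rewrite (hermJ hs) sDl conjD -!(hermJ hs). Qed.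
Lemma s0r z : s z 0 = 0.
Proof. by rewrite (hermJ hs) s0l conj0. Qed.
Lemma sZr a x z : s z (a *: x) = a^* * s z x.
Proof. by rewrite (hermJ hs) sZl conjM -(hermJ hs). Qed.
Lemma sNr x z : s z (- x) = - s z x.
Proof. by rewrite -scaleN1r sZr conjN conj1 mulN1r. Qed.
Lemma sBr x y z : s z (x - y) = s z x - s z y.
Proof. by rewrite sDr sNr. Qed.
Lemma s_suml (I : Type) (r : seq I) (P : pred I) (F : I -> V) z :
  s (\sum_(i <- r | P i) F i) z = \sum_(i <- r | P i) s (F i) z.
Proof. by elim/big_rec2: _ => [|i y x _ <-]; rewrite ?s0l ?sDl. Qed.
Lemma s_sumr (I : Type) (r : seq I) (P : pred I) (F : I -> V) z :
  s z (\sum_(i <- r | P i) F i) = \sum_(i <- r | P i) s z (F i).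
Proof. by elim/big_rec2: _ => [|i y x _ <-]; rewrite ?s0r ?sDr. Qed.
Lemma im_sxx x : im (s x x) = 0.
Proof. by have /(congr1 im) := hermJ hs x x; rewrite imJ; lra. Qed.
Lemma sxxE x : s x x = rc (re (s x x)).
Proof. exact: rc_re (im_sxx x). Qed.
Lemma cn_sC x y : cn (s x y) = cn (s y x).
Proof. by rewrite (hermJ hs) cnJ. Qed.

Lemma re_sxxD x y : re (s (x + y) (x + y)) =
  re (s x x) + re (s y y) + 2 * re (s x y).
Proof. by rewrite sDl !sDr !reD [s y x](hermJ hs) reJ; ring. Qed.
Lemma re_sxxB x y : re (s (x - y) (x - y)) =
  re (s x x) + re (s y y) - 2 * re (s x y).
Proof. by rewrite sBl !sBr !reB [s y x](hermJ hs) reJ; ring. Qed.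
Lemma re_sxxZ a x : re (s (a *: x) (a *: x)) = cn a ^+ 2 * re (s x x).
Proof. by rewrite sZl sZr mulrA mulcJ re_rcM. Qed.
End OneForm.

Definition is_psd s := forall x, 0 <= re (s x x).

Section Psd.
Context (s : V -> V -> C) (hs : is_herm s) (ps : is_psd s).

Lemma nrm_ge0 x : 0 <= nrm s x. Proof. exact: sqrtr_ge0. Qed.
Lemma nrm2 x : nrm s x ^+ 2 = re (s x x). Proof. exact: sqr_sqrtr. Qed.
Lemma nrm0 : nrm s 0 = 0. Proof. by rewrite /nrm (s0l hs) re0 sqrtr0. Qed.
Lemma nrmZ a x : nrm s (a *: x) = cn a * nrm s x.
Proof.
by rewrite /nrm (re_sxxZ hs) sqrtrM ?sqr_ge0 // sqrtr_sqr ger0_norm ?cn_ge0.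
Qed.
Lemma nrmN x : nrm s (- x) = nrm s x.
Proof. by rewrite -scaleN1r nrmZ cnN cn1 mul1r. Qed.
Lemma nrmBC x y : nrm s (x - y) = nrm s (y - x).
Proof. by rewrite -nrmN opprB. Qed.

Lemma cauchy_schwarz x y : cn (s x y) <= nrm s x * nrm s y.
Proof.
have h a : 0 <= re (s x x) - 2 * re (a^* * s x y) + cn a ^+ 2 * re (s y y).
  have := ps (x - a *: y); rewrite (re_sxxB hs) (re_sxxZ hs) (sZr hs).
  by rewrite addrAC.
(* The choice a = t (x, y) removes the phase and leaves a real quadratic in t. *)
have h2 (t : R) :
    0 <= re (s x x) - 2 * t * cn (s x y) ^+ 2
      + t ^+ 2 * cn (s x y) ^+ 2 * re (s y y).
  have := h (rc t * s x y).
  rewrite conjM conj_rc -mulrA re_rcM [(s x y)^* * _]mulrC mulcJ re_rc cnM.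
  by rewrite cn_rc exprMn real_normK ?num_real // mulrA.
rewrite -(@ler_sqr _ (cn (s x y)))
  ?nnegrE ?cn_ge0 ?mulr_ge0 ?nrm_ge0 //.
rewrite exprMn !nrm2.
set c := cn (s x y) ^+ 2 in h2 *; set A := re (s x x) in h2 *.
set B := re (s y y) in h2 *.
have c0 : 0 <= c by exact: sqr_ge0.
have A0 : 0 <= A by exact: ps.
have B0 : 0 <= B by exact: ps.
clearbody c A B.
(* If y has norm 0 the quadratic is affine in t, and a large t forces c = 0. Otherwise t = 1/B is
   the minimiser. *)
have [B1|B1] := eqVneq B 0.
  rewrite B1 mulr0; rewrite leNgt; apply/negP => c1.
  have := h2 ((A + 1) / c); rewrite B1 mulr0 addr0 -!mulrA mulVf ?gt_eqF //.
  by lra.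
have := h2 B^-1; rewrite exprVn.
have Bp : 0 < B by rewrite lt0r B1.
rewrite -(pmulr_lge0 _ Bp) => k.
have e : (A - 2 * B^-1 * c + (B ^+ 2)^-1 * c * B) * B = A * B - c.
  by field.
by rewrite e in k; rewrite -subr_ge0.
Qed.

Lemma nrmD x y : nrm s (x + y) <= nrm s x + nrm s y.
Proof.
rewrite -ler_sqr ?nnegrE ?addr_ge0 ?nrm_ge0 //.
rewrite sqrrD !nrm2 (re_sxxD hs).
have := le_trans (re_le_cn _) (cauchy_schwarz x y).
rewrite -mulr_natl; lra.
Qed.
Lemma nrmB x y : nrm s (x - y) <= nrm s x + nrm s y.
Proof. by rewrite -[nrm s y]nrmN nrmD. Qed.
Lemma nrmDl x y : nrm s x - nrm s y <= nrm s (x - y).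
Proof. by rewrite lerBlDr; have := nrmD (x - y) y; rewrite subrK. Qed.
Lemma nrm_sum (I : Type) (r : seq I) (P : pred I) (F : I -> V) :
  nrm s (\sum_(i <- r | P i) F i) <= \sum_(i <- r | P i) nrm s (F i).
Proof.
elim/big_rec2: _ => [|i y x _ h]; first by rewrite nrm0.
by apply: le_trans (nrmD _ _) _; rewrite lerD2l.
Qed.
Lemma parallelogram x y :
  nrm s (x + y) ^+ 2 + nrm s (x - y) ^+ 2 =
  2 * nrm s x ^+ 2 + 2 * nrm s y ^+ 2.
Proof. by rewrite !nrm2 (re_sxxD hs) (re_sxxB hs); ring. Qed.
End Psd.

Lemma fnormE s : is_herm s -> is_psd s -> forall x, fnorm s x = rc (nrm s x).
Proof. by move=> hs ps x; rewrite /fnorm (sxxE hs) sqrtC_rc. Qed.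
End Forms.
Arguments nrm {R V} s x : simpl never.

(** * Goursat's lemma for midpoint sums over squares *)

Section Null.
Context (R : realType).
Implicit Types (u v : nat -> R).

(** One-sided: the limit superior is at most 0. For moduli and norms this is convergence to 0, and
    it also expresses upper bounds up to a vanishing error. *)
Definition null u := forall e, 0 < e -> exists N, forall n, (N <= n)%N -> u n < e.

Lemma null_le u v : (forall n, u n <= v n) -> null v -> null u.
Proof.
move=> h hv e /hv[N hN]; exists N => n /hN; exact: le_lt_trans.
Qed.
Lemma null_near u v N : (forall n, (N <= n)%N -> u n <= v n) -> null v -> null u.
Proof.
move=> h hv e /hv[M hM]; exists (maxn N M) => n; rewrite geq_max => /andP[a b].
by apply: le_lt_trans (hM _ b); exact: h.
Qed.
Lemma nullD u v : null u -> null v -> null (fun n => u n + v n).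
Proof.
move=> hu hv e e0; have e2 : 0 < e / 2 by lra.
have [N hN] := hu _ e2; have [M hM] := hv _ e2.
exists (maxn N M) => n; rewrite geq_max => /andP[/hN a /hM b]; lra.
Qed.
Lemma nullZ (c : R) u : 0 <= c -> null u -> null (fun n => c * u n).
Proof.
move=> c0 hu e e0; have c1 : 0 < c + 1 by lra.
have [N hN] := hu (e / (c + 1)) (divr_gt0 e0 c1); exists N => n /hN h.
have [h1|h1] := leP (u n) 0.
  by apply: le_lt_trans e0; rewrite mulr_ge0_le0.
apply: (@lt_trans _ _ ((c + 1) * u n)); first by rewrite ltr_pM2r //; lra.
by rewrite mulrC -ltr_pdivlMr.
Qed.
Lemma null0 : null (fun=> 0).
Proof. by move=> e e0; exists 0%N. Qed.
Lemma null_shift u k : null u -> null (fun n => u (n + k)%N).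
Proof.
move=> h e /h[N hN]; exists N => n hn; apply: hN.
exact: leq_trans hn (leq_addr _ _).
Qed.
Lemma null_const (c : R) : null (fun=> c) -> c <= 0.
Proof.
move=> h; rewrite leNgt; apply/negP => /[dup] c0 /h[N /(_ _ (leqnn _))].
by rewrite ltxx.
Qed.
Lemma null_sum (I : Type) (r : seq I) (P : pred I) (F : I -> nat -> R) :
  (forall i, P i -> null (F i)) -> null (fun n => \sum_(i <- r | P i) F i n).
Proof.
move=> h; elim: r => [|i r ih].
  by apply: null_le null0 => n; rewrite big_nil.
have [Pi|Pi] := boolP (P i).
  apply: null_le (nullD (h _ Pi) ih) => n; by rewrite big_cons Pi.
by apply: null_le ih => n; rewrite big_cons (negPf Pi).
Qed.
Lemma null_harmonic : null (fun n => n.+1%:R^-1 : R).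
Proof.
move=> e e0; exists (Num.bound e^-1) => n hn.
have e1 : 0 <= e^-1 by rewrite invr_ge0 ltW.
have h : e^-1 < n.+1%:R.
  apply: lt_le_trans (archi_boundP e1) _.
  by rewrite ler_nat leqW.
by rewrite -[e]invrK ltf_pV2 // posrE ?invr_gt0 // ltr0n.
Qed.
Lemma null_geom (c q : R) : 0 <= q -> q < 1 -> null (fun n => c * q ^+ n).
Proof.
rewrite le_eqVlt => /orP[/eqP <- _|q0 q1].
  move=> e e0; exists 1%N => -[//|n] _; by rewrite exprS mul0r mulr0.
pose x := q^-1 - 1.
have x0 : 0 < x by rewrite subr_gt0 invf_gt1.
(* Bernoulli's inequality for q^-1 = 1 + x; the minimum with 1 covers n = 0. *)
have h n : n.+1%:R * Num.min 1 x <= (q ^+ n)^-1.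
  elim: n => [|n ih]; first by rewrite expr0 invr1 mul1r ge_min lexx.
  have m0 : 0 <= Num.min 1 x by rewrite le_min ler01 ltW.
  rewrite exprS invfM.
  have -> : q^-1 = 1 + x by rewrite /x; ring.
  have g1 : 1 <= (q ^+ n)^-1.
    by rewrite invf_ge1 ?exprn_gt0 // exprn_ile1 // ltW.
  have -> : n.+2%:R = 1 + n.+1%:R :> R by rewrite mulrS.
  have mx : Num.min 1 x <= x by rewrite ge_min lexx orbT.
  by nra.
have m0 : 0 < Num.min 1 x by rewrite lt_min ltr01.
have key n : q ^+ n <= (Num.min 1 x)^-1 * n.+1%:R^-1.
  rewrite -invfM mulrC -[q ^+ n]invrK lef_pV2 ?posrE ?h //.
    by rewrite invr_gt0 exprn_gt0.
  by rewrite mulr_gt0.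
apply: null_le (_ : null (fun n => `|c| * ((Num.min 1 x)^-1 * n.+1%:R^-1))).
  move=> n; apply: le_trans (_ : `|c| * q ^+ n <= _).
    by rewrite ler_pM2r ?exprn_gt0 // ler_norm.
  by rewrite ler_wpM2l.
apply: nullZ => //; apply: nullZ null_harmonic; by rewrite invr_ge0 ltW.
Qed.
Lemma exists_pow_lt (c e : R) : 0 < e -> exists n, c * 2^-1 ^+ n < e.
Proof.
move=> e0; have [||N hN] := @null_geom c 2^-1 _ _ e e0; try lra.
by exists N; exact: hN.
Qed.
Lemma le_eps (x y : R) : (forall e, 0 < e -> x <= y + e) -> x <= y.
Proof.
move=> h; rewrite leNgt; apply/negP => yx.
have /h : 0 < (x - y) / 2 by lra.
lra.
Qed.
End Null.

Section Goursat.
Context (R : realType).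
Local Notation C := (Cplx R).
Implicit Types (f g : C -> C) (p a v w z : C) (d : R).

Definition cdiff f z := exists f' : C, forall e : R, 0 < e ->
  exists2 r : R, 0 < r & forall w, cn (w - z) < r ->
    cn (f w - f z - f' * (w - z)) <= e * cn (w - z).

(** Midpoint sum for the line integral from a to a + v over 2 ^ n equal pieces. Halving the segment
    lowers n by one without error, and the sum is exact on affine functions, so no integral has to
    be constructed. *)
Fixpoint Seg n f a v : C :=
  if n is m.+1 then Seg m f a (v / 2) + Seg m f (a + v / 2) (v / 2)
  else f (a + v / 2) * v.

Definition onseg a v w := exists2 t : R, 0 <= t <= 1 & w = a + rc t * v.

Lemma two_neq0 : (2 : C) != 0. Proof. by rewrite pnatr_eq0. Qed.
Lemma half_rc : (2^-1 : C) = rc 2^-1.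
Proof. by rewrite rcV rc_nat. Qed.

Lemma onseg_mid a v : onseg a v (a + v / 2).
Proof. by exists 2^-1; [lra | rewrite mulrC half_rc]. Qed.
Lemma onseg_l a v w : onseg a (v / 2) w -> onseg a v w.
Proof.
move=> [t h ->]; exists (t / 2); first lra.
by rewrite rcM -half_rc; congr (_ + _); field.
Qed.
Lemma onseg_r a v w : onseg (a + v / 2) (v / 2) w -> onseg a v w.
Proof.
move=> [t h ->]; exists ((t + 1) / 2); first lra.
by rewrite rcM rcD rc1 -half_rc; field.
Qed.

Lemma cn_half v : cn (v / 2) = cn v / 2.
Proof. by rewrite cnM half_rc cn_rc ger0_norm //; lra. Qed.

Lemma Seg_le n f a v M : (forall w, onseg a v w -> cn (f w) <= M) ->
  cn (Seg n f a v) <= M * cn v.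
Proof.
elim: n a v => [|n ih] a v h /=.
  by rewrite cnM ler_wpM2r ?cn_ge0 //; apply: h; exact: onseg_mid.
apply: le_trans (cnD _ _) _.
have h1 := ih a (v / 2) (fun w hw => h w (onseg_l hw)).
have h2 := ih _ (v / 2) (fun w hw => h w (onseg_r hw)).
by rewrite cn_half in h1 h2; lra.
Qed.

Lemma Seg_im n f a v m : (forall w, onseg a v w -> m <= im (f w * v)) ->
  m <= im (Seg n f a v).
Proof.
elim: n a v m => [|n ih] a v m h /=; first by apply: h; exact: onseg_mid.
have im_half w : im (w * (v / 2)) = im (w * v) / 2.
  by rewrite mulrA half_rc mulrC im_rcM mulrC.
have h1 : m / 2 <= im (Seg n f a (v / 2)).
  by apply: ih => w /onseg_l/h; rewrite im_half; lra.
have h2 : m / 2 <= im (Seg n f (a + v / 2) (v / 2)).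
  by apply: ih => w /onseg_r/h; rewrite im_half; lra.
by rewrite imD; lra.
Qed.

Lemma SegD n f g a v :
  Seg n (fun w => f w + g w) a v = Seg n f a v + Seg n g a v.
Proof.
by elim: n a v => [|n ih] a v /=; rewrite ?mulrDl // !ih addrACA.
Qed.
Lemma SegZ n c f a v : Seg n (fun w => c * f w) a v = c * Seg n f a v.
Proof. by elim: n a v => [|n ih] a v /=; rewrite ?mulrA // !ih mulrDr. Qed.
Lemma Seg_ext n f g a v : f =1 g -> Seg n f a v = Seg n g a v.
Proof. by move=> h; elim: n a v => [|n ih] a v /=; rewrite ?h ?ih. Qed.
Lemma Seg_lin n a v (al be : C) :
  Seg n (fun w => al + be * w) a v = (al + be * (a + v / 2)) * v.
Proof. by elim: n a v => [|n ih] a v //=; rewrite !ih; field. Qed.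

(* midpoint sums along the boundary of the square with lower left corner [p]
   and side [d] *)
Definition J : C := mkc 0 1.
Lemma JJ : J * J = -1.
Proof.
by apply: c_ext; rewrite ?reM ?imM ?reN ?imN !re_mkc !im_mkc ?re1 ?im1; ring.
Qed.
Lemma reJz z : re (J * z) = - im z.
Proof. by rewrite reM re_mkc im_mkc; ring. Qed.
Lemma imJz z : im (J * z) = re z.
Proof. by rewrite imM re_mkc im_mkc; ring. Qed.
Lemma cn_J : cn J = 1.
Proof. by rewrite /cn re_mkc im_mkc expr0n expr1n add0r sqrtr1. Qed.

Definition Bd n f p d : C :=
  Seg n f p (rc d) + Seg n f (p + rc d) (J * rc d)
  - Seg n f (p + J * rc d) (rc d) - Seg n f p (J * rc d).

Definition bd p d w := [\/ onseg p (rc d) w, onseg (p + rc d) (J * rc d) w,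
  onseg (p + J * rc d) (rc d) w | onseg p (J * rc d) w].

Lemma BdD n f g p d : Bd n (fun w => f w + g w) p d = Bd n f p d + Bd n g p d.
Proof. by rewrite /Bd !SegD; ring. Qed.
Lemma BdZ n c f p d : Bd n (fun w => c * f w) p d = c * Bd n f p d.
Proof. by rewrite /Bd !SegZ; ring. Qed.
Lemma Bd_ext n f g p d : f =1 g -> Bd n f p d = Bd n g p d.
Proof. by move=> h; rewrite /Bd !(Seg_ext _ _ _ h). Qed.
Lemma BdB n f g p d : Bd n (fun w => f w - g w) p d = Bd n f p d - Bd n g p d.
Proof.
rewrite -mulN1r -BdZ -BdD; apply: Bd_ext => w; by rewrite mulN1r.
Qed.
Lemma Bd_sum n (N : nat) (F : 'I_N -> C -> C) p d :
  Bd n (fun w => \sum_(i < N) F i w) p d = \sum_(i < N) Bd n (F i) p d.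
Proof.
elim: N F => [|N ih] F.
  rewrite big_ord0 -[RHS](mul0r (Bd n (fun=> 0) p d)) -BdZ.
  by apply: Bd_ext => w; rewrite big_ord0 mul0r.
rewrite big_ord_recr /= -ih -BdD; apply: Bd_ext => w; by rewrite big_ord_recr.
Qed.
Lemma Bd_lin n p d (al be : C) : Bd n (fun w => al + be * w) p d = 0.
Proof.
rewrite /Bd !Seg_lin.
have -> : (al + be * (p + rc d / 2)) * rc d +
  (al + be * (p + rc d + J * rc d / 2)) * (J * rc d) -
  (al + be * (p + J * rc d + rc d / 2)) * rc d -
  (al + be * (p + J * rc d / 2)) * (J * rc d) = 0; last by [].
by field.
Qed.
Lemma Bd_le n f p d M : 0 <= d -> (forall w, bd p d w -> cn (f w) <= M) ->
  cn (Bd n f p d) <= 4 * d * M.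
Proof.
move=> d0 h; have ed : cn (rc d) = d by rewrite cn_rc ger0_norm.
have h1 := @Seg_le n f p (rc d) M (fun w hw => h w (Or41 _ _ _ hw)).
have h2 := @Seg_le n f _ (J * rc d) M (fun w hw => h w (Or42 _ _ _ hw)).
have h3 := @Seg_le n f _ (rc d) M (fun w hw => h w (Or43 _ _ _ hw)).
have h4 := @Seg_le n f p (J * rc d) M (fun w hw => h w (Or44 _ _ _ hw)).
rewrite cnM cn_J mul1r ed in h2 h4; rewrite ed in h1 h3.
apply: le_trans (cnB _ _) _; apply: le_trans (lerD (cnB _ _) (lexx _)) _.
have h5 := cnD (Seg n f p (rc d)) (Seg n f (p + rc d) (J * rc d)).
lra.
Qed.
Lemma Bd_eq n f g p d : 0 <= d -> (forall w, bd p d w -> f w = g w) ->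
  Bd n f p d = Bd n g p d.
Proof.
move=> d0 h; apply/eqP; rewrite -subr_eq0 -BdB; apply/eqP/cn_le0.
rewrite -(mulr0 (4 * d)); apply: Bd_le => // w /h ->.
by rewrite subrr cn0.
Qed.

(** The sums along the inner edges cancel, so this is an identity of finite sums with no error
    term. *)
Lemma Bd_split n f p d : Bd n.+1 f p d =
  Bd n f p (d / 2) + Bd n f (p + rc (d / 2)) (d / 2) +
  Bd n f (p + J * rc (d / 2)) (d / 2) +
  Bd n f (p + rc (d / 2) + J * rc (d / 2)) (d / 2).
Proof.
rewrite /Bd /= -[_ * rc d / 2]mulrA.
have -> : rc d / 2 = rc (d / 2) :> C by rewrite rcM half_rc.
have -> : rc d = rc (d / 2) + rc (d / 2) :> C by rewrite -rcD; congr rc; field.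
set h := rc (d / 2); rewrite !mulrDr !addrA.
rewrite [p + J * h + h]addrAC [p + J * h + J * h + h]addrAC.
rewrite [p + h + J * h + h]addrAC [p + J * h + h]addrAC.
ring.
Qed.

Definition inS p d w :=
  re p <= re w <= re p + d /\ im p <= im w <= im p + d.

Lemma bd_inS p d w : 0 <= d -> bd p d w -> inS p d w.
Proof.
move=> d0; rewrite /inS; case=> [] [t /andP[t0 t1] ->];
  rewrite !reD !imD ?re_rcM ?im_rcM ?reJz ?imJz ?re_rc ?im_rc;
  split; nra.
Qed.

Lemma inS_cn p d w z : inS p d w -> inS p d z -> cn (w - z) <= 2 * d.
Proof.
move=> [a b] [a' b']; apply: le_trans (cn_le_reim _) _.
rewrite reB imB.
have h1 : `|re w - re z| <= d by rewrite ler_norml; lra.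
have h2 : `|im w - im z| <= d by rewrite ler_norml; lra.
lra.
Qed.

Definition half_squares p d (P : C -> R -> Prop) :=
  [/\ P p (d / 2), P (p + rc (d / 2)) (d / 2), P (p + J * rc (d / 2)) (d / 2) &
      P (p + rc (d / 2) + J * rc (d / 2)) (d / 2)].

(** Cousin's lemma by bisection: if P failed on the large square, it would fail on a nested sequence
    of quarters. These shrink to a point, where the local hypothesis is contradicted. *)
Lemma cousin (P : C -> R -> Prop) p0 d0 : 0 < d0 ->
  (forall p d, 0 < d -> half_squares p d P -> P p d) ->
  (forall z, inS p0 d0 z -> exists2 r : R, 0 < r & forall p d, 0 < d -> d < r ->
     inS p d z -> (forall w, inS p d w -> inS p0 d0 w) -> P p d) ->
  P p0 d0.
Proof.
move=> d00 hs hl; apply: contrapT => hP.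
(* Selects the lower left corner of a quarter where P fails; the value 0 is a default for the cases
   in which there is nothing to select. *)
have step (pd : C * R) : exists q : C, 0 < pd.2 -> ~ P pd.1 pd.2 ->
    ~ P q (pd.2 / 2) /\
    [/\ re pd.1 <= re q, re q <= re pd.1 + pd.2 / 2,
        im pd.1 <= im q & im q <= im pd.1 + pd.2 / 2].
  case: pd => p d /=; have [pd|pd] := pselect (P p d); first by exists 0.
  have [d1|d1] := pselect (0 < d); last by exists 0 => /d1.
  have [k1|k1] := pselect (P p (d / 2)); last by exists p => _ _; split=> //; split; lra.
  have [k2|k2] := pselect (P (p + rc (d / 2)) (d / 2)); last first.
    exists (p + rc (d / 2)) => _ _; split=> //.
    by rewrite reD imD re_rc im_rc; split; lra.
  have [k3|k3] := pselect (P (p + J * rc (d / 2)) (d / 2)); last first.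
    exists (p + J * rc (d / 2)) => _ _; split=> //.
    by rewrite reD imD reJz imJz re_rc im_rc; split; lra.
  have [k4|k4] := pselect (P (p + rc (d / 2) + J * rc (d / 2)) (d / 2)).
    by case: pd; apply: hs.
  exists (p + rc (d / 2) + J * rc (d / 2)) => _ _; split=> //.
  by rewrite !reD !imD reJz imJz re_rc im_rc; split; lra.
have [F hF] := choice step.
pose q k := iter k (fun pd => (F pd, pd.2 / 2)) (p0, d0).
have q2 k : (q k).2 = d0 * 2^-1 ^+ k.
  by elim: k => [|k ih]; rewrite ?expr0 ?mulr1 // /q iterS /= -/(q k) ih exprSr mulrA.
have qpos k : 0 < (q k).2 by rewrite q2 mulr_gt0 // exprn_gt0 //; lra.
have qN k : ~ P (q k).1 (q k).2.
  elim: k => [//|k ih]; rewrite /q iterS -/(q k) /=.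
  by have [] := hF (q k) (qpos k) ih.
have qS k : [/\ re (q k).1 <= re (q k.+1).1,
     re (q k.+1).1 + (q k.+1).2 <= re (q k).1 + (q k).2,
     im (q k).1 <= im (q k.+1).1 &
     im (q k.+1).1 + (q k.+1).2 <= im (q k).1 + (q k).2].
  have [_ [a b c e]] := hF (q k) (qpos k) (qN k).
  by rewrite /q iterS -/(q k) /=; split=> //; lra.
have mono m k : (m <= k)%N -> [/\ re (q m).1 <= re (q k).1,
     re (q k).1 + (q k).2 <= re (q m).1 + (q m).2,
     im (q m).1 <= im (q k).1 &
     im (q k).1 + (q k).2 <= im (q m).1 + (q m).2].
  elim: k => [|k ih]; first by rewrite leqn0 => /eqP ->.
  rewrite leq_eqVlt => /orP[/eqP -> //|]; rewrite ltnS => /ih [a b c e].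
  by have [a' b' c' e'] := qS k; split; lra.
have sandwich m k : re (q m).1 <= re (q k).1 + (q k).2 /\
    im (q m).1 <= im (q k).1 + (q k).2.
  have [a b c e] := mono _ _ (leq_maxl m k).
  have [a' b' c' e'] := mono _ _ (leq_maxr m k).
  by have := qpos (maxn m k); split; lra.
pose X := [set re (q k).1 | k in setT]; pose Y := [set im (q k).1 | k in setT].
have hX k : re (q k).1 <= sup X /\ sup X <= re (q k).1 + (q k).2.
  have X0 : X !=set0 by exists (re (q 0%N).1), 0%N.
  have ubX m : ubound X (re (q m).1 + (q m).2).
    by move=> _ [j _ <-]; have [] := sandwich j m.
  split; last exact: ge_sup.
  by apply: ub_le_sup; [exists (re (q 0%N).1 + (q 0%N).2) | exists k].
have hY k : im (q k).1 <= sup Y /\ sup Y <= im (q k).1 + (q k).2.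
  have Y0 : Y !=set0 by exists (im (q 0%N).1), 0%N.
  have ubY m : ubound Y (im (q m).1 + (q m).2).
    by move=> _ [j _ <-]; have [] := sandwich j m.
  split; last exact: ge_sup.
  by apply: ub_le_sup; [exists (im (q 0%N).1 + (q 0%N).2) | exists k].
pose z := mkc (sup X) (sup Y).
have hz k : inS (q k).1 (q k).2 z.
  rewrite /inS re_mkc im_mkc.
  by have [a b] := hX k; have [a' b'] := hY k; rewrite a b a' b'.
have [r r0 hr] := hl z (hz 0%N).
have [k hk] := exists_pow_lt d0 r0.
apply: (qN k); apply: hr => //; first by rewrite q2.
move=> w [a b]; have [a' b' c' e'] := mono _ _ (leq0n k).
move: a' b' c' e'; rewrite [q 0%N]/q /=.
by move=> a' b' c' e'; split; lra.
Qed.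

Lemma goursat f p d : 0 < d -> (forall z, inS p d z -> cdiff f z) ->
  null (fun n => cn (Bd n f p d)).
Proof.
move=> d0 hf; suff h (e : R) : 0 < e ->
    exists N, forall n, (N <= n)%N -> cn (Bd n f p d) <= e * d ^+ 2.
  move=> e e0; have [|N hN] := h (e / 2 / d ^+ 2).
    by rewrite !divr_gt0 // exprn_gt0.
  exists N => n /hN; rewrite mulfVK ?expf_neq0 ?gt_eqF //; lra.
move=> e0.
(* The bound e d^2 is additive over quarters. On a small square near z the affine part of f
   contributes nothing by [Bd_lin], and the rest is at most e/8 times the diameter bound 2 l, on a
   perimeter 4 l. *)
apply: (@cousin (fun p d => exists N, forall n, (N <= n)%N ->
  cn (Bd n f p d) <= e * d ^+ 2)) => // [q l l0|z /hf[f' hf']].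
  move=> [[N1 h1] [N2 h2] [N3 h3] [N4 h4]].
  exists (maxn (maxn N1 N2) (maxn N3 N4)).+1 => -[//|n].
  rewrite ltnS !geq_max => /andP[/andP[/h1 k1 /h2 k2] /andP[/h3 k3 /h4 k4]].
  rewrite Bd_split; apply: le_trans (cnD _ _) _.
  have := cnD (Bd n f q (l / 2) + Bd n f (q + rc (l / 2)) (l / 2))
    (Bd n f (q + J * rc (l / 2)) (l / 2)).
  have := cnD (Bd n f q (l / 2)) (Bd n f (q + rc (l / 2)) (l / 2)).
  by move: k1 k2 k3 k4; rewrite !expr2; nra.
have e8 : 0 < e / 8 by lra.
have [r r0 hr] := hf' _ e8; exists (r / 2) => [|q l l0 lr zq sub]; first lra.
exists 0%N => n _.
rewrite -[Bd n f q l]subr0 -(Bd_lin n q l (f z - f' * z) f') -BdB.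
have -> : e * l ^+ 2 = 4 * l * (e / 8 * (2 * l)) by rewrite expr2; field.
apply: Bd_le => [|w /(bd_inS (ltW l0)) wq]; first exact: ltW.
have wz := inS_cn wq zq.
have -> : f w - (f z - f' * z + f' * w) = f w - f z - f' * (w - z) by ring.
apply: le_trans (hr _ _) _; first by lra.
by rewrite ler_pM2l.
Qed.
End Goursat.

(** * Complex differentiability of scalar functions *)

Section ComplexDerivative.
Context (R : realType).
Local Notation C := (Cplx R).
Implicit Types (f g : C -> C) (z w c : C) (e r : R).

Lemma cdiff_lip f z : cdiff f z -> exists K r, [/\ 0 <= K, 0 < r &
  forall w, cn (w - z) < r -> cn (f w - f z) <= K * cn (w - z)].
Proof.
move=> [f' h]; have [r r0 hr] := h 1 ltr01.
exists (1 + cn f'), r; split=> [|//|w /hr k]; first by rewrite addr_ge0 ?cn_ge0.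
have -> : f w - f z = (f w - f z - f' * (w - z)) + f' * (w - z) by ring.
apply: le_trans (cnD _ _) _; rewrite cnM; lra.
Qed.

Lemma cdiff_cont f z e : cdiff f z -> 0 < e -> exists2 r, 0 < r &
  forall w, cn (w - z) < r -> cn (f w - f z) < e.
Proof.
move=> /cdiff_lip [K [r [K0 r0 h]]] e0.
have K1 : 0 < K + 1 by lra.
exists (Num.min r (e / (K + 1))); first by rewrite lt_min r0 divr_gt0.
move=> w; rewrite lt_min => /andP[/h k h2]; apply: le_lt_trans k _.
move: h2; rewrite ltr_pdivlMr // => h2; have c0 := cn_ge0 (w - z).
by rewrite mulrDr mulr1 mulrC in h2; lra.
Qed.

Lemma cdiff_near f g z r : 0 < r -> (forall w, cn (w - z) < r -> f w = g w) ->
  cdiff f z -> cdiff g z.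
Proof.
move=> r0 h [f' hf]; exists f' => e /hf [r' r'0 hr].
exists (Num.min r r') => [|w]; first by rewrite lt_min r0.
rewrite lt_min => /andP[a b]; rewrite -!h ?subrr ?cn0 //; exact: hr.
Qed.

Lemma cdiff_lin (al be : C) z : cdiff (fun w => al + be * w) z.
Proof.
exists be => e e0; exists 1 => // w _.
have -> : al + be * w - (al + be * z) - be * (w - z) = 0 by ring.
by rewrite cn0 mulr_ge0 ?cn_ge0 // ltW.
Qed.

Lemma cdiff_cst c z : cdiff (fun=> c) z.
Proof.
by apply: (@cdiff_near _ _ _ 1 ltr01 _ (cdiff_lin c 0 z)) => w _; rewrite mul0r addr0.
Qed.

Lemma cdiffD f g z : cdiff f z -> cdiff g z -> cdiff (fun w => f w + g w) z.
Proof.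
move=> [f' hf] [g' hg]; exists (f' + g') => e e0.
have e2 : 0 < e / 2 by lra.
have [r r0 hr] := hf _ e2; have [q q0 hq] := hg _ e2.
exists (Num.min r q) => [|w]; first by rewrite lt_min r0.
rewrite lt_min => /andP[/hr a /hq b].
have -> : f w + g w - (f z + g z) - (f' + g') * (w - z) =
  (f w - f z - f' * (w - z)) + (g w - g z - g' * (w - z)) by ring.
apply: le_trans (cnD _ _) _; lra.
Qed.

Lemma cdiff_comp f g z : cdiff g z -> cdiff f (g z) -> cdiff (fun w => f (g w)) z.
Proof.
move=> dg [f' hf]; have [K [r [K0 r0 hr]]] := cdiff_lip dg.
have [g' hg] := dg; exists (f' * g') => e e0.
have K1 : 0 < K + 1 by lra.
have e1 : 0 < e / 2 / (K + 1) by rewrite !divr_gt0.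
have f1 : 0 < cn f' + 1 by rewrite ltr_wpDl ?cn_ge0.
have e2 : 0 < e / 2 / (cn f' + 1) by rewrite !divr_gt0.
have [r1 r10 hr1] := hf _ e1; have [r2 r20 hr2] := hg _ e2.
exists (Num.min r (Num.min r2 (r1 / (K + 1)))) => [|w].
  by rewrite !lt_min r0 r20 divr_gt0.
rewrite !lt_min => /andP[/hr a /andP[/hr2 b]].
rewrite ltr_pdivlMr // => c.
have := cn_ge0 (w - z); set D := cn (w - z) in a b c * => D0.
have gw : cn (g w - g z) < r1 by apply: le_lt_trans a _; nra.
have k1 := hr1 _ gw.
have -> : f (g w) - f (g z) - f' * g' * (w - z) =
  (f (g w) - f (g z) - f' * (g w - g z)) + f' * (g w - g z - g' * (w - z)) by ring.
apply: le_trans (cnD _ _) _; rewrite cnM.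
have k2 : e / 2 / (K + 1) * cn (g w - g z) <= e / 2 * D.
  apply: le_trans (_ : e / 2 / (K + 1) * ((K + 1) * D) <= _).
    by apply: ler_wpM2l; [exact: ltW | lra].
  by rewrite mulrA mulfVK // gt_eqF.
have k3 : cn f' * cn (g w - g z - g' * (w - z)) <= e / 2 * D.
  apply: le_trans (_ : (cn f' + 1) * (e / 2 / (cn f' + 1) * D) <= _).
    by apply: ler_pM => //; rewrite ?cn_ge0 // lerDl ler01.
  by rewrite mulrA [(cn f' + 1) * _]mulrC mulfVK // gt_eqF.
lra.
Qed.

Lemma cdiffX2 z : cdiff (fun w => w * w) z.
Proof.
exists (z + z) => e e0; exists e => // w hw.
have -> : w * w - z * z - (z + z) * (w - z) = (w - z) * (w - z) by ring.
by rewrite cnM ler_wpM2r ?cn_ge0 // ltW.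
Qed.

Lemma cdiffZ c f z : cdiff f z -> cdiff (fun w => c * f w) z.
Proof.
move=> h; apply: (cdiff_near ltr01 _ (cdiff_comp h (cdiff_lin 0 c (f z)))).
by move=> w _; rewrite add0r.
Qed.

(* polarization: 4 f g = (f + g)^2 - (f - g)^2 *)
Lemma cdiffM f g z : cdiff f z -> cdiff g z -> cdiff (fun w => f w * g w) z.
Proof.
move=> df dg.
have dN := cdiffZ (-1) dg.
have k1 := cdiff_comp (cdiffD df dg) (cdiffX2 _).
have k2 := cdiff_comp (cdiffD df dN) (cdiffX2 _).
apply: (cdiff_near ltr01 _ (cdiffZ (4^-1) (cdiffD k1 (cdiffZ (-1) k2)))).
by move=> w _; field.
Qed.

Lemma cdiffB f g z : cdiff f z -> cdiff g z -> cdiff (fun w => f w - g w) z.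
Proof.
move=> df dg; apply: (cdiff_near ltr01 _ (cdiffD df (cdiffZ (-1) dg))).
by move=> w _; rewrite mulN1r.
Qed.

Lemma cdiff_id z : cdiff (fun w => w) z.
Proof.
apply: (cdiff_near ltr01 _ (cdiff_lin 0 1 z)) => w _.
by rewrite add0r mul1r.
Qed.

Lemma cdiff_inv z : z != 0 -> cdiff (fun w => w^-1) z.
Proof.
move=> z0; have cz : 0 < cn z by rewrite cn_gt0.
exists (- (z ^+ 2)^-1) => e e0.
have r0 : 0 < e * cn z ^+ 3 / 2.
  by rewrite divr_gt0 // mulr_gt0 // exprn_gt0.
exists (Num.min (cn z / 2) (e * cn z ^+ 3 / 2)) => [|w].
  by rewrite lt_min r0 andbT divr_gt0.
rewrite lt_min => /andP[a b].
have cw : cn z / 2 <= cn w.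
  by have := cnDl z w; rewrite cnBC; lra.
have cw0 : 0 < cn w by apply: lt_le_trans cw; rewrite divr_gt0.
have w0 : w != 0 by rewrite -cn_gt0.
have -> : w^-1 - z^-1 - - (z ^+ 2)^-1 * (w - z) = (w - z) * ((w - z) / (w * z ^+ 2)).
  by field; rewrite w0 z0.
rewrite cnM mulrC ler_wpM2r ?cn_ge0 // cnM cnV cnM cnX.
rewrite ler_pdivrMr ?mulr_gt0 ?exprn_gt0 //.
apply: le_trans (ltW b) _.
have k : cn z / 2 * cn z ^+ 2 <= cn w * cn z ^+ 2 by rewrite ler_wpM2r // sqr_ge0.
by have := ler_wpM2l (ltW e0) k; rewrite [cn z ^+ 3]exprS; lra.
Qed.

Lemma cdiffV f z : cdiff f z -> f z != 0 -> cdiff (fun w => (f w)^-1) z.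
Proof. by move=> df fz; apply: cdiff_comp df (cdiff_inv fz). Qed.

Lemma cdiffXn f z n : cdiff f z -> cdiff (fun w => f w ^+ n) z.
Proof.
move=> df; elim: n => [|n ih]; first exact: cdiff_cst.
by apply: (cdiff_near ltr01 _ (cdiffM df ih)) => w _; rewrite exprS.
Qed.

Lemma cdiff_subV z w : w != z -> cdiff (fun v => (v - z)^-1) w.
Proof.
move=> wz; apply: cdiffV; last by rewrite subr_eq0.
by apply: cdiffB (cdiff_id w) (cdiff_cst z w).
Qed.

Lemma cdiff_quot f z w : cdiff f w -> w != z ->
  cdiff (fun v => (f v - f z) / (v - z)) w.
Proof.
move=> df wz; apply: cdiffM (cdiff_subV wz).
exact: cdiffB df (cdiff_cst _ w).
Qed.
End ComplexDerivative.

(** * Cauchy's formula and Taylor expansion *)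

Section Cauchy.
Context (R : realType).
Local Notation C := (Cplx R).
Implicit Types (f g : C -> C) (p z w c : C) (d e r s : R).

Lemma null_unshift (u : nat -> R) : null (fun n => u n.+1) -> null u.
Proof. by move=> h e /h[N hN]; exists N.+1 => -[//|n]; exact: hN. Qed.

Lemma Bd_splitE n f (x y d : R) : Bd n.+1 f (mkc x y) d =
  Bd n f (mkc x y) (d / 2) + Bd n f (mkc (x + d / 2) y) (d / 2) +
  Bd n f (mkc x (y + d / 2)) (d / 2) + Bd n f (mkc (x + d / 2) (y + d / 2)) (d / 2).
Proof.
have e1 (a b c : R) : mkc a b + rc c = mkc (a + c) b.
  by apply: c_ext; rewrite ?reD ?imD ?re_mkc ?im_mkc ?re_rc ?im_rc ?addr0.
have e2 (a b c : R) : mkc a b + J R * rc c = mkc a (b + c).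
  apply: c_ext; rewrite ?reD ?imD ?reJz ?imJz ?re_mkc ?im_mkc ?re_rc ?im_rc //.
  by rewrite oppr0 addr0.
by rewrite Bd_split e1 !e2.
Qed.

(* [e (a, b)] is the square of the four halves that has the corner (a, b) *)
Lemma corner_null f z (a b : bool) x y d : 0 < d ->
  z = mkc (x + a%:R * d) (y + b%:R * d) ->
  (forall w, inS (mkc x y) d w -> cdiff f w) ->
  null (fun n => cn (Bd n (fun w => (f w - f z) / (w - z)) (mkc x y) d)).
Proof.
move=> d0 ez hf; set g := fun w => _.
have [M [r [M0 r0 hM]]] : exists M r, [/\ 0 <= M, 0 < r &
    forall w, cn (w - z) < r -> cn (g w) <= M].
  have [|K [r [K0 r0 hr]]] := @cdiff_lip _ f z.
    apply: hf; rewrite ez; split; rewrite ?re_mkc ?im_mkc;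
      case: (a); case: (b); rewrite /= ?mul1r ?mul0r; lra.
  exists K, r; split=> // w hw; rewrite /g cnM cnV.
  have [->|wz] := eqVneq w z; first by rewrite !subrr cn0 mul0r.
  rewrite ler_pdivrMr ?cn_gt0 ?subr_eq0 //; exact: hr.
have good q l : 0 < l -> (forall w, inS q l w -> inS (mkc x y) d w) ->
    ~ inS q l z -> null (fun n => cn (Bd n g q l)).
  move=> l0 sub nz; apply: goursat => // w hw.
  apply: cdiff_quot; first exact/hf/sub.
  by apply/eqP => e; apply: nz; rewrite -e.
(* After m splittings only one subsquare still touches z, and there the difference quotient is
   bounded by M, so it contributes at most 4 l 2^-m M. All other subsquares avoid z and fall under
   [goursat]. *)
suff claim m : forall x' y' l, 0 < l -> z = mkc (x' + a%:R * l) (y' + b%:R * l) ->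
    (forall w, inS (mkc x' y') l w -> inS (mkc x y) d w) ->
    2 * l * 2^-1 ^+ m < r ->
    null (fun n => cn (Bd n g (mkc x' y') l) - 4 * (l * 2^-1 ^+ m) * M).
  move=> e e0; have e2 : 0 < e / 2 by lra.
  have [m1 hm1] := exists_pow_lt (4 * d * M) e2.
  have [m2 hm2] := exists_pow_lt (2 * d) r0.
  pose m := maxn m1 m2.
  have pw k : (k <= m)%N -> 2^-1 ^+ m <= 2^-1 ^+ k :> R.
    by move=> km; rewrite ler_wiXn2l //; lra.
  have [||N hN] := claim m x y d d0 ez _ _ _ e2 => //.
    apply: le_lt_trans hm2; rewrite ler_pM2l ?pw ?leq_maxr //; lra.
  exists N => n /hN h.
  have : 4 * (d * 2^-1 ^+ m) * M <= 4 * d * M * 2^-1 ^+ m1.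
    have := pw _ (leq_maxl m1 m2).
    have -> : 4 * (d * 2^-1 ^+ m) * M = 4 * d * M * 2^-1 ^+ m by ring.
    by apply: ler_wpM2l; rewrite !mulr_ge0 // ltW.
  lra.
elim: m => [|m ih] x' y' l l0 ez' sub lr.
  move=> e e0; exists 0%N => n _.
  rewrite expr0 mulr1; apply: le_lt_trans e0; rewrite subr_le0.
  apply: Bd_le => [|w /(bd_inS (ltW l0)) hw]; first exact: ltW.
  apply: hM; apply: le_lt_trans (inS_cn hw _) _; last first.
    by rewrite expr0 mulr1 in lr.
  rewrite ez'; split; rewrite ?re_mkc ?im_mkc;
    case: (a); case: (b); rewrite /= ?mul1r ?mul0r; lra.
have l2 : 0 < l / 2 by lra.
apply: null_unshift.
pose X (i : bool) := x' + i%:R * (l / 2); pose Y (j : bool) := y' + j%:R * (l / 2).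
have sub' i j w : inS (mkc (X i) (Y j)) (l / 2) w -> inS (mkc x y) d w.
  move=> [h1 h2]; apply: sub; move: h1 h2; rewrite /inS !re_mkc !im_mkc /X /Y.
  by case: i; case: j; rewrite /= ?mul1r ?mul0r => h1 h2; split; lra.
have other i j : (i, j) != (a, b) -> null (fun n => cn (Bd n g (mkc (X i) (Y j)) (l / 2))).
  move=> ij; apply: good => //; first exact: sub'.
  rewrite ez' /inS !re_mkc !im_mkc /X /Y.
  by move: ij; case: i; case: j; case: (a); case: (b) => //= _ [];
    rewrite ?mul1r ?mul0r; lra.
have one : null (fun n => cn (Bd n g (mkc (X a) (Y b)) (l / 2)) -
    4 * (l * 2^-1 ^+ m.+1) * M).
  have -> : l * 2^-1 ^+ m.+1 = l / 2 * 2^-1 ^+ m by rewrite exprS mulrA.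
  apply: ih => //; last by rewrite exprS in lr; lra.
    rewrite ez' /X /Y; congr mkc; case: (a); case: (b); rewrite /= ?mul1r ?mul0r; lra.
  exact: sub'.
have tot i j : null (fun n => cn (Bd n g (mkc (X i) (Y j)) (l / 2)) -
    (if (i, j) == (a, b) then 4 * (l * 2^-1 ^+ m.+1) * M else 0)).
  case: eqP => [[-> ->] //|/eqP/other]; apply: null_le => n; by rewrite subr0.
have := nullD (nullD (tot false false) (tot true false))
  (nullD (tot false true) (tot true true)).
apply: null_le => n; rewrite Bd_splitE.
have -> : mkc x' y' = mkc (X false) (Y false) :> C by rewrite /X /Y !mul0r !addr0.
have -> : mkc (x' + l / 2) y' = mkc (X true) (Y false) :> C
  by rewrite /X /Y mul0r mul1r addr0.
have -> : mkc x' (y' + l / 2) = mkc (X false) (Y true) :> C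
  by rewrite /X /Y mul0r mul1r addr0.
have -> : mkc (x' + l / 2) (y' + l / 2) = mkc (X true) (Y true) :> C
  by rewrite /X /Y !mul1r.
have t4 (c1 c2 c3 c4 : C) : cn (c1 + c2 + c3 + c4) <= cn c1 + cn c2 + cn c3 + cn c4.
  by have := cnD (c1 + c2 + c3) c4; have := cnD (c1 + c2) c3; have := cnD c1 c2; lra.
have := t4 (Bd n g (mkc (X false) (Y false)) (l / 2))
  (Bd n g (mkc (X true) (Y false)) (l / 2)) (Bd n g (mkc (X false) (Y true)) (l / 2))
  (Bd n g (mkc (X true) (Y true)) (l / 2)).
by case: (a); case: (b) => /=; lra.
Qed.

End Cauchy.

(** * Cauchy's formula at dyadic points of a square *)

Section Taylor.
Context (R : realType).
Local Notation C := (Cplx R).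
Implicit Types (f g : C -> C) (p z w c : C) (d e r s : R).

(** Cauchy's theorem for the difference quotient at a point z of the grid of level k. After k
    splittings z is a corner of every subsquare that contains it, where [corner_null] applies; the
    other subsquares fall under [goursat]. General z are reached by density in [taylor0]. *)
Lemma vertex_null f z k (i j : nat) x y d : 0 < d -> (i <= 2 ^ k)%N -> (j <= 2 ^ k)%N ->
  z = mkc (x + i%:R * (d * 2^-1 ^+ k)) (y + j%:R * (d * 2^-1 ^+ k)) ->
  (forall w, inS (mkc x y) d w -> cdiff f w) ->
  null (fun n => cn (Bd n (fun w => (f w - f z) / (w - z)) (mkc x y) d)).
Proof.
elim: k i j x y d => [|k ih] i j x y d d0 hi hj ez hf.
  have [a ea] : exists a : bool, i = a by case: i hi {ez} => [|[|//]]; [exists false|exists true].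
  have [b eb] : exists b : bool, j = b by case: j hj {ez} => [|[|//]]; [exists false|exists true].
  by apply: (@corner_null R f z a b x y d) => //; rewrite ez ea eb expr0 mulr1.
apply: null_unshift; have d2 : 0 < d / 2 by lra.
have e2 : 2^-1 ^+ k * (2 ^ k)%:R = 1 :> R.
  by rewrite natrX -exprMn mulVf ?pnatr_eq0 // expr1n.
have p0 : 0 < 2^-1 ^+ k :> R by rewrite exprn_gt0 //; lra.
have sub (a b : bool) w :
    inS (mkc (x + a%:R * (d / 2)) (y + b%:R * (d / 2))) (d / 2) w -> inS (mkc x y) d w.
  rewrite /inS !re_mkc !im_mkc.
  by case: a; case: b; rewrite /= ?mul1r ?mul0r => -[h1 h2]; split; lra.
have ez2 : z = mkc (x + i%:R * (d / 2 * 2^-1 ^+ k)) (y + j%:R * (d / 2 * 2^-1 ^+ k)).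
  by rewrite ez exprS !mulrA.
have part (a b : bool) : null (fun n => cn (Bd n (fun w => (f w - f z) / (w - z))
    (mkc (x + a%:R * (d / 2)) (y + b%:R * (d / 2))) (d / 2))).
  have [zin|zout] := pselect (inS (mkc (x + a%:R * (d / 2)) (y + b%:R * (d / 2))) (d / 2) z).
    have coord (c : bool) (m : nat) (t : R) : (m <= 2 ^ k.+1)%N ->
        t + c%:R * (d / 2) <= t + m%:R * (d / 2 * 2^-1 ^+ k) <= t + c%:R * (d / 2) + d / 2 ->
        exists2 m' : nat, (m' <= 2 ^ k)%N &
          t + m%:R * (d / 2 * 2^-1 ^+ k) =
          t + c%:R * (d / 2) + m'%:R * (d / 2 * 2^-1 ^+ k).
      have h0 : 0 < d / 2 * 2^-1 ^+ k by rewrite mulr_gt0.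
      have eh : (2 ^ k)%:R * (d / 2 * 2^-1 ^+ k) = d / 2.
        by rewrite mulrCA [_ * 2^-1 ^+ k]mulrC e2 mulr1.
      move: h0 eh; set h := d / 2 * _ => h0 eh.
      move=> hm; case: c => /=; rewrite ?mul1r ?mul0r ?addr0 => /andP[k1 k2].
        have mk : (2 ^ k <= m)%N by rewrite -(ler_nat R) -(ler_pM2r h0) eh; lra.
        exists (m - 2 ^ k)%N; first by rewrite leq_subLR addnn -mul2n -expnS.
        rewrite natrB // mulrBl eh; ring.
      exists m => //; by rewrite -(ler_nat R) -(ler_pM2r h0) eh; lra.
    move: zin; rewrite {1}ez2 /inS !re_mkc !im_mkc => -[/coord h1 /coord h2].
    have [i' hi' ei] := h1 hi; have [j' hj' ej] := h2 hj.
    apply: (ih i' j') => //; first by rewrite ez2 ei ej.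
    by move=> w /sub/hf.
  apply: goursat => // w hw; apply: cdiff_quot; first exact/hf/(sub _ _ _ hw).
  by apply/eqP => e; apply: zout; rewrite -e.
have := nullD (nullD (part false false) (part true false))
  (nullD (part false true) (part true true)).
apply: null_le => n; rewrite Bd_splitE !mul0r !mul1r !addr0.
set c1 := Bd _ _ _ _; set c2 := Bd _ _ _ _; set c3 := Bd _ _ _ _; set c4 := Bd _ _ _ _.
by have := cnD (c1 + c2 + c3) c4; have := cnD (c1 + c2) c3; have := cnD c1 c2; lra.
Qed.
End Taylor.

(** * Limits of bounded sequences along an ultrafilter *)

Section BoundedLimits.
Context (R : realType).
Local Notation C := (Cplx R).

(** One ultrafilter finer than the tails gives limits to all bounded sequences at once. It provides
    Taylor coefficients without a proof that the midpoint sums converge, and completeness of C. *)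
Lemma ultrafilter_limits : exists2 U : set (nat -> Prop), ProperFilter U &
  (forall N, U [set n | (N <= n)%N]) /\
  forall (u : nat -> C) M, (forall n, cn (u n) <= M) ->
    exists l : C, forall e, 0 < e -> U [set n | cn (u n - l) < e].
Proof.
have [U [uU sU]] := ultraFilterLemma (@eventually_filter).
exists U; first exact: ultra_proper; split=> [N|u M uM].
  by apply: sU; exists N.
have real_lim (v : nat -> R) : (forall n, `|v n| <= M) ->
    exists l : R, forall e, 0 < e -> U [set n | `|v n - l| < e].
  move=> vM; pose A := [set x : R | U [set n | x <= v n]].
  have A0 : A (- M).
    rewrite /A /=; have -> : [set n | - M <= v n] = setT.
      by apply/seteqP; split=> n //= _; have := vM n; rewrite ler_norml => /andP[].
    exact: filterT.
  have ubA : ubound A M.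
    move=> x Ax; have [n hn] := filter_ex Ax.
    by apply: le_trans hn _; have := vM n; rewrite ler_norml => /andP[].
  exists (sup A) => e e0.
  have [x Ax hx] : exists2 x, A x & sup A - e < x.
    by apply: sup_adherent => //; split; [exists (- M) | exists M].
  have nA : ~ A (sup A + e / 2).
    move=> /(ub_le_sup (ex_intro _ M ubA)); lra.
  have [//|h] := in_ultra_setVsetC [set n | sup A + e / 2 <= v n] uU.
  apply: filterS (filterI Ax h) => n [/= h1 /negP]; rewrite -ltNge => h2.
  by rewrite ltr_norml; lra.
have [a ha] : exists l : R, forall e, 0 < e -> U [set n | `|re (u n) - l| < e].
  by apply: real_lim => n; exact: le_trans (cn_re _) (uM n).
have [b hb] : exists l : R, forall e, 0 < e -> U [set n | `|im (u n) - l| < e].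
  by apply: real_lim => n; exact: le_trans (cn_im _) (uM n).
exists (mkc a b) => e e0; have e2 : 0 < e / 2 by lra.
apply: filterS (filterI (ha _ e2) (hb _ e2)) => n [/= h1 h2].
by apply: le_lt_trans (cn_le_reim _) _; rewrite reB imB re_mkc im_mkc; lra.
Qed.
End BoundedLimits.

(** * Midpoint sums of powers over a centred square *)

Section TaylorExpansion.
Context (R : realType).
Local Notation C := (Cplx R).
Implicit Types (f g : C -> C) (p z w c : C) (d e : R).

Lemma re_inv z : re z^-1 = re z / cn z ^+ 2.
Proof.
have [->|z0] := eqVneq z 0; first by rewrite invr0 re0 mul0r.
have -> : z^-1 = rc (cn z ^+ 2)^-1 * z^*.
  by rewrite rcV -mulcJ; field; rewrite conjC_eq0 z0.
by rewrite re_rcM reJ mulrC.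
Qed.
Lemma im_inv z : im z^-1 = - im z / cn z ^+ 2.
Proof.
have [->|z0] := eqVneq z 0; first by rewrite invr0 im0 oppr0 mul0r.
have -> : z^-1 = rc (cn z ^+ 2)^-1 * z^*.
  by rewrite rcV -mulcJ; field; rewrite conjC_eq0 z0.
by rewrite im_rcM imJ mulrC.
Qed.

(* midpoint sums over the square with centre 0 and side [2 s] *)
Definition Sq (s : R) n f : C := Bd n f (mkc (- s) (- s)) (2 * s).

Section Square.
Context (s : R) (s0 : 0 < s).
Local Notation p0 := (mkc (- s) (- s)).
Local Notation Q := (Sq s).

Lemma side_gt0 : 0 < 2 * s. Proof. by have sp := s0; lra. Qed.
Local Notation d0 := side_gt0.

Lemma bd_center w : bd p0 (2 * s) w -> s <= cn w.
Proof.
have sp := s0.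
have h1 z : `|re z| = s -> s <= cn z by move=> <-; exact: cn_re.
have h2 z : `|im z| = s -> s <= cn z by move=> <-; exact: cn_im.
case=> [] [t ht ->].
- apply: h2; rewrite !imD im_rcM im_rc im_mkc mulr0 addr0 normrN gtr0_norm //.
- apply: h1; rewrite !reD re_rcM reJz re_rc re_mkc im_rc oppr0 mulr0 addr0.
  by rewrite gtr0_norm; lra.
- apply: h2; rewrite !imD im_rcM imJz im_rc im_mkc re_rc mulr0 addr0.
  by rewrite gtr0_norm; lra.
- apply: h1; rewrite !reD re_rcM reJz im_rc re_mkc oppr0 mulr0 addr0.
  by rewrite normrN gtr0_norm.
Qed.

(** Stands in for the value 2 pi i of the contour integral of 1/w: each of the four oriented sides
    contributes at least 1 to the imaginary part, at every level n. *)
Lemma omega_ge n : 4 <= cn (Q n (fun w => w^-1)).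
Proof.
have sp := s0.
have key (a b : R) : `|a| <= s -> b ^+ 2 = s ^+ 2 ->
    1 <= s * (2 * s) / (a ^+ 2 + b ^+ 2).
  move=> ha ->; have a2 : a ^+ 2 <= s ^+ 2.
    by rewrite -[a ^+ 2]real_normK ?num_real // lerXn2r ?nnegrE // ltW.
  have s2 : 0 < s ^+ 2 by rewrite exprn_gt0.
  rewrite ler_pdivlMr ?mul1r; last by have := sqr_ge0 a; lra.
  by rewrite mulrCA -expr2; lra.
have hr t : 0 <= t <= 1 -> `|- s + t * (2 * s)| <= s.
  by move=> /andP[t0 t1]; rewrite ler_norml; apply/andP; split; nra.
have valI w d : im (w^-1 * rc d) = - im w * d / (re w ^+ 2 + im w ^+ 2).
  by rewrite mulrC im_rcM im_inv cn2; ring.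
have valJ w d : im (w^-1 * (J R * rc d)) = re w * d / (re w ^+ 2 + im w ^+ 2).
  by rewrite mulrCA imJz mulrC re_rcM re_inv cn2; ring.
have simp := (reD, imD, re_rcM, im_rcM, reJz, imJz, re_rc, im_rc, re_mkc, im_mkc).
have sN : (- s) ^+ 2 = s ^+ 2 by rewrite sqrrN.
have S1 : 1 <= im (Seg n (fun w => w^-1) p0 (rc (2 * s))).
  apply: Seg_im => w [t /hr ht ew]; rewrite valI.
  have -> : re w = - s + t * (2 * s) by rewrite ew !simp.
  have -> : im w = - s by rewrite ew !simp; ring.
  by rewrite opprK; apply: key.
have S2 : 1 <= im (Seg n (fun w => w^-1) (p0 + rc (2 * s)) (J R * rc (2 * s))).
  apply: Seg_im => w [t /hr ht ew]; rewrite valJ addrC.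
  have -> : re w = s by rewrite ew !simp; ring.
  have -> : im w = - s + t * (2 * s) by rewrite ew !simp; ring.
  exact: key.
have S3 : 1 <= im (- Seg n (fun w => w^-1) (p0 + J R * rc (2 * s)) (rc (2 * s))).
  rewrite -mulN1r -SegZ.
  apply: Seg_im => w [t /hr ht ew]; rewrite mulN1r mulNr imN valI.
  have -> : re w = - s + t * (2 * s) by rewrite ew !simp; ring.
  have -> : im w = s by rewrite ew !simp; ring.
  by rewrite !mulNr opprK; apply: key.
have S4 : 1 <= im (- Seg n (fun w => w^-1) p0 (J R * rc (2 * s))).
  rewrite -mulN1r -SegZ.
  apply: Seg_im => w [t /hr ht ew]; rewrite mulN1r mulNr imN valJ addrC.
  have -> : re w = - s by rewrite ew !simp; ring.
  have -> : im w = - s + t * (2 * s) by rewrite ew !simp; ring.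
  by rewrite !mulNr opprK; apply: key.
apply: le_trans (le_trans (ler_norm _) (cn_im _)).
by rewrite /Sq /Bd !imD; lra.
Qed.

Lemma Q_le n f M : (forall w, s <= cn w -> inS p0 (2 * s) w -> cn (f w) <= M) ->
  cn (Q n f) <= 8 * s * M.
Proof.
have sp := s0.
move=> h; have -> : 8 * s * M = 4 * (2 * s) * M by ring.
apply: Bd_le => [|w hw]; first exact: ltW d0.
by apply: h; [exact: bd_center | exact: bd_inS (ltW d0) hw].
Qed.

Lemma Q_eq n f g : (forall w, s <= cn w -> inS p0 (2 * s) w -> f w = g w) -> Q n f = Q n g.
Proof.
have sp := s0.
move=> h; apply: Bd_eq => [|w hw]; first exact: ltW d0.
by apply: h; [exact: bd_center | exact: bd_inS (ltW d0) hw].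
Qed.

Lemma Seg_scale n f a v :
  Seg n f (a / 2) (v / 2) = Seg n (fun w => f (w / 2)) a v / 2.
Proof.
have sp := s0.
elim: n a v => [|n ih] a v /=.
  by rewrite -mulrDl mulrA.
by rewrite ih -mulrDl ih -mulrDl.
Qed.

Lemma Q_scale n f : Bd n f (mkc (- (s / 2)) (- (s / 2))) s =
  Q n (fun w => f (w / 2)) / 2.
Proof.
have sp := s0.
rewrite /Sq /Bd.
have -> : mkc (- (s / 2)) (- (s / 2)) = p0 / 2.
  by rewrite half_rc mulrC; apply: c_ext; rewrite ?re_rcM ?im_rcM ?re_mkc ?im_mkc; ring.
have -> : rc s = rc (2 * s) / 2 :> C.
  by rewrite half_rc mulrC -rcM; congr rc; field.
by rewrite mulrA -!mulrDl !Seg_scale; ring.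
Qed.

(** Two splittings cut the square into 16. The four in the middle form the square of half the side,
    and the remaining twelve, listed in [T], avoid 0 and fall under [goursat]. *)
Lemma annulus_null f : (forall w, w != 0 -> cdiff f w) ->
  null (fun n => cn (Q n.+2 f - Bd n.+1 f (mkc (- (s / 2)) (- (s / 2))) s)).
Proof.
have sp := s0.
move=> df; pose G a b n := Bd n f (mkc a b) (s / 2).
have good a b : [\/ 0 < a, a + s / 2 < 0, 0 < b | b + s / 2 < 0] ->
    null (fun n => cn (G a b n)).
  move=> h; apply: goursat => [|w hw]; first lra.
  apply: df; apply/eqP => w0; move: hw; rewrite w0 /inS re_mkc im_mkc re0 im0.
  by case: h => ? []; lra.
pose T := [:: (- s, - s); (- (s / 2), - s); (0, - s); (s / 2, - s);
  (- s, - (s / 2)); (s / 2, - (s / 2)); (- s, 0); (s / 2, 0);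
  (- s, s / 2); (- (s / 2), s / 2); (0, s / 2); (s / 2, s / 2)].
have Tgood ab : ab \in T -> null (fun n => cn (G ab.1 ab.2 n)).
  move=> abT; apply: good; move: abT; rewrite !inE.
  do 11 (case/orP; first by move=> /eqP -> /=;
    first [apply: Or41; lra | apply: Or42; lra | apply: Or43; lra | apply: Or44; lra]).
  by move=> /eqP -> /=; apply: Or43; lra.
have nT := @null_sum R _ T (fun ab => ab \in T) (fun ab n => cn (G ab.1 ab.2 n)) Tgood.
apply: null_le nT => n; rewrite -big_seq /Sq !Bd_splitE.
have -> : 2 * s / 2 = s by field.
have -> : - s + s / 2 = - (s / 2) by field.
have -> : - s + s = 0 by ring.
have -> : - (s / 2) + s / 2 = 0 by ring.
rewrite !add0r -!/(G _ _ n).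
apply: le_trans (cn_sum T _ _).
by rewrite !big_cons big_nil /= le_eqVlt; apply/orP; left; apply/eqP; congr cn; ring.
Qed.

(** Iterating m times bounds u n by M / 2 ^ m plus a geometric sum of late values of v. The
    recursion runs towards larger n, so the uniform bound M replaces an initial value. *)
Lemma contract_null (u v : nat -> R) M : (forall n, u n <= M) ->
  (forall n, u n <= 2^-1 * (u n.+1 + v n)) -> null v -> null u.
Proof.
have sp := s0.
move=> uM uv nv e e0; have e2 : 0 < e / 2 by lra.
have [N hN] := nv _ e2.
have claim m n : (N <= n)%N -> u n <= M * 2^-1 ^+ m + e / 2.
  elim: m n => [|m ih] n hn; first by rewrite expr0 mulr1; have := uM n; lra.
  apply: le_trans (uv n) _; have := hN _ hn; have := ih n.+1 (leqW hn).
  by rewrite exprS; lra.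
have [m hm] := exists_pow_lt M e2.
by exists N => n /(claim m); lra.
Qed.

Lemma inv_bound w j : s <= cn w -> cn (w^-1 ^+ j) <= s^-1 ^+ j.
Proof.
have sp := s0.
move=> h; rewrite cnX cnV lerXn2r ?nnegrE ?invr_ge0 ?cn_ge0 //.
  exact: ltW.
by rewrite lef_pV2 ?posrE //; apply: lt_le_trans h.
Qed.

(** By homogeneity the sum over the half-sized square is 2 ^ (j + 1) times the sum over the full
    one, while by [annulus_null] the two nearly agree at consecutive levels. Hence the sums contract
    by a factor of at most 1/2. This replaces the existence of a primitive. *)
Lemma beta_null j : null (fun n => cn (Q n (fun w => w^-1 ^+ j.+2))).
Proof.
have sp := s0.
apply: null_unshift.
have df (w : C) : w != 0 -> cdiff (fun v => v^-1 ^+ j.+2) w.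
  by move=> w0; apply: cdiffXn; exact: cdiff_inv.
have h := annulus_null df.
apply: contract_null h.
  by move=> n; apply: Q_le => w hw _; apply: inv_bound.
move=> n /=; set b := Q n.+1 _; set b' := Q n.+2 _.
have -> : Bd n.+1 (fun w => w^-1 ^+ j.+2) (mkc (- (s / 2)) (- (s / 2))) s = 2 ^+ j.+1 * b.
  rewrite Q_scale; have -> : Q n.+1 (fun w => (w / 2)^-1 ^+ j.+2) = 2 ^+ j.+2 * b.
    by rewrite -BdZ; apply: Bd_ext => w; rewrite invfM invrK exprMn mulrC.
  by rewrite exprS; field.
have p2 : 2 <= 2 ^+ j.+1 :> R.
  by rewrite exprS ler_peMr //; apply: exprn_ege1; lra.
have := cnD b' (2 ^+ j.+1 * b - b'); rewrite subrKC cnBC cnM.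
have -> : cn (2 ^+ j.+1 : C) = 2 ^+ j.+1.
  by rewrite cnX -(rc_nat R 2) cn_rc ger0_norm.
by have := ler_wpM2r (cn_ge0 b) p2; lra.
Qed.

Lemma kernel_expand N z w : s <= cn w -> cn z < s ->
  (w - z)^-1 = \sum_(j < N) z ^+ j * w^-1 ^+ j.+1 + z ^+ N * (w^-1 ^+ N * (w - z)^-1).
Proof.
have sp := s0.
move=> hw hz.
have w0 : w != 0 by rewrite -cn_gt0; apply: lt_le_trans hw.
have wz : w - z != 0.
  by rewrite -cn_gt0; have := cnDl w z; lra.
elim: N => [|N ih]; first by rewrite big_ord0 !expr0 add0r !mul1r.
rewrite big_ord_recr /= {1}ih -addrA; congr (_ + _).
rewrite !exprS; move: (z ^+ N) (w^-1 ^+ N) => A B.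
by field; rewrite w0 wz.
Qed.

Lemma kernel_bound z w : s <= cn w -> cn z < s / 2 -> cn (w - z)^-1 <= 2 / s.
Proof.
have sp := s0.
move=> hw hz; have h : s / 2 <= cn (w - z) by have := cnDl w z; lra.
have s2 : 0 < s / 2 by lra.
have -> : 2 / s = (s / 2)^-1 by rewrite invf_div.
by rewrite cnV lef_pV2 ?posrE //; apply: lt_le_trans h.
Qed.

(** Expand 1/(w - z) in powers of z/w: every term after the first is null by [beta_null], and the
    remainder is geometrically small uniformly in n because |z| < s/2. *)
Lemma omega_null z : cn z < s / 2 ->
  null (fun n => cn (Q n (fun w => (w - z)^-1) - Q n (fun w => w^-1))).
Proof.
have sp := s0.
move=> hz e e0; have e2 : 0 < e / 2 by lra.
have zs : cn z < s by apply: lt_trans hz _; lra.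
have [N hN] := exists_pow_lt 16 e2.
have ns : null (fun n => \sum_(j < N) cn (z ^+ j.+1) * cn (Q n (fun w => w^-1 ^+ j.+2))).
  apply: null_sum => j _; apply: nullZ; [exact: cn_ge0 | exact: beta_null].
have [N0 hN0] := ns _ e2; exists N0 => n hn.
have -> : Q n (fun w => (w - z)^-1) = Q n (fun w => w^-1) +
   \sum_(j < N) z ^+ j.+1 * Q n (fun w => w^-1 ^+ j.+2) +
   Q n (fun w => z ^+ N.+1 * (w^-1 ^+ N.+1 * (w - z)^-1)).
  rewrite (@Q_eq n _ (fun w => \sum_(j < N.+1) z ^+ j * w^-1 ^+ j.+1 +
     z ^+ N.+1 * (w^-1 ^+ N.+1 * (w - z)^-1))); last first.
    by move=> w hw _; exact: kernel_expand.
  rewrite {1}/Sq BdD Bd_sum big_ord_recl /= -!/(Sq s _ _); congr (_ + _ + _).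
    by apply: Bd_ext => w; rewrite expr0 mul1r expr1.
  by apply: eq_bigr => j _; rewrite -BdZ.
have aux (a b c : C) : a + b + c - a = b + c by ring.
rewrite aux.
apply: le_lt_trans (cnD _ _) _.
have k1 := le_lt_trans (le_trans (cn_sum _ _ _) _) (hN0 n hn).
have {k1} k1 : cn (\sum_(j < N) z ^+ j.+1 * Q n (fun w => w^-1 ^+ j.+2)) < e / 2.
  by apply: k1; apply: ler_sum => j _; rewrite cnM.
suff : cn (Q n (fun w => z ^+ N.+1 * (w^-1 ^+ N.+1 * (w - z)^-1))) <= 16 * 2^-1 ^+ N by lra.
apply: le_trans (_ : 8 * s * ((s / 2) ^+ N.+1 * (s^-1 ^+ N.+1 * (2 / s))) <= _).
  apply: Q_le => w hw _; rewrite !cnM.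
  apply: ler_pM; rewrite ?mulr_ge0 ?cn_ge0 //.
    by rewrite cnX lerXn2r ?nnegrE ?cn_ge0 //; lra.
  by apply: ler_pM; rewrite ?cn_ge0 ?inv_bound ?kernel_bound.
rewrite [X in 8 * s * X]mulrA -exprMn.
have -> : s / 2 * s^-1 = 2^-1 by field; rewrite gt_eqF.
have -> : 8 * s * (2^-1 ^+ N.+1 * (2 / s)) = 16 * 2^-1 ^+ N.+1 by field; rewrite gt_eqF.
have h0 : 0 <= 2^-1 ^+ N :> R by apply: exprn_ge0; lra.
by rewrite exprS; lra.
Qed.

Lemma vertex_dense z e : cn z < s -> 0 < e -> exists z' k (i j : nat),
  [/\ cn (z' - z) < e, (i <= 2 ^ k)%N, (j <= 2 ^ k)%N &
      z' = mkc (- s + i%:R * (2 * s * 2^-1 ^+ k)) (- s + j%:R * (2 * s * 2^-1 ^+ k))].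
Proof.
have sp := s0.
move=> zs e0; have e2 : 0 < e / 2 by lra.
have [k hk] := exists_pow_lt (2 * s) e2.
have p0' : 0 < 2^-1 ^+ k :> R by apply: exprn_gt0; lra.
have eh : (2 ^ k)%:R * (2 * s * 2^-1 ^+ k) = 2 * s.
  by rewrite mulrCA [_ * 2^-1 ^+ k]mulrC natrX -exprMn mulVf ?pnatr_eq0 // expr1n mulr1.
have h0 : 0 < 2 * s * 2^-1 ^+ k by apply: mulr_gt0 => //; exact: d0.
move: hk h0 eh; set h := _ * _ ^+ k => hk h0 eh.
have coord (x : R) : `|x| < s ->
    exists2 i : nat, (i <= 2 ^ k)%N & `|- s + i%:R * h - x| < e / 2.
  rewrite ltr_norml => /andP[x1 x2].
  have y0 : 0 <= (x + s) / h by apply: divr_ge0; lra.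
  have /andP[l1 l2] := truncn_itv y0.
  set i := Num.truncn _ in l1 l2; exists i.
    rewrite -(ler_nat R) -(ler_pM2r h0) eh.
    by move: l1; rewrite ler_pdivlMr //; lra.
  move: l1 l2; rewrite ler_pdivlMr // ltr_pdivrMr // -[i.+1%:R]natr1 mulrDl mul1r => l1 l2.
  by rewrite ltr_norml; lra.
have [i hi ei] := coord _ (le_lt_trans (cn_re z) zs).
have [j hj ej] := coord _ (le_lt_trans (cn_im z) zs).
exists (mkc (- s + i%:R * h) (- s + j%:R * h)), k, i, j; split=> //.
apply: le_lt_trans (cn_le_reim _) _.
by rewrite reB imB re_mkc im_mkc; lra.
Qed.
End Square.
End TaylorExpansion.

(** * Taylor expansion with a remainder estimate, and isolation of zeros *)

Section TaylorTheorem.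
Context (R : realType).
Local Notation C := (Cplx R).
Implicit Types (f g : C -> C) (z w c : C) (e s M : R).

Lemma le_eps_mul (x y k : R) : (forall e, 0 < e -> x <= y + k * e) -> x <= y.
Proof.
move=> h; apply: le_eps => e e0.
have k1 : 0 < `|k| + 1 by rewrite ltr_wpDl.
apply: le_trans (h (e / (`|k| + 1)) (divr_gt0 e0 k1)) _.
rewrite lerD2l mulrA ler_pdivrMr // mulrC ler_pM2l //.
by apply: le_trans (ler_norm _) _; rewrite lerDl.
Qed.

(** The constants 2 and 4 come from the estimates over the square. The bounds depend on M and s only
    and are therefore stable under limits of functions. *)
Definition tayl s M f (a : nat -> C) :=
  (forall j, cn (a j) <= 2 * M * s^-1 ^+ j) /\
  forall N z, cn z < s / 2 ->
    cn (f z - \sum_(j < N) a j * z ^+ j) <= 4 * M * (cn z / s) ^+ N.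

Lemma filter_forall_lt (U : set (nat -> Prop)) (P : nat -> nat -> Prop) N :
  ProperFilter U -> (forall j, U [set n | P j n]) ->
  U [set n | forall j, (j < N)%N -> P j n].
Proof.
move=> pU h; elim: N => [|N ih]; first by apply: filterS filterT => n _.
apply: filterS (filterI ih (h N)) => n [/= h1 h2] j.
by rewrite ltnS leq_eqVlt => /orP[/eqP -> //|]; exact: h1.
Qed.

(** Estimates valid for every n up to a null error b n pass to the ultrafilter limits of the
    coefficients, since each involves finitely many of them. *)
Lemma coef_limit s M (al : nat -> nat -> C) :
  (forall n j, cn (al n j) <= 2 * M * s^-1 ^+ j) ->
  exists a : nat -> C, (forall j, cn (a j) <= 2 * M * s^-1 ^+ j) /\
  forall (v z : C) N B (b : nat -> R), null b ->
    (forall n, cn (v - \sum_(j < N) al n j * z ^+ j) <= B + b n) ->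
    cn (v - \sum_(j < N) a j * z ^+ j) <= B.
Proof.
move=> hal; have [U pU [Uinf Ulim]] := ultrafilter_limits R.
have [a ha] := choice (fun j => Ulim (fun n => al n j) _ (fun n => hal n j)).
exists a; split=> [j|v z N B b nb hb].
  apply: le_eps => e e0; have [n /= hn] := filter_ex (ha j e e0).
  by have := hal n j; have := cnDl (a j) (al n j); rewrite cnBC; lra.
apply: (@le_eps_mul _ _ (1 + \sum_(j < N) cn z ^+ j)) => e e0.
have [N1 hN1] := nb _ e0.
have [n [/= /hN1 h1 hn2]] := filter_ex (filterI (Uinf N1)
  (filter_forall_lt N pU (fun j => ha j e e0))).
have -> : v - \sum_(j < N) a j * z ^+ j =
    (v - \sum_(j < N) al n j * z ^+ j) + \sum_(j < N) (al n j - a j) * z ^+ j.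
  have -> : \sum_(j < N) (al n j - a j) * z ^+ j =
      \sum_(j < N) al n j * z ^+ j - \sum_(j < N) a j * z ^+ j.
    by rewrite -sumrB; apply: eq_bigr => j _; rewrite mulrBl.
  by ring.
apply: le_trans (cnD _ _) _; have h3 := hb n.
have h4 : cn (\sum_(j < N) (al n j - a j) * z ^+ j) <= (\sum_(j < N) cn z ^+ j) * e.
  apply: le_trans (cn_sum _ _ _) _; rewrite mulr_suml; apply: ler_sum => j _.
  rewrite cnM cnX mulrC; apply: ler_wpM2l; first by rewrite exprn_ge0 ?cn_ge0.
  by apply: ltW; apply: hn2.
by rewrite mulrDl mul1r; lra.
Qed.

Lemma tayl_limit s M (F : nat -> C -> C) (al : nat -> nat -> C) f :
  (forall n, tayl s M (F n) (al n)) ->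
  (forall z, cn z < s / 2 -> null (fun n => cn (f z - F n z))) ->
  exists a, tayl s M f a.
Proof.
move=> hF hf; have [a [ha hlim]] := coef_limit (fun n => (hF n).1).
exists a; split=> // N z hz; apply: hlim (hf z hz) _ => n.
have := (hF n).2 N z hz.
have := cnD (F n z - \sum_(j < N) al n j * z ^+ j) (f z - F n z).
by rewrite addrC subrKA; lra.
Qed.

Lemma le_sqr_norm (x s : R) : - s <= x <= - s + 2 * s -> x ^+ 2 <= s ^+ 2.
Proof. by move=> h; rewrite -subr_ge0 subr_sqr mulr_ge0 //; lra. Qed.

Lemma bound_M0 s M f : 0 < s -> (forall w, cn w < 3 * s -> cn (f w) <= M) -> 0 <= M.
Proof.
move=> s0 /(_ 0) h; apply: le_trans (cn_ge0 (f 0)) (h _).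
by rewrite cn0; lra.
Qed.

(** Cauchy's formula at level n, with expansion of the kernel giving the coefficients. Division by
    the sum of 1/w, of modulus at least 4, replaces division by 2 pi i. The two errors are the sum
    of the difference quotient and the change of the sum of 1/w when its pole moves to z. *)
Lemma taylor_vertex s M f z n N : 0 < s ->
  (forall w, cn w < 3 * s -> cdiff f w) -> (forall w, cn w < 3 * s -> cn (f w) <= M) ->
  cn z < s / 2 ->
  cn (f z - \sum_(j < N) (Sq s n (fun w => f w * w^-1 ^+ j.+1) / Sq s n (fun w => w^-1))
     * z ^+ j) <= 4 * M * (cn z / s) ^+ N +
     4^-1 * (cn (Sq s n (fun w => (f w - f z) / (w - z))) +
     M * cn (Sq s n (fun w => (w - z)^-1) - Sq s n (fun w => w^-1))).
Proof.
move=> s0 df fM hz; have M0 := bound_M0 s0 fM.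
have hS w : inS (mkc (- s) (- s)) (2 * s) w -> cn w < 3 * s.
  rewrite /inS re_mkc im_mkc => -[h1 h2].
  have e : cn w ^+ 2 <= 2 * s ^+ 2.
    have h3 := le_sqr_norm h1; have h4 := le_sqr_norm h2; rewrite cn2; lra.
  rewrite -(@ltr_pXn2r _ 2) ?nnegrE ?cn_ge0 //; last lra.
  by apply: le_lt_trans e _; have : 0 < s ^+ 2 by [exact: exprn_gt0]; rewrite exprMn; lra.
set om := Sq s n (fun w => w^-1); have om4 : 4 <= cn om := omega_ge s0 n.
have om0 : om != 0 by rewrite -cn_gt0; lra.
set X := Sq s n (fun w => (f w - f z) / (w - z)).
set kap := Sq s n (fun w => (w - z)^-1) - om.
pose Rem := Sq s n (fun w => f w * (w^-1 ^+ N * (w - z)^-1)).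
have zs : cn z < s by lra.
have e1 : Sq s n (fun w => f w / (w - z)) =
    \sum_(j < N) z ^+ j * Sq s n (fun w => f w * w^-1 ^+ j.+1) + z ^+ N * Rem.
  rewrite (@Q_eq _ s s0 n _ (fun w => \sum_(j < N) z ^+ j * (f w * w^-1 ^+ j.+1) +
     z ^+ N * (f w * (w^-1 ^+ N * (w - z)^-1)))); last first.
    move=> w hw _; rewrite [in LHS](kernel_expand s0 N hw zs) mulrDr mulr_sumr.
    by congr (_ + _); [apply: eq_bigr => l _; rewrite mulrCA | rewrite mulrCA].
  rewrite {1}/Sq BdD Bd_sum -!/(Sq s _ _); congr (_ + _); last by rewrite -BdZ.
  by apply: eq_bigr => l _; rewrite -BdZ.
have e2 : X = Sq s n (fun w => f w / (w - z)) - f z * (om + kap).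
  rewrite /kap subrKC -BdZ -BdB; apply: Bd_ext => w; by rewrite mulrBl.
have e3 : f z - \sum_(j < N) (Sq s n (fun w => f w * w^-1 ^+ j.+1) / om) * z ^+ j =
    om^-1 * (z ^+ N * Rem - X - f z * kap).
  have -> : \sum_(j < N) (Sq s n (fun w => f w * w^-1 ^+ j.+1) / om) * z ^+ j =
      om^-1 * \sum_(j < N) z ^+ j * Sq s n (fun w => f w * w^-1 ^+ j.+1).
    by rewrite mulr_sumr; apply: eq_bigr => l _; rewrite mulrAC mulrC [z ^+ l * _]mulrC.
  rewrite e2 e1; move: (\sum_(j < N) _) => S; by field.
have hRem : cn Rem <= 8 * s * (M * (s^-1 ^+ N * (2 / s))).
  apply: (Q_le s0) => w hw inw; rewrite !cnM; apply: ler_pM => //.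
  - exact: cn_ge0.
  - by rewrite mulr_ge0 ?cn_ge0.
  - exact/fM/hS.
  - by apply: ler_pM; rewrite ?cn_ge0 ?(inv_bound s0) ?(kernel_bound s0).
have hz1 : cn (f z) <= M by apply: fM; lra.
rewrite e3 cnM cnV.
have h4 : (cn om)^-1 <= 4^-1 by rewrite lef_pV2 ?posrE //; lra.
apply: le_trans (ler_wpM2r (cn_ge0 _) h4) _.
have h5 : cn (z ^+ N * Rem) <= 16 * M * (cn z / s) ^+ N.
  rewrite cnM cnX; apply: le_trans (ler_wpM2l (exprn_ge0 _ (cn_ge0 _)) hRem) _.
  rewrite exprMn le_eqVlt; apply/orP; left; apply/eqP.
  move: (s^-1 ^+ N) (cn z ^+ N) => a b; by field; rewrite gt_eqF.
have h6 : cn (f z * kap) <= M * cn kap by rewrite cnM ler_wpM2r ?cn_ge0.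
have := cnB (z ^+ N * Rem - X) (f z * kap); have := cnB (z ^+ N * Rem) X.
lra.
Qed.

Theorem taylor0 s M f : 0 < s ->
  (forall w, cn w < 3 * s -> cdiff f w) -> (forall w, cn w < 3 * s -> cn (f w) <= M) ->
  exists a, tayl s M f a.
Proof.
move=> s0 df fM; have M0 := bound_M0 s0 fM.
pose al n j := Sq s n (fun w => f w * w^-1 ^+ j.+1) / Sq s n (fun w => w^-1).
have hS w : inS (mkc (- s) (- s)) (2 * s) w -> cn w < 3 * s.
  rewrite /inS re_mkc im_mkc => -[h1 h2].
  have e : cn w ^+ 2 <= 2 * s ^+ 2.
    have h3 := le_sqr_norm h1; have h4 := le_sqr_norm h2; rewrite cn2; lra.
  rewrite -(@ltr_pXn2r _ 2) ?nnegrE ?cn_ge0 //; last lra.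
  by apply: le_lt_trans e _; have : 0 < s ^+ 2 by [exact: exprn_gt0]; rewrite exprMn; lra.
have hal n j : cn (al n j) <= 2 * M * s^-1 ^+ j.
  rewrite cnM cnV ler_pdivrMr; last by have := omega_ge s0 n; lra.
  apply: le_trans (_ : 8 * s * (M * s^-1 ^+ j.+1) <= _).
    apply: (Q_le s0) => w hw inw; rewrite cnM.
    by apply: ler_pM; rewrite ?cn_ge0 ?(inv_bound s0) //; exact/fM/hS.
  have -> : 8 * s * (M * s^-1 ^+ j.+1) = 2 * M * s^-1 ^+ j * 4.
    by rewrite exprS; move: (s^-1 ^+ j) => a; field; rewrite gt_eqF.
  apply: ler_wpM2l (omega_ge s0 n).
  by rewrite !mulr_ge0 ?exprn_ge0 ?invr_ge0 // ltW.
pose V := [set z | exists k (i j : nat), [/\ (i <= 2 ^ k)%N, (j <= 2 ^ k)%N &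
  z = mkc (- s + i%:R * (2 * s * 2^-1 ^+ k)) (- s + j%:R * (2 * s * 2^-1 ^+ k))]].
have [a [ha hlim]] := coef_limit hal.
have onV z N : V z -> cn z < s / 2 ->
    cn (f z - \sum_(j < N) a j * z ^+ j) <= 4 * M * (cn z / s) ^+ N.
  move=> [k [i [j [hi hj ez]]]] hz.
  apply: (hlim _ _ _ _ (fun n => 4^-1 *
    (cn (Sq s n (fun w => (f w - f z) / (w - z))) +
     M * cn (Sq s n (fun w => (w - z)^-1) - Sq s n (fun w => w^-1))))).
    apply: nullZ; first lra; apply: nullD; last first.
      by apply: nullZ => //; apply: omega_null.
    apply: (vertex_null _ hi hj ez) => [|w /hS]; [lra | exact: df].
  by move=> n; apply: taylor_vertex.
exists a; split=> // N z hz.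
(* The estimate is known at dyadic points. For fixed N both of its sides are continuous in z, so
   [vertex_dense] extends it. *)
have c1 : cdiff (fun w => f w - \sum_(j < N) a j * w ^+ j) z.
  apply: cdiffB; first by apply: df; lra.
  elim: N => [|N ih].
    by apply: (cdiff_near ltr01 _ (cdiff_cst 0 z)) => w _; rewrite big_ord0.
  have k1 := cdiffD ih (cdiffZ (a N) (cdiffXn N (cdiff_id z))).
  by apply: (cdiff_near ltr01 _ k1) => w _; rewrite big_ord_recr.
have c2 : cdiff (fun w => (rc s^-1 * w) ^+ N) z.
  exact/cdiffXn/cdiffZ/cdiff_id.
apply: (@le_eps_mul _ _ (1 + 4 * M)) => e e0.
have [r1 r10 h1] := cdiff_cont c1 e0; have [r2 r20 h2] := cdiff_cont c2 e0.
pose r := Num.min (Num.min r1 r2) (s / 2 - cn z).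
have r0 : 0 < r by rewrite !lt_min r10 r20; lra.
have [|z' [k [i [j [hz' hi hj ez]]]]] := @vertex_dense _ s s0 z r _ r0; first lra.
move: hz'; rewrite !lt_min => /andP[/andP[/h1 g1 /h2 g2] g3].
have z's : cn z' < s / 2 by have := cnDl z' z; lra.
have := onV z' N (ex_intro _ k (ex_intro _ i (ex_intro _ j (And3 hi hj ez)))) z's.
have cX w : cn ((rc s^-1 * w) ^+ N) = (cn w / s) ^+ N.
  by rewrite cnX cnM cn_rc ger0_norm ?invr_ge0 ?(ltW s0) // mulrC.
have := cnDl ((rc s^-1 * z') ^+ N) ((rc s^-1 * z) ^+ N).
rewrite !cX => k1 k2.
have := cnDl (f z - \sum_(j < N) a j * z ^+ j) (f z' - \sum_(j < N) a j * z' ^+ j).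
rewrite [X in _ <= X]cnBC => k3.
have M4 : 0 <= 4 * M by rewrite mulr_ge0.
have k4 : 4 * M * (cn z' / s) ^+ N <= 4 * M * ((cn z / s) ^+ N + e).
  by apply: ler_wpM2l => //; rewrite -lerBlDl; apply: le_trans k1 (ltW g2).
move: (le_trans k3 (ltW g1)); rewrite lerBlDl => k5.
apply: le_trans k5 _; apply: le_trans (lerD (le_trans k2 k4) (lexx e)) _.
rewrite le_eqVlt; apply/orP; left; apply/eqP.
by move: ((cn z / s) ^+ N) => P; ring.
Qed.

(** If all coefficients vanish, the remainder estimate for large N gives f = 0 near 0. Otherwise the
    first nonzero term a m z^m dominates the remainder of order m + 1 close to 0. *)
Lemma tayl_dichotomy s M f a : 0 < s -> 0 <= M -> tayl s M f a ->
  (exists2 r, 0 < r & forall z, cn z < r -> f z = 0) \/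
  (exists2 r, 0 < r & forall z, z != 0 -> cn z < r -> f z != 0).
Proof.
move=> s0 M0 [_ h].
have [[m am]|am] := pselect (exists m, a m != 0); last first.
  left; exists (s / 2) => [|z hz]; first lra.
  apply: cn_le0; apply: le_eps => e e0; rewrite add0r.
  have [N hN] := exists_pow_lt (4 * M) e0.
  apply: le_trans (ltW hN).
  have := h N z hz; rewrite big1 ?subr0; last first.
    by move=> j _; have [->|aj] := eqVneq (a j) 0; [rewrite mul0r | case: am; exists j].
  move=> k; apply: le_trans k _; apply: ler_wpM2l; first by rewrite mulr_ge0.
  rewrite lerXn2r ?nnegrE ?divr_ge0 ?cn_ge0 ?(ltW s0) //.
    by rewrite invr_ge0.
  by rewrite ler_pdivrMr // mulrC; lra.
right; have ex : exists n, a n != 0 by exists m.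
case: (ex_minnP ex) => {m am ex} m am hm.
have az : forall j : 'I_m, a j = 0.
  move=> j; apply/eqP/negPn/negP => /hm; by rewrite leqNgt ltn_ord.
have cm : 0 < cn (a m) by rewrite cn_gt0.
pose q := 4 * M * s^-1 ^+ m.+1.
have q0 : 0 <= q by rewrite !mulr_ge0 ?exprn_ge0 ?invr_ge0 // ltW.
have q1 : 0 < q + 1 by lra.
exists (Num.min (s / 2) (cn (a m) / (q + 1))) => [|z z0].
  by rewrite lt_min; apply/andP; split; [lra | exact: divr_gt0].
rewrite lt_min => /andP[hz hq]; apply/eqP => fz.
have zp : 0 < cn z by rewrite cn_gt0.
have := h m.+1 z hz.
rewrite fz sub0r cnN big_ord_recr big1 /=; last by move=> j _; rewrite az mul0r.
rewrite add0r.
rewrite cnM cnX exprMn mulrA.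
have -> : 4 * M * cn z ^+ m.+1 * s^-1 ^+ m.+1 = (q * cn z) * cn z ^+ m.
  by rewrite /q [cn z ^+ m.+1]exprS; ring.
rewrite ler_pM2r ?exprn_gt0 //.
by move: hq; rewrite ltr_pdivlMr //; nra.
Qed.
End TaylorTheorem.


(** * Continuation in the upper half-plane *)

Section Continuation.
Context (R : realType).
Local Notation C := (Cplx R).
Implicit Types (O G W : C -> Prop) (z w a b : C).

Definition locconst O W := forall z, O z -> exists2 r : R, 0 < r &
  forall w, O w -> cn (w - z) < r -> (W w <-> W z).

(** Connectedness of a segment: the supremum of the parameters up to which W persists cannot lie
    below 1. *)
Lemma segment_const O W a b : locconst O W ->
  (forall t : R, 0 <= t <= 1 -> O (a + rc t * (b - a))) -> W a -> W b.
Proof.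
move=> lc onO Wa; pose g (t : R) := a + rc t * (b - a).
have g0 : g 0 = a by rewrite /g rc0 mul0r addr0.
have g1 : g 1 = b by rewrite /g rc1 mul1r subrKC.
pose D := cn (b - a) + 1; have D0 : 0 < D by rewrite /D; have := cn_ge0 (b - a); lra.
have gd t u : cn (g t - g u) <= `|t - u| * D.
  have -> : g t - g u = rc (t - u) * (b - a) by rewrite /g rcB; ring.
  by rewrite cnM cn_rc ler_wpM2l // /D; lra.
pose T := [set t : R | 0 <= t <= 1 /\ forall u : R, 0 <= u <= t -> W (g u)].
have T0 : T 0.
  split; first by rewrite lexx ler01.
  by move=> u /andP[u0 u1]; have -> : u = 0 by [apply/eqP; rewrite eq_le u0 u1]; rewrite g0.
have ubT : ubound T 1 by move=> t [/andP[]].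
have supT : has_sup T by split; [exists 0 | exists 1].
have t0 : 0 <= sup T by apply: ub_le_sup => //; exists 1.
have t1 : sup T <= 1 by apply: ge_sup => //; exists 0.
have [|r r0 hr] := lc (g (sup T)); first by apply: onO; rewrite t0 t1.
have rD : 0 < r / D by rewrite divr_gt0.
have near (u : R) : 0 <= u <= 1 -> `|u - sup T| < r / D -> (W (g u) <-> W (g (sup T))).
  move=> hu h; apply: hr; first exact: onO.
  by apply: le_lt_trans (gd _ _) _; rewrite -ltr_pdivlMr.
have [t Tt ht] := sup_adherent rD supT.
have tle : t <= sup T by apply: ub_le_sup => //; exists 1.
have Wsup : W (g (sup T)).
  have [/andP[a1 a2] a3] := Tt.
  apply/(near t); first by rewrite a1.
    by rewrite ltr_norml; lra.
  by apply: a3; rewrite a1 lexx.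
pose t' := Num.min 1 (sup T + r / D / 2).
have Tt' : T t'.
  split; first by rewrite /t' le_min ge_min lexx ler01 /=; lra.
  move=> u /andP[u0]; rewrite le_min => /andP[u1 u2].
  have [ut|ut] := leP u t; first by apply: (proj2 Tt); rewrite u0.
  apply/(near u) => //; first by rewrite u0.
  by rewrite ltr_norml; lra.
have := ub_le_sup (ex_intro _ 1 ubT) Tt'.
rewrite /t' ge_min => /orP[h|h]; last by exfalso; move: rD h; clear; lra.
have e1 : sup T = 1 by apply: le_anti; rewrite t1 h.
by rewrite -g1 -e1.
Qed.

(** Connectedness of a punctured disc. A point of the closed upper half is joined to [up], one of
    the open lower half to [dn], and both of these to [mi], by segments that miss the centre. *)
Lemma punctured_const O W z r : 0 < r -> locconst O W ->
  (forall w, w != z -> cn (w - z) < r -> O w) ->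
  forall p q, p != z -> cn (p - z) < r -> q != z -> cn (q - z) < r -> W p -> W q.
Proof.
move=> r0 lc hO.
have r2 : 0 <= r / 2 by lra.
pose up : C := z + mkc 0 (r / 2); pose dn : C := z + mkc 0 (- (r / 2)).
pose mi : C := z + mkc (r / 2) 0.
have cmk (x y : R) : `|x| + `|y| < r -> cn (mkc x y : C) < r.
  by move=> h; apply: le_lt_trans (cn_le_reim _) _; rewrite re_mkc im_mkc.
have seg p q (sg : R) : (sg == 1) || (sg == -1) -> p != z -> cn (p - z) < r ->
    q != z -> cn (q - z) < r ->
    0 <= sg * im (p - z) -> 0 < sg * im (q - z) -> (W p -> W q) /\ (W q -> W p).
  move=> hs pz pr qz qr ip iq.
  have inr (a b : C) : cn (a - z) < r -> cn (b - z) < r ->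
      forall t, 0 <= t <= 1 -> cn (a + rc t * (b - a) - z) < r.
    move=> ar br t /andP[t0 t1].
    have -> : a + rc t * (b - a) - z = rc (1 - t) * (a - z) + rc t * (b - z).
      by rewrite rcB rc1; ring.
    apply: le_lt_trans (cnD _ _) _; rewrite !cnM !cn_rc !ger0_norm ?subr_ge0 //.
    have mr : Num.max (cn (a - z)) (cn (b - z)) < r by rewrite gt_max ar br.
    have ma : cn (a - z) <= Num.max (cn (a - z)) (cn (b - z)) by rewrite le_max lexx.
    have mb : cn (b - z) <= Num.max (cn (a - z)) (cn (b - z)) by rewrite le_max lexx orbT.
    apply: le_lt_trans mr; have t1' : 0 <= 1 - t by rewrite subr_ge0.
    by have := ler_wpM2l t1' ma; have := ler_wpM2l t0 mb; lra.
  have imz (a b : C) t : im (a + rc t * (b - a) - z) =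
      (1 - t) * im (a - z) + t * im (b - z).
    by rewrite !imB imD im_rcM !imB; ring.
  split; apply: segment_const lc _ => t /[dup] tt /andP[t0 t1]; apply: hO; try exact: inr.
  - apply/eqP => e; have := imz p q t; rewrite e subrr im0 => e2.
    have e3 : (1 - t) * (sg * im (p - z)) + t * (sg * im (q - z)) = 0.
      by rewrite -(mulr0 sg) e2; ring.
    have tz : t = 0 by nra.
    by move: e pz; rewrite tz rc0 mul0r addr0 => ->; rewrite eqxx.
  - apply/eqP => e; have := imz q p t; rewrite e subrr im0 => e2.
    have e3 : (1 - t) * (sg * im (q - z)) + t * (sg * im (p - z)) = 0.
      by rewrite -(mulr0 sg) e2; ring.
    have tz : t = 1 by nra.
    by move: e pz; rewrite tz rc1 mul1r subrKC => ->; rewrite eqxx.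
have zD (x y : R) : (x != 0) || (y != 0) -> z + mkc x y != z.
  move=> h; apply/eqP => e; have e2 : mkc x y = 0 by apply: (@addrI _ z); rewrite e addr0.
  by move: h (congr1 re e2) (congr1 im e2); rewrite re_mkc im_mkc re0 im0 => h' e1 e3; move: h'; rewrite e1 e3 eqxx.
have Dz (x y : R) : z + mkc x y - z = mkc x y by rewrite addrAC subrr add0r.
have [mz uz dz] : [/\ mi != z, up != z & dn != z].
  by split; apply: zD; rewrite ?oppr_eq0 ?(gt_eqF (_ : 0 < r / 2)) ?orbT //; lra.
have [mr ur dr] : [/\ cn (mi - z) < r, cn (up - z) < r & cn (dn - z) < r].
  by split; rewrite Dz; apply: cmk; rewrite ?normrN normr0 ger0_norm //; lra.
have s1 : ((1 : R) == 1) || ((1 : R) == -1) by rewrite eqxx.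
have s2 : ((-1 : R) == 1) || ((-1 : R) == -1) by rewrite eqxx orbT.
have mu := seg mi up 1 s1 mz mr uz ur.
have md := seg mi dn (-1) s2 mz mr dz dr.
rewrite !Dz !im_mkc !mul1r !mulN1r opprK in mu md.
have {}mu := mu ltac:(lra) ltac:(lra); have {}md := md ltac:(lra) ltac:(lra).
have all p : p != z -> cn (p - z) < r -> (W p -> W mi) /\ (W mi -> W p).
  move=> pz pr; have [h|h] := leP 0 (im (p - z)).
    have := seg p up 1 s1 pz pr uz ur; rewrite Dz im_mkc !mul1r => /(_ h ltac:(lra)).
    tauto.
  have := seg p dn (-1) s2 pz pr dz dr; rewrite Dz im_mkc !mulN1r opprK => /(_ ltac:(lra) ltac:(lra)).
  tauto.
move=> p q pz pr qz qr; have := all p pz pr; have := all q qz qr; tauto.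
Qed.

(** [W'] extends W across the punctures by its constant value on a small punctured disc. It is
    locally constant on the whole half-plane, which is convex, so [segment_const] applies. *)
Lemma continuation G W :
  (forall z, 0 < im z -> exists2 r : R, 0 < r & forall w, w != z -> cn (w - z) < r ->
     G w /\ 0 < im w) ->
  locconst (fun z => G z /\ 0 < im z) W ->
  forall z1 z2, G z1 -> 0 < im z1 -> G z2 -> 0 < im z2 -> W z1 -> W z2.
Proof.
move=> hG lc; pose W' z := exists2 r : R, 0 < r &
  forall w, w != z -> cn (w - z) < r -> W w.
have point z r : 0 < r -> z + rc (r / 2) != z /\ cn (z + rc (r / 2) - z) < r.
  move=> r0; split; last by rewrite addrAC subrr add0r cn_rc ger0_norm; lra.
  rewrite -subr_eq0 addrAC subrr add0r rc_eq0; lra.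
have W'E z : G z -> 0 < im z -> (W' z <-> W z).
  move=> Gz iz; have [r r0 hr] := lc z (conj Gz iz); have [r1 r10 hr1] := hG z iz.
  split=> [[r2 r20 hr2]|Wz].
    have m0 : 0 < Num.min r (Num.min r1 r2) by rewrite !lt_min r0 r10.
    have [p1 p2] := point z _ m0; move: p2; rewrite !lt_min => /andP[a /andP[b c]].
    by apply/(hr _ (hr1 _ p1 b) a); apply: hr2.
  exists (Num.min r r1) => [|w wz]; first by rewrite lt_min r0.
  by rewrite lt_min => /andP[a b]; apply/(hr _ (hr1 _ wz b) a).
have lc' : locconst (fun z => 0 < im z) W'.
  move=> z iz; have [r r0 hr] := hG z iz.
  have pc := punctured_const r0 lc hr.
  exists r => // w iw wr; have [-> //|wz] := eqVneq w z.
  have [Gw _] := hr _ wz wr; rewrite (W'E _ Gw iw); split=> [Ww|[r2 r20 hr2]].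
    by exists r => // v vz vr; apply: (pc w).
  have m0 : 0 < Num.min r r2 by rewrite !lt_min r0.
  have [p1 p2] := point z _ m0; move: p2; rewrite !lt_min => /andP[a b].
  by apply: (pc _ _ p1 a wz wr); apply: hr2.
move=> z1 z2 G1 i1 G2 i2 /(W'E _ G1 i1) h; apply/(W'E _ G2 i2).
apply: segment_const lc' _ h => t /andP[t0 t1].
by rewrite imD im_rcM imB; nra.
Qed.
End Continuation.

(** * Hilbert spaces *)

Section Sequences.
Context (R : realType).
Local Notation C := (Cplx R).

Definition clim (u : nat -> C) l := null (fun n => cn (u n - l)).

Lemma clim_unique u l l' : clim u l -> clim u l' -> l = l'.
Proof.
move=> h h'; apply/eqP; rewrite -subr_eq0; apply/eqP/cn_le0.
apply: null_const; apply: null_le (nullD h h') => n.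
by have := cnD (l - u n) (u n - l'); rewrite subrKA [cn (l - u n)]cnBC.
Qed.
Lemma climD u v l k : clim u l -> clim v k -> clim (fun n => u n + v n) (l + k).
Proof.
move=> h h'; apply: null_le (nullD h h') => n.
have -> : u n + v n - (l + k) = (u n - l) + (v n - k) by ring.
exact: cnD.
Qed.
Lemma climZ c u l : clim u l -> clim (fun n => c * u n) (c * l).
Proof.
move=> h; apply: null_le (nullZ (cn_ge0 c) h) => n.
by rewrite -mulrBr cnM.
Qed.
Lemma climJ u l : clim u l -> clim (fun n => (u n)^*) l^*.
Proof. by move=> h; apply: (null_le _ h) => n; rewrite -conjB cnJ. Qed.
Lemma clim_cst l : clim (fun=> l) l.
Proof. by apply: (null_le _ (@null0 R)) => n; rewrite subrr cn0. Qed.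
Lemma clim_ext u v l : (forall n, u n = v n) -> clim u l -> clim v l.
Proof. by move=> h k; apply: (null_le _ k) => n; rewrite h. Qed.
Lemma clim_re_ge u l : clim u l -> (forall n, 0 <= re (u n)) -> 0 <= re l.
Proof.
move=> h u0; rewrite leNgt; apply/negP => l0.
have e0 : 0 < - re l by lra.
have [N hN] := h _ e0; have := hN N (leqnn _); have := u0 N.
have := cn_re (u N - l); rewrite reB => /(le_trans (ler_norm _)); lra.
Qed.

Lemma cauchy_complex (u : nat -> C) :
  (forall e : R, 0 < e -> exists N, forall m n, (N <= m)%N -> (N <= n)%N ->
    cn (u m - u n) < e) -> exists l, clim u l.
Proof.
move=> hc; have [N0 h0] := hc 1 ltr01.
have [U pU [Uinf Ulim]] := ultrafilter_limits R.
have bd n : cn (u (n + N0)%N) <= cn (u N0) + 1.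
  have := h0 _ _ (leq_addl n N0) (leqnn N0).
  by have := cnDl (u (n + N0)%N) (u N0); lra.
have [l hl] := Ulim _ _ bd; exists l => e e0.
have e2 : 0 < e / 2 by lra.
have [N hN] := hc _ e2; exists N => n hn.
have [m [/= m1 m2]] := filter_ex (filterI (Uinf N) (hl _ e2)).
have := hN _ _ hn (leq_trans m1 (leq_addr N0 m)).
have := cnD (u n - u (m + N0)%N) (u (m + N0)%N - l).
by rewrite subrKA; lra.
Qed.
End Sequences.

(** * Riesz representation, extension by continuity, perturbation of inverses *)

Section HilbertSpaces.
Context (R : realType).
Local Notation C := (Cplx R).

Definition cau (V : lmodType C) (s : V -> V -> C) (u : nat -> V) :=
  forall e : R, 0 < e -> exists N, forall m n, (N <= m)%N -> (N <= n)%N ->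
    nrm s (u m - u n) < e.
Definition slim (V : lmodType C) (s : V -> V -> C) (u : nat -> V) l :=
  null (fun n => nrm s (u n - l)).
Definition cmpl (V : lmodType C) (s : V -> V -> C) :=
  forall u, cau s u -> exists l, slim s u l.
Definition is_def (V : lmodType C) (s : V -> V -> C) :=
  forall x, nrm s x = 0 -> x = 0.

Record hilb (V : lmodType C) (s : V -> V -> C) : Prop := Hilb {
  hb_h : is_herm s; hb_p : is_psd s; hb_d : is_def s; hb_c : cmpl s }.

Definition lin (V W : lmodType C) (T : V -> W) := forall a x y,
  T (a *: x + y) = a *: T x + T y.

Lemma lin_linear (V W : lmodType C) (T : {linear V -> W}) : lin T.
Proof. by move=> a x y; rewrite linearP. Qed.
Lemma linear_of (V W : lmodType C) (T : V -> W) : lin T ->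
  exists F : {linear V -> W}, F =1 T.
Proof.
move=> h; pose L := GRing.isLinear.Build C V W *:%R T h.
by exists (HB.pack_for {linear V -> W} T L).
Qed.

Section Lin.
Context (V W : lmodType C) (T : V -> W) (lT : lin T).
Lemma linD x y : T (x + y) = T x + T y.
Proof. by rewrite -{1}[x]scale1r lT scale1r. Qed.
Lemma lin0 : T 0 = 0.
Proof. by apply: (@addrI _ (T 0)); rewrite -linD !addr0. Qed.
Lemma linZ a x : T (a *: x) = a *: T x.
Proof. by rewrite -[a *: x]addr0 lT lin0 addr0. Qed.
Lemma linN x : T (- x) = - T x.
Proof. by rewrite -scaleN1r linZ scaleN1r. Qed.
Lemma linB x y : T (x - y) = T x - T y.
Proof. by rewrite linD linN. Qed.
Lemma lin_sum (I : Type) (r : seq I) (P : pred I) (F : I -> V) :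
  T (\sum_(i <- r | P i) F i) = \sum_(i <- r | P i) T (F i).
Proof. by elim/big_rec2: _ => [|i y x _ <-]; rewrite ?lin0 ?linD. Qed.
End Lin.

Section SeqLimits.
Context (V : lmodType C) (s : V -> V -> C) (hs : is_herm s) (ps : is_psd s).

Lemma slim_cau u l : slim s u l -> cau s u.
Proof.
move=> h e e0; have e2 : 0 < e / 2 by lra.
have [N hN] := h _ e2; exists N => m n /hN hm /hN hn.
have := nrmD hs ps (u m - l) (l - u n); rewrite subrKA [nrm s (l - u n)]nrmBC //.
by lra.
Qed.
Lemma slim_unique u l l' : slim s u l -> slim s u l' -> nrm s (l - l') = 0.
Proof.
move=> h h'; apply: le_anti; rewrite nrm_ge0 andbT.
apply: null_const; apply: null_le (nullD h h') => n.
by have := nrmD hs ps (l - u n) (u n - l'); rewrite subrKA [nrm s (l - u n)]nrmBC.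
Qed.
Lemma slimD u v l k : slim s u l -> slim s v k -> slim s (fun n => u n + v n) (l + k).
Proof.
move=> h h'; apply: null_le (nullD h h') => n.
by rewrite opprD addrACA; exact: nrmD.
Qed.
Lemma slimZ c u l : slim s u l -> slim s (fun n => c *: u n) (c *: l).
Proof.
move=> h; apply: null_le (nullZ (cn_ge0 c) h) => n.
by rewrite -scalerBr (nrmZ hs).
Qed.
Lemma slim_cst l : slim s (fun=> l) l.
Proof. by apply: (null_le _ (@null0 R)) => n; rewrite subrr (nrm0 hs). Qed.
Lemma slim_form u l y : slim s u l -> clim (fun n => s (u n) y) (s l y).
Proof.
move=> h; apply: null_le (nullZ (nrm_ge0 s y) h) => n.
rewrite -(sBl hs) mulrC; exact: cauchy_schwarz.
Qed.
Lemma cau_bounded u : cau s u -> exists M : R, forall n, nrm s (u n) <= M.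
Proof.
move=> /(_ 1 ltr01) [N hN].
exists (\sum_(i < N) nrm s (u i) + nrm s (u N) + 1) => n.
have s0 : 0 <= \sum_(i < N) nrm s (u i) by apply: sumr_ge0 => i _; exact: nrm_ge0.
have n0 := nrm_ge0 s (u N).
have [h|h] := leqP N n.
  have := hN _ _ h (leqnn N); have := nrmDl hs ps (u n) (u N); lra.
have := ler_sum (index_enum 'I_N) (fun i (_ : true) => nrm_ge0 s (u i)).
have : nrm s (u n) <= \sum_(i < N) nrm s (u i).
  rewrite (bigD1 (Ordinal h)) //= lerDl; apply: sumr_ge0 => i _; exact: nrm_ge0.
lra.
Qed.
End SeqLimits.

Lemma quad_zero (A B : R) : (forall t : R, 0 <= A * t ^+ 2 + 2 * B * t) -> B = 0.
Proof.
move=> h; have h1 : 0 <= `|A| + 1 by rewrite addr_ge0.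
have k : 0 < `|A| + 1 by rewrite ltr_wpDl.
have := h (- (B / (`|A| + 1))); rewrite sqrrN => h2.
have h3 : A * (B / (`|A| + 1)) ^+ 2 <= (`|A| + 1) * (B / (`|A| + 1)) ^+ 2.
  by apply: ler_wpM2r; [exact: sqr_ge0 | have := ler_norm A; lra].
have e : (`|A| + 1) * (B / (`|A| + 1)) ^+ 2 = B * (B / (`|A| + 1)).
  by field; rewrite gt_eqF.
have h4 : 0 <= - (B * (B / (`|A| + 1))).
  have -> : - (B * (B / (`|A| + 1))) = B * (B / (`|A| + 1)) + 2 * B * - (B / (`|A| + 1)) by ring.
  by rewrite e in h3; lra.
rewrite oppr_ge0 mulrA -expr2 in h4.
have h5 : B ^+ 2 <= 0 by rewrite -[0](mul0r (`|A| + 1)) -ler_pdivrMr.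
by apply/eqP; rewrite -sqrf_eq0 eq_le h5 sqr_ge0.
Qed.

(** The functional |x|^2 - 2 re l(x) is bounded below, and the parallelogram law makes a minimising
    sequence Cauchy. Its limit y is a critical point, which identifies the real parts; the vector -
    i v gives the imaginary parts. *)
Lemma riesz (V : lmodType C) (s : V -> V -> C) (l : V -> C) (M : R) :
  is_herm s -> is_psd s -> cmpl s ->
  (forall a x y, l (a *: x + y) = a * l x + l y) ->
  (forall x, cn (l x) <= M * nrm s x) ->
  exists y, forall x, l x = s x y.
Proof.
move=> hs ps cs ll lM.
have lD x y : l (x + y) = l x + l y by rewrite -{1}[x]scale1r ll mul1r.
have l0 : l 0 = 0 by apply: (@addrI _ (l 0)); rewrite -lD !addr0.
have lZ a x : l (a *: x) = a * l x by rewrite -[a *: x]addr0 ll l0 addr0.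
have lN x : l (- x) = - l x by rewrite -scaleN1r lZ mulN1r.
have [F FE] : exists F : V -> R, forall x, F x = nrm s x ^+ 2 - 2 * re (l x).
  by exists (fun x => nrm s x ^+ 2 - 2 * re (l x)).
have Fge x : - (M ^+ 2) <= F x.
  have := le_trans (re_le_cn _) (lM x); have := sqr_ge0 (nrm s x - M).
  rewrite FE; move: (nrm s x) (re (l x)) => a b; nra.
pose S := [set F x | x in setT].
have hS : has_inf S.
  by split; [exists (F 0), 0 | exists (- (M ^+ 2)) => _ [x _ <-]].
have mF x : inf S <= F x by apply: ge_inf; [exact: hS.2 | exists x].
have seqx n : exists x, F x < inf S + n.+1%:R^-1.
  have e0 : 0 < n.+1%:R^-1 :> R by rewrite invr_gt0.
  by have [_ [x _ <-] hx] := inf_adherent e0 hS; exists x.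
have [x hx] := choice seqx.
move: (inf S) mF hx => m mF hx {seqx hS S}.
have par a b : nrm s (a - b) ^+ 2 <= 2 * (F a - m) + 2 * (F b - m).
  have := mF (2^-1 *: (a + b)); rewrite !FE (nrmZ hs) lZ lD half_rc cn_rc re_rcM reD.
  rewrite ger0_norm; last lra.
  have := parallelogram hs ps a b.
  move: (nrm s (a + b)) (nrm s (a - b)) (nrm s a) (nrm s b) => p q u v.
  by rewrite exprMn; lra.
have cx : cau s x.
  move=> e e0; have e4 : 0 < e ^+ 2 / 4 by rewrite divr_gt0 // exprn_gt0.
  have [N hN] := null_harmonic e4; exists N => i j /hN hi /hN hj.
  rewrite -(@ltr_pXn2r _ 2) ?nnegrE ?nrm_ge0 // ?ltW //.
  apply: le_lt_trans (par _ _) _.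
  have k n : n.+1%:R^-1 < e ^+ 2 / 4 -> F (x n) < m + e ^+ 2 / 4.
    by move=> h; apply: lt_trans (hx n) _; rewrite ltrD2l.
  have := k _ hi; have := k _ hj; lra.
have [y hy] := cs _ cx; exists y.
have Fy : F y <= m.
  apply: le_eps => e e0.
  pose k := 2 * nrm s y + 1 + 2 * `|M|; have k0 : 0 < k.
    by rewrite /k; have := nrm_ge0 s y; have := normr_ge0 M; lra.
  pose d := Num.min 1 (e / 2 / k).
  have d0 : 0 < d by rewrite lt_min ltr01 !divr_gt0.
  have e2 : 0 < e / 2 by lra.
  have [N1 h1] := hy _ d0; have [N2 h2] := @null_harmonic R _ e2.
  pose n := maxn N1 N2; have {}h1 := h1 n (leq_maxl _ _).
  have {}h2 := h2 n (leq_maxr _ _).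
  have h3 : F (x n) < m + e / 2 by apply: lt_trans (hx n) _; rewrite ltrD2l.
  move: h1; rewrite lt_min => /andP[h11]; rewrite ltr_pdivlMr // => h12.
  have k1 : nrm s y ^+ 2 <= nrm s (x n) ^+ 2 + nrm s (x n - y) * (2 * nrm s y + 1).
    have a1 := nrmDl hs ps y (x n); rewrite (nrmBC hs) in a1.
    have a2 := nrm_ge0 s (x n); have a3 := nrm_ge0 s y.
    have a4 := nrmDl hs ps (x n) y; have a5 := nrm_ge0 s (x n - y).
    move: a1 a2 a3 a4 a5 h11.
    by move: (nrm s y) (nrm s (x n)) (nrm s (x n - y)) => p q r; clear; nra.
  have k2 : re (l (x n)) - re (l y) <= nrm s (x n - y) * `|M|.
    have -> : re (l (x n)) - re (l y) = re (l (x n - y)) by rewrite lD lN reB.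
    apply: le_trans (re_le_cn _) _; apply: le_trans (lM _) _.
    by rewrite mulrC ler_wpM2l ?nrm_ge0 // ler_norm.
  have -> : F y = F (x n) + (nrm s y ^+ 2 - nrm s (x n) ^+ 2)
      + 2 * (re (l (x n)) - re (l y)) by rewrite !FE; ring.
  have k3 : nrm s (x n - y) * k = nrm s (x n - y) * (2 * nrm s y + 1)
      + 2 * (nrm s (x n - y) * `|M|) by rewrite /k; ring.
  rewrite k3 in h12; lra.
have crit v : re (l v) = re (s v y).
  apply/esym/eqP; rewrite -subr_eq0; apply/eqP.
  apply: (@quad_zero (re (s v v))) => t.
  have := le_trans Fy (mF (y + rc t *: v)).
  rewrite !FE !nrm2 // (re_sxxD hs) (re_sxxZ hs) lD lZ reD re_rcM cn_rc.
  rewrite real_normK ?num_real // (sZr hs) conj_rc re_rcM.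
  by rewrite [s y v](hermJ hs) reJ; lra.
move=> v; apply: c_ext; first exact: crit.
have := crit (- J R *: v); rewrite lZ (sZl hs) !mulNr !reN !reJz; lra.
Qed.

(** Apply [riesz] to the form (T x, T x'), complete by the lower bound. It yields x such that T x -
    y is orthogonal to the range of T, hence zero. *)
Lemma onto_of (V W : lmodType C) (s : V -> V -> C) (t : W -> W -> C) (T : V -> W) (c M : R) :
  hilb s -> hilb t -> lin T -> 0 < c ->
  (forall x, c * nrm s x <= nrm t (T x)) -> (forall x, nrm t (T x) <= M * nrm s x) ->
  (forall w, (forall x, t (T x) w = 0) -> w = 0) ->
  forall y, exists x, T x = y.
Proof.
move=> [hs ps ds cs] [ht pt dt ct] lT c0 below above inj y.
pose q x x' := t (T x) (T x').
have hq : is_herm q.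
  by split=> [a x x' z|x x']; rewrite /q ?lT ?(hermL ht) // (hermJ ht).
have pq : is_psd q by move=> x; exact: pt.
have nq x : nrm q x = nrm t (T x) by [].
have cq : cmpl q.
  move=> u cu; have [|l hl] := cs u.
    move=> e e0; have ec : 0 < c * e by rewrite mulr_gt0.
    have [N hN] := cu _ ec; exists N => m n hm hn.
    rewrite -(ltr_pM2l c0); apply: le_lt_trans (below _) _; rewrite -nq; exact: hN.
  exists l; have M0 : 0 <= `|M| by [].
  apply: null_le (nullZ M0 hl) => n; rewrite nq; apply: le_trans (above _) _.
  by rewrite ler_wpM2r ?nrm_ge0 // ler_norm.
have [||x hx] := @riesz V q (fun x => t (T x) y) (nrm t y) hq pq cq.
- by move=> a x x'; rewrite lT (hermL ht).
- by move=> x; rewrite nq mulrC; apply: cauchy_schwarz.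
exists x; apply/eqP; rewrite -subr_eq0; apply/eqP; apply: inj => x'.
by rewrite (sBr ht) -/(q x' x) -hx subrr.
Qed.

(** Extension by continuity from the dense image of j. As j may have a kernel, G x is defined as the
    limit of g (u n) along sequences with j (u n) tending to x; the bound makes it independent of
    the sequence. *)
Lemma extension (V K L : lmodType C) (s : K -> K -> C) (t : L -> L -> C)
    (j : V -> K) (g : V -> L) (M : R) :
  is_herm s -> is_psd s -> hilb t -> lin j -> lin g ->
  (forall x (e : R), 0 < e -> exists v, nrm s (x - j v) < e) ->
  (forall v, nrm t (g v) <= M * nrm s (j v)) ->
  exists G : {linear K -> L}, (forall v, G (j v) = g v) /\
    forall x, nrm t (G x) <= M * nrm s x.
Proof.
move=> hs ps [ht pt dt ct] lj lg dj gM.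
have appr x : exists u, slim s (fun n => j (u n)) x.
  have h n : exists v, nrm s (x - j v) < n.+1%:R^-1 by apply: dj; rewrite invr_gt0.
  have [u hu] := choice h; exists u.
  by apply: null_le (@null_harmonic R) => n; rewrite (nrmBC hs) ltW.
have gM' v : nrm t (g v) <= `|M| * nrm s (j v).
  by apply: le_trans (gM v) _; rewrite ler_wpM2r ?nrm_ge0 // ler_norm.
have glim u x : slim s (fun n => j (u n)) x -> exists l, slim t (fun n => g (u n)) l.
  move=> h; apply: ct => e e0.
  have k : 0 < `|M| + 1 by rewrite ltr_wpDl.
  have [N hN] := slim_cau hs ps h (divr_gt0 e0 k); exists N => m n hm hn.
  rewrite -(linB lg); apply: le_lt_trans (gM' _) _; rewrite (linB lj).
  have := hN m n hm hn; rewrite ltr_pdivlMr // mulrC.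
  apply: le_lt_trans; apply: ler_wpM2r; first exact: nrm_ge0.
  by rewrite lerDl.
have ex x : exists l, exists u, slim s (fun n => j (u n)) x /\ slim t (fun n => g (u n)) l.
  by have [u hu] := appr x; have [l hl] := glim _ _ hu; exists l, u.
have [G hG] := choice ex.
have uniq x l u : slim s (fun n => j (u n)) x -> slim t (fun n => g (u n)) l -> l = G x.
  move=> h1 h2; have [u' [h1' h2']] := hG x.
  apply/eqP; rewrite -subr_eq0; apply/eqP/dt.
  apply: le_anti; rewrite nrm_ge0 andbT; apply: null_const.
  have h3 := slimD hs ps h1 (slimZ hs (-1) h1').
  have h4 := slimD ht pt h2 (slimZ ht (-1) h2').
  rewrite scaleN1r subrr in h3; rewrite scaleN1r in h4.
  apply: null_le (nullD h4 (nullZ (normr_ge0 M) h3)) => n.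
  apply: le_trans (_ : nrm t ((g (u n) - g (u' n)) - (g (u n) - g (u' n) - (l - G x))) <= _).
    by rewrite subKr.
  apply: le_trans (nrmB ht pt _ _) _; rewrite addrC !scaleN1r subr0.
  by apply: lerD => //; rewrite -(linB lg) -(linB lj).
have lG : lin G.
  move=> a x y; have [u [h1 h2]] := hG x; have [v [k1 k2]] := hG y.
  apply/esym; apply: (uniq _ _ (fun n => a *: u n + v n)).
    by apply: null_le (slimD hs ps (slimZ hs a h1) k1) => n; rewrite lj.
  by apply: null_le (slimD ht pt (slimZ ht a h2) k2) => n; rewrite lg.
have [F hF] := linear_of lG; exists F; split=> [v|x]; rewrite hF.
  by apply/esym; apply: (uniq _ _ (fun=> v)); exact: slim_cst.
have [u [h1 h2]] := hG x; apply: le_eps => e e0.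
have k : 0 < `|M| + 1 by rewrite ltr_wpDl.
have e2 : 0 < e / 2 by lra.
have [N1 H1] := h1 _ (divr_gt0 e2 k); have [N2 H2] := h2 _ e2.
have {}H1 := H1 _ (leq_maxl N1 N2); have {}H2 := H2 _ (leq_maxr N1 N2).
set n := maxn N1 N2 in H1 H2.
rewrite ltr_pdivlMr // in H1.
have a1 := nrmDl ht pt (G x) (g (u n)); rewrite (nrmBC ht) in a1.
have a2 := gM (u n).
have a3 : M * nrm s (j (u n)) <= M * nrm s x + `|M| * nrm s (j (u n) - x).
  rewrite -lerBlDl -mulrBr; apply: le_trans (ler_norm _) _; rewrite normrM.
  apply: ler_wpM2l => //; rewrite ler_norml.
  have := nrmDl hs ps (j (u n)) x; have := nrmDl hs ps x (j (u n)).
  by rewrite [nrm s (x - _)](nrmBC hs); lra.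
have := nrm_ge0 s (j (u n) - x); lra.
Qed.

Lemma fixpoint (V : lmodType C) (s : V -> V -> C) (F : V -> V) (q : R) : hilb s ->
  0 <= q -> q < 1 -> (forall x y, nrm s (F x - F y) <= q * nrm s (x - y)) ->
  exists x, F x = x.
Proof.
move=> [hs ps ds cs] q0 q1 hF; pose u n := iter n F 0.
pose D := nrm s (F 0 - 0) / (1 - q).
have p1 : 0 < 1 - q by lra.
have D0 : 0 <= D by rewrite divr_ge0 ?nrm_ge0 // ltW.
have step n : nrm s (u n.+1 - u n) <= q ^+ n * ((1 - q) * D).
  elim: n => [|n ih]; first by rewrite expr0 mul1r /D mulrCA mulfV ?gt_eqF // mulr1.
  apply: le_trans (hF _ _) _; rewrite exprS -mulrA; exact: ler_wpM2l.
have dist n k : nrm s (u (k + n)%N - u n) <= q ^+ n * (1 - q ^+ k) * D.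
  elim: k => [|k ih]; first by rewrite subrr (nrm0 hs) expr0 subrr mulr0 mul0r.
  have := nrmD hs ps (u (k.+1 + n)%N - u (k + n)%N) (u (k + n)%N - u n).
  rewrite subrKA => h; apply: le_trans h _.
  apply: le_trans (lerD (step _) ih) _; rewrite exprD exprS le_eqVlt.
  by apply/orP; left; apply/eqP; ring.
have cu : cau s u.
  move=> e e0; have e2 : 0 < e / 2 by lra.
  have [N hN] := @null_geom R D q q0 q1 _ e2; exists N => m n hm hn.
  have dN k : (N <= k)%N -> nrm s (u k - u N) < e / 2.
    move=> hk; rewrite -(subnK hk); apply: le_lt_trans (dist _ _) _.
    apply: le_lt_trans (hN N (leqnn _)); rewrite mulrC; apply: ler_wpM2l => //.
    by rewrite ler_piMr ?exprn_ge0 // gerBl exprn_ge0.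
  have := nrmD hs ps (u m - u N) (u N - u n); rewrite subrKA [nrm s (u N - u n)](nrmBC hs).
  by have := dN _ hm; have := dN _ hn; lra.
have [x hx] := cs _ cu; exists x; apply/eqP; rewrite -subr_eq0; apply/eqP/ds.
apply: (@slim_unique _ _ hs ps (fun n => u n.+1)).
  apply: null_le (nullZ q0 hx) => n; exact: hF.
by move=> e /hx [N hN]; exists N => n hn; apply: hN; exact: leqW.
Qed.

Definition binv (V W : lmodType C) (s : V -> V -> C) (t : W -> W -> C)
    (T : V -> W) (S : {linear W -> V}) (M : R) :=
  [/\ cancel T S, cancel S T & forall y, nrm s (S y) <= M * nrm t y].

Lemma binv_of (V W : lmodType C) (s : V -> V -> C) (t : W -> W -> C) (T : V -> W) (c : R) :
  is_herm s -> is_psd s -> is_def s -> is_herm t -> lin T -> 0 < c ->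
  (forall x, c * nrm s x <= nrm t (T x)) -> (forall y, exists x, T x = y) ->
  exists S : {linear W -> V}, binv s t T S c^-1.
Proof.
move=> hs ps ds ht lT c0 below onto.
have [S hS] := choice onto.
have TS : cancel S T by exact: hS.
have below' x : nrm s x <= c^-1 * nrm t (T x).
  by rewrite -(ler_pM2l c0) mulrA mulfV ?gt_eqF // mul1r.
have Tinj x y : T x = T y -> x = y.
  move=> e; apply/eqP; rewrite -subr_eq0; apply/eqP/ds; apply: le_anti.
  rewrite nrm_ge0 andbT; apply: le_trans (below' _) _.
  by rewrite (linB lT) e subrr (nrm0 ht) mulr0.
have lS : lin S by move=> a x y; apply: Tinj; rewrite TS lT !TS.
have [F hF] := linear_of lS; exists F; split=> [x|y|y]; rewrite hF //.
  by apply: Tinj; rewrite TS.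
by apply: le_trans (below' _) _; rewrite TS.
Qed.

(** Neumann series in fixed point form: T x + E x = y means x = S (y - E x), a contraction with
    factor 1/2. The inverse is bounded by 2 M; adding 1 keeps the constant positive when M = 0. *)
Lemma binv_perturb (V W : lmodType C) (s : V -> V -> C) (t : W -> W -> C) (T E : V -> W)
    (S : {linear W -> V}) (M e : R) :
  hilb s -> is_herm t -> is_psd t -> lin T -> lin E -> 0 <= M -> binv s t T S M ->
  (forall x, nrm t (E x) <= e * nrm s x) -> M * e <= 2^-1 ->
  exists S' : {linear W -> V}, binv s t (fun x => T x + E x) S' (2 * M + 1).
Proof.
move=> hbs ht pt lT lE M0 [ST TS SM] hE Me; have [hs ps ds cs] := hbs.
have hSE x : nrm s (S (E x)) <= 2^-1 * nrm s x.
  apply: le_trans (SM _) _; apply: le_trans (ler_wpM2l M0 (hE x)) _.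
  by rewrite mulrA ler_wpM2r ?nrm_ge0.
have lTE : lin (fun x => T x + E x).
  by move=> a x y; rewrite lT lE scalerDr addrACA.
have onto y : exists x, T x + E x = y.
  have [||x y'|x hx] := @fixpoint V s (fun x => S (y - E x)) 2^-1 hbs; try lra.
    rewrite -linearB opprB addrC subrKA -(linB lE).
    by rewrite [nrm s (x - y')](nrmBC hs).
  by exists x; rewrite -{1}hx TS subrK.
have below x : nrm s x <= 2 * M * nrm t (T x + E x).
  have := SM (T x + E x); rewrite linearD ST.
  have := nrmDl hs ps x (- S (E x)); rewrite opprK (nrmN hs).
  by have := hSE x; lra.
have [|x|S' hS'] := @binv_of V W s t (fun x => T x + E x) (2 * M + 1)^-1 hs ps ds ht lTE _ _ onto.
- by rewrite invr_gt0; lra.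
- rewrite ler_pdivrMl; last lra.
  apply: le_trans (below x) _; rewrite ler_wpM2r ?nrm_ge0 //; lra.
by exists S'; rewrite invrK in hS'.
Qed.
End HilbertSpaces.

(** * Completion *)

(* The completion of [V] is the space of the functions [lim s (u n) v] of [v],
   where [u] is a Cauchy sequence. *)
Record psd_form (R : realType) (V : lmodType (Cplx R)) := PsdForm {
  pf :> V -> V -> Cplx R; pf_h : is_herm pf; pf_p : is_psd pf }.

Section CompletionSpace.
Context (R : realType).
Local Notation C := (Cplx R).
Context (V : lmodType C) (s : psd_form V).
Local Notation hs := (pf_h s).
Local Notation ps := (pf_p s).

Definition represents (u : nat -> V) (phi : V -> C) :=
  cau s u /\ forall v, clim (fun n => s (u n) v) (phi v).

Definition compl_pred : {pred (V -> C)} := [pred phi | `[< exists u, represents u phi >]].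

Lemma represents_lin a u (phi : V -> C) v (psi : V -> C) : represents u phi -> represents v psi ->
  represents (fun n => a *: u n + v n) (a *: phi + psi).
Proof.
move=> [cu hu] [cv hv]; split=> [e e0|x].
  have e2 : 0 < e / 2 by lra.
  have k : 0 < cn a + 1 by rewrite ltr_wpDl ?cn_ge0.
  have [N hN] := cu _ (divr_gt0 e2 k); have [M hM] := cv _ e2.
  exists (maxn N M) => m n; rewrite !geq_max => /andP[m1 m2] /andP[n1 n2].
  rewrite opprD addrACA -scalerBr; apply: le_lt_trans (nrmD hs ps _ _) _.
  rewrite (nrmZ hs); have h1 := hN _ _ m1 n1; have := hM _ _ m2 n2.
  have : cn a * nrm s (u m - u n) <= e / 2.
    rewrite ltr_pdivlMr // in h1; have := nrm_ge0 s (u m - u n).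
    by have := cn_ge0 a; nra.
  lra.
apply: clim_ext (climD (climZ a (hu x)) (hv x)) => n.
by rewrite (hermL hs).
Qed.

Lemma represents_cst v : represents (fun=> v) (s v).
Proof.
split=> [e e0|x]; last exact: clim_cst.
by exists 0%N => m n _ _; rewrite subrr (nrm0 hs).
Qed.

Fact compl_submod_closed : submod_closed compl_pred.
Proof.
split.
  apply/asboolP; exists (fun=> 0); have [h1 h2] := represents_cst 0.
  by split=> // v; have := h2 v; rewrite (s0l hs).
move=> a phi psi /asboolP[u hu] /asboolP[v hv].
by apply/asboolP; exists (fun n => a *: u n + v n); exact: represents_lin.
Qed.

HB.instance Definition _ :=
  GRing.isSubmodClosed.Build C (V -> C : lmodType C) compl_pred compl_submod_closed.

Definition compl_space : Type := {x : V -> C | x \in compl_pred}.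
HB.instance Definition _ := SubChoice.on compl_space.
HB.instance Definition _ := [SubChoice_isSubLmodule of compl_space by <:].

Lemma compl_repr (x : compl_space) : exists u, represents u (\val x).
Proof. by apply/asboolP; exact: (valP x). Qed.

Definition crep (x : compl_space) : nat -> V := sval (cid (compl_repr x)).
Lemma crepP x : represents (crep x) (\val x).
Proof. exact: (svalP (cid (compl_repr x))). Qed.

Lemma compl_of u (phi : V -> C) : represents u phi -> exists x : compl_space, \val x = phi.
Proof.
move=> h; have hin : phi \in compl_pred by apply/asboolP; exists u.
by exists (exist _ phi hin).
Qed.

(** So a functional determines its Cauchy sequence up to a null sequence. Split (u n, u n) at a late
    fixed term u N: one part is small by the Cauchy property, the other tends to phi (u N) = 0. *)
Lemma null_repr u (phi : V -> C) : represents u phi -> (forall v, phi v = 0) ->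
  null (fun n => nrm s (u n)).
Proof.
move=> [cu hu] p0; have [M hM] := cau_bounded hs ps cu.
have M0 : 0 <= M := le_trans (nrm_ge0 s _) (hM 0%N).
move=> e e0; have M1 : 0 < 2 * (M + 1) by lra.
have e2 : 0 < e ^+ 2 by rewrite exprn_gt0.
have e3 : 0 < e ^+ 2 / 2 by lra.
have [N hN] := cu _ (divr_gt0 e2 M1).
have [N' hN'] := hu (u N) _ e3.
exists (maxn N N') => n; rewrite geq_max => /andP[n1 n2].
rewrite -(@ltr_pXn2r _ 2) ?nnegrE ?nrm_ge0 ?(ltW e0) // (nrm2 ps).
have -> : s (u n) (u n) = s (u n) (u n - u N) + s (u n) (u N).
  by rewrite -(sDr hs) subrK.
have h1 := hN' n n2; rewrite p0 subr0 in h1.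
have h2 := hN _ _ n1 (leqnn N); rewrite ltr_pdivlMr // in h2.
have h3 := cauchy_schwarz hs ps (u n) (u n - u N).
have h4 := hM n; have h5 := nrm_ge0 s (u n - u N).
have h6 := ler_wpM2r h5 h4.
have := re_le_cn (s (u n) (u n - u N)); have := re_le_cn (s (u n) (u N)).
by rewrite reD; lra.
Qed.

Lemma form_clim u v (phi psi : V -> C) : represents u phi -> represents v psi ->
  exists l, clim (fun n => s (u n) (v n)) l.
Proof.
move=> [cu hu] [cv hv]; have [M hM] := cau_bounded hs ps cu.
have [M' hM'] := cau_bounded hs ps cv.
have M0 : 0 <= M := le_trans (nrm_ge0 s _) (hM 0%N).
have M0' : 0 <= M' := le_trans (nrm_ge0 s _) (hM' 0%N).
apply: cauchy_complex => e e0.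
have k : 0 < M + M' + 1 by lra.
have [N1 h1] := cu _ (divr_gt0 e0 k); have [N2 h2] := cv _ (divr_gt0 e0 k).
exists (maxn N1 N2) => m n; rewrite !geq_max => /andP[m1 m2] /andP[n1 n2].
have -> : s (u m) (v m) - s (u n) (v n) = s (u m) (v m - v n) + s (u m - u n) (v n).
  by rewrite (sBr hs) (sBl hs); ring.
have a1 := h1 _ _ m1 n1; have a2 := h2 _ _ m2 n2.
rewrite ltr_pdivlMr // in a1; rewrite ltr_pdivlMr // in a2.
apply: le_lt_trans (cnD _ _) _.
have c1 := cauchy_schwarz hs ps (u m) (v m - v n).
have c2 := cauchy_schwarz hs ps (u m - u n) (v n).
have p1 := nrm_ge0 s (v m - v n); have p2 := nrm_ge0 s (u m - u n).
have b1 := ler_wpM2r p1 (hM m); have b2 := ler_wpM2l p2 (hM' n).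
move: a1 a2 c1 c2 p1 p2 b1 b2.
move: (nrm s (v m - v n)) (nrm s (u m - u n)) (nrm s (u m)) (nrm s (v n)).
move: (cn _) (cn _) => c1 c2 q p um vn; clear -M0 M0'; nra.
Qed.

Definition cform (x y : compl_space) : C :=
  sval (cid (form_clim (crepP x) (crepP y))).
Lemma cformP x y : clim (fun n => s (crep x n) (crep y n)) (cform x y).
Proof. exact: (svalP (cid (form_clim (crepP x) (crepP y)))). Qed.

Lemma cform_eq x y u v : represents u (\val x) -> represents v (\val y) ->
  clim (fun n => s (u n) (v n)) (cform x y).
Proof.
move=> hu hv.
have diff a b (p : V -> C) : represents a p -> represents b p ->
    null (fun n => nrm s (a n - b n)).
  move=> ha hb; have h := represents_lin (-1) hb ha.
  apply: null_le (null_repr h _) => [n|w]; first by rewrite scaleN1r addrC.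
  by rewrite scaleN1r addNr.
have [M hM] := cau_bounded hs ps hu.1.
have [M' hM'] := cau_bounded hs ps (crepP y).1.
have M0 : 0 <= M := le_trans (nrm_ge0 s _) (hM 0%N).
have M0' : 0 <= M' := le_trans (nrm_ge0 s _) (hM' 0%N).
have n1 := nullZ M0' (diff _ _ _ hu (crepP x)).
have n2 := nullZ M0 (diff _ _ _ hv (crepP y)).
apply: null_le (nullD (nullD n1 n2) (cformP x y)) => n.
set a := crep x n; set b := crep y n; set l := cform x y.
have -> : s (u n) (v n) - l = s (u n - a) b + s (u n) (v n - b) + (s a b - l).
  by rewrite (sBr hs) (sBl hs); ring.
apply: le_trans (cnD _ _) _; rewrite lerD2r; apply: le_trans (cnD _ _) _.
apply: lerD; apply: le_trans (cauchy_schwarz hs ps _ _) _.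
  by rewrite mulrC; apply: ler_wpM2r; [exact: nrm_ge0 | exact: hM'].
by apply: ler_wpM2r; [exact: nrm_ge0 | exact: hM].
Qed.

Lemma cform_herm : is_herm cform.
Proof.
split=> [a x y z|x y].
  have h := represents_lin a (crepP x) (crepP y).
  have h1 := @cform_eq (a *: x + y) z _ _ h (crepP z).
  apply: clim_unique h1 _.
  apply: clim_ext (climD (climZ a (cformP x z)) (cformP y z)) => n.
  by rewrite (hermL hs).
apply: clim_unique (cformP x y) _.
by apply: clim_ext (climJ (cformP y x)) => n; rewrite -(hermJ hs).
Qed.

Lemma cform_psd : is_psd cform.
Proof. by move=> x; apply: clim_re_ge (cformP x x) _ => n; exact: ps. Qed.

Lemma cform_def : is_def cform.
Proof.
move=> x /eqP; rewrite sqrtr_eq0 => x0.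
have re0 : cform x x = 0.
  rewrite (sxxE cform_herm); have := cform_psd x => h.
  by have -> : re (cform x x) = 0 by apply: le_anti; rewrite x0 h.
apply/val_inj/funext => v /=.
have [cu hu] := crepP x; apply: clim_unique (hu v) _.
have := cformP x x; rewrite re0 => h e e0.
have k : 0 < nrm s v + 1 by have := nrm_ge0 s v; lra.
have [N hN] := h ((e / (nrm s v + 1)) ^+ 2) (exprn_gt0 _ (divr_gt0 e0 k)).
exists N => n /hN; rewrite !subr0 => h1.
have h2 : nrm s (crep x n) < e / (nrm s v + 1).
  rewrite -(@ltr_pXn2r _ 2) ?nnegrE ?nrm_ge0 ?(divr_ge0 (ltW e0) (ltW k)) // (nrm2 ps).
  by apply: le_lt_trans (re_le_cn _) h1.
rewrite ltr_pdivlMr // in h2.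
apply: le_lt_trans (cauchy_schwarz hs ps _ _) _.
by have := nrm_ge0 s (crep x n); lra.
Qed.

Lemma cau_repr u : cau s u -> exists phi : V -> C, represents u phi.
Proof.
move=> cu; have h v : exists l, clim (fun n => s (u n) v) l.
  apply: cauchy_complex => e e0.
  have k : 0 < nrm s v + 1 by have := nrm_ge0 s v; lra.
  have [N hN] := cu _ (divr_gt0 e0 k); exists N => m n hm hn.
  have := hN _ _ hm hn; rewrite ltr_pdivlMr // => h1.
  rewrite -(sBl hs); apply: le_lt_trans (cauchy_schwarz hs ps _ _) _.
  by have := nrm_ge0 s (u m - u n); lra.
by have [phi hphi] := choice h; exists phi.
Qed.

Lemma compl_embed : exists j : {linear V -> compl_space},
  (forall v w, cform (j v) (j w) = s v w) /\
  forall u x, represents u (\val x) -> slim cform (fun n => j (u n)) x.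
Proof.
have ex v : exists x : compl_space, \val x = s v := compl_of (represents_cst v).
have [j hj] := choice ex.
have hjr v : represents (fun=> v) (\val (j v)) by rewrite hj; exact: represents_cst.
have lj : lin j.
  move=> a x y; apply/val_inj/funext => v; rewrite hj (hermL hs).
  rewrite -!hj; by [].
have [F hF] := linear_of lj; exists F; split=> [v w|u x hu e e0].
  rewrite !hF; apply: clim_unique (cform_eq (hjr v) (hjr w)) _; exact: clim_cst.
have e2 : 0 < e / 2 by lra.
have [N hN] := hu.1 _ e2; exists N => m hm; rewrite hF.
have h' : represents (fun n => -1 *: u n + u m) (\val (j (u m) - x)).
  have -> : \val (j (u m) - x) = -1 *: \val x + \val (j (u m)).
    by rewrite scaleN1r addrC.
  exact: represents_lin hu (hjr (u m)).
have h2 := cform_eq h' h'.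
have h3 : nrm cform (j (u m) - x) <= e / 2.
  rewrite -(@ler_pXn2r _ 2) ?nnegrE ?nrm_ge0 ?(ltW e2) // (nrm2 cform_psd).
  apply: le_eps => d d0; have [M hM] := h2 d d0.
  have := hM _ (leq_maxl M N); have := hN _ _ hm (leq_maxr M N).
  move: (maxn M N) => n k1 /=; rewrite scaleN1r ![- u n + _]addrC cnBC => k2.
  have k3 : re (s (u m - u n) (u m - u n)) <= (e / 2) ^+ 2.
    rewrite -(nrm2 ps).
    by rewrite lerXn2r ?nnegrE ?nrm_ge0 ?(ltW e2) // ltW.
  have := re_le_cn (cform (j (u m) - x) (j (u m) - x) - s (u m - u n) (u m - u n)).
  by rewrite reB; lra.
lra.
Qed.

Lemma compl_complete : cmpl cform.
Proof.
have arith (x y a c d e : R) : x <= a + y -> y <= c + d ->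
  a < e / 3 -> c < e / 3 -> d < e / 3 -> x < e by lra.
have [j [jf jl]] := compl_embed => u cu.
have ch := cform_herm; have cp := cform_psd.
have jn v : nrm cform (j v) = nrm s v by rewrite /nrm jf.
have happ n : exists v, nrm cform (u n - j v) < n.+1%:R^-1.
  have e0 : 0 < n.+1%:R^-1 :> R by rewrite invr_gt0.
  have [N hN] := jl _ _ (crepP (u n)) _ e0; exists (crep (u n) N).
  by rewrite (nrmBC ch); exact: hN.
have [v hv] := choice happ.
have nv : null (fun n => nrm cform (u n - j (v n))).
  by apply: null_le (@null_harmonic R) => n; rewrite ltW.
have cv : cau s v.
  move=> e e0; have e3 : 0 < e / 3 by lra.
  have [N1 h1] := cu _ e3; have [N2 h2] := nv _ e3.
  exists (maxn N1 N2) => m n; rewrite !geq_max => /andP[m1 m2] /andP[n1 n2].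
  rewrite -jn linearB.
  have k1 := nrmD ch cp (j (v m) - u m) (u m - j (v n)); rewrite subrKA in k1.
  have k2 := nrmD ch cp (u m - u n) (u n - j (v n)); rewrite subrKA in k2.
  rewrite [nrm cform (j (v m) - u m)](nrmBC ch) in k1.
  exact: (arith _ _ _ _ _ _ k1 k2 (h2 _ m2) (h1 _ _ m1 n1) (h2 _ n2)).
have [phi hphi] := cau_repr cv; have [x hx] := compl_of hphi.
exists x; have h : represents v (\val x) by rewrite hx.
apply: null_le (nullD nv (jl _ _ h)) => n.
by have := nrmD ch cp (u n - j (v n)) (j (v n) - x); rewrite subrKA.
Qed.
End CompletionSpace.

Lemma completion (R : realType) (V : lmodType (Cplx R)) (s : V -> V -> Cplx R) :
  is_herm s -> is_psd s ->
  exists (K : lmodType (Cplx R)) (t : K -> K -> Cplx R) (j : {linear V -> K}),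
  [/\ hilb t, forall v w, t (j v) (j w) = s v w &
      forall x (e : R), 0 < e -> exists v, nrm t (x - j v) < e].
Proof.
move=> hs ps; pose S := PsdForm hs ps; have [j [jf jl]] := compl_embed S.
exists (compl_space S), (@cform R V S), j; split=> // [|x e e0].
  split; [exact: cform_herm | exact: cform_psd | exact: cform_def | exact: compl_complete].
have [N hN] := jl _ _ (crepP x) _ e0; exists (crep x N).
by rewrite (nrmBC (cform_herm S)); exact: hN.
Qed.

(** * Indefinite forms with finitely many negative squares *)

Section KernelVector.
Context (F : fieldType).
Lemma nontrivial_kernel n k (A : 'M[F]_(n, k)) : (k < n)%N ->
  exists2 c : 'rV[F]_n, c != 0 & c *m A = 0.
Proof.
move=> kn; have : kermx A != 0.
  rewrite -mxrank_eq0 mxrank_ker -lt0n subn_gt0.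
  exact: leq_ltn_trans (rank_leq_col A) kn.
move=> /rowV0Pn[c]; rewrite sub_kermx => /eqP cA c0.
by exists c.
Qed.
End KernelVector.

Section Indefinite.
Context (R : realType).
Local Notation C := (Cplx R).

Section Forms.
Context (V : lmodType C) (b : V -> V -> C).

Definition onf k (e : 'I_k -> V) := forall i j, b (e i) (e j) = - (i == j)%:R.
(** At most k negative squares, expressed through negative orthonormal families. *)
Definition NI k := forall n (e : 'I_n -> V), onf e -> (n <= k)%N.

Section Family.
Context (k : nat) (e : 'I_k -> V).
(** For a negative orthonormal family e, [jf] is the reflection that sends each e i to its negative,
    a candidate for a fundamental symmetry, and [sf x y] is b (jf x) y. [pf_perp] is the projection
    onto the orthogonal complement of e. *)
Definition sf x y : C := b x y + 2 * \sum_i b x (e i) * (b y (e i))^*.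
Definition jf x : V := x + 2 *: \sum_i b x (e i) *: e i.
Definition pf_perp x : V := x + \sum_i b x (e i) *: e i.

Hypothesis hb : is_herm b.

Lemma sf_herm : is_herm sf.
Proof.
split=> [a x y z|x y]; rewrite /sf.
  have -> : \sum_i b (a *: x + y) (e i) * (b z (e i))^* =
    a * (\sum_i b x (e i) * (b z (e i))^*) + \sum_i b y (e i) * (b z (e i))^*.
    rewrite mulr_sumr -big_split; apply: eq_bigr => i _.
    by rewrite (hermL hb) mulrDl mulrA.
  by rewrite (hermL hb); ring.
rewrite conjD conjM -(hermJ hb) conj_sum -[X in X^*](rc_nat R 2) conj_rc rc_nat.
congr (_ + _ * _); apply: eq_bigr => i _.
by rewrite conjM conjCK mulrC.
Qed.

Lemma jf_lin : lin jf.
Proof.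
move=> a x y; rewrite /jf scalerDr addrACA; congr (_ + _).
rewrite scalerA [a * 2]mulrC -scalerA -scalerDr; congr (_ *: _).
rewrite scaler_sumr -big_split; apply: eq_bigr => i _.
by rewrite (hermL hb) scalerDl scalerA.
Qed.
Lemma perp_lin : lin pf_perp.
Proof.
move=> a x y; rewrite /pf_perp scalerDr addrACA; congr (_ + _).
rewrite scaler_sumr -big_split; apply: eq_bigr => i _.
by rewrite (hermL hb) scalerDl scalerA.
Qed.

Lemma b_jf x y : b (jf x) y = sf x y.
Proof.
rewrite /jf (sDl hb) (sZl hb) (s_suml hb) /sf; congr (_ + _ * _).
by apply: eq_bigr => i _; rewrite (sZl hb) [b (e i) y](hermJ hb).
Qed.

Hypothesis he : onf e.

Lemma sum_delta (c : 'I_k -> C) i : \sum_j c j * b (e j) (e i) = - c i.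
Proof.
rewrite (bigD1 i) //= he eqxx mulrN mulr1 big1 ?addr0 // => j ji.
by rewrite he (negPf ji) oppr0 mulr0.
Qed.

Lemma b_jf_e x i : b (jf x) (e i) = - b x (e i).
Proof.
rewrite /jf (sDl hb) (sZl hb) (s_suml hb).
under eq_bigr do rewrite (sZl hb).
by rewrite sum_delta; ring.
Qed.
Lemma b_perp_e x i : b (pf_perp x) (e i) = 0.
Proof.
rewrite /pf_perp (sDl hb) (s_suml hb).
under eq_bigr do rewrite (sZl hb).
by rewrite sum_delta subrr.
Qed.

Lemma sf_e x i : sf x (e i) = - b x (e i).
Proof. by rewrite -b_jf b_jf_e. Qed.

Lemma jf_invol x : jf (jf x) = x.
Proof.
rewrite {1}/jf; under eq_bigr do rewrite b_jf_e scaleNr.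
by rewrite sumrN scalerN /jf addrK.
Qed.

Lemma b_sf x y : b x y = sf (jf x) y.
Proof. by rewrite -b_jf jf_invol. Qed.

Lemma b_jfC x y : b (jf x) y = b x (jf y).
Proof. by rewrite b_jf (hermJ sf_herm) -b_jf -(hermJ hb). Qed.

Lemma nrm_jf x : nrm sf (jf x) = nrm sf x.
Proof. by rewrite /nrm -!b_jf jf_invol [in RHS]b_jfC. Qed.

Lemma nrm_e i : nrm sf (e i) = 1.
Proof. by rewrite /nrm sf_e he eqxx opprK re1 sqrtr1. Qed.

Lemma sf_of_perp x y : (forall i, b x (e i) = 0) -> sf x y = b x y.
Proof. by move=> h; rewrite /sf big1 ?mulr0 ?addr0 // => i _; rewrite h mul0r. Qed.

Hypothesis ps : is_psd sf.

Lemma b_bound x y : cn (b x y) <= nrm sf x * nrm sf y.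
Proof. by rewrite b_sf -(nrm_jf x); apply: cauchy_schwarz => //; exact: sf_herm. Qed.

Lemma b_e_bound x i : cn (b x (e i)) <= nrm sf x.
Proof. by have := b_bound x (e i); rewrite nrm_e mulr1. Qed.

(* A vector combination of n > k vectors that is orthogonal to e is positive. *)
Lemma onf_size_le : NI k.
Proof.
move=> n x hx; rewrite leqNgt; apply/negP => kn.
have [c c0 cA] := nontrivial_kernel (\matrix_(i < n, j < k) b (x i) (e j)) kn.
pose y := \sum_i c 0 i *: x i.
have ye j : b y (e j) = 0.
  have := congr1 (fun M : 'rV_k => M 0 j) cA; rewrite !mxE => <-.
  by rewrite (s_suml hb); apply: eq_bigr => i _; rewrite (sZl hb) mxE.
have := ps y; rewrite sf_of_perp //.
have -> : b y y = - rc (\sum_i cn (c 0 i) ^+ 2).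
  rewrite {1}/y (s_suml hb) rc_sum -sumrN; apply: eq_bigr => i _.
  rewrite (sZl hb) (hermJ hb) (s_suml hb) conj_sum.
  rewrite (bigD1 i) //= big1 ?addr0 => [|j ji].
    by rewrite (sZl hb) hx eqxx conjM mulrA mulcJ conjN conj1 mulrN mulr1.
  by rewrite (sZl hb) hx (negPf ji) oppr0 mulr0 conj0.
rewrite reN re_rc oppr_ge0 => h; move: c0; apply/negP; rewrite negbK.
apply/eqP/rowP => i; rewrite mxE; apply/eqP; rewrite -cn_eq0 -sqrf_eq0.
apply/eqP; apply: (@psumr_eq0P R 'I_n xpredT (fun i => cn (c 0 i) ^+ 2)) => // [j _|].
  exact: sqr_ge0.
by apply: le_anti; rewrite h; apply: sumr_ge0 => j _; exact: sqr_ge0.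
Qed.
End Family.

(** Take a family of maximal size. A vector x with [sf e x x] negative would have a negative
    projection to the complement of e, which could be normalised and adjoined. *)
Lemma max_onf kap : is_herm b -> NI kap ->
  exists k (e : 'I_k -> V), onf e /\ is_psd (sf e).
Proof.
move=> hb ni; pose Pk := [pred n | `[< exists e : 'I_n -> V, onf e >]].
have ex : exists n, Pk n.
  exists 0%N; apply/asboolP; exists (fun=> 0) => -[] //.
have bd n : Pk n -> (n <= kap)%N by move=> /asboolP[e he]; exact: ni he.
case: (ex_maxnP ex bd) => k /asboolP[e he] hmax.
exists k, e; split=> // x; rewrite leNgt; apply/negP => neg.
pose y := pf_perp e x.
have ye i : b y (e i) = 0 by exact: b_perp_e.
have byy : re (b y y) < 0.
  apply: le_lt_trans neg; rewrite /sf reD.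
  have -> : b y y = b x x + rc (\sum_i cn (b x (e i)) ^+ 2).
    have -> : b y y = b x y.
      rewrite {1}/y /pf_perp (sDl hb) (s_suml hb) big1 ?addr0 // => i _.
      by rewrite (sZl hb) [b (e i) y](hermJ hb) ye conj0 mulr0.
    rewrite /y /pf_perp (sDr hb) (s_sumr hb) rc_sum; congr (_ + _).
    by apply: eq_bigr => i _; rewrite (sZr hb) mulrC mulcJ.
  have -> : \sum_i b x (e i) * (b x (e i))^* = rc (\sum_i cn (b x (e i)) ^+ 2).
    by rewrite rc_sum; apply: eq_bigr => i _; rewrite mulcJ.
  rewrite reD re_rc -(rc_nat R 2) -rcM re_rc.
  have : 0 <= \sum_i cn (b x (e i)) ^+ 2 by apply: sumr_ge0 => i _; exact: sqr_ge0.
  lra.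
pose m := (Num.sqrt (- re (b y y)))^-1.
have m2 : m ^+ 2 * re (b y y) = -1.
  rewrite /m exprVn sqr_sqrtr; last lra.
  by rewrite invrN mulNr mulVf // lt_eqF.
pose z := rc m *: y.
have ze i : b z (e i) = 0 by rewrite (sZl hb) ye mulr0.
have zz : b z z = -1.
  rewrite (sxxE hb) (re_sxxZ hb) cn_rc real_normK ?num_real // m2.
  by rewrite rcN rc1.
pose e' (i : 'I_k.+1) := if unlift ord_max i is Some j then e j else z.
have /hmax : Pk k.+1; last by rewrite ltnn.
apply/asboolP; exists e' => i j; rewrite /e'.
case: unliftP => [i' ->|->]; case: unliftP => [j' ->|->].
- by rewrite he (inj_eq lift_inj).
- by rewrite (hermJ hb) ze conj0 eq_sym (negPf (neq_lift _ _)) oppr0.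
- by rewrite ze (negPf (neq_lift _ _)) oppr0.
- by rewrite zz eqxx.
Qed.
End Forms.

(** Bound the first factor on the right of the quadratic estimate by a multiple of [nrm s1 x],
    through [J1], and cancel it. *)
Lemma norm_equiv (V : lmodType C) (s1 s2 : V -> V -> C) (J1 : V -> V) (c1 c2 c3 : R) :
  0 <= c1 -> 0 <= c2 ->
  (forall x, nrm s1 x ^+ 2 <= c1 * nrm s2 (J1 x) * nrm s2 x) ->
  (forall x, nrm s2 x <= c2 * nrm s1 x) -> (forall x, nrm s1 (J1 x) <= c3 * nrm s1 x) ->
  forall x, nrm s1 x <= c1 * c2 * c3 * nrm s2 x.
Proof.
move=> c10 c20 h1 h2 h3 x.
have [x0|x0] := eqVneq (nrm s1 x) 0.
  have s20 : nrm s2 x = 0.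
    by apply: le_anti; rewrite nrm_ge0 andbT; have := h2 x; rewrite x0 mulr0.
  by rewrite x0 s20 mulr0.
have xp : 0 < nrm s1 x by rewrite lt0r x0 nrm_ge0.
rewrite -(ler_pM2r xp) -expr2; apply: le_trans (h1 x) _.
have -> : c1 * c2 * c3 * nrm s2 x * nrm s1 x = c1 * (c2 * (c3 * nrm s1 x)) * nrm s2 x.
  by ring.
apply: ler_wpM2r; first exact: nrm_ge0.
apply: ler_wpM2l => //; apply: le_trans (h2 _) _; exact: ler_wpM2l.
Qed.

(** The ratios of successive terms do not decrease, so a first ratio above q would make a n outgrow
    c q^n. The constant c drops out of the conclusion, which makes pointwise growth bounds
    uniform. *)
Lemma logconvex (a : nat -> R) (c q : R) : (forall n, 0 <= a n) -> 0 < q ->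
  (forall n, a n.+1 ^+ 2 <= a n * a n.+2) -> (forall n, a n <= c * q ^+ n) ->
  a 1%N <= q * a 0%N.
Proof.
move=> a0 q0 lc aq; rewrite leNgt; apply/negP => h.
have a00 : 0 < a 0%N.
  rewrite lt0r a0 andbT; apply/eqP => e; have := lc 0%N; rewrite e mul0r.
  rewrite e mulr0 in h; have : 0 < a 1%N ^+ 2 by rewrite exprn_gt0.
  lra.
pose rho := a 1%N / a 0%N.
have rq : q < rho by rewrite ltr_pdivlMr.
have r0 : 0 < rho by apply: lt_trans rq.
have grow n : 0 < a n /\ rho * a n <= a n.+1.
  elim: n => [|n [p1 p2]]; first by split=> //; rewrite /rho mulfVK ?gt_eqF.
  have p3 : 0 < a n.+1 by apply: lt_le_trans p2; rewrite mulr_gt0.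
  split=> //; rewrite -(ler_pM2l p1); apply: le_trans (lc n).
  have -> : a n * (rho * a n.+1) = (rho * a n) * a n.+1 by ring.
  rewrite expr2; exact: ler_wpM2r (ltW p3) _ _ p2.
have ge n : rho ^+ n * a 0%N <= a n.
  elim: n => [|n ih]; first by rewrite expr0 mul1r.
  apply: le_trans (grow n).2; rewrite exprS -mulrA ler_pM2l //.
have qr1 : q / rho < 1 by rewrite ltr_pdivrMr // mul1r.
have qr0 : 0 <= q / rho by rewrite divr_ge0 // ltW.
have [N hN] := @null_geom R c _ qr0 qr1 _ a00.
have := hN N (leqnn N); rewrite exprMn exprVn mulrA ltr_pdivrMr ?exprn_gt0 // mulrC.
by have := ge N; have := aq N; lra.
Qed.

(** The growth constant of an orbit may depend on x. Compress T to the positive complement of e: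
    there the norms along an orbit are log-convex, and [logconvex] gives a uniform bound. The
    remaining parts of T have finite rank and are bounded by symmetry. *)
Lemma symmetric_bound (V : lmodType C) (b : V -> V -> C) k (e : 'I_k -> V) (T : V -> V) (r : R) :
  is_herm b -> onf b e -> is_psd (sf b e) -> lin T ->
  (forall x y, b (T x) y = b x (T y)) -> 0 < r ->
  (forall x, exists c, forall n, nrm (sf b e) (iter n T x) <= c * r ^+ n) ->
  exists2 M : R, 0 <= M & forall x, nrm (sf b e) (T x) <= M * nrm (sf b e) x.
Proof.
move=> hb he ps lT sT r0 gT.
have hs := sf_herm e hb.
have [N hN] : exists N : V -> R, N = nrm (sf b e) by exists (nrm (sf b e)).
have ND x y : N (x + y) <= N x + N y by rewrite hN; exact: nrmD.
have N0 x : 0 <= N x by rewrite hN; exact: nrm_ge0.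
have NS (c : 'I_k -> C) (y : 'I_k -> V) : N (\sum_i c i *: y i) <= \sum_i cn (c i) * N (y i).
  rewrite hN; apply: le_trans (nrm_sum hs ps _ _ _) _.
  by apply: ler_sum => i _; rewrite (nrmZ hs).
have bN x y : cn (b x y) <= N x * N y by rewrite hN; exact: b_bound.
rewrite -hN in gT *.
have [c hc] := choice gT.
have c0 x : 0 <= c x by have := hc x 0%N; rewrite expr0 mulr1; exact: le_trans.
pose T0 x := pf_perp b e (T x).
have T0E x : T0 x = T x + \sum_i b x (T (e i)) *: e i.
  by rewrite /T0 /pf_perp; congr (_ + _); apply: eq_bigr => i _; rewrite sT.
have [D D0 hD] : exists2 D, 0 <= D & forall x j,
    \sum_i cn (b x (T (e i))) * N (iter j T (e i)) <= D * N x * r ^+ j.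
  exists (\sum_i N (T (e i)) * c (e i)).
    by apply: sumr_ge0 => i _; rewrite mulr_ge0.
  move=> x j; rewrite !mulr_suml; apply: ler_sum => i _.
  have -> : N (T (e i)) * c (e i) * N x * r ^+ j = (N x * N (T (e i))) * (c (e i) * r ^+ j).
    by ring.
  by apply: ler_pM; rewrite ?cn_ge0.
have q0 : 0 < r + D by rewrite ltr_pwDl.
have iterD j x y : iter j T (x + y) = iter j T x + iter j T y.
  by elim: j => [//|j ih]; rewrite !iterS ih (linD lT).
have iterS' j (d : 'I_k -> C) (y : 'I_k -> V) :
    iter j T (\sum_i d i *: y i) = \sum_i d i *: iter j T (y i).
  elim: j => [//|j ih]; rewrite iterS ih (lin_sum lT).
  by apply: eq_bigr => i _; rewrite (linZ lT).
(* [T0] differs from T by combinations of the e i, so its orbits still grow exponentially, at the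
   rate r + D. The index j closes the induction, as the correction terms are later moved by T. *)
have growth x n j : N (iter j T (iter n T0 x)) <= c x * (r + D) ^+ n * r ^+ j.
  elim: n j => [|n ih] j; first by rewrite expr0 mulr1; exact: hc.
  rewrite iterS T0E iterD -iterSr iterS'.
  apply: le_trans (ND _ _) _; apply: le_trans (lerD (ih _) (NS _ _)) _.
  apply: le_trans (lerD (lexx _) (hD _ _)) _.
  have := ih 0%N; rewrite expr0 mulr1 /= => h.
  have h2 := ler_wpM2l D0 h.
  have h3 : 0 <= r ^+ j by rewrite exprn_ge0 // ltW.
  have h4 := ler_wpM2r h3 h2.
  by rewrite !exprS; move: h4; move: (N _) (c x) (_ ^+ n) (r ^+ j) => a1 a2 a3 a4; lra.
have perp0 x i : b (T0 x) (e i) = 0 by exact: b_perp_e.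
have onperp x : (forall i, b x (e i) = 0) -> N (T0 x) <= (r + D) * N x.
  move=> xe; apply: (@logconvex (fun n => N (iter n T0 x)) (c x)) => // [n|n]; last first.
    by have := growth x n 0%N; rewrite expr0 mulr1.
  have pn m i : b (iter m T0 x) (e i) = 0 by case: m => [//|m]; exact: perp0.
  have sym y z : (forall i, b y (e i) = 0) -> (forall i, b z (e i) = 0) ->
      b (T0 y) z = b y (T0 z).
    have half y' z' : (forall i, b z' (e i) = 0) -> b (T0 y') z' = b (T y') z'.
      move=> z'e; rewrite T0E (sDl hb) (s_suml hb) big1 ?addr0 // => i _.
      by rewrite (sZl hb) [b (e i) z'](hermJ hb) z'e conj0 mulr0.
    move=> ye ze; rewrite half // sT [RHS](hermJ hb) half // -(hermJ hb); by [].
  have -> : N (iter n.+1 T0 x) ^+ 2 = re (b (iter n T0 x) (iter n.+2 T0 x)).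
    rewrite hN (nrm2 ps) sf_of_perp; last exact: pn.
    by rewrite [iter n.+2 _ _]iterS -sym; [| exact: pn | exact: pn].
  exact: le_trans (re_le_cn _) (bN _ _).
pose S1 := \sum_i N (T (e i)).
have S10 : 0 <= S1 by apply: sumr_ge0.
have Ne i : N (e i) = 1 by rewrite hN nrm_e.
have A0 : 0 <= r + D + S1 := addr_ge0 (ltW q0) S10.
exists ((r + D + S1) * (1 + k%:R) + S1) => [|x].
  by rewrite addr_ge0 // mulr_ge0 // addr_ge0 // ler0n.
pose y := pf_perp b e x.
have hy : N y <= (1 + k%:R) * N x.
  apply: le_trans (ND _ _) _; rewrite mulrDl mul1r lerD2l.
  apply: le_trans (NS _ _) _; apply: le_trans (_ : \sum_(i < k) N x <= _).
    by apply: ler_sum => i _; have := bN x (e i); rewrite Ne !mulr1.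
  by rewrite sumr_const card_ord mulr_natl.
have hTy : N (T y) <= (r + D + S1) * N y.
  have -> : T y = T0 y + \sum_i (- b y (T (e i))) *: e i.
    by rewrite T0E -addrA -big_split big1 ?addr0 // => i _; rewrite /= scaleNr subrr.
  apply: le_trans (ND _ _) _; rewrite mulrDl; apply: lerD.
    by apply: onperp => i; exact: b_perp_e.
  apply: le_trans (NS _ _) _; rewrite mulr_suml; apply: ler_sum => i _.
  by rewrite Ne mulr1 cnN mulrC; exact: bN.
have -> : T x = T y + \sum_i (- b x (e i)) *: T (e i).
  rewrite /y /pf_perp (linD lT) (lin_sum lT) -addrA -big_split big1 ?addr0 // => i _.
  by rewrite /= (linZ lT) scaleNr subrr.
apply: le_trans (ND _ _) _; rewrite mulrDl; apply: lerD.
  by apply: le_trans hTy _; rewrite -mulrA; apply: ler_wpM2l.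
apply: le_trans (NS _ _) _; rewrite mulr_suml; apply: ler_sum => i _.
rewrite cnN mulrC; apply: ler_wpM2l => //.
by have := bN x (e i); rewrite Ne mulr1.
Qed.
End Indefinite.

(** * Pontryagin spaces *)

Section Pontryagin.
Context (R : realType).
Local Notation C := (Cplx R).

(** A Pontryagin space presented by a negative orthonormal family whose reflected form is a Hilbert
    inner product; that norm is the working norm below. *)
Record pont (K : lmodType C) (f : K -> K -> C) k (e : 'I_k -> K) : Prop := Pont {
  pt_h : is_herm f; pt_on : onf f e; pt_hilb : hilb (sf f e) }.

(** Complete V in the positive form and reflect the completed form back in the images of the e i;
    this extends b. *)
Lemma pont_completion (V : lmodType C) (b : V -> V -> C) k (e : 'I_k -> V) :
  is_herm b -> onf b e -> is_psd (sf b e) ->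
  exists (K : lmodType C) (f : K -> K -> C) (j : {linear V -> K}),
  [/\ pont f (fun i => j (e i)), forall v w, f (j v) (j w) = b v w &
      forall x (d : R), 0 < d -> exists v, nrm (sf f (fun i => j (e i))) (x - j v) < d].
Proof.
move=> hb he ps; have hs := sf_herm e hb.
have [K [t [j [ht jt jd]]]] := completion hs ps.
have th := hb_h ht.
pose f x y := t x y - 2 * \sum_i t x (j (e i)) * (t y (j (e i)))^*.
have fh : is_herm f.
  split=> [a x y z|x y]; rewrite /f.
    have -> : \sum_i t (a *: x + y) (j (e i)) * (t z (j (e i)))^* =
      a * (\sum_i t x (j (e i)) * (t z (j (e i)))^*) + \sum_i t y (j (e i)) * (t z (j (e i)))^*.
      rewrite mulr_sumr -big_split; apply: eq_bigr => i _.
      by rewrite (hermL th) mulrDl mulrA.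
    by rewrite (hermL th); ring.
  rewrite conjB conjM -(hermJ th) conj_sum -[X in X^*](rc_nat R 2) conj_rc rc_nat.
  congr (_ - _ * _); apply: eq_bigr => i _.
  by rewrite conjM conjCK mulrC.
have te i i' : t (j (e i)) (j (e i')) = (i == i')%:R.
  by rewrite jt sf_e // he opprK.
have fe x i : f x (j (e i)) = - t x (j (e i)).
  rewrite /f (bigD1 i) //= te eqxx conj1 mulr1 big1 ?addr0; first by ring.
  by move=> i' ii; rewrite te eq_sym (negPf ii) conj0 mulr0.
have sfE : sf f (fun i => j (e i)) = t.
  apply/funext => x; apply/funext => y; rewrite /sf /f.
  have -> : \sum_i f x (j (e i)) * (f y (j (e i)))^* =
      \sum_i t x (j (e i)) * (t y (j (e i)))^*.
    by apply: eq_bigr => i _; rewrite !fe conjN mulrNN.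
  by rewrite subrK.
exists K, f, j; rewrite sfE; split=> // [|v w].
  split=> //; last by rewrite sfE.
  by move=> i i'; rewrite fe te.
rewrite /f jt; under eq_bigr do rewrite !jt !sf_e // conjN mulrNN.
by rewrite /sf addrK.
Qed.

Lemma sf_upper_of (K : lmodType C) (f s : K -> K -> C) k (e : 'I_k -> K) :
  (forall x y, cn (f x y) <= nrm s x * nrm s y) -> is_psd (sf f e) ->
  exists2 c : R, 0 <= c & forall x, nrm (sf f e) x <= c * nrm s x.
Proof.
move=> bd ps1; pose c2 := 1 + 2 * \sum_i nrm s (e i) ^+ 2.
have c20 : 0 <= c2.
  by rewrite addr_ge0 // mulr_ge0 // sumr_ge0 // => i _; exact: sqr_ge0.
exists (Num.sqrt c2) => [|x]; first exact: sqrtr_ge0.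
rewrite -(@ler_pXn2r _ 2) ?nnegrE ?mulr_ge0 ?sqrtr_ge0 ?nrm_ge0 //.
rewrite exprMn (nrm2 ps1) (sqr_sqrtr c20) {1}/sf reD -(rc_nat R 2) re_rcM.
have h1 : re (f x x) <= nrm s x ^+ 2.
  by rewrite expr2; apply: le_trans (re_le_cn _) (bd _ _).
have h2 : re (\sum_i f x (e i) * (f x (e i))^*) <= (\sum_i nrm s (e i) ^+ 2) * nrm s x ^+ 2.
  rewrite re_sum mulr_suml; apply: ler_sum => i _; rewrite mulcJ re_rc -exprMn.
  rewrite lerXn2r ?nnegrE ?cn_ge0 ?mulr_ge0 ?nrm_ge0 // mulrC; exact: bd.
apply: le_trans (lerD h1 (ler_wpM2l (ler0n R 2) h2)) _.
by rewrite /c2 le_eqVlt; apply/orP; left; apply/eqP; ring.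
Qed.

(** With [sf_upper_of] this shows that the norms of different fundamental decompositions are
    equivalent: |x|^2 = f(J1 x, x) is bounded by the second norm of both factors. *)
Lemma sf_lower_of (K : lmodType C) (f s : K -> K -> C) (J1 : K -> K) (c3 : R) k
    (e : 'I_k -> K) :
  is_herm f -> is_psd s -> (forall x y, cn (f x y) <= nrm s x * nrm s y) ->
  (forall x, nrm s x ^+ 2 = re (f (J1 x) x)) ->
  (forall x, nrm s (J1 x) <= c3 * nrm s x) -> 0 <= c3 ->
  onf f e -> is_psd (sf f e) ->
  exists2 c : R, 0 <= c & forall x, nrm s x <= c * nrm (sf f e) x.
Proof.
move=> fh sp bd J1E J1b c30 on1 ps1; have [c c0 hc] := sf_upper_of bd ps1.
exists (1 * c * c3); first by rewrite !mulr_ge0.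
apply: (@norm_equiv _ _ _ _ J1) => // x.
by rewrite mul1r J1E; apply: le_trans (re_le_cn _) _; exact: b_bound.
Qed.

Section Space.
Context (K : lmodType C) (f : K -> K -> C) (k : nat) (e : 'I_k -> K).
Hypothesis pt : pont f e.
Let fh : is_herm f := pt_h pt.
Let fon : onf f e := pt_on pt.
Let sp : is_psd (sf f e) := hb_p (pt_hilb pt).
Local Notation N := (nrm (sf f e)).

Lemma pt_sh : is_herm (sf f e). Proof. exact: hb_h (pt_hilb pt). Qed.
Let sh := pt_sh.

Lemma pont_bound x y : cn (f x y) <= N x * N y.
Proof. exact: b_bound. Qed.

Lemma pont_NI : NI f k.
Proof. exact: (onf_size_le fh sp). Qed.

Lemma pont_nondeg x : (forall y, f x y = 0) -> x = 0.
Proof.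
move=> h; apply: (hb_d (pt_hilb pt)).
by rewrite /nrm (hermJ sh) -(b_jf e fh) (hermJ fh) conjCK h re0 sqrtr0.
Qed.

Lemma pont_lim_form (u : nat -> K) x y : slim (sf f e) u x -> clim (fun n => f (u n) y) (f x y).
Proof.
move=> h; apply: null_le (nullZ (nrm_ge0 (sf f e) y) h) => n.
by rewrite -(sBl fh) mulrC; exact: pont_bound.
Qed.

Lemma pont_nondeg_dense x (P : K -> Prop) :
  (forall y (d : R), 0 < d -> exists2 v, P v & N (y - v) < d) ->
  (forall v, P v -> f x v = 0) -> x = 0.
Proof.
move=> dP h; apply: pont_nondeg => y; apply: cn_le0; apply: (@le_eps_mul _ _ _ (N x)) => d d0.
rewrite add0r; have [v Pv hv] := dP y d d0.
have -> : f x y = f x (y - v) by rewrite (sBr fh) (h v Pv) subr0.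
apply: le_trans (pont_bound _ _) _; apply: ler_wpM2l; [exact: nrm_ge0 | exact: ltW].
Qed.

Lemma sf_upper k1 (e1 : 'I_k1 -> K) : is_psd (sf f e1) ->
  exists2 c : R, 0 <= c & forall x, nrm (sf f e1) x <= c * N x.
Proof. by move=> ps1; apply: sf_upper_of => //; exact: pont_bound. Qed.

Lemma sf_lower k1 (e1 : 'I_k1 -> K) : onf f e1 -> is_psd (sf f e1) ->
  exists2 c : R, 0 <= c & forall x, N x <= c * nrm (sf f e1) x.
Proof.
move=> on1 ps1; apply: (@sf_lower_of _ _ _ (jf f e) 1 _ _ fh sp pont_bound) => // x.
  by rewrite (nrm2 sp) -(b_jf e fh).
by rewrite nrm_jf // mul1r.
Qed.

(** A densely defined symmetric operator with exponentially bounded orbits extends to a bounded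
    self-adjoint one. The given family e need not lie in the image of j, so a maximal family [je] is
    chosen inside it; its norm is equivalent, and [symmetric_bound] applies on V. *)
Lemma op_extension (V : lmodType C) (j : V -> K) (T : V -> V) (r : R) :
  lin j -> lin T -> 0 < r ->
  (forall x (d : R), 0 < d -> exists v, N (x - j v) < d) ->
  (forall v w, f (j (T v)) (j w) = f (j v) (j (T w))) ->
  (forall v, exists c, forall n, N (j (iter n T v)) <= c * r ^+ n) ->
  exists (B : {linear K -> K}) (M : R), [/\ forall v, B (j v) = j (T v),
    forall x, N (B x) <= M * N x & forall x y, f (B x) y = f x (B y)].
Proof.
move=> lj lT r0 dj sT gT.
pose b v w := f (j v) (j w).
have hb : is_herm b by split=> [a v w z|v w]; rewrite /b ?lj ?(hermL fh) // (hermJ fh).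
have niV : NI b k by move=> n v hv; apply: (pont_NI (e := fun i => j (v i))) => i i'; exact: hv.
have [k1 [e1 [on1 ps1]]] := max_onf hb niV.
pose je i := j (e1 i).
have onje : onf f je by move=> i i'; exact: on1.
have sje v w : sf f je (j v) (j w) = sf b e1 v w by [].
have jeh := sf_herm je fh.
(* Positivity is known on the image of V and passes to K by density and continuity of f. *)
have psje : is_psd (sf f je).
  move=> x; have [v hv] : exists v, slim (sf f e) (fun n => j (v n)) x.
    have h n : exists v, N (x - j v) < n.+1%:R^-1 by apply: dj; rewrite invr_gt0.
    have [v hv] := choice h; exists v.
    by apply: null_le (@null_harmonic R) => n; rewrite (nrmBC sh) ltW.
  have h1 : clim (fun n => sf f je (j (v n)) (j (v n))) (sf f je x x).
    have hxy y : clim (fun n => f (j (v n)) y) (f x y) by exact: pont_lim_form.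
    have hself : clim (fun n => f (j (v n)) (j (v n))) (f x x).
      have [Mx hMx] := cau_bounded sh sp (slim_cau sh sp hv).
      have Mx0 : 0 <= Mx := le_trans (nrm_ge0 _ _) (hMx 0%N).
      have n1 := nullZ Mx0 hv; have n2 := hxy x.
      apply: null_le (nullD n1 n2) => n.
      have -> : f (j (v n)) (j (v n)) - f x x =
          f (j (v n)) (j (v n) - x) + (f (j (v n)) x - f x x).
        by rewrite (sBr fh); ring.
      apply: le_trans (cnD _ _) _; rewrite lerD2r; apply: le_trans (pont_bound _ _) _.
      by apply: ler_wpM2r; [exact: nrm_ge0 | exact: hMx].
    rewrite {2}/sf; apply: (clim_ext (fun n => erefl)).
    apply: climD hself (climZ 2 _).
    have hsum (I : seq 'I_k1) : clim (fun n => \sum_(i <- I) f (j (v n)) (je i) * (f (j (v n)) (je i))^*)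
        (\sum_(i <- I) f x (je i) * (f x (je i))^*).
      elim: I => [|i I ih].
        by rewrite big_nil; apply: clim_ext (clim_cst 0) => n; rewrite big_nil.
      rewrite big_cons; apply: (@clim_ext _ (fun n => f (j (v n)) (je i) * (f (j (v n)) (je i))^* +
        \sum_(i <- I) f (j (v n)) (je i) * (f (j (v n)) (je i))^*)).
        by move=> n; rewrite big_cons.
      apply: climD ih; have hi := hxy (je i).
      have [Mx hMx] := cau_bounded sh sp (slim_cau sh sp hv).
      have n1 := nullZ (mulr_ge0 (le_trans (nrm_ge0 _ _) (hMx 0%N)) (nrm_ge0 (sf f e) (je i))) hi.
      have n2 := nullZ (cn_ge0 (f x (je i))) hi.
      apply: null_le (nullD n1 n2) => n; set a := f (j (v n)) _; set a' := f x _.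
      have -> : a * a^* - a' * a'^* = a * (a - a')^* + a'^* * (a - a') by rewrite conjB; ring.
      apply: le_trans (cnD _ _) _; rewrite !cnM !cnJ lerD2r.
      apply: ler_wpM2r; first exact: cn_ge0.
      apply: le_trans (pont_bound _ _) _; apply: ler_wpM2r; [exact: nrm_ge0 | exact: hMx].
    exact: hsum.
  by apply: clim_re_ge h1 _ => n; rewrite sje; exact: ps1.
have [c c0 hc] := sf_upper psje; have [c' c0' hc'] := sf_lower onje psje.
have Nje v : nrm (sf f je) (j v) = nrm (sf b e1) v by [].
have gT1 v : exists a, forall n, nrm (sf b e1) (iter n T v) <= a * r ^+ n.
  have [a ha] := gT v; exists (c * a) => n.
  by rewrite -Nje -mulrA; apply: le_trans (hc _) _; apply: ler_wpM2l.
have [M M0 hM] := symmetric_bound hb on1 ps1 lT sT r0 gT1.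
have bd v : N (j (T v)) <= c' * (M * c) * N (j v).
  apply: le_trans (hc' _) _; rewrite -mulrA; apply: ler_wpM2l => //.
  rewrite Nje; apply: le_trans (hM v) _; rewrite -mulrA; apply: ler_wpM2l => //.
  by rewrite -Nje; exact: hc.
have ljT : lin (fun v => j (T v)) by move=> a x y; rewrite lT lj.
have [B [hB hBM]] := extension sh sp (pt_hilb pt) lj ljT dj bd.
exists B, (c' * (M * c)); split=> // x y.
have BM0 : 0 <= c' * (M * c) by rewrite !mulr_ge0.
apply/eqP; rewrite -subr_eq0; apply/eqP/cn_le0.
apply: (@le_eps_mul _ _ _ (c' * (M * c) * (N y + N y) + (N x + 1 + (N x + 1)) * (c' * (M * c)))) => d d0.
rewrite add0r.
pose d1 := Num.min d 1; have d10 : 0 < d1 by rewrite lt_min d0 ltr01.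
have [v hv] := dj x d1 d10; have [w hw] := dj y d1 d10.
move: hv hw; rewrite !lt_min => /andP[v1 v2] /andP[w1 w2].
(* Symmetry on the image of j cancels the main term; each of the four remaining terms has a small
   factor x - j v or y - j w. *)
have -> : f (B x) y - f x (B y) = f (B (x - j v)) y - f (x - j v) (B y) +
    (f (B (j v)) (y - j w) - f (j v) (B (y - j w))).
  rewrite !linearB !(sBl fh) !(sBr fh) !hB sT; ring.
have vb : N (j v) <= N x + 1.
  by have := nrmDl sh sp (j v) x; rewrite (nrmBC sh); lra.
have t1 : cn (f (B (x - j v)) y) <= c' * (M * c) * N y * d.
  apply: le_trans (pont_bound _ _) _; rewrite [leRHS]mulrAC; apply: ler_wpM2r; first exact: nrm_ge0.
  by apply: le_trans (hBM _) _; apply: ler_wpM2l => //; exact: ltW.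
have t2 : cn (f (x - j v) (B y)) <= c' * (M * c) * N y * d.
  apply: le_trans (pont_bound _ _) _; rewrite mulrC.
  by apply: ler_pM; rewrite ?nrm_ge0 ?hBM // ltW.
have t3 : cn (f (B (j v)) (y - j w)) <= (N x + 1) * (c' * (M * c)) * d.
  apply: le_trans (pont_bound _ _) _; apply: ler_pM; rewrite ?nrm_ge0 //; last exact: ltW.
  by apply: le_trans (hBM _) _; rewrite mulrC; apply: ler_wpM2r.
have t4 : cn (f (j v) (B (y - j w))) <= (N x + 1) * (c' * (M * c)) * d.
  apply: le_trans (pont_bound _ _) _; rewrite -mulrA.
  apply: ler_pM; rewrite ?nrm_ge0 //.
  by apply: le_trans (hBM _) _; apply: ler_wpM2l => //; exact: ltW.
apply: le_trans (cnD _ _) _; apply: le_trans (lerD (cnB _ _) (cnB _ _)) _.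
move: t1 t2 t3 t4; move: (cn _) (cn _) (cn _) (cn _) (c' * (M * c)) (N x) (N y) => q1 q2 q3 q4 q nx ny.
by rewrite !mulrDl !mulrDr; lra.
Qed.

(* After applying the inverse [S] of [A] this is a system of n linear equations. *)
Lemma finite_rank_onto (V : lmodType C) (A : V -> V) (S : {linear V -> V}) n
    (l : 'I_n -> V -> C) (v : 'I_n -> V) :
  lin A -> cancel S A -> (forall i a x y, l i (a *: x + y) = a * l i x + l i y) ->
  (forall x, A x + \sum_i l i x *: v i = 0 -> x = 0) ->
  exists W : 'M[C]_n, forall y,
    let x := S y - \sum_m (\sum_i l i (S y) * W i m) *: S (v m) in
    A x + \sum_i l i x *: v i = y.
Proof.
move=> lA SA ll inj.
have lsum i (c : 'I_n -> C) (w : 'I_n -> V) : l i (\sum_m c m *: w m) = \sum_m c m * l i (w m).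
  have l0 : l i 0 = 0.
    have := ll i 1 0 0; rewrite scale1r addr0 mul1r => /eqP.
    by rewrite -subr_eq0 opprD addNKr oppr_eq0 => /eqP.
  elim/big_rec2: _ => [//|m a b _ <-]; by rewrite ll.
pose M : 'M[C]_n := \matrix_(m, i) ((m == i)%:R + l i (S (v m))).
have Mu : row_free M.
  rewrite -kermx_eq0; apply/eqP/row_matrixP => q; rewrite row0.
  set c := row q _.
  have cM : c *m M = 0.
    by rewrite /c -row_mul mulmx_ker row0.
  clearbody c; have cE i : c 0 i = - \sum_m c 0 m * l i (S (v m)).
    have h := congr1 (fun X : 'rV_n => X 0 i) cM; move/eqP: h; rewrite !mxE.
    under eq_bigr do rewrite [X in _ * X]mxE mulrDr.
    rewrite big_split /= (bigD1 i) //= eqxx mulr1 big1 ?addr0; last first.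
      by move=> m mi; rewrite (negPf mi) mulr0.
    by rewrite addr_eq0 => /eqP.
  pose x := - \sum_m c 0 m *: S (v m).
  have lx i : l i x = c 0 i.
    by rewrite /x -sumrN; under eq_bigr do rewrite -scaleNr; rewrite lsum cE -sumrN;
      apply: eq_bigr => m _; rewrite mulNr.
  have x0 : x = 0.
    apply: inj; rewrite {1}/x (linN lA) (lin_sum lA).
    under [X in _ + X]eq_bigr do rewrite lx.
    under [X in - X]eq_bigr do rewrite (linZ lA) SA.
    by rewrite addNr.
  apply/rowP => i; rewrite -lx x0 mxE.
  have := ll i 1 0 0; rewrite scale1r addr0 mul1r => /eqP.
  by rewrite -subr_eq0 opprD addNKr oppr_eq0 => /eqP.
exists (invmx M) => y; cbv zeta.
have [c hcd] : exists c : 'rV_n, c = \row_i l i (S y) *m invmx M by eexists.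
have hc : c *m M = \row_i l i (S y) by rewrite hcd mulmxKV // -row_free_unit.
have cE m : \sum_i l i (S y) * invmx M i m = c 0 m.
  by rewrite hcd mxE; apply: eq_bigr => i _; rewrite mxE.
under [X in A (_ - X)]eq_bigr do rewrite cE.
under [X in _ + X]eq_bigr do (under eq_bigr do rewrite cE).
have hy i : l i (S y) = c 0 i + \sum_m c 0 m * l i (S (v m)).
  have h := congr1 (fun X : 'rV_n => X 0 i) hc; move: h; rewrite !mxE => <-.
  under eq_bigr do rewrite [X in _ * X]mxE mulrDr.
  rewrite big_split /=; congr (_ + _).
  rewrite (bigD1 i) //= eqxx mulr1 big1 ?addr0 // => m mi.
  by rewrite (negPf mi) mulr0.
have lx i : l i (S y - \sum_m c 0 m *: S (v m)) = c 0 i.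
  have -> : S y - \sum_m c 0 m *: S (v m) = (-1) *: (\sum_m c 0 m *: S (v m)) + S y.
    by rewrite scaleN1r addrC.
  by rewrite ll lsum hy; ring.
rewrite (linB lA) SA (lin_sum lA); under [X in _ + X]eq_bigr do rewrite lx.
by under [X in _ - X + _]eq_bigr do rewrite (linZ lA) SA; rewrite subrK.
Qed.

Lemma lin_sub_scale (V : lmodType C) (T : V -> V) z : lin T -> lin (fun x => T x - z *: x).
Proof.
move=> lT a x y.
by rewrite lT scalerBr scalerDr !scalerA [z * a]mulrC opprD addrACA.
Qed.

Section Operator.
Context (A : K -> K) (MA : R).
Hypothesis lA : lin A.
Hypothesis bA : forall x, N (A x) <= MA * N x.
Hypothesis sA : forall x y, f (A x) y = f x (A y).

Definition rsv (z : C) (S : {linear K -> K}) :=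
  exists M : R, binv (sf f e) (sf f e) (fun x => A x - z *: x) S M.

Lemma lin_shift z : lin (fun x => A x - z *: x).
Proof. exact: lin_sub_scale. Qed.

Lemma bound_shift z x : N (A x - z *: x) <= (MA + cn z) * N x.
Proof.
apply: le_trans (nrmB sh sp _ _) _; rewrite (nrmZ sh) mulrDl lerD2r; exact: bA.
Qed.

(** [A1] = J A is self-adjoint in the Hilbert space, so [A1] - z is invertible with lower bound |im
    z|. As A - [A1] has rank at most k, an injective A - z is onto by linear algebra
    ([finite_rank_onto]). *)
Lemma resolvent_of_injective z : im z != 0 -> (forall x, A x - z *: x = 0 -> x = 0) ->
  exists S, rsv z S.
Proof.
move=> iz inj.
pose A1 x := jf f e (A x).
have lA1 : lin A1 by move=> a x y; rewrite /A1 lA (jf_lin e fh).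
have sA1 x y : sf f e (A1 x) y = sf f e x (A1 y).
  by rewrite /A1 -(b_sf fh fon) sA (hermJ sh) -(b_sf fh fon) (hermJ fh).
have NA1 x : N (A1 x) = N (A x) by rewrite /A1 nrm_jf.
have below w x : cn (sf f e (A1 x - w *: x) x) >= `|im w| * N x ^+ 2.
  apply: le_trans (cn_im _); rewrite (sBl sh) (sZl sh) imB.
  have -> : im (sf f e (A1 x) x) = 0.
    have := sA1 x x; rewrite [RHS](hermJ sh) => /(congr1 im); rewrite imJ; lra.
  rewrite sub0r normrN (sxxE sh) [w * _]mulrC im_rcM normrM -(nrm2 sp) mulrC.
  by rewrite [`|_ ^+ 2|]ger0_norm ?sqr_ge0.
have below' w x : `|im w| * N x <= N (A1 x - w *: x).
  have [x0|x0] := eqVneq (N x) 0; first by rewrite x0 mulr0 nrm_ge0.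
  have xp : 0 < N x by rewrite lt0r x0 nrm_ge0.
  rewrite -(ler_pM2r xp) -mulrA -expr2; apply: le_trans (below w x) _.
  exact: cauchy_schwarz.
have lA1z w : lin (fun x => A1 x - w *: x).
  exact: lin_sub_scale.
have izp : 0 < `|im z| by rewrite normr_gt0.
have onto1 : forall y, exists x, A1 x - z *: x = y.
  apply: (onto_of (pt_hilb pt) (pt_hilb pt) (lA1z z) izp (below' z)).
    move=> x; apply: le_trans (nrmB sh sp _ _) _; rewrite (nrmZ sh) NA1.
    by apply: le_trans (lerD (bA x) (lexx _)) _; rewrite -mulrDl.
  move=> w h; apply: (hb_d (pt_hilb pt)).
  have h2 : A1 w - z^* *: w = 0.
    apply: (hb_d (pt_hilb pt)).
    have h3 := h (A1 w - z^* *: w); rewrite (sBl sh) (sZl sh) sA1 in h3.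
    suff e0 : sf f e (A1 w - z^* *: w) (A1 w - z^* *: w) = 0 by rewrite /nrm e0 re0 sqrtr0.
    by rewrite (sBr sh) (sZr sh) conjCK.
  apply: le_anti; rewrite nrm_ge0 andbT.
  have := below' (z^*) w; rewrite h2 (nrm0 sh) imJ normrN.
  by rewrite pmulr_rle0.
have [S1 hS1] := binv_of sh sp (hb_d (pt_hilb pt)) sh (lA1z z) izp (below' z) onto1.
have [S1K SK1 bS1] := hS1.
pose l i x := - (2 * f (A x) (e i)).
have ll i a x y : l i (a *: x + y) = a * l i x + l i y.
  by rewrite /l lA (hermL fh); ring.
have AE x : A x - z *: x = (A1 x - z *: x) + \sum_i l i x *: e i.
  have -> : \sum_i l i x *: e i = - (2 *: \sum_i f (A x) (e i) *: e i).
    by rewrite scaler_sumr -sumrN; apply: eq_bigr => i _; rewrite /l scalerA scaleNr.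
  by rewrite /A1 /jf [_ + _ - z *: x]addrAC addrK.
have [|W hW] := @finite_rank_onto K (fun x => A1 x - z *: x) S1 k l e (lA1z z) SK1 ll.
  by move=> x; rewrite -AE; exact: inj.
pose G y := S1 y - \sum_m (\sum_i l i (S1 y) * W i m) *: S1 (e m).
have GE y : A (G y) - z *: G y = y by rewrite AE; exact: hW.
have izi : 0 <= `|im z|^-1 by rewrite invr_ge0.
have [D D0 hD] : exists2 D, 0 <= D & forall y, N (G y) <= D * N y.
  pose D1 := \sum_m (\sum_i 2 * `|MA| * cn (W i m)) * N (S1 (e m)).
  have D10 : 0 <= D1.
    apply: sumr_ge0 => m _; rewrite mulr_ge0 ?nrm_ge0 // sumr_ge0 // => i _.
    by rewrite !mulr_ge0 ?cn_ge0.
  exists ((1 + D1) * `|im z|^-1); first by rewrite mulr_ge0 // addr_ge0.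
  move=> y; have SyN : N (S1 y) <= `|im z|^-1 * N y by exact: bS1.
  have li i x : cn (l i x) <= 2 * `|MA| * N x.
    rewrite /l cnN cnM -(rc_nat R 2) cn_rc ger0_norm // -mulrA ler_pM2l //.
    apply: le_trans (pont_bound _ _) _; rewrite nrm_e // mulr1.
    by apply: le_trans (bA x) _; apply: ler_wpM2r; [exact: nrm_ge0 | exact: ler_norm].
  rewrite -mulrA; apply: le_trans (_ : (1 + D1) * N (S1 y) <= _); last first.
    by apply: ler_wpM2l => //; rewrite addr_ge0.
  apply: le_trans (nrmB sh sp _ _) _; rewrite mulrDl mul1r lerD2l.
  apply: le_trans (nrm_sum sh sp _ _ _) _; rewrite mulr_suml; apply: ler_sum => m _.
  rewrite (nrmZ sh) mulrAC; apply: ler_wpM2r; first exact: nrm_ge0.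
  apply: le_trans (cn_sum _ _ _) _; rewrite mulr_suml; apply: ler_sum => i _.
  rewrite cnM mulrAC; apply: ler_wpM2r; [exact: cn_ge0 | exact: li].
have GK x : G (A x - z *: x) = x.
  apply/eqP; rewrite -subr_eq0; apply/eqP; apply: inj.
  by rewrite (linB (lin_shift z)) GE subrr.
have D1 : 0 < D + 1 by lra.
have D2 : 0 < (D + 1)^-1 by rewrite invr_gt0.
have below2 x : (D + 1)^-1 * N x <= N (A x - z *: x).
  rewrite ler_pdivrMl //; apply: le_trans (_ : D * N (A x - z *: x) <= _).
    by rewrite -{1}(GK x); exact: hD.
  by rewrite ler_wpM2r ?nrm_ge0 // lerDl.
have [S hS] := binv_of sh sp (hb_d (pt_hilb pt)) sh (lin_shift z) D2 below2
  (fun y => ex_intro _ (G y) (GE y)).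
by exists S, ((D + 1)^-1)^-1.
Qed.

End Operator.
End Space.
End Pontryagin.

(** * Nonreal eigenvalues of self-adjoint operators in a Pontryagin space *)

Section Eigenvalues.
Context (R : realType).
Local Notation C := (Cplx R).
Context (K : lmodType C) (f : K -> K -> C) (k : nat) (e : 'I_k -> K) (A : K -> K).

Definition eigen_free (w : C) := forall x, A x - w *: x = 0 -> x = 0.

Definition shifts (s : seq C) (y : K) := foldr (fun w v => A v - w *: v) y s.

(* The eigenvectors span a neutral subspace, because z_i - z_j^* is not real. *)
Lemma eigen_family n (z : 'I_n -> C) (x : 'I_n -> K) : pont f e -> lin A ->
  (forall x y, f (A x) y = f x (A y)) ->
  injective z -> (forall i, 0 < im (z i)) -> (forall i, A (x i) = z i *: x i) ->
  (forall i, x i != 0) -> (n <= k)%N.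
Proof.
move=> pt lA sA injz iz Ax x0; have fh := pt_h pt.
rewrite leqNgt; apply/negP => kn.
have [c c0 cA] := nontrivial_kernel (\matrix_(i < n, j < k) f (x i) (e j)) kn.
have neutral i j : f (x i) (x j) = 0.
  have h := sA (x i) (x j); rewrite !Ax (sZl fh) (sZr fh) in h.
  have : (z i - (z j)^*) * f (x i) (x j) = 0 by rewrite mulrBl h subrr.
  move=> /eqP; rewrite mulf_eq0 => /orP[/eqP zz|/eqP //].
  have h1 := congr1 im zz; rewrite imB imJ im0 opprK in h1.
  by have := addr_gt0 (iz i) (iz j); rewrite h1 ltxx.
have y0 : \sum_i c 0 i *: x i = 0.
  apply: (hb_d (pt_hilb pt)); rewrite /nrm sf_of_perp => [|j].
    rewrite (s_suml fh) big1 ?re0 ?sqrtr0 // => i _.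
    rewrite (s_sumr fh) big1 // => j _.
    by rewrite (sZl fh) (sZr fh) neutral !mulr0.
  have := congr1 (fun M : 'rV_k => M 0 j) cA; rewrite !mxE => <-.
  by rewrite (s_suml fh); apply: eq_bigr => i _; rewrite (sZl fh) mxE.
move: c0; apply/negP; rewrite negbK; apply/eqP/rowP => i; rewrite mxE.
have ls s : lin (shifts s).
  elim: s => [|w s ih] // a u v; rewrite /= -!/(shifts s _) ih lA scalerDr scalerBr !scalerA.
  by rewrite [w * a]mulrC opprD addrACA.
have shE s j : shifts s (x j) = (\prod_(w <- s) (z j - w)) *: x j.
  elim: s => [|w s ih]; first by rewrite big_nil scale1r.
  by rewrite /= -/(shifts s (x j)) ih (linZ lA) Ax big_cons !scalerA -scalerBl mulrBl [_ * z j]mulrC.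
(* The product of the A - z j over j other than i annihilates every term of the relation except the
   i-th. *)
pose s := [seq z j | j <- [seq j <- index_enum 'I_n | j != i]].
have := congr1 (shifts s) y0; rewrite (lin0 (ls s)) (lin_sum (ls s)) (bigD1 i) //=.
rewrite big1 ?addr0 => [|j ji]; last first.
  rewrite (linZ (ls s)) shE (_ : \prod_(w <- s) _ = 0) ?scale0r ?scaler0 //.
  apply/eqP; rewrite prodf_seq_eq0; apply/hasP; exists (z j); last by rewrite /= subrr.
  by rewrite map_f // mem_filter ji mem_index_enum.
rewrite (linZ (ls s)) shE scalerA => /eqP; rewrite scaler_eq0 (negPf (x0 i)) orbF.
rewrite mulf_eq0 => /orP[/eqP //|]; rewrite prodf_seq_eq0 => /hasP[w /mapP[j]].
rewrite mem_filter => /andP[ji _] -> /=; rewrite subr_eq0 => /eqP /injz ij.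
by rewrite ij eqxx in ji.
Qed.

(** The bound 1 / (1 + sum of the 1 / d i) also serves the empty family. *)
Lemma pos_min n (d : 'I_n -> R) : (forall i, 0 < d i) ->
  exists2 r : R, 0 < r & forall i, r <= d i.
Proof.
move=> d0; pose S := 1 + \sum_i (d i)^-1.
have S0 : 0 < S.
  rewrite ltr_pwDl // sumr_ge0 // => i _; rewrite invr_ge0; exact: ltW.
exists S^-1 => [|i]; first by rewrite invr_gt0.
rewrite -[d i]invrK lef_pV2 ?posrE ?invr_gt0 // /S (bigD1 i) //=.
rewrite addrCA lerDl addr_ge0 // sumr_ge0 // => j _; rewrite invr_ge0; exact: ltW.
Qed.

(** By [eigen_family] there are at most k eigenvalues in the upper half-plane. A maximal family of
    those other than z has a positive distance from z, and a further one closer to z would enlarge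
    it. *)
Lemma eigen_isolated z : pont f e -> lin A -> (forall x y, f (A x) y = f x (A y)) ->
  0 < im z -> exists2 r : R, 0 < r & forall w, w != z -> cn (w - z) < r ->
    0 < im w /\ eigen_free w.
Proof.
move=> pt lA sA iz.
pose fam n (zf : 'I_n -> C) := [/\ injective zf, forall i, 0 < im (zf i),
  forall i, zf i != z & forall i, exists2 x, x != 0 & A x = zf i *: x].
pose Pk := [pred n | `[< exists zf : 'I_n -> C, fam n zf >]].
have ex : exists n, Pk n.
  by exists 0%N; apply/asboolP; exists (fun=> 0); split=> -[].
have bd n : Pk n -> (n <= k)%N.
  move=> /asboolP[zf [h1 h2 _ h4]].
  have hx i : exists x, x != 0 /\ A x = zf i *: x by have [x] := h4 i; exists x.
  have [x hx'] := choice hx.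
  by apply: (@eigen_family n zf x) => // i; have [] := hx' i.
case: (ex_maxnP ex bd) => n /asboolP[zf [h1 h2 h3 h4]] hmax.
have [|r r0 hr] := @pos_min n (fun i => cn (zf i - z)).
  by move=> i; rewrite cn_gt0 subr_eq0.
exists (Num.min r (im z)) => [|w wz]; first by rewrite lt_min r0.
rewrite lt_min => /andP[wr wi].
have iw : 0 < im w.
  by have := cn_im (w - z); rewrite imB ler_norml => /andP[]; lra.
split=> // x /eqP; rewrite subr_eq0 => /eqP Ax; apply: contrapT => /eqP x0.
have : Pk n.+1; last by move=> /hmax; rewrite ltnn.
have wn i : w != zf i.
  by apply/eqP => ewi; have := hr i; rewrite -ewi leNgt wr.
apply/asboolP; exists (fun i : 'I_n.+1 => if unlift ord_max i is Some j then zf j else w).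
split.
- move=> i j; case: unliftP => [i' ->|->]; case: unliftP => [j' ->|->] //.
  + by move=> /h1 ->.
  + by move=> ee; have := wn i'; rewrite ee eqxx.
  + by move=> ee; have := wn j'; rewrite -ee eqxx.
- by move=> i; case: unliftP.
- by move=> i; case: unliftP.
- by move=> i; case: unliftP => // _; exists x.
Qed.
End Eigenvalues.

(** * Passage between the definitions of the statement and the working ones *)

Section Conversions.
Context (R : realType).
Local Notation C := (Cplx R).

Lemma herm_of (K : lmodType C) (f : {hermitian K for false & conjC}) :
  is_herm (fun x y => f x y).
Proof.
split=> [a x y z|x y]; first exact: linearPl.
by have := @hermitian_subproof _ _ _ _ f x y; rewrite expr0 mul1r.
Qed.

Lemma herm_pack (K : lmodType C) (f : K -> K -> C) : is_herm f ->
  exists F : {hermitian K for false & conjC}, (fun x y => F x y) = f.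
Proof.
move=> hf.
have ll y : GRing.linear_for *%R (f ^~ y) by move=> a x x'; exact: hermL.
have lr x : GRing.linear_for (conjC \; *%R) (f x).
  by move=> a y y'; rewrite (sDr hf) (sZr hf).
have fh x y : f x y = (-1) ^+ false * conjC (f y x).
  by rewrite expr0 mul1r; exact: hermJ.
pose L := bilinear_isBilinear.Build C K K C *%R (conjC \; *%R) f (ll, lr).
pose M := isHermitianSesquilinear.Build C K false conjC f fh.
by exists (HB.pack_for {hermitian K for false & conjC} f L M).
Qed.

Section PosForm.
Context (V W : lmodType C) (s : V -> V -> C) (t : W -> W -> C).
Hypothesis hs : is_herm s.
Hypothesis ps : is_psd s.
Hypothesis ht : is_herm t.
Hypothesis pt : is_psd t.

Lemma fcomplete_cmpl : fcomplete s <-> cmpl s.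
Proof.
have fn x : fnorm s x = rc (nrm s x) by exact: fnormE.
split=> [h u cu|h u cu].
  have [|l hl] := h u.
    move=> e e0; have [re0' ee] : 0 < re e /\ e = rc (re e).
      by move: (e0); rewrite lt_cE => /andP[/eqP ie re0']; split=> //; rewrite -rc_re.
    have [N hN] := cu _ re0'; exists N => m n hm hn.
    by rewrite fn ee lt_rc; exact: hN.
  exists l => e e0; have [|N hN] := hl (rc e); first by rewrite -rc0 lt_rc.
  by exists N => n hn; have := hN _ hn; rewrite fn lt_rc.
have [|l hl] := h u.
  move=> e e0; have [|N hN] := cu (rc e); first by rewrite -rc0 lt_rc.
  by exists N => m n hm hn; have := hN _ _ hm hn; rewrite fn lt_rc.
exists l => e e0; have [re0' ee] : 0 < re e /\ e = rc (re e).
  by move: (e0); rewrite lt_cE => /andP[/eqP ie re0']; split=> //; rewrite -rc_re.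
by have [N hN] := hl _ re0'; exists N => n hn; rewrite fn ee lt_rc; exact: hN.
Qed.

Lemma bounded_opE (T : V -> W) : bounded_op (fnorm s) (fnorm t) T <->
  exists M : R, forall x, nrm t (T x) <= M * nrm s x.
Proof.
split=> [[M hM]|[M hM]].
  exists (re M) => x; have := hM x; rewrite !fnormE // le_cE => /andP[_].
  by rewrite re_rc mulrC re_rcM mulrC.
by exists (rc M) => x; rewrite !fnormE // -rcM le_rc.
Qed.
End PosForm.

Lemma bounded_inverseE (V W : lmodType C) (s : V -> V -> C) (t : W -> W -> C)
    (T : V -> W) (S : {linear W -> V}) :
  is_herm s -> is_psd s -> is_herm t -> is_psd t ->
  bounded_inverse (fnorm s) (fnorm t) T S <-> exists M : R, binv s t T S M.
Proof.
move=> hs ps ht pt; split=> [[/(bounded_opE ht pt hs ps)[M hM] h1 h2]|[M [h1 h2 h3]]].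
  by exists M.
by split=> //; apply/(bounded_opE ht pt hs ps); exists M.
Qed.

Lemma dot_hilb (H : lmodType C) (dot : {dot H for conjC}) : hilbert dot ->
  hilb (fun x y => dot x y).
Proof.
move=> hH; have h := @herm_of H dot.
have p : is_psd (fun x y => dot x y).
  move=> x; have [->|x0] := eqVneq x 0; first by rewrite (s0l h).
  have := @neq0_dnorm_gt0 _ _ _ dot x x0.
  by rewrite lt_cE => /andP[_ /ltW].
split=> //; last exact/(fcomplete_cmpl h p).
move=> x /eqP; rewrite sqrtr_eq0 => x0; apply: contrapT => /eqP xn0.
have := @neq0_dnorm_gt0 _ _ _ dot x xn0.
by rewrite lt_cE => /andP[_]; rewrite ltNge x0.
Qed.

Lemma pont_pontryagin (K : lmodType C) (f : {hermitian K for false & conjC}) k (e : 'I_k -> K) :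
  pont (fun x y => f x y) e ->
  exists J : {linear K -> K}, pontryagin f J /\
    jform f J = sf (fun x y => f x y) e.
Proof.
move=> pt; have fh := pt_h pt; have fon := pt_on pt.
have [J hJ] := linear_of (jf_lin e fh).
have jE : jform f J = sf (fun x y => f x y) e.
  apply/funext => x; apply/funext => y; rewrite /jform hJ; exact: b_jf.
exists J; split=> //; split=> [x|x y|x x0||].
- by rewrite !hJ jf_invol.
- by rewrite !hJ; exact: b_jfC.
- rewrite jE (sxxE (pt_sh pt)) -rc0 lt_rc -(nrm2 (hb_p (pt_hilb pt))) exprn_gt0 //.
  rewrite lt0r nrm_ge0 andbT; apply: contra_neq x0; exact: hb_d (pt_hilb pt) x.
- rewrite jE; apply/(fcomplete_cmpl (pt_sh pt) (hb_p (pt_hilb pt))).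
  exact: hb_c (pt_hilb pt).
exists k, e => x; rewrite hJ /jf => /eqP h.
exists (fun i => - f x (e i)); under eq_bigr do rewrite scaleNr.
rewrite sumrN; set S := \sum_i _ in h *.
have h2 : (2 : C) *: (x + S) = 0.
  by rewrite scalerDr [2 *: x]scaler_nat mulr2n -addrA addrC; move: h; rewrite -subr_eq0 opprK addrC => /eqP.
move/eqP: h2; rewrite scaler_eq0 pnatr_eq0 /= addr_eq0 => /eqP //.
Qed.

(** A finite spanning family of the eigenspace of J for -1 bounds the number of negative squares, so
    a maximal negative orthonormal family exists. Its norm is equivalent to that of J and hence
    complete. *)
Lemma pontryagin_pont (K : lmodType C) (f : {hermitian K for false & conjC}) (J : {linear K -> K}) :
  pontryagin f J -> let g := fun x y => f x y in
  [/\ is_herm (jform f J), is_psd (jform f J) & exists k (e : 'I_k -> K), pont g e /\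
    exists2 c : R, 0 <= c & forall x, nrm (sf g e) x <= c * nrm (jform f J) x /\
      nrm (jform f J) x <= c * nrm (sf g e) x].
Proof.
move=> [Ji Js Jp Jc [n [v hv]]]; set g := fun x y => f x y; cbv zeta.
have gh : is_herm g := herm_of f.
have sh : is_herm (jform f J).
  split=> [a x y z|x y]; rewrite /jform.
    by rewrite linearP; exact: (hermL gh).
  by rewrite Js; exact: (hermJ gh).
have sp : is_psd (jform f J).
  move=> x; have [->|x0] := eqVneq x 0; first by rewrite (s0l sh).
  by have := Jp x x0; rewrite lt_cE => /andP[_ /ltW].
have sd : is_def (jform f J).
  move=> x /eqP; rewrite sqrtr_eq0 => x0; apply: contrapT => /eqP xn0.
  by have := Jp x xn0; rewrite lt_cE => /andP[_]; rewrite ltNge x0.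
have sc : cmpl (jform f J) by apply/(fcomplete_cmpl sh sp).
split=> //.
have gj x y : g x y = jform f J (J x) y by rewrite /jform Ji.
have Jn x : nrm (jform f J) (J x) = nrm (jform f J) x.
  by rewrite /nrm /jform Ji -Js.
have bd x y : cn (g x y) <= nrm (jform f J) x * nrm (jform f J) y.
  by rewrite gj -(Jn x); exact: cauchy_schwarz.
(* K- is spanned by n vectors, and f is positive on its orthogonal complement. *)
have ni : NI g n.
  move=> m x hx; rewrite leqNgt; apply/negP => nm.
  pose P y := 2^-1 *: (y - J y).
  have PJ y : J (P y) = - P y by rewrite /P linearZ linearB /= Ji -scalerN opprB.
  have hP i : exists a : 'I_n -> C, P (x i) = \sum_j a j *: v j by apply: hv.
  have [a ha] := choice hP.
  have [c c0 cA] := nontrivial_kernel (\matrix_(i < m, j < n) a i j) nm.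
  pose y := \sum_i c 0 i *: x i.
  have Py : P y = 0.
    have -> : P y = \sum_i c 0 i *: P (x i).
      rewrite /P /y linear_sum -sumrB scaler_sumr; apply: eq_bigr => i _.
      by rewrite linearZ -scalerBr !scalerA mulrC.
    under eq_bigr do rewrite ha scaler_sumr.
    rewrite exchange_big big1 // => j _ /=.
    under eq_bigr do rewrite scalerA.
    rewrite -scaler_suml (_ : \sum_i _ = 0) ?scale0r //.
    have h := congr1 (fun M : 'rV_n => M 0 j) cA; rewrite !mxE in h.
    by rewrite -[RHS]h; apply: eq_bigr => i _; rewrite mxE.
  have Jy : J y = y.
    move/eqP: Py; rewrite scaler_eq0 invr_eq0 pnatr_eq0 /= subr_eq0 => /eqP //.
  have := sp y; rewrite /jform Jy -/(g y y).
  have -> : g y y = - rc (\sum_i cn (c 0 i) ^+ 2).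
    rewrite {1}/y (s_suml gh) rc_sum -sumrN; apply: eq_bigr => i _.
    rewrite (sZl gh) (hermJ gh) (s_suml gh) conj_sum.
    rewrite (bigD1 i) //= big1 ?addr0 => [|j ji].
      by rewrite (sZl gh) hx eqxx conjM mulrA mulcJ conjN conj1 mulrN mulr1.
    by rewrite (sZl gh) hx (negPf ji) oppr0 mulr0 conj0.
  rewrite reN re_rc oppr_ge0 => h; move: c0; apply/negP; rewrite negbK.
  apply/eqP/rowP => i; rewrite mxE; apply/eqP; rewrite -cn_eq0 -sqrf_eq0.
  apply/eqP; apply: (@psumr_eq0P R 'I_m xpredT (fun i => cn (c 0 i) ^+ 2)) => // [j _|].
    exact: sqr_ge0.
  by apply: le_anti; rewrite h; apply: sumr_ge0 => j _; exact: sqr_ge0.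
have [k [e [on1 ps1]]] := max_onf gh ni.
have [c c0 hc] := sf_upper_of bd ps1.
have [||c' c0' hc'] := @sf_lower_of _ _ _ _ J 1 _ _ gh sp bd _ _ ler01 on1 ps1.
- by move=> x; rewrite (nrm2 sp).
- by move=> x; rewrite Jn mul1r.
have le_max x : nrm (sf g e) x <= (c + c') * nrm (jform f J) x /\
    nrm (jform f J) x <= (c + c') * nrm (sf g e) x.
  split.
    by apply: le_trans (hc x) _; apply: ler_wpM2r; [exact: nrm_ge0 | rewrite lerDl].
  by apply: le_trans (hc' x) _; apply: ler_wpM2r; [exact: nrm_ge0 | rewrite lerDr].
exists k, e; split; last by exists (c + c') => //; rewrite addr_ge0.
have sfh := sf_herm e gh; split=> //; split=> // [x x0|u cu].
  apply: sd; apply: le_anti; rewrite nrm_ge0 andbT.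
  by apply: le_trans (hc' x) _; rewrite x0 mulr0.
have [|l hl] := sc u; last first.
  by exists l; apply: null_le (nullZ c0 hl) => n'; exact: hc.
move=> d d0; have k0 : 0 < c' + 1 by rewrite ltr_wpDl.
have [N hN] := cu _ (divr_gt0 d0 k0); exists N => p q hp hq.
apply: le_lt_trans (hc' _) _; have := hN _ _ hp hq; rewrite ltr_pdivlMr // mulrC.
by apply: le_lt_trans; apply: ler_wpM2r; [exact: nrm_ge0 | rewrite lerDl].
Qed.
End Conversions.

(** * Negative eigenvalues of Hermitian matrices *)

Section NegativeEigenvalues.
Context (R : realType).
Local Notation C := (Cplx R).
Local Open Scope sesquilinear_scope.

Lemma char_poly_conj n (P D : 'M[C]_n) : P \in unitmx ->
  char_poly (invmx P *m D *m P) = char_poly D.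
Proof.
move=> uP; pose mP := map_mx (@polyC C) P; pose mV := map_mx (@polyC C) (invmx P).
have VP : mV *m mP = 1%:M by rewrite -map_mxM mulVmx // map_mx1.
have -> : char_poly (invmx P *m D *m P) = \det (mV *m char_poly_mx D *m mP).
  congr (\det _); rewrite /char_poly_mx !map_mxM mulmxBr mulmxBl.
  by rewrite -/mP -/mV [mV *m 'X%:M]scalar_mxC -[_ *m mV *m mP]mulmxA VP mulmx1.
by rewrite !det_mulmx mulrAC -det_mulmx VP det1 mul1r.
Qed.

(** The rows of B span an m-dimensional negative subspace. With fewer than m negative eigenvalues,
    some nonzero combination of the rows would be orthogonal to all the negative eigenvectors, so
    the form would be both negative and nonnegative on it. *)
Lemma neg_eigenvalues_ge n (M : 'M[C]_n) m (B : 'M[C]_(m, n)) :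
  (forall i j, M i j = (M j i)^*) ->
  (forall i j, \sum_p \sum_q B i p * M p q * (B j q)^* = - (i == j)%:R) ->
  (m <= neg_eigenvalues M)%N.
Proof.
move=> Mh BMB.
have Mherm : M \is hermsymmx.
  apply/is_hermitianmxP; rewrite expr0 scale1r; apply/matrixP => i j.
  by rewrite !mxE; exact: Mh.
have Mn := hermitian_normalmx Mherm.
have /orthomx_spectralP := Mn.
set P := spectralmx M; set d := spectral_diag M => Md.
have uP : P \in unitmx := spectral_unit M.
have uniP : P \is unitarymx := spectral_unitarymx M.
have dreal i : d 0 i = rc (re (d 0 i)).
  have /mxOverP/(_ 0 i) := hermitian_spectral_diag_real Mherm.
  by move=> /Creal_ImP; rewrite ImE_rc => h; apply: rc_re; apply: rc_inj.
pose S := [seq i <- enum 'I_n | d 0 i < 0].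
have negE : neg_eigenvalues M = size S.
  rewrite /neg_eigenvalues; case: closed_field_poly_normal => r /= hr.
  have cp : char_poly M = \prod_(z <- [seq d 0 i | i <- enum 'I_n]) ('X - z%:P).
    rewrite {1}Md char_poly_conj // char_poly_trig ?diag_mx_is_trig //.
    by rewrite big_map enumT; apply: eq_bigr => i _; rewrite mxE eqxx.
  have lc := monicP (char_poly_monic M); rewrite lc scale1r cp in hr.
  have /permP -> := prod_XsubC_eq (esym hr).
  by rewrite count_map size_filter.
rewrite negE leqNgt; apply/negP => Sm.
pose W := B *m P^t*.
have [c c0 cW] := nontrivial_kernel (\matrix_(i < m, j < size S) W i (tnth (in_tuple S) j)) Sm.
have [w wE] : exists w, w = c *m W by eexists.
have wS i : d 0 i < 0 -> w 0 i = 0.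
  move=> di; have iS : i \in S by rewrite mem_filter di mem_enum.
  have [j ij] : exists j, i = tnth (in_tuple S) j by apply/tnthP.
  have h := congr1 (fun M : 'rV_(size S) => M 0 j) cW; rewrite !mxE in h.
  by rewrite wE mxE -[RHS]h; apply: eq_bigr => l _; rewrite [X in _ = _ * X]mxE ij.
have q1 : (c *m B) *m M *m (c *m B)^t* = - (c *m c^t*).
  have -> : c *m B *m M *m (c *m B)^t* = c *m (B *m M *m B^t*) *m c^t*.
    by rewrite trmx_mul map_mxM !mulmxA.
  have -> : B *m M *m B^t* = - 1%:M.
    apply/matrixP => i j; rewrite !mxE -BMB.
    under eq_bigr do rewrite mxE mulr_suml.
    rewrite exchange_big; apply: eq_bigr => p _; apply: eq_bigr => q _.
    by rewrite !mxE.
  by rewrite mulmxN mulmx1 mulNmx.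
have q2 : (c *m B) *m M *m (c *m B)^t* = w *m diag_mx d *m w^t*.
  rewrite {1}Md (invmx_unitary uniP) wE /W !trmx_mul !map_mxM !mulmxA.
  by rewrite trmxCK.
have e1 : (c *m c^t*) 0 0 = rc (\sum_i cn (c 0 i) ^+ 2).
  by rewrite mxE rc_sum; apply: eq_bigr => i _; rewrite !mxE mulcJ.
have e2 : (w *m diag_mx d *m w^t*) 0 0 = rc (\sum_i re (d 0 i) * cn (w 0 i) ^+ 2).
  rewrite mxE rc_sum; apply: eq_bigr => i _; rewrite mul_mx_diag !mxE.
  by rewrite rcM -mulcJ -dreal; ring.
have := congr1 (fun X : 'M_1 => re (X 0 0)) (etrans (esym q1) q2).
rewrite e2 mxE e1 reN !re_rc => e3.
have ge0 : 0 <= \sum_i re (d 0 i) * cn (w 0 i) ^+ 2.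
  apply: sumr_ge0 => i _; have [di|di] := boolP (d 0 i < 0).
    by rewrite wS // cn0 expr0n mulr0.
  apply: mulr_ge0 (sqr_ge0 _); rewrite leNgt; apply: contra di => di.
  by rewrite dreal -rc0 lt_rc.
rewrite -e3 oppr_ge0 in ge0.
move: c0; apply/negP; rewrite negbK.
apply/eqP/rowP => i; rewrite mxE; apply/eqP; rewrite -cn_eq0 -sqrf_eq0.
apply/eqP; apply: (@psumr_eq0P R 'I_m xpredT (fun i => cn (c 0 i) ^+ 2)) => // [j _|].
  exact: sqr_ge0.
by apply: le_anti; rewrite ge0; apply: sumr_ge0 => j _; exact: sqr_ge0.
Qed.
End NegativeEigenvalues.

(** * Free modules and the form defined by a kernel *)

Section FreeModule.
Import multinomials.freeg.
Context (R : realType).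
Local Notation C := (Cplx R).

(** [cf] and [sp] are the coefficients and the support. Expansion is stated over any list containing
    the support, so that several vectors can be expanded over a common list. *)
Lemma free_module (X : choiceType) : exists (V : lmodType C) (de : X -> V)
    (cf : V -> X -> C) (sp : V -> seq X),
  (forall (M : lmodType C) (g : X -> M), exists L : {linear V -> M}, forall x, L (de x) = g x) /\
  forall v (xs : seq X), uniq xs -> {subset sp v <= xs} -> v = \sum_(x <- xs) cf v x *: de x.
Proof.
exists ({freeg X / C} : lmodType C), (fun x => << x >>), (fun D x => coeff x D), (fun D => dom D).
have scaleU (c k : C) (x : X) : c *: << k *g x >> = << c * k *g x >> :> {freeg X / C}.
  by apply/eqP/freeg_eqP => y; rewrite coeffZ !coeffU mulrA.
split=> [M g|v xs uxs sub].
  have fB x y : fglift g (x - y) = fglift g x - fglift g y by exact: lift_is_additive.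
  have f0 : fglift g 0 = 0 by rewrite -[0 in LHS](subrr 0) fB subrr.
  have fD x y : fglift g (x + y) = fglift g x + fglift g y.
    by rewrite -[y in LHS]opprK -[- y]add0r !fB f0 sub0r opprK.
  have lg : lin (fglift g).
    move=> a x y; rewrite fD; congr (_ + _).
    rewrite -[x]freeg_sumE; elim: (dom x) => [|z r ih].
      by rewrite !big_nil scaler0 f0 scaler0.
    by rewrite !big_cons scalerDr !fD ih scalerDr scaleU !liftU scalerA.
  have [L hL] := linear_of lg; exists L => x; by rewrite hL liftU scale1r.
rewrite -[LHS]freeg_sumE.
have -> : \sum_(x <- xs) coeff x v *: << x >> = \sum_(x <- xs | x \in dom v) coeff x v *: << x >>.
  rewrite [LHS](bigID (mem (dom v))) /= [X in _ + X]big1 ?addr0 // => x /coeff_outdom ->.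
  by rewrite scale0r.
have pe : perm_eq (dom v) [seq x <- xs | x \in dom v].
  apply: uniq_perm; rewrite ?uniq_dom ?filter_uniq // => x.
  rewrite mem_filter; case: (boolP (x \in dom v)) => // /sub -> //.
rewrite (perm_big _ pe) big_filter; apply: eq_bigr => x _.
by rewrite scaleU mulr1.
Qed.

(* [k x y] becomes the value of the form at the generators x and y *)
Lemma kernel_module (X : choiceType) (k : X -> X -> C) : (forall x y, k x y = (k y x)^*) ->
  exists (V : lmodType C) (de : X -> V) (b : V -> V -> C),
  [/\ is_herm b, forall x y, b (de x) (de y) = k x y,
    (forall (M : lmodType C) (g : X -> M), exists L : {linear V -> M}, forall x, L (de x) = g x) &
    forall m (v : 'I_m -> V), exists n (x : 'I_n -> X) (B : 'M[C]_(m, n)),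
      (forall p q, x p = x q -> p = q) /\
      forall i, v i = \sum_p B i p *: de (x p)].
Proof.
move=> kh; have [V [de [cf [sp [ext fin]]]]] := free_module X.
have fam m (v : 'I_m -> V) : exists n (x : 'I_n -> X) (B : 'M[C]_(m, n)),
    (forall p q, x p = x q -> p = q) /\ forall i, v i = \sum_p B i p *: de (x p).
  pose xs := undup (flatten [seq sp (v i) | i <- enum 'I_m]).
  exists (size xs), (tnth (in_tuple xs)), (\matrix_(i, p) cf (v i) (tnth (in_tuple xs) p)).
  split=> [p q|i].
    by move=> /tuple_uniqP; apply; exact: undup_uniq.
  rewrite [LHS](fin _ xs (undup_uniq _)) => [|x xi].
    rewrite (big_tnth _ _ xs); apply: eq_bigr => p _; by rewrite mxE.
  rewrite mem_undup; apply/flattenP; exists (sp (v i)) => //.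
  by apply/mapP; exists i; rewrite ?mem_enum.
(* The form comes from extending linearly twice: first k in its left variable, then the conjugate of
   the result. This makes b linear in v and conjugate linear in w. *)
have exL x : exists L : {linear V -> C^o}, forall y, L (de y) = k y x.
  by have [L hL] := ext C^o (fun y => k y x); exists L.
have [L hL] := choice exL.
have exM w : exists L' : {linear V -> C^o}, forall x, L' (de x) = (L x w)^*.
  by have [L' hL'] := ext C^o (fun x => (L x w)^*); exists L'.
have [L' hL'] := choice exM.
pose b v w := (L' w v : C).
have bE n (x : 'I_n -> X) (c d : 'I_n -> C) :
    b (\sum_p c p *: de (x p)) (\sum_q d q *: de (x q)) =
    \sum_p \sum_q c p * k (x p) (x q) * (d q)^*.
  rewrite /b linear_sum; apply: eq_bigr => p _.
  set w := \sum_q _.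
  have -> : L' w (c p *: de (x p)) = c p * (L (x p) w : C)^* :> C by rewrite linearZ hL'.
  have -> : L (x p) w = \sum_q d q * k (x q) (x p) :> C.
    by rewrite linear_sum; apply: eq_bigr => q _; rewrite linearZ hL.
  rewrite conj_sum mulr_sumr; apply: eq_bigr => q _.
  by rewrite conjM -kh; ring.
have fam2 v w : exists n (x : 'I_n -> X) c d,
    v = \sum_p c p *: de (x p) /\ w = \sum_p d p *: de (x p).
  have [n [x [B [_ h]]]] := fam 2%N (fun i => if i == 0 then v else w).
  exists n, x, (B 0), (B 1); split; first exact: h 0.
  exact: h 1.
exists V, de, b; split=> // [|x y].
  split=> [a x y z|x y]; first by rewrite /b linearP.
  have [n [u [c [d [-> ->]]]]] := fam2 x y; rewrite !bE conj_sum exchange_big.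
  apply: eq_bigr => p _; rewrite conj_sum; apply: eq_bigr => q _.
  by rewrite !conjM conjCK -kh; ring.
by rewrite /b hL' hL -kh.
Qed.
End FreeModule.

(** * Ranges of symmetric projections in a Pontryagin space *)

Section Range.
Context (R : realType).
Local Notation C := (Cplx R).

(** The number of negative squares is inherited. The compression E J of the reflection represents
    the ambient norm on the range, so [sf_lower_of] makes the intrinsic norm equivalent to it;
    completeness follows since the fixed vectors of E form a closed set. *)
Lemma pont_range (K : lmodType C) (f : {hermitian K for false & conjC}) k (e : 'I_k -> K)
    (E : {linear K -> K}) (M : R) : let g := fun x y => f x y in
  pont g e -> (forall x, nrm (sf g e) (E x) <= M * nrm (sf g e) x) ->
  (forall x, E (E x) = E x) -> (forall x y, f (E x) y = f x (E y)) ->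
  exists k' (e' : 'I_k' -> range_space E),
    pont (fun x y => range_form E f x y) e' /\
    exists2 c : R, 0 <= c & forall x,
      nrm (sf (fun x y => range_form E f x y) e') x <= c * nrm (sf g e) (\val x) /\
      nrm (sf g e) (\val x) <= c * nrm (sf (fun x y => range_form E f x y) e') x.
Proof.
move=> g pt bE EE sE; have gh := pt_h pt; have sh := pt_sh pt.
have sp := hb_p (pt_hilb pt).
pose fr := fun x y => range_form E f x y.
have frh : is_herm fr := @herm_of R _ (range_form E f).
have Ex (x : range_space E) : E (\val x) = \val x.
  by have /asboolP[y ->] := valP x.
have mk y : exists x : range_space E, \val x = E y.
  have h : E y \in range_pred E by apply/asboolP; exists y.
  by exists (exist _ (E y) h).
have [r hr] := choice mk.
pose s (x y : range_space E) := sf g e (\val x) (\val y).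
have s_h : is_herm s.
  by split=> [a x y z|x y]; [exact: (hermL sh) | exact: (hermJ sh)].
have s_p : is_psd s by move=> x; exact: sp.
have nsE x : nrm s x = nrm (sf g e) (\val x) by [].
have bd x y : cn (fr x y) <= nrm s x * nrm s y by exact: (pont_bound pt).
have ni : NI fr k.
  move=> n v hv; have hv' : onf g (fun i => \val (v i)) by move=> i j; exact: hv.
  exact: pont_NI pt _ _ hv'.
have [k' [e' [on' ps']]] := max_onf frh ni.
have [c c0 hc] := sf_upper_of bd ps'.
have M0 : 0 <= `|M| by [].
have [||c' c0' hc'] := @sf_lower_of R _ fr s (fun x => r (jf g e (\val x))) `|M| k' e' frh s_p bd _ _ M0 on' ps'.
- move=> x; rewrite nsE (nrm2 sp) -(b_jf e gh) /fr /range_form hr /g.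
  by rewrite sE Ex.
- move=> x; rewrite !nsE hr; apply: le_trans (bE _) _; rewrite nrm_jf //; last exact: pt_on pt.
  by apply: ler_wpM2r; [exact: nrm_ge0 | exact: ler_norm].
have le_max x : nrm (sf fr e') x <= (c + c') * nrm s x /\ nrm s x <= (c + c') * nrm (sf fr e') x.
  split.
    by apply: le_trans (hc x) _; apply: ler_wpM2r; [exact: nrm_ge0 | rewrite lerDl].
  by apply: le_trans (hc' x) _; apply: ler_wpM2r; [exact: nrm_ge0 | rewrite lerDr].
exists k', e'; split; last by exists (c + c') => //; rewrite addr_ge0.
have sfh := sf_herm e' frh; split=> //; split=> // [x x0|u cu].
  apply/val_inj/(hb_d (pt_hilb pt)); apply: le_anti; rewrite nrm_ge0 andbT -nsE.
  by apply: le_trans (hc' x) _; rewrite x0 mulr0.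
have cv : cau (sf g e) (fun n => \val (u n)).
  move=> d d0; have k0 : 0 < c' + 1 by rewrite ltr_wpDl.
  have [N hN] := cu _ (divr_gt0 d0 k0); exists N => p q hp hq.
  rewrite -[nrm _ _]/(nrm s (u p - u q)).
  apply: le_lt_trans (hc' _) _; have := hN _ _ hp hq; rewrite ltr_pdivlMr // mulrC.
  by apply: le_lt_trans; apply: ler_wpM2r; [exact: nrm_ge0 | rewrite lerDl].
have [l hl] := hb_c (pt_hilb pt) cv.
have El : E l = l.
  apply/eqP; rewrite -subr_eq0; apply/eqP/(hb_d (pt_hilb pt)).
  apply: (slim_unique sh sp (u := fun n => \val (u n))) => //.
  apply: null_le (nullZ M0 hl) => n; rewrite -{1}(Ex (u n)) -linearB.
  apply: le_trans (bE _) _; apply: ler_wpM2r; [exact: nrm_ge0 | exact: ler_norm].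
exists (r l); apply: null_le (nullZ c0 hl) => n; apply: le_trans (hc _) _.
by rewrite nsE -[\val (u n - r l)]/(\val (u n) - \val (r l)) hr El.
Qed.
End Range.

(** * Expansion of a family of vectors at a boundary point *)

Section Expansions.
Context (R : realType).
Local Notation C := (Cplx R).
Implicit Types (S : R -> Prop) (v : R -> C) (a : nat -> C) (B r y : R).

Definition iy y : C := mkc 0 y.

Lemma iyE y : iy y = J R * rc y.
Proof.
by apply: c_ext; rewrite ?reJz ?imJz ?im_rc ?re_rc ?oppr0.
Qed.
Lemma cn_iy y : 0 <= y -> cn (iy y) = y.
Proof. by move=> y0; rewrite iyE cnM cn_J mul1r cn_rc ger0_norm. Qed.
Lemma conj_iy y : (iy y)^* = - iy y.
Proof.
by apply: c_ext; rewrite ?reJ ?imJ ?reN ?imN ?re_mkc ?im_mkc ?oppr0.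
Qed.
Lemma iy_neq0 y : 0 < y -> iy y != 0.
Proof. by move=> y0; rewrite -cn_gt0 cn_iy // ltW. Qed.

(** A power series in iy with geometric remainder, required on S only. By [small], S merely
    accumulates at 0: near infinity D may omit points of the imaginary axis. *)
Definition expn S v a B r := forall y, S y -> forall N,
  cn (v y - \sum_(j < N) a j * iy y ^+ j) <= B * (r * y) ^+ N.

Definition small S := (forall y, S y -> 0 < y <= 1) /\
  forall d, 0 < d -> exists2 y, S y & y < d.

Section OneSet.
Context (S : R -> Prop) (sS : small S).

Lemma small_gt0 y : S y -> 0 < y. Proof. by move=> /sS.1 /andP[]. Qed.

Lemma small_seq : exists t : nat -> R, (forall n, S (t n)) /\ null t.
Proof.
have h n : exists y, S y /\ y < n.+1%:R^-1.
  have e0 : 0 < n.+1%:R^-1 :> R by rewrite invr_gt0.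
  by have [y Sy hy] := sS.2 _ e0; exists y.
have [t ht] := choice h; exists t; split=> [n|]; first by have [] := ht n.
by apply: null_le (@null_harmonic R) => n; have [_ /ltW] := ht n.
Qed.

Lemma expn_lim v a B r (t : nat -> R) : expn S v a B r -> (forall n, S (t n)) -> null t ->
  clim (fun n => v (t n)) (a 0%N).
Proof.
move=> h St nt; have Br : 0 <= `|B * r| by [].
apply: null_le (nullZ Br nt) => n.
have := h _ (St n) 1%N; rewrite big_ord1 expr0 mulr1 expr1 => /le_trans; apply.
rewrite mulrA; apply: ler_wpM2r; last exact: ler_norm.
exact/ltW/small_gt0/St.
Qed.

Lemma expn_shift v a B r : expn S v a B r ->
  expn S (fun y => (v y - a 0%N) / iy y) (fun j => a j.+1) (B * r) r.
Proof.
move=> h y Sy N; have y0 := small_gt0 Sy.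
have z0 := iy_neq0 y0.
have -> : (v y - a 0%N) / iy y - \sum_(j < N) a j.+1 * iy y ^+ j =
    (v y - \sum_(j < N.+1) a j * iy y ^+ j) / iy y.
  rewrite big_ord_recl expr0 mulr1 opprD addrA [RHS]mulrBl; congr (_ - _).
  rewrite mulr_suml; apply: eq_bigr => j _; rewrite lift0 exprSr.
  by rewrite mulrA mulfK.
rewrite cnM cnV cn_iy ?(ltW y0) // ler_pdivrMr //.
apply: le_trans (h y Sy N.+1) _; rewrite exprS le_eqVlt; apply/orP; left; apply/eqP.
ring.
Qed.

Lemma expn_bound v a B r j : expn S v a B r -> cn (a j) <= B * r ^+ j.
Proof.
elim: j v a B => [|j ih] v a B h; last first.
  by rewrite exprS mulrA; exact: ih (expn_shift h).
rewrite expr0 mulr1; have [t [St nt]] := small_seq.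
have hl := expn_lim h St nt; apply: le_eps => e e0; have [N hN] := hl _ e0.
have := hN _ (leqnn N); have := h _ (St N) 0%N; rewrite big_ord0 subr0 expr0 mulr1.
by have := cnDl (a 0%N) (v (t N)); rewrite cnBC; lra.
Qed.

Lemma expn_unique v a B r a' B' r' : expn S v a B r -> expn S v a' B' r' ->
  forall j, a j = a' j.
Proof.
move=> h h' j; elim: j v a a' B B' h h' => [|j ih] v a a' B B' h h'.
  have [t [St nt]] := small_seq.
  exact: clim_unique (expn_lim h St nt) (expn_lim h' St nt).
have e0 : a 0%N = a' 0%N.
  have [t [St nt]] := small_seq.
  exact: clim_unique (expn_lim h St nt) (expn_lim h' St nt).
have h1 := expn_shift h; have h2 := expn_shift h'; rewrite -e0 in h2.
exact: ih h1 h2.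
Qed.

Lemma expnD c v a B v' a' B' r : expn S v a B r -> expn S v' a' B' r ->
  expn S (fun y => c * v y + v' y) (fun j => c * a j + a' j) (cn c * B + B') r.
Proof.
move=> h h' y Sy N.
have -> : \sum_(j < N) (c * a j + a' j) * iy y ^+ j =
    c * (\sum_(j < N) a j * iy y ^+ j) + \sum_(j < N) a' j * iy y ^+ j.
  rewrite mulr_sumr -big_split; apply: eq_bigr => j _.
  by rewrite mulrDl mulrA.
have -> : c * v y + v' y - (c * (\sum_(j < N) a j * iy y ^+ j) + \sum_(j < N) a' j * iy y ^+ j) =
  c * (v y - \sum_(j < N) a j * iy y ^+ j) + (v' y - \sum_(j < N) a' j * iy y ^+ j) by ring.
apply: le_trans (cnD _ _) _; rewrite cnM mulrDl -mulrA; apply: lerD; last exact: h'.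
by apply: ler_wpM2l; [exact: cn_ge0 | exact: h].
Qed.

Lemma expn0 B r : 0 <= B -> 0 <= r -> expn S (fun=> 0) (fun=> 0) B r.
Proof.
move=> B0 r0 y Sy N; rewrite big1 ?subrr ?cn0 => [|j _]; last by rewrite mul0r.
by rewrite mulr_ge0 // exprn_ge0 // mulr_ge0 // ltW // small_gt0.
Qed.

Lemma expn_weaken v a B r B' r' : 0 <= B -> B <= B' -> 0 <= r -> r <= r' ->
  expn S v a B r -> expn S v a B' r'.
Proof.
move=> B0 BB r0 rr h y Sy N; apply: le_trans (h y Sy N) _.
have y0 := ltW (small_gt0 Sy).
apply: ler_pM => //; first by rewrite exprn_ge0 // mulr_ge0.
apply: lerXn2r; rewrite ?nnegrE; [exact: mulr_ge0| | exact: ler_wpM2r].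
by apply: mulr_ge0 => //; exact: le_trans rr.
Qed.

Lemma expn_ext v v' a a' B r : (forall y, S y -> v y = v' y) -> (forall j, a j = a' j) ->
  expn S v a B r -> expn S v' a' B r.
Proof.
move=> hv ha h y Sy N; rewrite -hv //.
by under eq_bigr do rewrite -ha; exact: h.
Qed.
End OneSet.
End Expansions.

(** * Power series of vectors from their Gram kernel *)

Section LocalExpansion.
Context (R : realType).
Local Notation C := (Cplx R).
Context (K : lmodType C) (f : K -> K -> C) (k : nat) (e : 'I_k -> K) (S : R -> Prop).
Local Notation N := (nrm (sf f e)).

(* [u] has the Gram kernel (W(z) - W(w)^* )/(z - w^* ), where W has the real
   Taylor coefficients [w]. *)
Record local_state (u : R -> K) (W : R -> C) (w : nat -> C) (a : 'I_k -> nat -> C)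
    (Bw Be r : R) : Prop := LocalState {
  ls_kernel : forall y y', S y -> S y' ->
    (iy y + iy y') * f (u y) (u y') = W y - (W y')^*;
  ls_real : forall j, (w j)^* = w j;
  ls_W : expn S W w Bw r;
  ls_e : forall i, expn S (fun y => f (u y) (e i)) (a i) Be r
}.

Definition tends (u : R -> K) (eta : K) := forall d : R, 0 < d -> exists2 c : R, 0 < c &
  forall y, S y -> y < c -> N (u y - eta) < d.

Hypothesis pt : pont f e.
Hypothesis sS : small S.
Let fh : is_herm f := pt_h pt.
Let sh : is_herm (sf f e) := pt_sh pt.
Let sp : is_psd (sf f e) := hb_p (pt_hilb pt).

Lemma tends_unique u l l' : tends u l -> tends u l' -> l = l'.
Proof.
move=> h h'; apply/eqP; rewrite -subr_eq0; apply/eqP/(hb_d (pt_hilb pt)).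
apply: le_anti; rewrite nrm_ge0 andbT; apply: le_eps => d d0; rewrite add0r.
have d2 : 0 < d / 2 by lra.
have [c c0 hc] := h _ d2; have [c' c0' hc'] := h' _ d2.
have [|y Sy] := sS.2 (Num.min c c'); first by rewrite lt_min c0.
rewrite lt_min => /andP[/(hc _ Sy) k1 /(hc' _ Sy) k2].
have := nrmD sh sp (l - u y) (u y - l'); rewrite subrKA [N (l - u y)](nrmBC sh).
by move: k1 k2; move: (N _) (N _) (N _) => x1 x2 x3; lra.
Qed.

Lemma tends_seq u l (t : nat -> R) : tends u l -> (forall n, S (t n)) -> null t ->
  slim (sf f e) (fun n => u (t n)) l.
Proof.
move=> h St nt d d0; have [c c0 hc] := h _ d0; have [M hM] := nt _ c0.
by exists M => n /hM tn; apply: hc.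
Qed.

Section Step.
Context (u : R -> K) (W : R -> C) (w : nat -> C) (a : 'I_k -> nat -> C) (Bw Be r : R).
Hypothesis ls : local_state u W w a Bw Be r.
Hypothesis r0 : 0 < r.

Lemma ls_Bw0 : 0 <= Bw.
Proof. by have := expn_bound sS 0 (ls_W ls); rewrite expr0 mulr1; apply: le_trans; exact: cn_ge0. Qed.
Lemma ls_Be0 : (0 < k)%N -> 0 <= Be.
Proof.
move=> k0; have := expn_bound sS 0 (ls_e ls (Ordinal k0)).
by rewrite expr0 mulr1; apply: le_trans; exact: cn_ge0.
Qed.

Lemma N2E x : N x ^+ 2 = re (f x x) + 2 * \sum_i cn (f x (e i)) ^+ 2.
Proof.
rewrite (nrm2 sp) {1}/sf reD -(rc_nat R 2) re_rcM re_sum; congr (_ + _ * _).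
by apply: eq_bigr => i _; rewrite mulcJ.
Qed.

(** On the diagonal the kernel relation divides W minus its conjugate by 2iy; as w 0 is real, the
    first-order remainder of W bounds the quotient. *)
Lemma ls_norm y : S y -> N (u y) ^+ 2 <= Bw * r + 2 * k%:R * Be ^+ 2.
Proof.
move=> Sy; have y0 := small_gt0 sS Sy; rewrite N2E; apply: lerD.
  apply: le_trans (re_le_cn _) _.
  have h := ls_W ls Sy 1; rewrite big_ord1 expr0 mulr1 expr1 in h.
  have h2 : cn (W y - (W y)^*) <= 2 * (Bw * (r * y)).
    have -> : W y - (W y)^* = (W y - w 0%N) - (W y - w 0%N)^*.
      by rewrite conjB (ls_real ls); ring.
    by apply: le_trans (cnB _ _) _; rewrite cnJ; lra.
  rewrite -(ls_kernel ls Sy Sy) cnM in h2.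
  have e2 : cn (iy y + iy y) = 2 * y.
    have -> : iy y + iy y = rc 2 * iy y by rewrite rc_nat mulr_natl mulr2n.
    by rewrite cnM cn_rc cn_iy ?(ltW y0) // ger0_norm.
  rewrite e2 -mulrA ler_pM2l // in h2.
  by rewrite -(ler_pM2l y0); apply: le_trans h2 _; rewrite mulrA mulrC.
rewrite -mulrA ler_pM2l // mulr_natl -[X in _ *+ X]card_ord -sumr_const.
apply: ler_sum => i _.
have := ls_e ls i Sy 0; rewrite big_ord0 subr0 expr0 mulr1 => h.
by rewrite lerXn2r ?nnegrE ?cn_ge0 // (le_trans (cn_ge0 _) h).
Qed.

(** The real affine part of W contributes exactly w 1 to the kernel, and the second-order remainder
    divided by y + y' is of order y + y'. *)
Lemma ls_kernel_lim y y' : S y -> S y' ->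
  cn (f (u y) (u y') - w 1%N) <= Bw * r ^+ 2 * (y + y').
Proof.
move=> Sy Sy'; have y0 := small_gt0 sS Sy; have y0' := small_gt0 sS Sy'.
have h y1 : S y1 -> cn (W y1 - (w 0%N + w 1%N * iy y1)) <= Bw * r ^+ 2 * y1 ^+ 2.
  move=> S1; have := ls_W ls S1 2; rewrite big_ord_recl big_ord1 expr0 expr1 mulr1.
  by rewrite exprMn mulrA.
have yy : 0 < y + y' by lra.
rewrite -(ler_pM2l yy).
have -> : y + y' = cn (iy y + iy y').
  have -> : iy y + iy y' = iy (y + y') by apply: c_ext; rewrite ?reD ?imD ?re_mkc ?im_mkc ?addr0.
  by rewrite cn_iy // ltW.
rewrite -cnM mulrBr (ls_kernel ls Sy Sy').
have -> : W y - (W y')^* - (iy y + iy y') * w 1%N =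
   (W y - (w 0%N + w 1%N * iy y)) - (W y' - (w 0%N + w 1%N * iy y'))^*.
  by rewrite conjB conjD conjM !(ls_real ls) conj_iy; ring.
apply: le_trans (cnB _ _) _; rewrite cnJ.
have -> : cn (iy y + iy y') = y + y'.
  have -> : iy y + iy y' = iy (y + y') by apply: c_ext; rewrite ?reD ?imD ?re_mkc ?im_mkc ?addr0.
  by rewrite cn_iy // ltW.
apply: le_trans (lerD (h _ Sy) (h _ Sy')) _.
have Br : 0 <= Bw * r ^+ 2 by rewrite mulr_ge0 ?sqr_ge0 // ls_Bw0.
have := mulr_ge0 (mulr_ge0 Br (ltW y0)) (ltW y0').
by rewrite !expr2; lra.
Qed.

(** The four inner products in the square of u y - u y' have the common limit w 1 and cancel. The
    finitely many components along e are controlled by their own expansions. *)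
Lemma ls_cauchy : exists2 c : R, 0 <= c & forall y y', S y -> S y' ->
  N (u y - u y') ^+ 2 <= c * (y + y').
Proof.
have B0 := ls_Bw0; pose c := 4 * (Bw * r ^+ 2) + 4 * k%:R * (Be * r) ^+ 2.
have c0 : 0 <= c.
  apply: addr_ge0; first by apply: mulr_ge0 => //; apply: mulr_ge0 => //; exact: sqr_ge0.
  by apply: mulr_ge0; [rewrite mulr_ge0 // ler0n | exact: sqr_ge0].
exists c => // y y' Sy Sy'.
have /andP[y0 y1] := sS.1 _ Sy; have /andP[y0' y1'] := sS.1 _ Sy'.
rewrite N2E [c * _]mulrDl; apply: lerD.
  have -> : f (u y - u y') (u y - u y') = (f (u y) (u y) - w 1%N) + (f (u y') (u y') - w 1%N)
      - (f (u y) (u y') - w 1%N) - (f (u y') (u y) - w 1%N).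
    by rewrite !(sBl fh) !(sBr fh); ring.
  apply: le_trans (re_le_cn _) _; apply: le_trans (cnB _ _) _.
  have h1 := ls_kernel_lim Sy Sy; have h2 := ls_kernel_lim Sy' Sy'.
  have h3 := ls_kernel_lim Sy Sy'; have h4 := ls_kernel_lim Sy' Sy.
  have t1 := cnB (f (u y) (u y) - w 1%N + (f (u y') (u y') - w 1%N)) (f (u y) (u y') - w 1%N).
  have t2 := cnD (f (u y) (u y) - w 1%N) (f (u y') (u y') - w 1%N).
  apply: le_trans (lerD (le_trans t1 (lerD t2 (lexx _))) h4) _.
  apply: le_trans (lerD (lerD (lerD h1 h2) h3) (lexx _)) _.
  by rewrite le_eqVlt; apply/orP; left; apply/eqP; ring.
have hi i : cn (f (u y - u y') (e i)) ^+ 2 <= 2 * (Be * r) ^+ 2 * (y + y').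
  have h1 := ls_e ls i Sy 1; have h2 := ls_e ls i Sy' 1.
  rewrite !big_ord1 !expr0 !mulr1 !expr1 mulrA in h1 h2.
  have h : cn (f (u y - u y') (e i)) <= Be * r * (y + y').
    rewrite (sBl fh); have -> : f (u y) (e i) - f (u y') (e i) =
      (f (u y) (e i) - a i 0%N) - (f (u y') (e i) - a i 0%N) by ring.
    by apply: le_trans (cnB _ _) _; rewrite mulrDr; apply: lerD => //; rewrite mulrA in h2.
  have h3 : cn (f (u y - u y') (e i)) ^+ 2 <= (Be * r * (y + y')) ^+ 2.
    by rewrite lerXn2r ?nnegrE ?cn_ge0 // (le_trans (cn_ge0 _) h).
  have -> : 2 * (Be * r) ^+ 2 * (y + y') = (Be * r) ^+ 2 * (2 * (y + y')) by ring.
  apply: le_trans h3 _; rewrite exprMn; apply: ler_wpM2l; first exact: sqr_ge0.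
  by rewrite expr2; apply: ler_wpM2r; lra.
have -> : 4 * k%:R * (Be * r) ^+ 2 * (y + y') = 2 * (k%:R * (2 * (Be * r) ^+ 2 * (y + y'))).
  by ring.
rewrite ler_pM2l // mulr_natl -[X in _ *+ X]card_ord -sumr_const.
exact: ler_sum.
Qed.

Lemma ls_limit : exists eta, tends u eta.
Proof.
have [c c0 hc] := ls_cauchy; have [t [St nt]] := small_seq sS.
have close d : 0 < d -> exists2 g : R, 0 < g & forall y y', S y -> S y' -> y < g -> y' < g ->
    N (u y - u y') < d.
  move=> d0; have c1 : 0 < 2 * (c + 1) by lra.
  exists (d ^+ 2 / (2 * (c + 1))) => [|y y' Sy Sy' yg yg'].
    by rewrite divr_gt0 // exprn_gt0.
  rewrite ltr_pdivlMr // in yg; rewrite ltr_pdivlMr // in yg'.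
  rewrite -(@ltr_pXn2r _ 2) ?nnegrE ?nrm_ge0 ?(ltW d0) //.
  apply: le_lt_trans (hc _ _ Sy Sy') _.
  have := small_gt0 sS Sy; have := small_gt0 sS Sy'; lra.
have [eta heta] : exists l, slim (sf f e) (fun n => u (t n)) l.
  apply: (hb_c (pt_hilb pt)) => d d0; have [g g0 hg] := close _ d0.
  by have [M hM] := nt _ g0; exists M => m n /hM tm /hM tn; apply: hg.
exists eta => d d0; have d2 : 0 < d / 2 by lra.
have [g g0 hg] := close _ d2; exists g => // y Sy yg.
have [M1 h1] := nt _ g0; have [M2 h2] := heta _ d2.
have k1 := h1 _ (leq_maxl M1 M2); have k2 := h2 _ (leq_maxr M1 M2).
have k3 := hg _ _ Sy (St _) yg k1.
have := nrmD sh sp (u y - u (t (maxn M1 M2))) (u (t (maxn M1 M2)) - eta).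
rewrite subrKA; move: k2 k3; move: (N _) (N _) (N _) => x1 x2 x3; lra.
Qed.

(** The difference quotient at 0 satisfies a relation of the same form, with W deprived of its first
    two coefficients. The constants gain powers of the unchanged r, so iteration yields geometric
    bounds. *)
Lemma ls_step eta : tends u eta ->
  local_state (fun y => (iy y)^-1 *: (u y - eta))
    (fun y => ((W y - w 0%N) / iy y - w 1%N) / iy y)
    (fun j => w j.+2) (fun i j => a i j.+1) (Bw * r * r) (Be * r) r.
Proof.
move=> heta; have [t [St nt]] := small_seq sS.
have ht := tends_seq heta St nt.
have eta_e i : f eta (e i) = a i 0%N.
  exact: clim_unique (pont_lim_form pt (e i) ht) (expn_lim sS (ls_e ls i) St nt).
have eta_u y : S y -> f (u y) eta = (W y - w 0%N) / iy y.
  move=> Sy; have y0 := small_gt0 sS Sy; have z0 := iy_neq0 y0.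
  suff : iy y * f (u y) eta = W y - w 0%N by move=> <-; rewrite mulrC mulKf.
  have c1 : clim (fun n => f (u y) (u (t n))) (f (u y) eta).
    rewrite (hermJ fh); apply: (clim_ext _ (climJ (pont_lim_form pt (u y) ht))) => n.
    by rewrite -(hermJ fh).
  have c2 : clim (fun n => iy (t n) * f (u y) (u (t n))) 0.
    have [M hM] : exists M, forall n, cn (f (u y) (u (t n))) <= M.
      have [M hM] := cau_bounded sh sp (slim_cau sh sp ht).
      exists (N (u y) * M) => n; apply: le_trans (pont_bound pt _ _) _.
      by apply: ler_wpM2l; [exact: nrm_ge0 | exact: hM].
    have M0 : 0 <= M := le_trans (cn_ge0 _) (hM 0%N).
    apply: null_le (nullZ M0 nt) => n; rewrite subr0 cnM cn_iy; last exact/ltW/(small_gt0 sS)/St.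
    by rewrite mulrC; apply: ler_wpM2r => //; exact/ltW/(small_gt0 sS)/St.
  have c3 := climD (climZ (iy y) c1) c2; rewrite addr0 in c3.
  apply: clim_unique c3 _.
  have c4 := climD (clim_cst (W y)) (climZ (-1) (climJ (expn_lim sS (ls_W ls) St nt))).
  rewrite (ls_real ls) mulN1r in c4.
  apply: clim_ext c4 => n; rewrite mulN1r -mulrDl; exact/esym/(ls_kernel ls).
have eta_eta : f eta eta = w 1%N.
  have h := expn_lim sS (expn_shift sS (ls_W ls)) St nt.
  apply: clim_unique (pont_lim_form pt eta ht) _.
  by apply: clim_ext h => n; rewrite eta_u.
split=> [y y' Sy Sy'|j||i].
- have z0 := iy_neq0 (small_gt0 sS Sy); have z0' := iy_neq0 (small_gt0 sS Sy').
  rewrite (sZl fh) (sZr fh) conjV conj_iy (sBl fh) !(sBr fh) eta_eta.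
  rewrite [f eta (u y')](hermJ fh) !eta_u // !conjM !conjB !conjV !conj_iy !conjM !conjB !(ls_real ls).
  have h := ls_kernel ls Sy Sy'.
  have zz : iy y + iy y' != 0.
    have -> : iy y + iy y' = iy (y + y') by apply: c_ext; rewrite ?reD ?imD ?re_mkc ?im_mkc ?addr0.
    apply: iy_neq0; apply: addr_gt0; exact: (small_gt0 sS).
  have -> : f (u y) (u y') = (W y - (W y')^*) / (iy y + iy y') by rewrite -h mulrC mulKf.
  rewrite ?conjV ?conj_iy; move: z0 z0' zz.
  by move: (iy y) (iy y') (W y) ((W y')^*) => p q P Q p0 q0 pq; field; rewrite p0 q0 pq.
- exact: ls_real ls _.
- by rewrite -mulrA; have h := expn_shift sS (expn_shift sS (ls_W ls)); rewrite -mulrA in h.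
- have h := expn_shift sS (ls_e ls i); apply: (expn_ext _ _ h) => // y Sy.
  by rewrite (sZl fh) (sBl fh) eta_e mulrC.
Qed.
End Step.

Theorem local_expansion u W w a Bw Be r : local_state u W w a Bw Be r -> 0 < r ->
  exists (eta : nat -> K) (c : R), [/\ 0 <= c, tends u (eta 0%N),
    forall m, N (eta m) <= c * r ^+ m &
    forall y, S y -> forall M, N (u y - \sum_(m < M) iy y ^+ m *: eta m) <= c * (r * y) ^+ M].
Proof.
move=> ls r0.
(* A total limit operator, 0 where no limit exists, so that the iteration [um] can be defined before
   its convergence is known. *)
have exl (u' : R -> K) : exists l, forall l', tends u' l' -> tends u' l.
  have [[l hl]|h] := pselect (exists l, tends u' l); first by exists l.
  by exists 0 => l' hl'; case: h; exists l'.
have [lm hlm] := choice exl.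
pose um m := iter m (fun (v : R -> K) y => (iy y)^-1 *: (v y - lm v)) u.
have st m : exists W' w' a', local_state (um m) W' w' a' (Bw * r ^+ m * r ^+ m) (Be * r ^+ m) r.
  elim: m => [|m [W' [w' [a' ih]]]]; first by exists W, w, a; rewrite expr0 !mulr1.
  have [l hl] := ls_limit ih.
  have := ls_step ih (hlm _ _ hl); rewrite -/(um m.+1) => h.
  eexists; eexists; eexists; move: h; rewrite exprSr !mulrA; rewrite [Bw * r ^+ m * r * r ^+ m]mulrAC.
  by apply.
pose c := Num.sqrt (Bw * r + 2 * k%:R * Be ^+ 2).
have c20 : 0 <= Bw * r + 2 * k%:R * Be ^+ 2.
  apply: addr_ge0; first (apply: mulr_ge0; [exact: (ls_Bw0 ls) | exact: ltW]).
  by apply: mulr_ge0; [rewrite mulr_ge0 // ler0n | exact: sqr_ge0].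
have numN m y : S y -> N (um m y) <= c * r ^+ m.
  move=> Sy; have [W' [w' [a' h]]] := st m.
  rewrite -(@ler_pXn2r _ 2) ?nnegrE ?nrm_ge0 ?mulr_ge0 ?sqrtr_ge0 ?exprn_ge0 ?(ltW r0) //.
  apply: le_trans (ls_norm h Sy) _; rewrite [(c * _) ^+ 2]exprMn {1}/c sqr_sqrtr //.
  by rewrite le_eqVlt; apply/orP; left; apply/eqP; move: (r ^+ m) => q; ring.
have tm m : tends (um m) (lm (um m)).
  have [W' [w' [a' h]]] := st m; have [l hl] := ls_limit h; exact: hlm hl.
exists (fun m => lm (um m)), c; split=> [||m|y Sy M]; first exact: sqrtr_ge0.
- exact: tm 0%N.
- apply: le_eps => d d0; have [g g0 hg] := tm m _ d0.
  have [y Sy yg] := sS.2 _ g0; have h1 := hg _ Sy yg; have h2 := numN m y Sy.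
  have h3 := nrmDl sh sp (lm (um m)) (um m y); rewrite (nrmBC sh) in h3.
  by move: h1 h2 h3; move: (N _) (N _) (N _) (c * _) => x1 x2 x3 x4; lra.
have y0 := small_gt0 sS Sy; have z0 := iy_neq0 y0.
have -> : u y - \sum_(m < M) iy y ^+ m *: lm (um m) = iy y ^+ M *: um M y.
  elim: M => [|M ih]; first by rewrite big_ord0 subr0 expr0 scale1r.
  rewrite big_ord_recr /= opprD addrA ih -scalerBr exprSr -scalerA.
  by congr (_ *: _); rewrite {2}/um /= -/(um M) scalerA mulfV // scale1r.
rewrite (nrmZ sh) cnX cn_iy ?(ltW y0) // exprMn mulrC mulrA.
by apply: ler_wpM2r; [rewrite exprn_ge0 // ltW | exact: numN].
Qed.
End LocalExpansion.

(** * Density from a trivial orthogonal complement *)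

Section OrthogonalDensity.
Context (R : realType).
Local Notation C := (Cplx R).
Context (K : lmodType C) (f : K -> K -> C) (k : nat) (e : 'I_k -> K).
Hypothesis pt : pont f e.
Let sh : is_herm (sf f e) := pt_sh pt.
Let sp : is_psd (sf f e) := hb_p (pt_hilb pt).
Local Notation s := (sf f e).
Local Notation N := (nrm (sf f e)).

(** The completion K' of V maps isometrically to K by G, and [riesz] in K' gives the vector y for
    which G y is the projection of x to the closure of the image. The difference x - G y is
    orthogonal to the image in the Hilbert sense, so its reflection is f-orthogonal and vanishes. *)
Lemma dense_of_orth (V : lmodType C) (j : V -> K) : lin j ->
  (forall x, (forall v, f x (j v) = 0) -> x = 0) ->
  forall x (d : R), 0 < d -> exists v, N (x - j v) < d.
Proof.
move=> lj h0 x d d0; pose b v w := s (j v) (j w).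
have bh : is_herm b by split=> [a v w z|v w]; rewrite /b ?lj ?(hermL sh) //; exact: hermJ sh _ _.
have bp : is_psd b by move=> v; exact: sp.
have [K' [t [j' [ht tj dj]]]] := completion bh bp.
have th := hb_h ht; have tp := hb_p ht.
have [|G [Gj GM]] := @extension _ V K' K t s j' j 1 th tp (pt_hilb pt) (lin_linear j') lj dj.
  by move=> v; rewrite mul1r /nrm tj.
have l1 : forall a p q, s (G (a *: p + q)) x = a * s (G p) x + s (G q) x.
  by move=> a p q; rewrite linearP (hermL sh).
have [|y hy] := riesz (M := N x) th tp (hb_c ht) l1.
  move=> p; apply: le_trans (cauchy_schwarz sh sp _ _) _; rewrite mulrC.
  by apply: ler_wpM2l; [exact: nrm_ge0 | have := GM p; rewrite mul1r].
have iso v : s (j v) (G y) = t (j' v) y.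
  apply/eqP; rewrite -subr_eq0; apply/eqP/cn_le0.
  apply: (@le_eps_mul _ _ _ (2 * nrm t (j' v))) => c c0; rewrite add0r.
  have [w hw] := dj y _ c0.
  have -> : s (j v) (G y) - t (j' v) y = s (G (j' v)) (G (y - j' w)) - t (j' v) (y - j' w).
    by rewrite linearB /= !(sBr sh) !(sBr th) tj !Gj /b; ring.
  apply: le_trans (cnB _ _) _.
  have h1 := cauchy_schwarz sh sp (G (j' v)) (G (y - j' w)).
  have h2 := cauchy_schwarz th tp (j' v) (y - j' w).
  have h3 := GM (y - j' w); have h4 := GM (j' v); rewrite !mul1r in h3 h4.
  have n0 := nrm_ge0 t (j' v); have n1 := nrm_ge0 t (y - j' w).
  have h5 := ler_pM (nrm_ge0 _ _) (nrm_ge0 _ _) h4 h3.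
  have h6 := ler_wpM2l n0 (ltW hw); move: h1 h2 h5 h6.
  lra.
have xG : x - G y = 0.
  rewrite -[LHS](jf_invol (pt_h pt) (pt_on pt)) [X in jf _ _ X]h0 ?(lin0 (jf_lin e (pt_h pt))) // => v; rewrite (b_jf e (pt_h pt)) (hermJ sh) (sBr sh) iso -hy Gj subrr.
  exact: conj0.
have [v hv] := dj y _ d0; exists v; move/eqP: xG; rewrite subr_eq0 => /eqP ->.
rewrite -Gj -linearB; apply: le_lt_trans (GM _) _; by rewrite mul1r.
Qed.
End OrthogonalDensity.

(** * The shift on expansion coefficients *)

Section LocalOperator.
Context (R : realType).
Local Notation C := (Cplx R).
Context (K : lmodType C) (f : K -> K -> C) (k : nat) (e : 'I_k -> K) (S : R -> Prop).
Hypothesis pt : pont f e.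
Hypothesis sS : small S.
Let fh : is_herm f := pt_h pt.
Let sh : is_herm (sf f e) := pt_sh pt.
Let sp : is_psd (sf f e) := hb_p (pt_hilb pt).
Local Notation N := (nrm (sf f e)).

Definition shiftc (a : nat -> C) j := if j is i.+1 then a i else 0.

Lemma expn_mul v a (B r : R) : 0 < r -> expn S v a B r ->
  expn S (fun y => iy y * v y) (shiftc a) (B + B / r) r.
Proof.
move=> r0 h y Sy [|M]; have /andP[y0 y1] := sS.1 _ Sy.
  have B0 : 0 <= B by have := expn_bound sS 0 h; rewrite expr0 mulr1; apply: le_trans; exact: cn_ge0.
  have := h y Sy 0%N; rewrite !big_ord0 !subr0 !expr0 !mulr1 cnM cn_iy ?(ltW y0) // => hB.
  have := ler_pM (ltW y0) (cn_ge0 _) y1 hB; have := divr_ge0 B0 (ltW r0); lra.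
have -> : iy y * v y - \sum_(j < M.+1) shiftc a j * iy y ^+ j =
    iy y * (v y - \sum_(j < M) a j * iy y ^+ j).
  rewrite big_ord_recl /= mul0r add0r mulrBr mulr_sumr; congr (_ - _).
  by apply: eq_bigr => j _; rewrite /= exprS mulrCA.
have B0 : 0 <= B by have := expn_bound sS 0 h; rewrite expr0 mulr1; apply: le_trans; exact: cn_ge0.
rewrite cnM cn_iy ?(ltW y0) //; apply: le_trans (ler_wpM2l (ltW y0) (h y Sy M)) _.
have -> : (B + B / r) * (r * y) ^+ M.+1 = B * (r * y) ^+ M.+1 + y * (B * (r * y) ^+ M).
  by rewrite exprS; move: ((r * y) ^+ M) => q; field; rewrite gt_eqF.
by rewrite lerDr mulr_ge0 // exprn_ge0 // mulr_ge0 // ltW.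
Qed.

Lemma expn_cst c B (r : R) : 0 <= B -> cn c <= B -> 0 <= r ->
  expn S (fun=> c) (fun j => if j is 0 then c else 0) B r.
Proof.
move=> B0 cB r0 y Sy [|M]; first by rewrite big_ord0 subr0 expr0 mulr1.
rewrite big_ord_recl expr0 mulr1 big1 => [|j _]; last by rewrite /= mul0r.
by rewrite addr0 subrr cn0 mulr_ge0 // exprn_ge0 // mulr_ge0 // ltW // (small_gt0 sS).
Qed.

Lemma affine_coef v a (B : R) (W : R -> C) w (B' r : R) (al be c : C) :
  0 < r -> expn S v a B r -> expn S W w B' r ->
  (forall y, S y -> (al + be * iy y) * v y = W y - c) ->
  al * a 0%N = w 0%N - c /\ forall m, al * a m.+1 + be * a m = w m.+1.
Proof.
move=> r0 hv hW h; have r0' := ltW r0.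
have h1 := expnD be (expn_mul r0 hv) (expnD al hv (expn0 sS (lexx 0) r0')).
have h2 := expnD (-1) (expn_cst (cn_ge0 c) (lexx _) r0') hW.
have eq y : S y -> be * (iy y * v y) + (al * v y + 0) = -1 * c + W y.
  by move=> Sy; rewrite addr0 mulN1r [RHS]addrC -h //; ring.
have {}h1 := expn_ext eq (fun=> erefl) h1.
have hu := expn_unique sS h1 h2; split=> [|m].
  by have := hu 0%N; rewrite /= mulr0 add0r addr0 mulN1r addrC.
by have := hu m.+1; rewrite /= addr0 mulr0 add0r addrC.
Qed.

Section Operator.
Context (H : lmodType C) (u : R -> H -> K) (W : R -> H -> H -> C) (w : H -> H -> nat -> C) (r : R).
Hypothesis r0 : 0 < r.

(** The local state for all h at once: the rate r is common, while the constants may depend on h and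
    g. *)
Record local_family : Prop := LocalFamily {
  lf_kernel : forall y y' h g, S y -> S y' ->
    (iy y + iy y') * f (u y h) (u y' g) = W y h g - (W y' g h)^*;
  lf_real : forall h g j, (w h g j)^* = w g h j;
  lf_W : forall h g, exists B : R, expn S (fun y => W y h g) (w h g) B r;
  lf_e : forall h i, exists a (B : R), expn S (fun y => f (u y h) (e i)) a B r
}.

Definition expands (eta : H -> nat -> K) := forall h,
  tends f e S (fun y => u y h) (eta h 0%N) /\ exists c : R, [/\ 0 <= c,
    forall m, N (eta h m) <= c * r ^+ m &
    forall y, S y -> forall M, N (u y h - \sum_(m < M) iy y ^+ m *: eta h m) <= c * (r * y) ^+ M].

Lemma family_expands : local_family -> exists eta, expands eta.
Proof.
move=> [hk hr hW he]; suff /choice[eta heta] : forall h, exists et : nat -> K,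
    tends f e S (fun y => u y h) (et 0%N) /\ exists c : R, [/\ 0 <= c,
    forall m, N (et m) <= c * r ^+ m &
    forall y, S y -> forall M, N (u y h - \sum_(m < M) iy y ^+ m *: et m) <= c * (r * y) ^+ M].
  by exists eta.
move=> h.
have [B hB] := hW h h.
have [a ha] := choice (he h).
have [b hb] := choice ha.
have b0 i : 0 <= b i.
  have := expn_bound sS 0 (hb i); rewrite expr0 mulr1; apply: le_trans; exact: cn_ge0.
have lb i : b i <= \sum_j b j by rewrite (bigD1 i) //= lerDl sumr_ge0.
have ls : local_state f e S (fun y => u y h) (fun y => W y h h) (w h h) a B (\sum_j b j) r.
  split=> [y y' Sy Sy'|j||i]; [exact: hk | exact: hr | exact: hB |].
  exact: expn_weaken (b0 i) (lb i) (ltW r0) (lexx _) (hb i).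
by have [et [c [c0 t0 hc hu]]] := local_expansion pt sS ls r0; exists et; split=> //; exists c.
Qed.

Section Coefficients.
Context (eta : H -> nat -> K).
Hypothesis lf : local_family.
Hypothesis ex : expands eta.

Lemma form_expn h x : exists B : R, expn S (fun y => f (u y h) x) (fun m => f (eta h m) x) B r.
Proof.
have [_ [c [c0 _ hc]]] := ex h; exists (c * N x) => y Sy M.
have -> : f (u y h) x - \sum_(j < M) f (eta h j) x * iy y ^+ j =
    f (u y h - \sum_(m < M) iy y ^+ m *: eta h m) x.
  rewrite (sBl fh) (s_suml fh); congr (_ - _).
  by apply: eq_bigr => m _; rewrite (sZl fh) mulrC.
apply: le_trans (pont_bound pt _ _) _; rewrite mulrAC.
by apply: ler_wpM2r; [exact: nrm_ge0 | exact: hc].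
Qed.

Lemma form_coef h g x al be c :
  (forall y, S y -> (al + be * iy y) * f (u y h) x = W y h g - c) ->
  al * f (eta h 0%N) x = w h g 0%N - c /\
  forall m, al * f (eta h m.+1) x + be * f (eta h m) x = w h g m.+1.
Proof.
have [B hB] := form_expn h x; have [B' hB'] := lf_W lf h g.
exact: affine_coef r0 hB hB'.
Qed.

Lemma shift_relation h g m : f (eta g 0%N) (eta h m) = w g h m.+1 /\
  forall n, f (eta g n.+1) (eta h m) = f (eta g n) (eta h m.+1).
Proof.
have q y : S y -> forall i, iy y * f (eta h i.+1) (u y g) + f (eta h i) (u y g) = w h g i.+1.
  move=> Sy i; have [|_ hq] := @form_coef h g (u y g) (iy y) 1 ((W y g h)^*).
    by move=> y' Sy'; rewrite mul1r addrC; exact: (lf_kernel lf).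
  by have := hq i; rewrite mul1r.
have [B hB] := form_expn g (eta h m); have [B' hB'] := form_expn g (eta h m.+1).
have h1 := expnD (-1) (expn_mul r0 hB') hB.
have eq y : S y -> -1 * (iy y * f (u y g) (eta h m.+1)) + f (u y g) (eta h m) = w g h m.+1.
  move=> Sy; rewrite -(lf_real lf) -(q y Sy m) conjD conjM conj_iy.
  by rewrite -!(hermJ fh); ring.
have {}h1 := expn_ext eq (fun=> erefl) h1.
have h2 := expn_cst (cn_ge0 (w g h m.+1)) (lexx _) (ltW r0).
have hu := expn_unique sS h1 h2; split=> [|n].
  by have := hu 0%N; rewrite /= mulr0 add0r.
by have := hu n.+1; rewrite /= mulN1r => /eqP; rewrite addrC subr_eq0 => /eqP.
Qed.

Lemma form_small h x : (forall m, f (eta h m) x = 0) -> forall y, S y -> r * y <= 2^-1 ->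
  f (u y h) x = 0.
Proof.
move=> h0 y Sy ry; have [B hB] := form_expn h x; apply: cn_le0.
have B0 : 0 <= B by have := expn_bound sS 0 hB; rewrite expr0 mulr1; apply: le_trans; exact: cn_ge0.
apply: le_eps => d d0; rewrite add0r; have [n hn] := exists_pow_lt B d0.
have := hB y Sy n; rewrite big1 => [|j _]; last by rewrite h0 mul0r.
rewrite subr0 => /le_trans; apply; apply: le_trans (ltW hn).
apply: ler_wpM2l => //; apply: lerXn2r ry; rewrite nnegrE ?invr_ge0 //.
by rewrite mulr_ge0 // ltW // (small_gt0 sS).
Qed.

(** On the free module over the pairs (h, m) the shift is trivially well defined. It is symmetric by
    [shift_relation], its orbits are bounded by c r^n, and the coefficients are total by
    [form_small] and the hypothesis, so [op_extension] carries it to K. *)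
Lemma shift_operator :
  (forall x, (exists2 d : R, 0 < d & forall y h, S y -> y < d -> f (u y h) x = 0) -> x = 0) ->
  exists (B : {linear K -> K}) (M : R), [/\ forall h m, B (eta h m) = eta h m.+1,
    forall x, N (B x) <= M * N x, forall x y, f (B x) y = f x (B y) &
    forall x, (forall h m, f x (eta h m) = 0) -> x = 0].
Proof.
move=> dens.
have nd x : (forall h m, f x (eta h m) = 0) -> x = 0.
  move=> hx; apply: dens; exists (2^-1 / r); first by rewrite divr_gt0 // invr_gt0.
  move=> y h Sy; rewrite ltr_pdivlMr // => yr; apply: form_small => // [m|].
    by rewrite (hermJ fh) hx conj0.
  by rewrite mulrC ltW.
have [V [de [cf [sup [univ hsup]]]]] := @free_module R (H * nat)%type.
have [j hj] := univ K (fun p => eta p.1 p.2).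
have [T hT] := univ V (fun p => de (p.1, p.2.+1)).
have dec v : v = \sum_(p <- undup (sup v)) cf v p *: de p.
  by apply: hsup; [exact: undup_uniq | move=> p; rewrite mem_undup].
have iterT n p : iter n T (de p) = de (p.1, (n + p.2)%N).
  by elim: n => [|n ih] /=; [case: p | rewrite ih hT].
have iter_lin n : lin (iter n T).
  by elim: n => [|n ih] a x y //=; rewrite ih linearP.
have [||||||B [M [h1 h2 h3]]] := op_extension pt (j := j) (T := T) (r := r).
- exact: lin_linear.
- exact: lin_linear.
- exact: r0.
- apply: (dense_of_orth pt); first exact: lin_linear.
  by move=> x hx; apply: nd => h m; rewrite -(hj (h, m)).
- move=> v v'; rewrite (dec v) (dec v') !linear_sum !(s_suml fh); apply: eq_bigr => p _.
  rewrite !(s_sumr fh); apply: eq_bigr => q _; rewrite !linearZ !(sZl fh) !(sZr fh) !hT !hj /=.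
  by rewrite (shift_relation _ _ _).2.
- move=> v; have hp p : exists c : R, forall n, N (j (iter n T (de p))) <= c * r ^+ n.
    have [_ [c [c0 hc _]]] := ex p.1; exists (c * r ^+ p.2) => n.
    by rewrite iterT hj -mulrA -exprD addnC; exact: hc.
  have [c hc] := choice hp.
  exists (\sum_(p <- undup (sup v)) cn (cf v p) * c p) => n.
  rewrite {1}(dec v) (lin_sum (iter_lin n)) linear_sum.
  apply: le_trans (nrm_sum sh sp _ _ _) _; rewrite mulr_suml; apply: ler_sum => p _.
  rewrite (linZ (iter_lin n)) linearZ (nrmZ sh) -mulrA.
  by apply: ler_wpM2l; [exact: cn_ge0 | exact: hc].
exists B, M; split=> // h m.
by rewrite -(hj (h, m)) h1 hT hj.
Qed.
End Coefficients.
End Operator.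
End LocalOperator.

(** * Operator functions *)

Section OperatorFunctions.
Import numFieldNormedType.Exports.
Context (R : realType).
Local Notation C := (Cplx R).

Lemma near_cn (z : C) (P : C -> Prop) : (\forall w \near z, P w) <->
  exists2 r : R, 0 < r & forall w, cn (w - z) < r -> P w.
Proof.
split=> [/nbhs_ballP[e /= e0 he]|[r r0 hr]].
  have [re0 eE] : 0 < re e /\ e = rc (re e).
    split; last exact/ge0_rc/ltW.
    by move: e0; rewrite lt_cE re0 => /andP[].
  exists (re e) => // w hw; apply: he; rewrite -ball_normE /ball_ /= normE.
  by rewrite eE lt_rc cnBC.
apply/nbhs_ballP; exists (rc r); first by rewrite /= -rc0 lt_rc.
by move=> w; rewrite -ball_normE /ball_ /= normE lt_rc cnBC => /hr.
Qed.

Lemma open_cn (U : set C) : open U <->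
  forall z, U z -> exists2 r : R, 0 < r & forall w, cn (w - z) < r -> U w.
Proof.
rewrite openE; split=> [h z /h /near_cn //|h z /h].
by move=> hz; apply/near_cn.
Qed.

Context (H : lmodType C) (dot : {dot H for conjC}) (hH : hilbert dot).
Let d (x y : H) : C := dot x y.
Let dh : hilb d := dot_hilb hH.
Let sh : is_herm d := hb_h dh.
Let sp : is_psd d := hb_p dh.
Local Notation N := (nrm d).

Definition hdiff (F : C -> H -> H) z (F' : H -> H) := forall b : R, 0 < b ->
  exists2 r : R, 0 < r & forall w, cn (w - z) < r ->
  forall h, N (F w h - F z h - (w - z) *: F' h) <= b * cn (w - z) * N h.

Lemma holomorphic_onE (U : set C) (F : C -> {linear H -> H}) :
  holomorphic_on dot U F <-> forall z, U z ->
  [/\ exists2 r : R, 0 < r & forall w, cn (w - z) < r -> U w,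
      exists M : R, forall h, N (F z h) <= M * N h &
      exists F' : {linear H -> H}, hdiff F z F' /\ exists M : R, forall h, N (F' h) <= M * N h].
Proof.
have fE x : fnorm dot x = rc (N x) := fnormE sh sp x.
split=> [[/open_cn oU hU] z Uz|h].
  have [b1 [F' b2 hF]] := hU _ Uz; split; [exact: oU | exact/bounded_opE |].
  exists F'; split; last exact/bounded_opE.
  move=> b b0; have b0' : 0 < rc b :> C by rewrite -rc0 lt_rc.
  have /near_cn[r r0 hr] := hF _ b0'; exists r => // w /hr hw h0.
  by have := hw h0; rewrite !fE normE -!rcM le_rc.
split=> [|z /h[_ b1 [F' [hF b2]]]]; first by apply/open_cn => z /h[].
split; first exact/bounded_opE.
exists F'; first exact/bounded_opE.
move=> c c0; have c0' : 0 < re c by move: c0; rewrite lt_cE re0 => /andP[].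
apply/near_cn; have [r r0 hr] := hF _ c0'; exists r => // w /hr hw h0.
by rewrite !fE normE [c](ge0_rc (ltW c0)) -!rcM le_rc.
Qed.

Section Holomorphic.
Context (U : set C) (F : C -> {linear H -> H}) (hF : holomorphic_on dot U F).

Lemma hol_open z : U z -> exists2 r : R, 0 < r & forall w, cn (w - z) < r -> U w.
Proof. by move/((holomorphic_onE U F).1 hF) => []. Qed.

Lemma hol_bounded z : U z -> exists M : R, forall h, N (F z h) <= M * N h.
Proof. by move/((holomorphic_onE U F).1 hF) => []. Qed.

Lemma hol_lip z : U z -> exists (M r : R), [/\ 0 <= M, 0 < r &
  forall w, cn (w - z) < r -> forall h, N (F w h - F z h) <= M * cn (w - z) * N h].
Proof.
move/((holomorphic_onE U F).1 hF) => [_ _ [F' [hF' [M hM]]]].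
have [r r0 hr] := hF' 1 ltr01; exists (`|M| + 1), r; split=> // [|w /hr hw h].
  by rewrite addr_ge0.
have h1 := hw h; have h2 := nrmDl sh sp (F w h - F z h) ((w - z) *: F' h).
rewrite (nrmZ sh) in h2.
have h3 := ler_wpM2l (cn_ge0 (w - z)) (hM h).
have h4 : cn (w - z) * (M * N h) <= cn (w - z) * (`|M| * N h).
  by apply: ler_wpM2l; [exact: cn_ge0 | apply: ler_wpM2r; [exact: nrm_ge0 | exact: ler_norm]].
have -> : (`|M| + 1) * cn (w - z) * N h = cn (w - z) * (`|M| * N h) + 1 * cn (w - z) * N h.
  by ring.
lra.
Qed.

Lemma hol_locbound z : U z -> exists (M r : R), [/\ 0 <= M, 0 < r &
  forall w, cn (w - z) < r -> forall h, N (F w h) <= M * N h].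
Proof.
move=> Uz; have [M1 h1] := hol_bounded Uz; have [M [r [M0 r0 hr]]] := hol_lip Uz.
exists (`|M1| + M * r), r; split=> // [|w wr h].
  by rewrite addr_ge0 // mulr_ge0 // ltW.
have h2 := hr w wr h; have h3 := nrmDl sh sp (F w h) (F z h).
have n0 := nrm_ge0 d h; have h4 := h1 h.
have h5 : M1 * N h <= `|M1| * N h by apply: ler_wpM2r => //; exact: ler_norm.
have h6 : M * cn (w - z) * N h <= M * r * N h.
  by apply: ler_wpM2r => //; apply: ler_wpM2l => //; exact: ltW.
rewrite mulrDl; lra.
Qed.

Lemma hol_cdiff z h g : U z -> cdiff (fun w => dot (F w h) g) z.
Proof.
move/((holomorphic_onE U F).1 hF) => [_ _ [F' [hF' _]]].
exists (dot (F' h) g) => b b0.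
have c0 : 0 < N h * N g + 1 by rewrite ltr_wpDl // mulr_ge0 // nrm_ge0.
have [r r0 hr] := hF' (b / (N h * N g + 1)) (divr_gt0 b0 c0).
exists r => // w wr; have := hr w wr h.
have -> : dot (F w h) g - dot (F z h) g - dot (F' h) g * (w - z) =
    d (F w h - F z h - (w - z) *: F' h) g.
  by rewrite !(sBl sh) (sZl sh) mulrC.
move=> h1; apply: le_trans (cauchy_schwarz sh sp _ _) _.
apply: le_trans (ler_wpM2r (nrm_ge0 _ _) h1) _.
have -> : b / (N h * N g + 1) * cn (w - z) * N h * N g =
    b * cn (w - z) * ((N h * N g) / (N h * N g + 1)) by ring.
rewrite -[leRHS]mulr1; apply: ler_wpM2l; first by rewrite mulr_ge0 ?cn_ge0 // ltW.
by rewrite ler_pdivrMr // mul1r lerDl.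
Qed.
End Holomorphic.
End OperatorFunctions.

(** * The space of the kernel *)

Section KernelSpace.
Context (R : realType).
Local Notation C := (Cplx R).
Context (H : lmodType C) (dot : {dot H for conjC}) (hH : hilbert dot) (kappa : nat).
Context (D : set C) (Q : C -> {linear H -> H}) (hQ : Nclass dot kappa D Q).
Let d (x y : H) : C := dot x y.
Let dh : is_herm d := hb_h (dot_hilb hH).

Definition upper_dom z := D z /\ 0 < im z.
Local Notation G := upper_dom.

Lemma Im_gt0 (z : C) : (0 < 'Im z) = (0 < im z).
Proof. by rewrite ImE_rc -rc0 lt_rc. Qed.

Lemma punctured_dom z : im z != 0 -> exists2 r : R, 0 < r &
  forall w, w != z -> cn (w - z) < r -> D w.
Proof.
move=> z0; have Iz : 'Im z != 0 by rewrite ImE_rc rc_eq0.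
have [m [U [F [Uz hF hU]]]] := N_meromorphic hQ Iz.
have [r r0 hr] := hol_open hH hF Uz; exists r => // w wz wr.
by have [] := hU w (hr w wr) wz.
Qed.

Lemma punctured_upper z : 0 < im z -> exists2 r : R, 0 < r &
  forall w, w != z -> cn (w - z) < r -> G w /\ 0 < im w.
Proof.
move=> z0; have [|r r0 hr] := punctured_dom (z := z); first by rewrite gt_eqF.
exists (Num.min r (im z)); first by rewrite lt_min r0.
move=> w wz; rewrite lt_min => /andP[wr wi].
have iw : 0 < im w.
  have := cn_im (w - z); rewrite imB ler_norml => /andP[]; lra.
by split=> //; split=> //; exact: hr.
Qed.

Lemma upper_dom_nonempty : exists z, G z.
Proof.
have i0 : 0 < im (J R) :> R by rewrite im_mkc.
have [r r0 hr] := punctured_upper i0; have r2 : 0 < r / 2 by lra.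
exists (J R + rc (r / 2)); apply: (hr _ _ _).1.
  by rewrite -subr_eq0 addrAC subrr add0r rc_eq0 gt_eqF.
by rewrite addrAC subrr add0r cn_rc ger0_norm; lra.
Qed.

(** Total version of the kernel, so that the free module can be taken over all pairs. *)
Definition kern (p q : C * H) : C := if `[< G p.1 /\ G q.1 >] then
  (dot (Q p.1 p.2) q.2 - dot p.2 (Q q.1 q.2)) / (p.1 - (q.1)^*) else 0.

Lemma upper_neq z w : G z -> G w -> z - w^* != 0.
Proof.
move=> [_ z0] [_ w0]; apply/eqP => /(congr1 im); rewrite imB imJ im0; lra.
Qed.

Lemma kern_herm p q : kern p q = (kern q p)^*.
Proof.
rewrite /kern; case: asboolP => [[hp hq]|h]; case: asboolP => [h'|h'].
- rewrite conjM conjV !conjB conjCK -[dot (Q _ _) _]/(d _ _) -[dot p.2 _]/(d _ _).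
  rewrite (hermJ dh (Q _ _)) (hermJ dh p.2) -[dot (Q _ _) _]/(d _ _) -[dot q.2 _]/(d _ _).
  have n1 := upper_neq hp hq.
  have n2 : (q.1)^* - p.1 != 0 by rewrite -opprB oppr_eq0.
  by move: n1 n2; move: (_^*) (_^*) (_^*) => a b c n1 n2; field; rewrite n1 n2.
- by case: h'; split.
- by case: h; case: h'.
- by rewrite conj0.
Qed.

Definition inspan (K : lmodType C) (ep : C -> H -> K) v :=
  exists n (c : 'I_n -> C) (z : 'I_n -> C) (h : 'I_n -> H),
  (forall p, G (z p)) /\ v = \sum_p c p *: ep (z p) (h p).

Lemma dot0r x : dot x 0 = 0. Proof. exact: s0r dh x. Qed.
Lemma dot0l x : dot 0 x = 0. Proof. exact: s0l dh x. Qed.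

Theorem kernel_space : exists (K : lmodType C) (f : K -> K -> C) k (e : 'I_k -> K)
    (ep : C -> H -> K),
  [/\ pont f e,
    forall z w h g, G z -> G w ->
      (z - w^*) * f (ep z h) (ep w g) = dot (Q z h) g - dot h (Q w g),
    forall z, G z -> lin (ep z),
    forall i, inspan ep (e i) &
    forall x (c : R), 0 < c -> exists2 v, inspan ep v & nrm (sf f e) (x - v) < c].
Proof.
have [V [de [b [bh bde _ fam]]]] := kernel_module kern_herm.
have [z0 Gz0] := upper_dom_nonempty.
have ni : NI b kappa.
  move=> m e one; have [n [x [B [xi hB]]]] := fam m e.
  pose z p := if `[< G (x p).1 >] then (x p).1 else z0.
  pose h p := if `[< G (x p).1 >] then (x p).2 else 0.
  have Gz p : G (z p) by rewrite /z; case: asboolP.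
  have kE p q : kernel_matrix dot Q z h p q = kern (x p) (x q).
    rewrite mxE /kern /z /h; case: asboolP => hp; case: asboolP => hq.
    - by rewrite asboolT.
    - by rewrite asboolF => [|[]] //; rewrite ?linear0 ?dot0r ?dot0l ?oppr0 ?addr0 mul0r.
    - by rewrite asboolF => [|[]] //; rewrite ?linear0 ?dot0r ?dot0l ?oppr0 ?addr0 mul0r.
    - by rewrite asboolF => [|[]] //; rewrite ?linear0 ?dot0r ?dot0l ?oppr0 ?addr0 mul0r.
  have h1 := @N_neg_le _ _ _ _ _ _ hQ n z h.
  apply: leq_trans (h1 _) => [|p]; last by have [? ?] := Gz p; rewrite Im_gt0.
  apply: (neg_eigenvalues_ge (B := B)) => [i j|i j]; first by rewrite !kE; exact: kern_herm.
  rewrite -(one i j) !hB (s_suml bh); apply: eq_bigr => p _.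
  rewrite (s_sumr bh); apply: eq_bigr => q _.
  by rewrite (sZl bh) (sZr bh) bde kE; ring.
have [k [e0 [on0 ps0]]] := max_onf bh ni.
have [K [f [j [pt fj dj]]]] := pont_completion bh on0 ps0.
have fh := pt_h pt.
pose ep z h := j (de (z, h)).
have ker z w h g : G z -> G w ->
    (z - w^*) * f (ep z h) (ep w g) = dot (Q z h) g - dot h (Q w g).
  move=> Gz Gw; rewrite fj bde /kern asboolT // mulrC mulfVK //; exact: upper_neq.
have spn v : exists n (c : 'I_n -> C) (x : 'I_n -> C * H), j v = \sum_p c p *: ep (x p).1 (x p).2.
  have [n [x [B [_ hB]]]] := fam 1%N (fun=> v); exists n, (B 0), x.
  rewrite (hB 0) linear_sum; apply: eq_bigr => p _.
  by rewrite linearZ /ep; case: (x p).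
have nd x : (forall w g, f x (ep w g) = 0) -> x = 0.
  move=> hx; apply: (pont_nondeg_dense pt (P := fun y => exists v, y = j v)) => [y c c0|_ [v ->]].
    by have [v hv] := dj y _ c0; exists (j v) => //; exists v.
  have [n [c [y ->]]] := spn v; rewrite (s_sumr fh) big1 // => p _.
  by rewrite (sZr fh) hx mulr0.
have off z h : ~ G z -> ep z h = 0.
  by move=> hz; apply: nd => w g; rewrite fj bde /kern asboolF // => -[].
have epl z : G z -> lin (ep z).
  move=> Gz a h h'; apply/eqP; rewrite -subr_eq0; apply/eqP/nd => w g.
  have [Gw|hw] := pselect (G w); last by rewrite (off _ _ hw) (s0r fh).
  apply: (mulfI (upper_neq Gz Gw)); rewrite mulr0 (sBl fh) (sDl fh) (sZl fh).
  rewrite mulrBr mulrDr mulrCA !ker // linearP -![dot _ _]/(d _ _).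
  by rewrite !(hermL dh); ring.
have spn' v : inspan ep (j v).
  have [n [c [x ->]]] := spn v.
  exists n, c, (fun p => if `[< G (x p).1 >] then (x p).1 else z0),
    (fun p => if `[< G (x p).1 >] then (x p).2 else 0).
  split=> [p|]; first by case: asboolP.
  apply: eq_bigr => p _; case: asboolP => // hp.
  by rewrite (off _ _ hp) (lin0 (epl _ Gz0)).
exists K, f, k, (fun i => j (e0 i)), ep; split=> // x c c0.
by have [v hv] := dj x _ c0; exists (j v).
Qed.
End KernelSpace.

Lemma cdiff_sum (R : realType) (I : Type) (r : seq I) (F : I -> Cplx R -> Cplx R) z :
  (forall i, cdiff (F i) z) -> cdiff (fun w => \sum_(i <- r) F i w) z.
Proof.
move=> h; elim: r => [|i r ih].
  by apply: (@cdiff_near _ (fun=> 0) _ _ 1) (cdiff_cst _ _) => // w _; rewrite big_nil.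
apply: (@cdiff_near _ (fun w => F i w + \sum_(j <- r) F j w) _ _ 1) => [//|w _|].
  by rewrite big_cons.
exact: cdiffD.
Qed.

(** * Analyticity and uniqueness for the functions pairing ep z h with a vector *)

Section KernelFunctions.
Context (R : realType).
Local Notation C := (Cplx R).
Context (H : lmodType C) (dot : {dot H for conjC}) (hH : hilbert dot) (kappa : nat).
Context (D : set C) (Q : C -> {linear H -> H}) (hQ : Nclass dot kappa D Q).
Local Notation d := (fun x y : H => dot x y).
Local Notation G := (upper_dom D).
Context (K : lmodType C) (f : K -> K -> C) (k : nat) (e : 'I_k -> K) (ep : C -> H -> K).

Record kspace : Prop := KSpace {
  ks_pt : pont f e;
  ks_ker : forall z w h g, G z -> G w ->
    (z - w^*) * f (ep z h) (ep w g) = dot (Q z h) g - dot h (Q w g);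
  ks_lin : forall z, G z -> lin (ep z);
  ks_e : forall i, inspan D ep (e i);
  ks_dense : forall x (c : R), 0 < c -> exists2 v, inspan D ep v & nrm (sf f e) (x - v) < c
}.

Hypothesis ks : kspace.
Let pt : pont f e := ks_pt ks.
Let fh : is_herm f := pt_h pt.
Let sh : is_herm (sf f e) := pt_sh pt.
Let sp : is_psd (sf f e) := hb_p (pt_hilb pt).
Local Notation N := (nrm (sf f e)).

Lemma ks_orth x : (forall w g, G w -> f x (ep w g) = 0) -> x = 0.
Proof.
move=> hx; apply: (pont_nondeg_dense pt (P := inspan D ep)) => [y c|_ [n [c [z [h [Gz ->]]]]]].
  exact: ks_dense.
by rewrite (s_sumr fh) big1 // => p _; rewrite (sZr fh) hx ?mulr0.
Qed.

Lemma upper_open z : G z -> exists2 r : R, 0 < r & forall w, cn (w - z) < r -> G w.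
Proof.
move=> [Dz z0]; have [r r0 hr] := hol_open hH (N_holomorphic hQ) Dz.
exists (Num.min r (im z)); first by rewrite lt_min r0.
move=> w; rewrite lt_min => /andP[wr wi]; split; first exact: hr.
have := cn_im (w - z); rewrite imB ler_norml => /andP[]; lra.
Qed.

Lemma ks_form z w h g : G z -> G w ->
  f (ep z h) (ep w g) = (dot (Q z h) g - dot h (Q w g)) / (z - w^*).
Proof. by move=> Gz Gw; rewrite -ks_ker // mulrC mulKf // (upper_neq Gz Gw). Qed.

Lemma ep_cdiff z h v : G z -> inspan D ep v -> cdiff (fun w => f (ep w h) v) z.
Proof.
move=> Gz [n [c [t [g [Gt ->]]]]]; have [r r0 hr] := upper_open Gz.
pose F w := \sum_p (c p)^* * ((dot (Q w h) (g p) - dot h (Q (t p) (g p))) * (w - (t p)^*)^-1).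
apply: (@cdiff_near _ F _ _ r r0) => [w wr|].
  rewrite /F (s_sumr fh); apply: eq_bigr => p _; rewrite (sZr fh) ks_form //; exact: hr.
apply: cdiff_sum => p; apply: cdiffZ; apply: cdiffM.
  apply: cdiffB (cdiff_cst _ _); exact: (hol_cdiff hH (N_holomorphic hQ)) Gz.1.
by apply: cdiff_subV; rewrite -subr_eq0; exact: upper_neq Gz (Gt p).
Qed.

(** The squared norm is the diagonal of the kernel, bounded by that of Q over im w, plus the
    components along e. These are continuous because the e i lie in the span of the [ep]. *)
Lemma ks_locbound z h : G z -> exists (B r : R), [/\ 0 <= B, 0 < r &
  forall w, cn (w - z) < r -> G w /\ N (ep w h) <= B].
Proof.
move=> Gz; have [Dz z0] := Gz.
have [M [r1 [M0 r10 hM]]] := hol_locbound hH (N_holomorphic hQ) Dz.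
have hi i : exists2 r : R, 0 < r & forall w, cn (w - z) < r ->
    cn (f (ep w h) (e i) - f (ep z h) (e i)) < 1.
  exact: cdiff_cont (ep_cdiff h Gz (ks_e ks i)) ltr01.
have hi' i : exists r : R, 0 < r /\ forall w, cn (w - z) < r ->
    cn (f (ep w h) (e i) - f (ep z h) (e i)) < 1.
  by have [r r0 h0] := hi i; exists r.
have [rr hrr] := choice hi'.
have [r2 r20 hr2] := pos_min (fun i => (hrr i).1).
have [r3 r30 hr3] := upper_open Gz.
have dh := hb_h (dot_hilb hH); have dp := hb_p (dot_hilb hH).
pose X := 2 * M * nrm d h ^+ 2 / im z + 2 * \sum_i (cn (f (ep z h) (e i)) + 1) ^+ 2.
have X0 : 0 <= X.
  apply: addr_ge0; first (apply: divr_ge0 (ltW z0); apply: mulr_ge0 (sqr_ge0 _); exact: mulr_ge0).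
  by rewrite mulr_ge0 // sumr_ge0 // => i _; exact: sqr_ge0.
exists (X + 1), (Num.min (Num.min r1 r2) (Num.min r3 (im z / 2))); split.
- by rewrite addr_ge0.
- by rewrite !lt_min r10 r20 r30 divr_gt0.
move=> w; rewrite !lt_min => /andP[/andP[w1 w2] /andP[w3 w4]].
have Gw := hr3 w w3; split=> //.
have iw : im z <= 2 * im w.
  by have := cn_im (w - z); rewrite imB ler_norml => /andP[]; lra.
suff : N (ep w h) ^+ 2 <= X by move: (N _) => n hn; have := sqr_ge0 (n - 1); rewrite sqrrB1; nra.
rewrite (N2E pt); apply: lerD; last first.
  rewrite ler_pM2l //; apply: ler_sum => i _.
  have h1 := (hrr i).2 w (lt_le_trans w2 (hr2 i)).
  apply: lerXn2r; rewrite ?nnegrE ?cn_ge0 ?addr_ge0 ?cn_ge0 //.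
  have := cnDl (f (ep w h) (e i)) (f (ep z h) (e i)); lra.
apply: le_trans (re_le_cn _) _; rewrite ks_form // cnM cnV.
have -> : cn (w - w^*) = 2 * im w.
  have -> : w - w^* = J R * rc (2 * im w).
    apply: c_ext; rewrite ?reJz ?imJz ?reB ?imB ?reJ ?imJ ?re_rc ?im_rc; lra.
  by rewrite cnM cn_J mul1r cn_rc ger0_norm //; lra.
have h1 : cn (dot (Q w h) h - dot h (Q w h)) <= 2 * M * nrm d h ^+ 2.
  have n0 := nrm_ge0 d h; have h2 := ler_wpM2r n0 (hM w w1 h).
  have h3 := cauchy_schwarz dh dp (Q w h) h; have h4 := cauchy_schwarz dh dp h (Q w h).
  apply: le_trans (cnB _ _) _; rewrite expr2; move: h2 h3 h4.
  by move: (cn _) (cn _) (nrm d h) (nrm d _) => x1 x2 x3 x4; nra.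
apply: ler_pM => //; [exact: cn_ge0 | by rewrite invr_ge0; lra |].
by rewrite lef_pV2 ?posrE //; lra.
Qed.

(** For vectors of the span the function is explicit and differentiable. A general x is a limit of
    such vectors, and local boundedness makes the Taylor estimates uniform, so [tayl_limit]
    applies. *)
Lemma ks_taylor z h x : G z -> exists s M a, [/\ 0 < s, 0 <= M &
  tayl s M (fun zeta => f (ep (z + zeta) h) x) a].
Proof.
move=> Gz; have [B [r [B0 r0 hr]]] := ks_locbound h Gz.
have hv n : exists v, inspan D ep v /\ N (x - v) < n.+1%:R^-1.
  have [|v hv1 hv2] := ks_dense ks x (c := n.+1%:R^-1); first by rewrite invr_gt0.
  by exists v.
have [v {}hv] := choice hv.
have s0 : 0 < r / 3 by rewrite divr_gt0.
have M0 : 0 <= B * (N x + 1) by rewrite mulr_ge0 // addr_ge0 // nrm_ge0.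
have near w : cn w < 3 * (r / 3) -> cn (z + w - z) < r.
  by rewrite addrAC subrr add0r; lra.
have ht n : exists a, tayl (r / 3) (B * (N x + 1)) (fun zeta => f (ep (z + zeta) h) (v n)) a.
  apply: taylor0 => // w /near wr; have [Gw Nw] := hr _ wr.
    apply: (cdiff_comp (f := fun w => f (ep w h) (v n)) (g := fun w => z + w)).
      exact: cdiffD (cdiff_cst _ _) (cdiff_id _).
    exact: ep_cdiff Gw (hv n).1.
  apply: le_trans (pont_bound pt _ _) _; apply: ler_pM => //; try exact: nrm_ge0.
  have h1 := nrmDl sh sp (v n) x; have := (hv n).2; rewrite (nrmBC sh) => h2.
  have h3 : n.+1%:R^-1 <= 1 :> R by rewrite invf_le1 // ler1n.
  by move: h1 h2 h3; move: (_^-1) (N _) (N _) (N _) => x1 x2 x3 x4; lra.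
have [al hal] := choice ht.
have [|a ha] := tayl_limit (f := fun zeta => f (ep (z + zeta) h) x) hal.
  move=> w ws; have wr : cn (z + w - z) < r.
    by apply: near; lra.
  have [Gw Nw] := hr _ wr.
  apply: (null_le _ (nullZ B0 (@null_harmonic R))) => n; rewrite -(sBr fh).
  apply: le_trans (pont_bound pt _ _) _; apply: ler_pM => //; try exact: nrm_ge0.
  exact: ltW (hv n).2.
by exists (r / 3), (B * (N x + 1)), a.
Qed.

Lemma ks_dichotomy z h x : G z ->
  (exists2 r : R, 0 < r & forall w, cn (w - z) < r -> f (ep w h) x = 0) \/
  (exists2 r : R, 0 < r & forall w, w != z -> cn (w - z) < r -> f (ep w h) x != 0).
Proof.
move=> Gz; have [s [M [a [s0 M0 ha]]]] := ks_taylor h x Gz.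
have zw w : z + (w - z) = w by rewrite addrCA subrr addr0.
have [[r r0 hr]|[r r0 hr]] := tayl_dichotomy s0 M0 ha; [left|right]; exists r => // w.
  by move/hr; rewrite zw.
by move=> wz wr; have := hr (w - z); rewrite zw subr_eq0; apply.
Qed.

(** Identity theorem: by the dichotomy an accumulation of zeros gives vanishing near z1, which
    spreads over the upper half-plane by [continuation]. *)
Lemma ks_vanish z1 h x : G z1 ->
  (forall r : R, 0 < r -> exists z, [/\ z != z1, cn (z - z1) < r & f (ep z h) x = 0]) ->
  forall z, G z -> f (ep z h) x = 0.
Proof.
move=> Gz1 acc z Gz.
pose W z := exists2 r : R, 0 < r & forall w, cn (w - z) < r -> f (ep w h) x = 0.
have W1 : W z1.
  have [//|[r r0 hr]] := ks_dichotomy h x Gz1; have [w [wz wr w0]] := acc _ r0.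
  by have := hr w wz wr; rewrite w0 eqxx.
have locW : locconst (fun z => G z /\ 0 < im z) W.
  move=> t [Gt _]; have [[r r0 hr]|[r r0 hr]] := ks_dichotomy h x Gt; exists r => // w _ wr.
    split=> _; first by exists r.
    exists (r - cn (w - t)) => [|v vw]; first by lra.
    by apply: hr; have := cnD (v - w) (w - t); rewrite subrKA; lra.
  have [->//|wt] := eqVneq w t; split=> -[r' r0' hr'].
    by have := hr w wt wr; rewrite hr' ?eqxx // subrr cn0.
  pose u := t + rc (Num.min r r' / 2).
  have m0 : 0 < Num.min r r' by rewrite lt_min r0.
  have ut : cn (u - t) = Num.min r r' / 2.
    by rewrite /u addrAC subrr add0r cn_rc ger0_norm // ltW // divr_gt0.
  have : cn (u - t) < Num.min r r' by rewrite ut; lra.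
  rewrite lt_min => /andP[u1 u2]; have := hr u; rewrite hr' // eqxx.
  have un : u != t by rewrite -subr_eq0 -cn_gt0 ut divr_gt0.
  by move=> /(_ un u1).
have [r r0 hr] := continuation (punctured_upper hH hQ) locW Gz1 Gz1.2 Gz Gz.2 W1.
by apply: hr; rewrite subrr cn0.
Qed.
End KernelFunctions.

(** * Expansions at real points and at infinity *)

Lemma half_bound (R : realType) (x b z m : R) : 0 <= b -> 0 <= z -> z < 3 * m ->
  m * (6 * (b + 1)) <= x -> b * z <= x / 2.
Proof. by move=> b0 z0 zm mx; nra. Qed.

Section LocalTheorem.
Context (R : realType).
Local Notation C := (Cplx R).
Context (H : lmodType C) (dot : {dot H for conjC}) (hH : hilbert dot) (kappa : nat).
Context (D : set C) (Q : C -> {linear H -> H}) (hQ : Nclass dot kappa D Q).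
Local Notation d := (fun x y : H => dot x y).
Local Notation G := (upper_dom D).
Context (K : lmodType C) (f : K -> K -> C) (k : nat) (e : 'I_k -> K) (ep : C -> H -> K).
Hypothesis ks : kspace dot D Q f e ep.
Let pt : pont f e := ks_pt ks.
Let fh : is_herm f := pt_h pt.
Let sh : is_herm (sf f e) := pt_sh pt.
Let sp : is_psd (sf f e) := hb_p (pt_hilb pt).
Local Notation N := (nrm (sf f e)).

(* At a real point x0 the variable is zeta = z - x0 and [u] is [ep z]; at infinity
   it is zeta = - 1 / z and [u] is [zeta^-1 *: ep z]. *)
Record local_data (S : R -> Prop) (u : R -> H -> K) (W : C -> H -> H -> C) (s0 : R)
    (al be : C -> C) : Prop := LocalData {
  ld_small : small S;
  ld_s0 : 0 < s0;
  ld_hol : forall h g, exists M : R, forall zeta, cn zeta < s0 ->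
    cdiff (fun zeta => W zeta h g) zeta /\ cn (W zeta h g) <= M;
  ld_conj : forall y h g, S y -> (W (iy y) h g)^* = W (- iy y) g h;
  ld_kernel : forall y y' h g, S y -> S y' ->
    (iy y + iy y') * f (u y h) (u y' g) = W (iy y) h g - (W (iy y') g h)^*;
  ld_al : forall w, G w -> al w != 0;
  ld_ep : forall w y h g, G w -> S y ->
    (al w + be w * iy y) * f (u y h) (ep w g) = W (iy y) h g - dot h (Q w g);
  ld_dens : forall x,
    (exists2 c : R, 0 < c & forall y h, S y -> y < c -> f (u y h) x = 0) -> x = 0
}.

Lemma expn_tayl (S : R -> Prop) (s M : R) g a : 0 < s -> tayl s M g a ->
  (forall y, S y -> 0 < y /\ y < s / 2) -> expn S (fun y => g (iy y)) a (4 * M) s^-1.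
Proof.
move=> s0 [_ ha] hS y /hS[y0 ys] n.
have := ha n (iy y); rewrite cn_iy ?(ltW y0) // [y / s]mulrC; exact.
Qed.

Lemma tayl_at0 (s M : R) g a : 0 < s -> tayl s M g a -> g 0 = a 0%N.
Proof.
move=> s0 [_ ha]; apply/eqP; rewrite -subr_eq0; apply/eqP/cn_le0.
have := ha 1%N 0; rewrite big_ord1 expr0 mulr1 cn0 mul0r expr1 mulr0; apply.
by rewrite divr_gt0.
Qed.

Section Data.
Context (S0 : R -> Prop) (u : R -> H -> K) (W : C -> H -> H -> C) (s0 : R) (al be : C -> C).
Hypothesis ld : local_data S0 u W s0 al be.

Lemma W_taylor (s : R) h g : 0 < s -> 3 * s <= s0 ->
  exists M a, tayl s M (fun zeta => W zeta h g) a.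
Proof.
move=> s1 s3; have [M hM] := ld_hol ld h g; exists M.
by apply: taylor0 => // w w3; have [] := hM w (lt_le_trans w3 s3).
Qed.

(** By [ld_ep] the pairing is a sum of quotients of analytic functions with affine denominators; s1
    keeps them away from 0 for the finitely many points that occur in v. *)
Lemma span_taylor v : inspan D ep v -> exists2 s1 : R, 0 < s1 &
  forall s : R, 0 < s -> s <= s1 -> forall h, exists M a g, tayl s M g a /\
  forall y, S0 y -> y < s -> f (u y h) v = g (iy y).
Proof.
move=> [n [c [z [g [Gz ->]]]]].
have hp p : exists q : R, 0 < q /\ 3 * q <= s0 /\ forall zeta, cn zeta < 3 * q ->
    cn (al (z p)) / 2 <= cn (al (z p) + be (z p) * zeta).
  have a0 : 0 < cn (al (z p)) by rewrite cn_gt0 (ld_al ld).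
  have s00 := ld_s0 ld; have b1 : 0 < cn (be (z p)) + 1 by rewrite ltr_wpDl ?cn_ge0.
  have q0 : 0 < cn (al (z p)) / (6 * (cn (be (z p)) + 1)) by rewrite divr_gt0 // mulr_gt0.
  exists (Num.min (s0 / 3) (cn (al (z p)) / (6 * (cn (be (z p)) + 1)))).
  set m := Num.min _ _; have m1 : m <= s0 / 3 by rewrite ge_min lexx.
  have m2 : m <= cn (al (z p)) / (6 * (cn (be (z p)) + 1)) by rewrite ge_min lexx orbT.
  split; first by rewrite lt_min divr_gt0.
  split=> [|zeta hz]; first by lra.
  rewrite ler_pdivlMr ?mulr_gt0 // in m2.
  have h1 : cn (be (z p) * zeta) <= cn (al (z p)) / 2.
    rewrite cnM; have b0 := cn_ge0 (be (z p)); have c0 := cn_ge0 zeta.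
    exact: half_bound b0 c0 hz m2.
  have := cnDl (al (z p)) (- (be (z p) * zeta)); rewrite opprK cnN; lra.
have [q hq] := choice hp.
have [s1 s10 hs1] := pos_min (fun p => (hq p).1).
exists (Num.min s1 (s0 / 3)); first by rewrite lt_min s10 divr_gt0 ?(ld_s0 ld).
move=> s s00; rewrite le_min => /andP[ss1 ss0] h.
have s3 : 3 * s <= s0 by lra.
pose F p zeta := (W zeta h (g p) - dot h (Q (z p) (g p))) * (al (z p) + be (z p) * zeta)^-1.
have near p zeta : cn zeta < 3 * s -> cn zeta < 3 * q p.
  by move/lt_le_trans; apply; have := hs1 p; lra.
have den p zeta : cn zeta < 3 * s -> cn (al (z p)) / 2 <= cn (al (z p) + be (z p) * zeta).
  by move=> /(near p); have [_ [_ h1]] := hq p; exact: h1.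
have a2 p : 0 < cn (al (z p)) / 2 by rewrite divr_gt0 // cn_gt0 (ld_al ld).
have [M hM] := choice (fun p => ld_hol ld h (g p)).
have bF p : exists B : R, forall zeta, cn zeta < 3 * s -> cn (F p zeta) <= B.
  exists ((M p + cn (dot h (Q (z p) (g p)))) * (cn (al (z p)) / 2)^-1) => zeta hz.
  have [_ hB] := hM p zeta (lt_le_trans hz s3).
  rewrite /F cnM cnV; apply: ler_pM => //; [exact: cn_ge0|by rewrite invr_ge0 cn_ge0| |].
    by apply: le_trans (cnB _ _) _; rewrite lerD2r.
  by rewrite lef_pV2 ?posrE ?den // (lt_le_trans (a2 p)) // den.
have [B hB] := choice bF.
pose GG zeta := \sum_p (c p)^* * F p zeta.
exists (\sum_p cn (c p) * B p).
have [a ha] : exists a, tayl s (\sum_p cn (c p) * B p) GG a.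
  apply: taylor0 => // zeta hz.
    apply: cdiff_sum => p; apply: cdiffZ; apply: cdiffM.
      have [k1 _] := hM p zeta (lt_le_trans hz s3).
      have k2 := cdiff_cst (dot h (Q (z p) (g p))) zeta.
      exact: (cdiffB (g := fun=> dot h (Q (z p) (g p))) k1 k2).
    apply: cdiffV; first exact: cdiff_lin.
    by rewrite -cn_gt0 (lt_le_trans (a2 p)) // den.
  apply: le_trans (cn_sum _ _ _) _; apply: ler_sum => p _; rewrite cnM cnJ.
  by apply: ler_wpM2l; [exact: cn_ge0 | exact: hB].
exists a, GG; split=> // y Sy ys.
have y0 := small_gt0 (ld_small ld) Sy.
rewrite (s_sumr fh); apply: eq_bigr => p _; rewrite (sZr fh) /F -(ld_ep ld) //.
congr (_ * _).
rewrite mulrC mulKf // -cn_gt0 (lt_le_trans (a2 p)) // den // cn_iy ?(ltW y0) //; lra.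
Qed.

Lemma local_setup : exists (s1 r : R) (w : H -> H -> nat -> C), let S y := S0 y /\ y < s1 in
  [/\ 0 < s1, 0 < r, small S, local_family f e S u (fun y => W (iy y)) w r &
    forall h g, w h g 0%N = W 0 h g].
Proof.
have hv i : exists s1 : R, 0 < s1 /\ forall s : R, 0 < s -> s <= s1 ->
    forall h, exists M a g, tayl s M g a /\ forall y, S0 y -> y < s -> f (u y h) (e i) = g (iy y).
  by have [s1 s10 hs1] := span_taylor (ks_e ks i); exists s1.
have [q hq] := choice hv.
have [s1 s10 hs1] := pos_min (fun i => (hq i).1).
pose s := Num.min s1 (s0 / 3).
have s00 : 0 < s by rewrite lt_min s10 divr_gt0 // (ld_s0 ld).
have s3 : 3 * s <= s0 by have : s <= s0 / 3 by [rewrite ge_min lexx orbT]; lra.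
have ss i : s <= q i by apply: le_trans (hs1 i); rewrite ge_min lexx.
have hW h g : exists a M, tayl s M (fun zeta => W zeta h g) a.
  by have [M [a h1]] := W_taylor h g s00 s3; exists a, M.
have hW' (p : H * H) : exists a M, tayl s M (fun zeta => W zeta p.1 p.2) a by exact: hW.
have [w' {}hW'] := choice hW'; pose w h g := w' (h, g).
have hw h g : exists M, tayl s M (fun zeta => W zeta h g) (w h g) by exact: hW' (h, g).
exists (s / 2), s^-1, w; split=> //.
- by rewrite divr_gt0.
- by rewrite invr_gt0.
- split=> [y [/((ld_small ld).1) //]|c c0].
  have [|y Sy] := (ld_small ld).2 (Num.min c (s / 2)); first by rewrite lt_min c0 divr_gt0.
  by rewrite lt_min => /andP[? ?]; exists y.
- have Spos y : S0 y /\ y < s / 2 -> 0 < y /\ y < s / 2.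
    by move=> [/(small_gt0 (ld_small ld))].
  have smS : small (fun y => S0 y /\ y < s / 2).
    split=> [y [/((ld_small ld).1) //]|c c0].
    have [|y Sy] := (ld_small ld).2 (Num.min c (s / 2)); first by rewrite lt_min c0 divr_gt0.
    by rewrite lt_min => /andP[? ?]; exists y.
  split=> [y y' h g [Sy _] [Sy' _]|h g j|h g|h i].
  + exact: ld_kernel ld _ _ _ _ Sy Sy'.
  (* Expand both sides of [ld_conj]. Conjugation and the substitution of - iy produce the same
     alternating signs, so uniqueness of expansions gives the symmetry of w. *)
  + have [M hM] := hw h g; have [M' hM'] := hw g h.
    pose sg j : C := (-1) ^+ j.
    have X1 : expn (fun y => S0 y /\ y < s / 2) (fun y => (W (iy y) h g)^*)
        (fun j => sg j * (w h g j)^*) (4 * M) s^-1.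
      move=> y Sy n; have := expn_tayl s00 hM Spos Sy n.
      rewrite -cnJ conjB conj_sum; congr (cn (_ - _) <= _); apply: eq_bigr => i _.
      by rewrite conjM conjX conj_iy exprNn /sg; ring.
    have X2 : expn (fun y => S0 y /\ y < s / 2) (fun y => (W (iy y) h g)^*)
        (fun j => sg j * w g h j) (4 * M') s^-1.
      move=> y Sy n; have [y0 ys] := Spos y Sy.
      have := hM'.2 n (- iy y); rewrite cnN cn_iy ?(ltW y0) // => /(_ ys).
      have E : \sum_(i < n) w g h i * (- iy y) ^+ i = \sum_(i < n) sg i * w g h i * iy y ^+ i.
        by apply: eq_bigr => i _; rewrite [(- _) ^+ _]exprNn /sg; ring.
      have W1 := ld_conj ld h g Sy.1.
      by rewrite E W1 [y / s]mulrC.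
    have := expn_unique smS X1 X2 j; apply: mulfI.
    by rewrite /sg expf_neq0 // oppr_eq0 oner_eq0.
  + by have [M hM] := hw h g; exists (4 * M); exact: expn_tayl hM Spos.
  + have [M [a [g [ha hg]]]] := (hq i).2 s s00 (ss i) h; exists a, (4 * M).
    apply: (expn_ext _ (fun=> erefl) (expn_tayl s00 ha Spos)) => y [Sy ys].
    by rewrite hg //; have := small_gt0 (ld_small ld) Sy; lra.
by move=> h g; have [M hM] := hw h g; exact/esym/(tayl_at0 s00 hM).
Qed.

(** Interface for the two applications: B becomes the inverse of A - x0 at a real point x0, and - A
    at infinity. *)
Theorem local_theorem : exists (eta : H -> nat -> K) (w : H -> H -> nat -> C)
    (B : {linear K -> K}),
  [/\ forall h, tends f e S0 (fun y => u y h) (eta h 0%N),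
    [/\ forall h m, B (eta h m) = eta h m.+1, exists M : R, forall x, N (B x) <= M * N x &
      forall x y, f (B x) y = f x (B y)],
    forall x, (forall h m, f x (eta h m) = 0) -> x = 0,
    forall c h g, G c -> al c * f (eta h 0%N) (ep c g) = W 0 h g - dot h (Q c g) /\
      forall m, al c * f (eta h m.+1) (ep c g) + be c * f (eta h m) (ep c g) = w h g m.+1 &
    forall h g m, f (eta g 0%N) (eta h m) = w g h m.+1 /\ (w h g m)^* = w g h m].
Proof.
have [s1 [r [w [s10 r0 smS lf w0]]]] := local_setup.
have [eta heta] := family_expands pt smS r0 lf.
have [|B [M [hB1 hB2 hB3 hB4]]] := shift_operator pt smS r0 lf heta.
  move=> x [c c0 hx]; apply: (ld_dens ld); exists (Num.min c s1); first by rewrite lt_min c0.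
  by move=> y h Sy; rewrite lt_min => /andP[yc ys]; exact: hx.
exists eta, w, B; split=> //.
- move=> h c c0; have [b b0 hb] := (heta h).1 c c0.
  exists (Num.min b s1); first by rewrite lt_min b0.
  by move=> y Sy; rewrite lt_min => /andP[yb ys]; exact: hb.
- by split=> //; exists M.
- move=> c h g Gc; rewrite -w0; apply: (form_coef pt smS r0 lf heta) => y [Sy _].
  exact: (ld_ep ld).
- by move=> h g m; split; [exact: (shift_relation pt smS r0 lf heta h g m).1 | exact: (lf_real lf)].
Qed.
End Data.
End LocalTheorem.

Lemma exists_below (R : realType) (a b c : R) : 0 < a -> 0 < b -> 0 < c ->
  exists m : R, [/\ 0 < m, m < a, m < b & m < c].
Proof.
move=> a0 b0 c0; have h1 : Num.min a (Num.min b c) <= a by rewrite ge_min lexx.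
have h2 : Num.min a (Num.min b c) <= b by rewrite ge_min [Num.min b c <= _]ge_min lexx orbT.
have h3 : Num.min a (Num.min b c) <= c by rewrite ge_min [Num.min b c <= _]ge_min lexx !orbT.
have : 0 < Num.min a (Num.min b c) by rewrite lt_min a0 lt_min b0.
by move: h1 h2 h3; move: (Num.min a _) => m *; exists (m / 2); split; lra.
Qed.

(** * Local data at real points and at infinity *)

Section Infinity.
Context (R : realType).
Local Notation C := (Cplx R).
Context (H : lmodType C) (dot : {dot H for conjC}) (hH : hilbert dot) (kappa : nat).
Context (D : set C) (Q : C -> {linear H -> H}) (hQ : Nclass dot kappa D Q).
Local Notation d := (fun x y : H => dot x y).
Local Notation G := (upper_dom D).
Let dh : is_herm d := hb_h (dot_hilb hH).
Let dp : is_psd d := hb_p (dot_hilb hH).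

Lemma dotZl a x y : dot (a *: x) y = a * dot x y. Proof. exact: sZl dh a x y. Qed.
Lemma dotBl x y z : dot (x - y) z = dot x z - dot y z. Proof. exact: sBl dh x y z. Qed.
Lemma dotJ x y : dot x y = (dot y x)^*. Proof. exact: hermJ dh x y. Qed.

Lemma iyD (a b : R) : iy (a + b) = iy a + iy b.
Proof. by apply: c_ext; rewrite ?reD ?imD ?re_mkc ?im_mkc ?addr0. Qed.
Lemma iyN (a : R) : iy (- a) = - iy a.
Proof. by apply: c_ext; rewrite ?reN ?imN ?re_mkc ?im_mkc ?oppr0. Qed.
Lemma iyB (a b : R) : iy (a - b) = iy a - iy b.
Proof. by rewrite iyD iyN. Qed.
Lemma iyM (a b : R) : iy a * iy b = - rc (a * b).
Proof. by apply: c_ext; rewrite ?reN ?imN ?reM ?imM ?re_mkc ?im_mkc ?re_rc ?im_rc; ring. Qed.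
Lemma iyV (y : R) : 0 < y -> iy y^-1 = - (iy y)^-1.
Proof.
move=> y0; apply: (mulfI (iy_neq0 y0)); by rewrite iyM mulrN mulfV ?gt_eqF // mulfV ?iy_neq0 // rc1.
Qed.
Lemma cn_iyR (y : R) : cn (iy y) = `|y|.
Proof. by rewrite iyE cnM cn_J mul1r cn_rc. Qed.

(** Nonreal singularities are isolated, so D contains a punctured disc around any chosen high point
    of the imaginary axis. *)
Lemma exists_high (t0 : R) : exists2 t : R, t0 < t & D (iy t).
Proof.
pose t := `|t0| + 1; have t1 : 0 < t by rewrite /t; have := normr_ge0 t0; lra.
have [|r r0 hr] := punctured_dom hH hQ (z := iy t); first by rewrite im_mkc gt_eqF.
exists (t + r / 2); first by have := ler_norm t0; rewrite /t; lra.
have E : iy (t + r / 2) - iy t = iy (r / 2) by rewrite iyD addrAC subrr add0r.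
have r2 : 0 < r / 2 by rewrite divr_gt0.
apply: hr; first by rewrite -subr_eq0 E iy_neq0.
by rewrite E cn_iy ?(ltW r2) //; lra.
Qed.

Lemma sym_dot z h g : D z -> (dot (Q z h) g)^* = dot (Q z^* g) h.
Proof.
move=> Dz; have [_ ad] := N_symmetric hQ Dz; rewrite ad.
exact/esym/(hermJ dh).
Qed.

Context (K : lmodType C) (f : K -> K -> C) (k : nat) (e : 'I_k -> K) (ep : C -> H -> K).
Hypothesis ks : kspace dot D Q f e ep.
Let pt : pont f e := ks_pt ks.
Let fh : is_herm f := pt_h pt.

Section RealPoint.
Context (x0 : R) (D0 : D (rc x0)).

Lemma real_data : exists s0 : R, let S y := 0 < y <= 1 /\ y < s0 in
  [/\ 0 < s0, forall y, S y -> G (rc x0 + iy y) &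
  local_data dot D Q f ep S (fun y => ep (rc x0 + iy y))
    (fun zeta h g => dot (Q (rc x0 + zeta) h) g) s0
    (fun c => rc x0 - c^*) (fun=> 1)].
Proof.
have [M [r [M0 r0 hM]]] := hol_locbound hH (N_holomorphic hQ) D0.
have [r' r0' hr'] := hol_open hH (N_holomorphic hQ) D0.
have s00 : 0 < Num.min r r' by rewrite lt_min r0.
exists (Num.min r r'); set S := fun y => _.
have sub zeta : rc x0 + zeta - rc x0 = zeta by rewrite addrAC subrr add0r.
have GS y : S y -> G (rc x0 + iy y).
  rewrite /S lt_min => -[/andP[y0 _] /andP[_ yr]]; split; last by rewrite imD im_rc im_mkc add0r.
  by apply: hr'; rewrite sub cn_iy // ltW.
split=> //; split=> //.
- split=> [y [] //|c c0]; have [m [m0 m1 m2 m3]] := exists_below s00 c0 ltr01.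
  by exists m => //; split=> //; rewrite m0 ltW.
- move=> h g; exists (M * nrm d h * nrm d g) => zeta; rewrite lt_min => /andP[z1 z2].
  have Dz : D (rc x0 + zeta) by apply: hr'; rewrite sub.
  split; last first.
    apply: le_trans (cauchy_schwarz dh dp _ _) _; apply: ler_wpM2r; first exact: nrm_ge0.
    by apply: hM; rewrite sub.
  have h1 := hol_cdiff hH (N_holomorphic hQ) h g Dz.
  have h2 := cdiffD (cdiff_cst (rc x0) zeta) (cdiff_id zeta).
  exact: (cdiff_comp (f := fun w => dot (Q w h) g) (g := fun w => rc x0 + w) h2 h1).
- move=> y h g Sy; rewrite (sym_dot _ _ (GS y Sy).1); congr (dot (Q _ _) _).
  by rewrite conjD conj_rc conj_iy.
- move=> y y' h g Sy Sy'; have := ks_ker ks h g (GS y Sy) (GS y' Sy').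
  rewrite conjD conj_rc conj_iy opprD opprK addrACA subrr add0r => ->.
  by rewrite (dotJ h).
- by move=> w Gw; apply/eqP => /(congr1 im); rewrite imB im_rc imJ im0; have := Gw.2; lra.
- move=> w y h g Gw Sy; rewrite -(ks_ker ks) //; last exact: GS.
  by congr (_ * _); ring.
(* The zeros on the vertical segment above x0 accumulate at x0 + i m/2, which lies inside the upper
   half-plane, so [ks_vanish] applies. *)
move=> x [c c0 hc]; apply: (ks_orth ks) => w g Gw; rewrite (hermJ fh).
have [m [m0 m1 m2 m3]] := exists_below s00 c0 ltr01.
have Sy y : 0 < y -> y <= m -> S y /\ y < c.
  move=> y0 ym; split; last exact: le_lt_trans m2.
  by split; [rewrite y0 ltW // (le_lt_trans ym) | exact: le_lt_trans m1].
have m20 : 0 < m / 2 by rewrite divr_gt0.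
have [S1 _] : S (m / 2) /\ m / 2 < c by apply: Sy => //; lra.
rewrite (ks_vanish hH hQ ks (z1 := rc x0 + iy (m / 2))) ?conj0 //; first exact: GS.
move=> b b0; have [q [q0 q1 q2 _]] := exists_below b0 m20 ltr01.
have [S2 c2] : S (m / 2 + q) /\ m / 2 + q < c by apply: Sy; lra.
have E : rc x0 + iy (m / 2 + q) - (rc x0 + iy (m / 2)) = iy q.
  by rewrite iyD; ring.
exists (rc x0 + iy (m / 2 + q)); split.
- by rewrite -subr_eq0 E iy_neq0.
- by rewrite E cn_iy // ltW.
- exact: hc.
Qed.
End RealPoint.

Section AtInfinity.
Context (L : {linear H -> H}) (hinf : holomorphic_at_infinity dot D Q L).

(** W is the extension F of Q in the variable zeta = -1/z, with the removable value 0 at zeta = 0.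
    The second clause bounds zeta^-1 Q near infinity and later yields boundedness of Gam. *)
Lemma infinity_data : exists (s0 : R) (W : C -> H -> H -> C),
  let S y := [/\ 0 < y <= 1, y < s0 & D (iy y^-1)] in
  [/\ forall h g, W 0 h g = 0,
    exists2 M : R, 0 <= M & forall y h, S y -> cn ((iy y)^-1 * dot (Q (iy y^-1) h) h) <= M * nrm d h ^+ 2 &
  local_data dot D Q f ep S (fun y h => (iy y)^-1 *: ep (iy y^-1) h) W s0
    (fun=> -1) (fun c => - c^*)].
Proof.
have [r [F [r0 hF FQ bL hl]]] := hinf.
have [ML hML] := (bounded_opE dh dp dh dp L).1 bL.
have fE x : fnorm dot x = rc (nrm d x) := fnormE dh dp x.
have [rE r0'] : r = rc (re r) /\ 0 < re r.
  by split; [exact/ge0_rc/ltW | move: r0; rewrite lt_cE re0 => /andP[]].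
have lim (b : R) : 0 < b -> exists2 t : R, re r < t & forall z, t < cn z -> forall h,
    nrm d (z *: F z h - L h) <= b * nrm d h.
  move=> b0; have b0' : 0 < rc b :> C by rewrite -rc0 lt_rc.
  have [t' rt ht] := hl _ b0'.
  have tE : t' = rc (re t') by apply/ge0_rc/ltW/(lt_trans r0).
  exists (re t') => [|z tz h]; first by move: rt; rewrite lt_cE => /andP[].
  have := ht z; rewrite normE tE lt_rc => /(_ tz h).
  by rewrite !fE -rcM le_rc.
have [t1 rt1 ht1] := lim 1 ltr01.
have t10 : 0 < t1 := lt_trans r0' rt1.
pose W (zeta : C) (h g : H) : C := if zeta == 0 then 0 else dot (F (- zeta^-1) h) g.
pose S (y : R) := [/\ 0 < y <= 1, y < t1^-1 & D (iy y^-1)].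
have t1V : 0 < t1^-1 by rewrite invr_gt0.
have big zeta : zeta != 0 -> cn zeta < t1^-1 -> t1 < cn (- zeta^-1).
  by rewrite -cn_gt0 => z0; rewrite cnN cnV -[X in _ -> X < _]invrK ltf_pV2 ?posrE ?invr_gt0.
have Fz zeta h : zeta != 0 -> F (- zeta^-1) h = - zeta *: (- zeta^-1 *: F (- zeta^-1) h).
  by move=> z0; rewrite scalerA mulrNN mulfV // scale1r.
have bz zeta h : zeta != 0 -> cn zeta < t1^-1 ->
    nrm d (- zeta^-1 *: F (- zeta^-1) h) <= (ML + 1) * nrm d h.
  move=> z0 zs; have h1 := ht1 _ (big _ z0 zs) h; have h2 := hML h.
  have := nrmDl dh dp (- zeta^-1 *: F (- zeta^-1) h) (L h); lra.
have ML1 h : 0 <= (ML + 1) * nrm d h.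
  have := nrm_ge0 d h; have := le_trans (nrm_ge0 d (L h)) (hML h); rewrite mulrDl; lra.
have Sy0 y : S y -> 0 < y by case=> /andP[].
have zy (y : R) : 0 < y -> - (iy y)^-1 = iy y^-1 by move=> y0; exact: esym (iyV y0).
have GS y : S y -> G (iy y^-1).
  by move=> Sy; have [_ _ Dy] := Sy; split=> //; rewrite im_mkc invr_gt0 Sy0.
have bigS y : S y -> r < `|iy y^-1|.
  move=> Sy; have y0 := Sy0 y Sy; have [_ ys _] := Sy.
  rewrite normE rE lt_rc (lt_trans rt1) // -zy //; apply: big; first exact: iy_neq0.
  by rewrite cn_iy // ltW.
have WS y h g : S y -> W (iy y) h g = dot (Q (iy y^-1) h) g.
  move=> Sy; have y0 := Sy0 y Sy; have [_ _ Dy] := Sy.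
  by rewrite /W (negPf (iy_neq0 y0)) zy // FQ //; exact: bigS.
have MW zeta h g : zeta != 0 -> cn zeta < t1^-1 ->
    cn (dot (F (- zeta^-1) h) g) <= cn zeta * ((ML + 1) * nrm d h * nrm d g).
  move=> z0 zs; rewrite Fz // dotZl cnM cnN.
  apply: ler_wpM2l; first exact: cn_ge0.
  apply: le_trans (cauchy_schwarz dh dp _ _) _.
  by apply: ler_wpM2r; [exact: nrm_ge0 | exact: bz].
exists t1^-1, W; split; first by move=> h g; rewrite /W eqxx.
  exists (`|ML| + 1) => [|y h Sy]; first by rewrite addr_ge0.
  have y0 := Sy0 y Sy; have [_ ys Dy] := Sy; have z0 := iy_neq0 y0.
  rewrite -WS // /W (negPf z0) cnM.
  have y1 : cn (iy y) < t1^-1 by rewrite cn_iy // ltW.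
  have h1 := MW _ h h z0 y1; rewrite cn_iy ?(ltW y0) // in h1.
  rewrite cnV cn_iy ?(ltW y0) // mulrC ler_pdivrMr // mulrC.
  apply: le_trans h1 _; apply: ler_wpM2l; first exact: ltW.
  have := mulr_ge0 (nrm_ge0 d h) (nrm_ge0 d h); have := ler_norm ML; rewrite expr2; nra.
have smS : small S.
  split=> [y [] //|c c0]; have [m [m0 m1 m2 m3]] := exists_below c0 ltr01 t1V.
  have [t mt Dt] := exists_high m^-1; have t0 : 0 < t by apply: lt_trans mt; rewrite invr_gt0.
  have tm : t^-1 < m by rewrite -[m]invrK ltf_pV2 ?posrE ?invr_gt0.
  exists t^-1; last exact: lt_trans m1.
  by split; rewrite ?invrK ?invr_gt0 ?t0 /= ?(ltW (lt_trans tm m2)) //; exact: lt_trans m3.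
split=> //.
- move=> h g; exists (t1^-1 * ((ML + 1) * nrm d h * nrm d g)) => zeta zs.
  have c0 : 0 <= (ML + 1) * nrm d h * nrm d g by rewrite mulr_ge0 ?nrm_ge0.
  have [->|z0] := eqVneq zeta 0; split.
  (* W(zeta)/zeta = - z F(z) at z = -1/zeta, so the derivative at 0 is - L. *)
  + exists (- dot (L h) g) => b b0.
    have n0 : 0 < nrm d h * nrm d g + 1 by rewrite ltr_wpDl // mulr_ge0 ?nrm_ge0.
    have [t2 rt2 ht2] := lim _ (divr_gt0 b0 n0).
    have t20 : 0 < t2 := lt_trans r0' rt2.
    exists t2^-1 => [|w]; first by rewrite invr_gt0.
    rewrite subr0 {2}/W eqxx subr0 => w2; have [->|w0] := eqVneq w 0.
      by rewrite /W eqxx mulr0 subr0 cn0 mulr0.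
    have big2 : t2 < cn (- w^-1).
      by rewrite cnN cnV -[X in X < _]invrK ltf_pV2 ?posrE ?invr_gt0 // cn_gt0.
    have -> : W w h g - - dot (L h) g * w = - w * dot (- w^-1 *: F (- w^-1) h - L h) g.
      by rewrite /W (negPf w0) dotBl {1}Fz // dotZl; ring.
    rewrite cnM cnN mulrC; apply: ler_wpM2r; first exact: cn_ge0.
    apply: le_trans (cauchy_schwarz dh dp _ _) _.
    apply: le_trans (ler_wpM2r (nrm_ge0 _ _) (ht2 _ big2 h)) _.
    rewrite -mulrA mulrAC ler_pdivrMr // ler_wpM2l ?(ltW b0) //; lra.
  + by rewrite /W eqxx cn0 mulr_ge0 // ltW.
  + apply: (@cdiff_near _ (fun w => dot (F (-1 * w^-1) h) g) _ _ (cn zeta)).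
    * by rewrite cn_gt0.
    * move=> w wz; rewrite /W mulN1r; case: eqVneq => // w0; move: wz.
      by rewrite w0 sub0r cnN ltxx.
    * have h1 := cdiffZ (-1) (cdiff_inv z0).
      have rz : [set z | r < `|z|] (-1 * zeta^-1).
        by rewrite /= normE rE lt_rc mulN1r (lt_trans rt1) // big.
      exact: (cdiff_comp (f := fun w => dot (F w h) g) h1 (hol_cdiff hH hF h g rz)).
  + rewrite /W (negPf z0); apply: le_trans (MW _ _ _ z0 zs) _.
    by apply: ler_wpM2r => //; exact: ltW.
- move=> y h g Sy; have y0 := Sy0 y Sy; have [_ _ Dy] := Sy; rewrite WS // sym_dot //.
  have zE : - (- iy y)^-1 = (iy y^-1)^* by rewrite conj_iy -zy // invrN opprK.
  rewrite /W oppr_eq0 (negPf (iy_neq0 y0)) zE FQ //; first exact: (N_symmetric hQ Dy).1.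
  by rewrite normE cnJ -normE; exact: bigS.
- move=> y y' h g Sy Sy'; rewrite !WS // (sZl fh) (sZr fh).
  have := ks_ker ks h g (GS y Sy) (GS y' Sy').
  rewrite (dotJ h) => <-.
  rewrite !mulrA; congr (_ * _); rewrite conjV !conj_iy -!zy ?Sy0 //.
  have := iy_neq0 (Sy0 y Sy); have := iy_neq0 (Sy0 y' Sy').
  by move: (iy y) (iy y') => p q q0 p0; field; rewrite p0 q0.
- by move=> w _; rewrite oppr_eq0 oner_eq0.
- move=> w y h g Gw Sy; rewrite WS // (sZl fh) -(ks_ker ks) //; last exact: GS.
  rewrite mulrA; congr (_ * _); rewrite -zy ?Sy0 //.
  by have := iy_neq0 (Sy0 y Sy); move: (iy y) => p p0; field.
move=> x [c c0 hc]; apply: (ks_orth ks) => w g Gw; rewrite (hermJ fh).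
have [m [m0 m1 m2 m3]] := exists_below c0 ltr01 t1V.
have [t mt Dt] := exists_high m^-1.
have mV : 0 < m^-1 by rewrite invr_gt0.
have vanish t' : m^-1 < t' -> D (iy t') -> f (ep (iy t') g) x = 0.
  move=> mt' Dt'; have t0 : 0 < t' := lt_trans mV mt'.
  have tm : t'^-1 < m by rewrite -[m]invrK ltf_pV2 ?posrE.
  have St : S t'^-1.
    by split; rewrite ?invrK ?invr_gt0 ?t0 /= ?(ltW (lt_trans tm m2)) //; exact: lt_trans m3.
  have := hc _ g St (lt_trans tm m1); rewrite (sZl fh) invrK => /eqP.
  by rewrite mulf_eq0 invr_eq0 (negPf (iy_neq0 _)) ?invr_gt0 //= => /eqP.
have Gt : G (iy t) by split=> //; rewrite im_mkc (lt_trans mV).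
have [rr rr0 hr] := upper_open hH hQ Gt.
rewrite (ks_vanish hH hQ ks (z1 := iy t)) ?conj0 // => b b0.
have [q [q0 q1 q2 _]] := exists_below b0 rr0 rr0.
have E : iy (t + q) - iy t = iy q by rewrite iyD addrAC subrr add0r.
exists (iy (t + q)); split.
- by rewrite -subr_eq0 E iy_neq0.
- by rewrite E cn_iy // ltW.
- apply: vanish; first by lra.
  by apply: (hr _ _).1; rewrite E cn_iy // ltW.
Qed.
End AtInfinity.
End Infinity.

(** * The minimal representation *)

Section MinimalRepresentation.
Context (R : realType).
Local Notation C := (Cplx R).
Context (H : lmodType C) (dot : {dot H for conjC}) (hH : hilbert dot) (kappa : nat).
Context (D : set C) (Q : C -> {linear H -> H}) (hQ : Nclass dot kappa D Q).
Local Notation d := (fun x y : H => dot x y).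
Local Notation G := (upper_dom D).
Let dh : is_herm d := hb_h (dot_hilb hH).
Let dp : is_psd d := hb_p (dot_hilb hH).

Lemma dot_ext x y : (forall g, dot x g = dot y g) -> x = y.
Proof.
move=> h; apply/eqP; rewrite -subr_eq0; apply/eqP/(hb_d (dot_hilb hH)).
rewrite /nrm dotBl // h subrr re0; exact: sqrtr0.
Qed.

Section Assembly.
Context (K : lmodType C) (f : K -> K -> C) (k : nat) (e : 'I_k -> K) (ep : C -> H -> K).
Hypothesis ks : kspace dot D Q f e ep.
Let pt : pont f e := ks_pt ks.
Let fh : is_herm f := pt_h pt.
Let sh : is_herm (sf f e) := pt_sh pt.
Let sp : is_psd (sf f e) := hb_p (pt_hilb pt).
Local Notation N := (nrm (sf f e)).

Lemma f_ext x y : (forall w g, G w -> f x (ep w g) = f y (ep w g)) -> x = y.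
Proof.
move=> h; apply/eqP; rewrite -subr_eq0; apply/eqP/(ks_orth ks) => w g Gw.
by rewrite (sBl fh) h // subrr.
Qed.

Section Operators.
Context (A : {linear K -> K}) (Gam : H -> K).
Hypothesis bA : exists M : R, forall x, N (A x) <= M * N x.
Hypothesis sA : forall x y, f (A x) y = f x (A y).
Hypothesis fGam : forall h w g, G w -> f (Gam h) (ep w g) = dot h (Q w g).
Hypothesis A_ep : forall z h, G z -> A (ep z h) - z *: ep z h = Gam h.

(** The conjugate point lies in G, so Gam h is the image of an [ep] vector under A minus the
    conjugate of z. An eigenvector of A at z is therefore orthogonal to the range of Gam. *)
Lemma rsv_lower z : D z -> im z < 0 -> (forall x, (forall h, f x (Gam h) = 0) ->
  A x = z *: x -> x = 0) -> exists S, rsv f e A z S.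
Proof.
move=> Dz iz nd; have [M hM] := bA.
apply: (resolvent_of_injective pt (lin_linear A) hM sA) => [|x hx]; first by rewrite lt_eqF.
have Gz : G z^* by split; [exact: (N_symmetric hQ Dz).1 | rewrite imJ; lra].
apply: nd => [h|]; last by apply/eqP; rewrite -subr_eq0 hx.
rewrite -(A_ep h Gz) (sBr fh) (sZr fh) conjCK -sA.
by rewrite -(sZl fh) -(sBl fh) hx (s0l fh).
Qed.

(** Surjectivity of A minus the conjugate of z, the adjoint of A - z, makes A - z injective. *)
Lemma rsv_upper z : G z -> (exists S, rsv f e A z^* S) -> exists S, rsv f e A z S.
Proof.
move=> Gz [S [MS [_ hS _]]]; have [M hM] := bA.
apply: (resolvent_of_injective pt (lin_linear A) hM sA) => [|x hx].
  by rewrite gt_eqF // Gz.2.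
apply: (pont_nondeg pt) => y; rewrite -(hS y) (sBr fh) (sZr fh) conjCK -sA.
by rewrite -(sZl fh) -(sBl fh) hx (s0l fh).
Qed.

(** Expand [ep] at x0. The zeroth coefficient solves (A - x0) eta = Gam h, and the local shift B
    turns out to be the two-sided inverse of A - x0. *)
Lemma rsv_real (x0 : R) : D (rc x0) -> exists S, rsv f e A (rc x0) S /\
  forall h g, f (S (Gam h)) (Gam g) = dot (Q (rc x0) h) g.
Proof.
move=> D0; have [s0 [s00 GS ld]] := real_data hH hQ ks D0.
have [eta [w [B [ht [hB [M hM] sB] nd hc he]]]] := local_theorem ks ld.
have [t [St nt]] := small_seq (ld_small ld).
have Tep c h : G c -> A (ep c h) - rc x0 *: ep c h = Gam h + (c - rc x0) *: ep c h.
  by move=> Gc; rewrite -(A_ep h Gc) scalerBl addrA subrK.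
have etaG h g : f (eta h 0%N) (Gam g) = dot (Q (rc x0) h) g.
  have c1 := pont_lim_form pt (Gam g) (tends_seq (ht h) St nt).
  apply: clim_unique c1 _.
  have [M1 [r1 [M10 r10 hl]]] := hol_lip hH (N_holomorphic hQ) D0.
  have c0 : 0 <= M1 * nrm d h * nrm d g by rewrite !mulr_ge0 // nrm_ge0.
  have [n1 hn1] := nt _ r10.
  apply: (null_near (N := n1) _ (nullZ c0 nt)) => n /hn1 tn.
  rewrite (hermJ fh) fGam; last exact: GS.
  rewrite -(dotJ hH) -dotBl //.
  apply: le_trans (cauchy_schwarz dh dp _ _) _.
  have t0 := small_gt0 (ld_small ld) (St n).
  have E : cn (rc x0 + iy (t n) - rc x0) = t n by rewrite addrAC subrr add0r cn_iy // ltW.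
  have := hl (rc x0 + iy (t n)); rewrite E => /(_ tn h) h1.
  apply: le_trans (ler_wpM2r (nrm_ge0 _ _) h1) _.
  by rewrite le_eqVlt; apply/orP; left; apply/eqP; ring.
have Teta h : A (eta h 0%N) - rc x0 *: eta h 0%N = Gam h.
  apply: f_ext => c g Gc; rewrite fGam // (sBl fh) (sZl fh) sA.
  have -> : A (ep c g) = Gam g + c *: ep c g.
    by rewrite -(A_ep g Gc) subrK.
  rewrite (sDr fh) (sZr fh) etaG; have [h0 _] := hc c h g Gc.
  rewrite addr0 in h0.
  have -> : dot (Q (rc x0) h) g = (rc x0 - c^*) * f (eta h 0%N) (ep c g) + dot h (Q c g).
    by rewrite h0 subrK.
  by ring.
(* The resolvent identity with B in the place of the inverse of A - x0, verified against the total
   family of coefficients. *)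
have Beq z h : G z -> (z - rc x0) *: B (ep z h) = ep z h - eta h 0%N.
  move=> Gz; apply/eqP; rewrite -subr_eq0; apply/eqP/nd => g n.
  have [_ h1] := hc z g h Gz; have := h1 n; rewrite mul1r.
  rewrite -[w g h n.+1]conjCK (he _ _ _).2 -(he g h n).1.
  move/(congr1 conjC); rewrite conjCK conjD conjM conjB conjCK conj_rc -!(hermJ fh).
  rewrite (sBl fh) (sZl fh) sB hB (sBl fh) => <-; ring.
have TB z h : G z -> A (B (ep z h)) - rc x0 *: B (ep z h) = ep z h.
  move=> Gz; have zx : z - rc x0 != 0.
    by apply/eqP => /(congr1 im); rewrite imB im_rc im0; have := Gz.2; lra.
  apply: (scalerI zx).
  have -> : (z - rc x0) *: (A (B (ep z h)) - rc x0 *: B (ep z h)) =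
      A ((z - rc x0) *: B (ep z h)) - rc x0 *: ((z - rc x0) *: B (ep z h)).
    by rewrite (linZ (lin_linear A)) scalerBr !scalerA [rc x0 * _]mulrC.
  rewrite Beq // linearB scalerBr opprB [rc x0 *: _ - _]addrC addrACA [- A (eta _ _) + _]addrC -[rc x0 *: _ - A _]opprB.
  by rewrite Teta Tep // addrAC subrr add0r.
have BT x : B (A x - rc x0 *: x) = x.
  apply: f_ext => z h Gz; rewrite sB (sBl fh) (sZl fh) sA.
  by rewrite -{3}(TB z h Gz) (sBr fh) (sZr fh) conj_rc.
have TB' x : A (B x) - rc x0 *: B x = x.
  apply/eqP; rewrite -subr_eq0; apply/eqP/(pont_nondeg pt) => y.
  rewrite (sBl fh) -{2}(BT y) -sB (sBr fh) (sZr fh) conj_rc -sA (sBl fh) (sZl fh).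
  by rewrite subrr.
exists B; split; first by exists M; split.
by move=> h g; rewrite -(Teta h) BT etaG.
Qed.
Lemma Gam_form_bound v : inspan D ep v ->
  exists2 b : R, 0 <= b & forall h, cn (f (Gam h) v) <= b * nrm d h.
Proof.
move=> [n [c [z [g [Gz ->]]]]]; exists (\sum_p cn (c p) * nrm d (Q (z p) (g p))) => [|h].
  by apply: sumr_ge0 => p _; rewrite mulr_ge0 ?cn_ge0 ?nrm_ge0.
rewrite (s_sumr fh) mulr_suml; apply: le_trans (cn_sum _ _ _) _; apply: ler_sum => p _.
rewrite (sZr fh) cnM cnJ fGam // -mulrA; apply: ler_wpM2l; first exact: cn_ge0.
by rewrite mulrC; exact: (cauchy_schwarz dh dp).
Qed.

(** Beyond the indefinite square, the Hilbert norm involves only the pairings with the e i. These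
    lie in the span of [ep], where [fGam] expresses the pairings through Q. *)
Lemma Gam_bounded (M : R) : 0 <= M -> (forall h, cn (f (Gam h) (Gam h)) <= M * nrm d h ^+ 2) ->
  exists M' : R, forall h, N (Gam h) <= M' * nrm d h.
Proof.
move=> M0 hM; have hb i : exists b : R, 0 <= b /\ forall h, cn (f (Gam h) (e i)) <= b * nrm d h.
  by have [b b0 hb] := Gam_form_bound (ks_e ks i); exists b.
have [b {}hb] := choice hb.
pose X := M + 2 * \sum_i b i ^+ 2.
have X0 : 0 <= X by rewrite addr_ge0 // mulr_ge0 // sumr_ge0 // => i _; exact: sqr_ge0.
exists (X + 1) => h; have n0 := nrm_ge0 d h.
have h1 : N (Gam h) ^+ 2 <= X * nrm d h ^+ 2.
  rewrite (N2E pt) [X * _]mulrDl; apply: lerD; first exact: le_trans (re_le_cn _) (hM h).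
  rewrite -[2 * _ * _]mulrA ler_pM2l // mulr_suml; apply: ler_sum => i _.
  rewrite -exprMn; apply: lerXn2r; rewrite ?nnegrE ?cn_ge0 ?mulr_ge0 ?(hb i).1 //.
  exact: (hb i).2.
have X1 : 0 <= X + 1 by lra.
rewrite -(@ler_pXn2r _ 2) ?nnegrE ?nrm_ge0 ?(mulr_ge0 X1) //.
apply: le_trans h1 _; rewrite exprMn; apply: ler_wpM2r; first exact: sqr_ge0.
by have := sqr_ge0 X; rewrite !expr2; nra.
Qed.
End Operators.
End Assembly.

Theorem minimal_of_infinity (L : {linear H -> H}) : holomorphic_at_infinity dot D Q L ->
  exists (K : lmodType C) (f : {hermitian K for false & conjC})
         (A : {linear K -> K}) (Gam : {linear H -> K}) (Gp : {linear K -> H}),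
    minimal_representation dot D Q f A Gam Gp.
Proof.
move=> hinf.
have [K [f [k [e [ep [p1 p2 p3 p4 p5]]]]]] := kernel_space hH hQ.
have ks : kspace dot D Q f e ep by [].
have [F FE] := herm_pack (pt_h p1); move: {p1 p2 p3 p4 p5} ks; rewrite -FE {f FE} => ks.
have pt := ks_pt ks; set f := (fun x y : K => F x y) in ks pt.
have fh := pt_h pt; have sh := pt_sh pt; have sp := hb_p (pt_hilb pt).
have [s0 [W [W0 [M0 M00 hM0] ld]]] := infinity_data hH hQ ks hinf.
have [eta [w [B [ht [hB [MB hMB] sB] nd hc he]]]] := local_theorem ks ld.
(* From zeta^-1 (A - z)^-1 = (1 + zeta A)^-1 at z = -1/zeta, the coefficients are the powers of - A
   applied to Gam h. *)
have [|A AE] := @linear_of _ _ _ (fun x => - B x).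
  by move=> a x y; rewrite linearP opprD scalerN.
have fG h c g : G c -> f (eta h 0%N) (ep c g) = dot h (Q c g).
  move=> Gc; have [h1 _] := hc c h g Gc; move: h1.
  by rewrite W0 sub0r mulN1r => /oppr_inj.
have [|Gam GE] := @linear_of _ _ _ (fun h => eta h 0%N).
  move=> a x y; apply: (f_ext ks) => c g Gc.
  by rewrite (hermL fh) !fG // -(dotZl hH) linearDl.
have fGam h c g : G c -> f (Gam h) (ep c g) = dot h (Q c g) by move=> ?; rewrite GE fG.
have bA : exists M : R, forall x, nrm (sf f e) (A x) <= M * nrm (sf f e) x.
  by exists MB => x; rewrite AE (nrmN sh).
have sA x y : f (A x) y = f x (A y) by rewrite !AE (sNl fh) (sNr fh) sB.
have A_ep z h : G z -> A (ep z h) - z *: ep z h = Gam h.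
  move=> Gz; apply/eqP; rewrite -subr_eq0; apply/eqP/nd => g n.
  have [_ h1] := hc z g h Gz; have := h1 n; rewrite -[w g h n.+1]conjCK (he _ _ _).2 -(he g h n).1.
  move/(congr1 conjC); rewrite conjCK conjD !conjM !conjN conjCK conj1 -!(hermJ fh).
  rewrite GE AE !(sBl fh) (sNl fh) (sZl fh) sB hB => <-; ring.
have [t [St nt]] := small_seq (ld_small ld).
(* The square of Gam h is the limit of its pairing with zeta^-1 [ep], which is, up to conjugation,
   the quantity bounded by [hM0]. *)
have bG : exists M : R, forall h, nrm (sf f e) (Gam h) <= M * nrm d h.
  apply: (Gam_bounded ks fGam M00) => h; rewrite GE.
  have c1 := pont_lim_form pt (eta h 0%N) (tends_seq (ht h) St nt).
  apply: le_eps => b b0; have [n hn] := c1 _ b0; have := hn n (leqnn n).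
  have h1 := cnDl (f (eta h 0%N) (eta h 0%N)) (f ((iy (t n))^-1 *: ep (iy (t n)^-1) h) (eta h 0%N)).
  have [_ _ Dt] := St n; have t0 := small_gt0 (ld_small ld) (St n).
  have Gt : G (iy (t n)^-1) by split=> //; rewrite im_mkc invr_gt0.
  have h2 := hM0 _ h (St n); rewrite cnBC; move: h1 h2.
  rewrite [f (_ *: _) _](hermJ fh) (sZr fh) fG // (dotJ hH h) -conjM cnJ conjCK !cnJ.
  by move: (cn _) (cn _) (cn _) (M0 * _) => q1 q2 q3 q4; lra.
have hGp x : exists y, forall h, dot y h = f x (Gam h).
  have [M hM] := bG.
  have [|h|y hy] := riesz (l := fun h => f (Gam h) x) (M := M * nrm (sf f e) x) dh dp (hb_c (dot_hilb hH)).
  - by move=> a g g'; rewrite linearP (hermL fh).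
  - apply: le_trans (pont_bound pt _ _) _; rewrite mulrAC.
    by apply: ler_wpM2r; [exact: nrm_ge0 | exact: hM].
  by exists y => h; rewrite (dotJ hH) -hy -(hermJ fh).
have [Gp0 hGp0] := choice hGp.
have [|Gp GpE] := @linear_of _ _ _ Gp0.
  move=> a x y; apply: dot_ext => g.
  by rewrite hGp0 (hermL fh) -!hGp0 -(dotZl hH) linearDl.
have adj x h : dot (Gp x) h = f x (Gam h) by rewrite GpE hGp0.
have [J [pJ JE]] := pont_pontryagin pt.
exists K, F, A, Gam, Gp, J.
rewrite /jnorm JE -/f.
have resE z S : rsv f e A z S -> resolvent (fnorm (sf f e)) A z S.
  by move=> h; apply/bounded_inverseE.
have rsvE z S : resolvent (fnorm (sf f e)) A z S -> rsv f e A z S.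
  by move/bounded_inverseE; apply.
(* An eigenvector orthogonal to all Gam h is orthogonal to all coefficients, since B multiplies it
   by - z. *)
have low z : D z -> im z < 0 -> exists S, rsv f e A z S.
  move=> Dz iz; apply: (rsv_lower ks bA sA A_ep Dz iz) => x hx Ax.
  apply: nd => h m; elim: m => [|m ih]; first by rewrite -GE hx.
  by rewrite -hB -sB -[B x]opprK -AE Ax (sNl fh) (sZl fh) ih mulr0 oppr0.
have up z : G z -> exists S, rsv f e A z S.
  move=> Gz; apply: (rsv_upper ks bA sA Gz); apply: low.
    exact: (N_symmetric hQ Gz.1).1.
  by rewrite imJ oppr_lt0 Gz.2.
have S_ep z S h : G z -> rsv f e A z S -> S (Gam h) = ep z h.
  by move=> Gz [M [c1 _ _]]; rewrite -(A_ep z h Gz) c1.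
split=> //.
- by split=> //; apply/bounded_opE.
- by split=> //; apply/bounded_opE.
- move=> z Dz; have [iz|iz|iz] := ltrgt0P (im z).
  + have Gz : G z by [].
    have [S hS] := up z Gz; exists S; first exact: resE.
    move=> h; rewrite (S_ep z S h Gz hS); apply: dot_ext => g.
    by rewrite adj (hermJ fh) fGam // -(dotJ hH).
  + have [S hS] := low z Dz iz; exists S; first exact: resE.
    have [M [_ c2 _]] := hS; have [Dz' ad] := N_symmetric hQ Dz.
    have Gz : G z^* by split; rewrite // imJ; lra.
    move=> h; apply: dot_ext => g; rewrite adj -(A_ep _ g Gz) (sBr fh) (sZr fh) conjCK -sA.
    by rewrite -(sZl fh) -(sBl fh) c2 fGam // (dotJ hH) -ad -(dotJ hH).
  + have zE : z = rc (re z) by apply: rc_re.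
    have [|S [hS hS2]] := rsv_real ks sA fGam A_ep (x0 := re z).
      by rewrite -zE.
    exists S; first by rewrite zE; exact: resE.
    by move=> h; apply: dot_ext => g; rewrite adj hS2 -zE.
- move=> x b b0.
  have [b1 b2] : 0 < re b /\ b = rc (re b).
    by split; [move: b0; rewrite lt_cE re0 => /andP[] | exact/ge0_rc/ltW].
  have [v [n [c [z [h [Gz ->]]]]] hv] := ks_dense ks x b1.
  have [S hS] := choice (fun p => up (z p) (Gz p)).
  exists n, z, S, (fun p => c p *: h p); split=> [p|]; first exact: resE.
  have -> : \sum_(i < n) S i (Gam (c i *: h i)) = \sum_p c p *: ep (z p) (h p).
    by apply: eq_bigr => p _; rewrite !linearZ /= (S_ep _ _ _ (Gz p) (hS p)).
  by rewrite (fnormE sh sp) b2 lt_rc.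
Qed.
End MinimalRepresentation.

(** * The inverse function *)

Section NormChange.
Context (R : realType).
Local Notation C := (Cplx R).

Definition bop (V W : lmodType C) (s : V -> V -> C) (t : W -> W -> C) (T : V -> W) :=
  exists M : R, forall x, nrm t (T x) <= M * nrm s x.

Lemma bop_pos (V W : lmodType C) (s : V -> V -> C) (t : W -> W -> C) (T : V -> W) :
  bop s t T -> exists2 M : R, 0 <= M & forall x, nrm t (T x) <= M * nrm s x.
Proof.
move=> [M hM]; exists `|M| => // x; apply: le_trans (hM x) _.
by apply: ler_wpM2r; [exact: nrm_ge0 | exact: ler_norm].
Qed.

Lemma bop_comp (V W X : lmodType C) (s : V -> V -> C) (t : W -> W -> C) (q : X -> X -> C)
    (T : V -> W) (U : W -> X) : bop s t T -> bop t q U -> bop s q (fun x => U (T x)).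
Proof.
move=> /bop_pos[M M0 hM] /bop_pos[M' M0' hM']; exists (M' * M) => x.
apply: le_trans (hM' _) _; rewrite -mulrA; exact: ler_wpM2l.
Qed.

Lemma bop_sub (V W : lmodType C) (s : V -> V -> C) (t : W -> W -> C) (T U : V -> W) :
  is_herm t -> is_psd t -> bop s t T -> bop s t U -> bop s t (fun x => T x - U x).
Proof.
move=> ht pt [M hM] [M' hM']; exists (M + M') => x.
by apply: le_trans (nrmB ht pt _ _) _; rewrite mulrDl lerD.
Qed.

Lemma bop_scale (V W : lmodType C) (s : V -> V -> C) (t : W -> W -> C) (T : V -> W) a :
  is_herm t -> is_psd t -> bop s t T -> bop s t (fun x => a *: T x).
Proof.
move=> ht pt [M hM]; exists (cn a * M) => x; rewrite (nrmZ ht) -mulrA.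
by apply: ler_wpM2l; [exact: cn_ge0 | exact: hM].
Qed.

Lemma bop_id (V : lmodType C) (s t : V -> V -> C) (c : R) :
  (forall x, nrm t x <= c * nrm s x) -> bop s t (fun x => x).
Proof. by move=> h; exists c. Qed.

Lemma binv_bop (V W : lmodType C) (s : V -> V -> C) (t : W -> W -> C) (T : V -> W)
    (S : {linear W -> V}) : (exists M, binv s t T S M) <-> [/\ cancel T S, cancel S T & bop t s S].
Proof. by split=> [[M []]|[h1 h2 [M h3]]]; [split=> //; exists M | exists M; split]. Qed.
End NormChange.

Section RangeProjection.
Context (R : realType).
Local Notation C := (Cplx R).

Lemma range_proj (K : lmodType C) (E : {linear K -> K}) :
  exists p : {linear K -> range_space E}, forall x, \val (p x) = E x.
Proof.
have h x : E x \in range_pred E by apply/asboolP; exists x.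
have [|p hp] := @linear_of _ K (range_space E) (fun x => exist _ (E x) (h x)).
  by move=> a x y; apply: val_inj; rewrite /= linearP.
by exists p => x; rewrite hp.
Qed.

Lemma range_val (K : lmodType C) (E : {linear K -> K}) (x : range_space E) :
  (forall y, E (E y) = E y) -> E (\val x) = \val x.
Proof. by move=> h; have /asboolP[y ->] := valP x; rewrite h. Qed.
End RangeProjection.

(** * The Schur complement with respect to the range of Gam *)

Section Schur.
Context (R : realType).
Local Notation C := (Cplx R).
Context (H : lmodType C) (dot : {dot H for conjC}) (hH : hilbert dot).
Context (D : set C) (Q : C -> {linear H -> H}).
Context (K : lmodType C) (F : {hermitian K for false & conjC}) (k : nat) (e : 'I_k -> K).
Context (A : {linear K -> K}) (Gam : {linear H -> K}) (Gp : {linear K -> H}) (GG : {linear H -> H}).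
Local Notation d := (fun x y : H => dot x y).
Local Notation f := (fun x y : K => F x y).
Local Notation s := (sf f e).
Hypothesis pt : pont f e.
Hypothesis bA : bop s s A.
Hypothesis sA : forall x y, F (A x) y = F x (A y).
Hypothesis bGam : bop d s Gam.
Hypothesis adj : forall x h, dot (Gp x) h = F x (Gam h).
Hypothesis bGG : bop d d GG.
Hypothesis GG1 : cancel (Gp \o Gam) GG.
Hypothesis GG2 : cancel GG (Gp \o Gam).
Hypothesis rep : forall z, D z -> exists2 S : {linear K -> K}, rsv f e A z S &
  forall h, Q z h = Gp (S (Gam h)).
Let fh : is_herm f := pt_h pt.
Let sh : is_herm s := pt_sh pt.
Let sp : is_psd s := hb_p (pt_hilb pt).
Let dh : is_herm d := hb_h (dot_hilb hH).
Let dp : is_psd d := hb_p (dot_hilb hH).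
Local Notation E := (coproj Gam Gp GG).

(** Duality: the square of the norm of Gp x is the pairing of x with Gam (Gp x). *)
Lemma bGp : bop s d Gp.
Proof.
have [M M0 hM] := bop_pos bGam; exists M => x.
have [n0|n0] := eqVneq (nrm d (Gp x)) 0; first by rewrite n0 mulr_ge0 // nrm_ge0.
have n1 : 0 < nrm d (Gp x) by rewrite lt_def n0 nrm_ge0.
rewrite -(ler_pM2r n1) -expr2 (nrm2 dp) adj.
apply: le_trans (re_le_cn _) _; apply: le_trans (pont_bound pt _ _) _.
have -> : M * nrm s x * nrm d (Gp x) = nrm s x * (M * nrm d (Gp x)) by ring.
by apply: ler_wpM2l; [exact: nrm_ge0 | exact: hM].
Qed.

Lemma GpGam_sym x y : dot (Gp (Gam x)) y = dot x (Gp (Gam y)).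
Proof. by rewrite adj (dotJ hH) adj; exact: (hermJ fh). Qed.

Lemma GG_sym x y : dot (GG x) y = dot x (GG y).
Proof. by rewrite -{1}(GG2 y) -{2}(GG2 x) /= GpGam_sym. Qed.

Lemma EE x : E x = x - Gam (GG (Gp x)). Proof. by []. Qed.
Lemma Gp_E x : Gp (E x) = 0.
Proof. by rewrite EE linearB; have /= -> := GG2 (Gp x); rewrite subrr. Qed.
Lemma E_Gam h : E (Gam h) = 0.
Proof. by rewrite EE; have /= -> := GG1 h; rewrite subrr. Qed.
Lemma E_of x : Gp x = 0 -> E x = x.
Proof. by move=> h; rewrite EE h !linear0 addr0. Qed.
Lemma E_idem x : E (E x) = E x. Proof. by rewrite E_of // Gp_E. Qed.

Lemma E_sym x y : F (E x) y = F x (E y).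
Proof.
rewrite !EE (sBl fh) (sBr fh); congr (_ - _).
by rewrite -adj -GG_sym (dotJ hH) adj; exact: (hermJ fh).
Qed.

Lemma bE : bop s s E.
Proof.
apply: (bop_sub sh sp); first by exists 1 => x; rewrite mul1r.
exact: bop_comp (bop_comp bGp bGG) bGam.
Qed.

Lemma val_Gp (x : range_space E) : Gp (\val x) = 0.
Proof. by rewrite -(range_val _ E_idem) Gp_E. Qed.

(** In the decomposition K = P K + E K the inverse of Q is a Schur complement. The new operator is
    the compression of A to the range of E, the new Gam is E A Gam GG, the constant term is - GG Gp
    A Gam GG, and the coefficient of z is GG. *)
Theorem schur_inverse : (exists2 z, D z & boundedly_invertible (fnorm dot) (fnorm dot) (Q z)) ->
  inverse_representation dot D Q (range_form E F).
Proof.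
move=> hz; split=> //.
have [M hM] := bE; have [k' [e' [pt' [c c0 hc]]]] := pont_range pt hM E_idem E_sym.
have [p pE] := range_proj E.
have [J [pJ JE]] := pont_pontryagin pt'.
set s' := sf _ e' in hc JE.
have sh' : is_herm s' := pt_sh pt'; have sp' : is_psd s' := hb_p (pt_hilb pt').
have bval : bop s' s \val by exists c => x; have [] := hc x.
have bp : bop s s' p.
  have [c1 c10 h1] := bop_pos bE; exists (c * c1) => x.
  have [h2 _] := hc (p x); apply: le_trans h2 _; rewrite pE -mulrA.
  exact: ler_wpM2l.
have [|At AtE] := @linear_of _ _ _ (fun x : range_space E => p (A (\val x))).
  by move=> a x y; rewrite -linearP -linearP.
have [|Gt GtE] := @linear_of _ _ _ (fun h : H => p (A (Gam (GG h)))).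
  by move=> a x y; rewrite !linearP.
have [|Gpt GptE] := @linear_of _ _ _ (fun x : range_space E => GG (Gp (A (\val x)))).
  by move=> a x y; rewrite -!linearP.
have [|S SE] := @linear_of _ _ _ (fun h : H => - GG (Gp (A (Gam (GG h))))).
  by move=> a x y; rewrite !linearP.
have Ev (x : range_space E) : E (\val x) = \val x := range_val x E_idem.
exists J, At, Gt, Gpt, S, GG; rewrite /jnorm JE -/s'.
have boE := @bounded_opE R.
have bAG : bop d s (fun h => A (Gam (GG h))) := bop_comp (bop_comp bGG bGam) bA.
split=> //.
- split.
    apply/boE => //; have [c1 h1] := bop_comp (bop_comp bval bA) bp.
    by exists c1 => x; rewrite AtE.
  move=> x y; change (F (\val (At x)) (\val y) = F (\val x) (\val (At y))).
  by rewrite !AtE !pE E_sym Ev sA -E_sym Ev.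
- split.
    apply/boE => //; have [c1 h1] := bop_comp bAG bp.
    by exists c1 => x; rewrite GtE.
  move=> x h; change (dot (Gpt x) h = F (\val x) (\val (Gt h))).
  by rewrite GptE GG_sym adj sA GtE pE -E_sym Ev.
- split.
  + split.
      apply/boE => //; have [c1 h1] := bop_comp (bop_comp bAG bGp) bGG.
      by exists c1 => x; rewrite SE (nrmN dh).
    move=> x y; rewrite !SE -[dot (- _) _]/(d _ _) -[RHS]/(d _ _) (sNl dh) (sNr dh); congr (- _).
    by rewrite GG_sym adj sA [LHS](hermJ fh) -adj -GG_sym -(dotJ hH).
  + by split; [apply/boE | move=> x y; rewrite GG_sym].
  + exists (Gp \o Gam); split=> //; apply/boE => //; exact: bop_comp bGam bGp.
move=> z Qi Dz /(bounded_inverseE _ _ dh dp dh dp) /binv_bop[Q1 Q2 bQi].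
have [T /binv_bop[T1 T2 bT] QE] := rep Dz.
(* Correcting T y by an element of the range of T Gam puts it in the kernel of Gp, that is, in the
   range of E, at the cost of a term in the range of Gam that E removes. So v is the resolvent of
   the compression. *)
pose v y := T y - T (Gam (Qi (Gp (T y)))).
have Gpv y : Gp (v y) = 0 by rewrite /v linearB /= -QE Q2 subrr.
have Av y : A (v y) - z *: v y = y - Gam (Qi (Gp (T y))).
  rewrite /v linearB scalerBr opprB [z *: _ - _]addrC addrACA.
  rewrite [- A (T (Gam _)) + _]addrC -[z *: _ - A _]opprB.
  by rewrite T2 T2.
have [|Rt RtE] := @linear_of _ _ _ (fun y : range_space E => p (v (\val y))).
  move=> a x y; rewrite -linearP; congr (p _); rewrite /v.
  have -> : \val (a *: x + y) = a *: \val x + \val y by [].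
  by rewrite !linearP scalerDr addrACA.
have Rtv y : \val (Rt y) = v (\val y) by rewrite RtE pE E_of.
have AtV x : \val (At x) = E (A (\val x)) by rewrite AtE pE.
have RtL : cancel (fun x => At x - z *: x) Rt.
    move=> x; apply: val_inj; rewrite Rtv.
    have -> : \val (At x - z *: x) = A (\val x) - z *: \val x - Gam (GG (Gp (A (\val x)))).
      have -> : \val (At x - z *: x) = \val (At x) - z *: \val x by [].
      by rewrite AtV EE addrAC.
    rewrite /v linearB /= T1 linearB /= val_Gp -QE sub0r [Qi _]linearN /= Q1.
    by rewrite linearN linearN opprK subrK.
have RtR : cancel Rt (fun x => At x - z *: x).
    move=> y; apply: val_inj.
    have -> : \val (At (Rt y) - z *: Rt y) = \val (At (Rt y)) - z *: \val (Rt y) by [].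
    rewrite AtV Rtv -{2}(E_of (Gpv (\val y))) -linearZ -linearB Av linearB E_Gam subr0.
    exact: Ev.
have bRt : bop s' s' Rt.
    have bv : bop s s v.
      apply: (bop_sub sh sp bT); exact: bop_comp (bop_comp (bop_comp (bop_comp bT bGp) bQi) bGam) bT.
    have [c1 h1] := bop_comp (bop_comp bval bv) bp.
    by exists c1 => x; rewrite RtE.
exists Rt; first by apply/bounded_inverseE => //; apply/binv_bop.
(* This x has Gp x = h, so its P-component is Gam (GG h); projecting (A - z) x = Gam (Qi h) by E
   determines its other component. *)
move=> h; set x := T (Gam (Qi h)).
have Gpx : Gp x = h by rewrite /x -QE Q2.
have Ax : A x - z *: x = Gam (Qi h) by exact: T2.
have dec : x = E x + Gam (GG h) by rewrite EE Gpx subrK.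
have Px : p x = - Rt (Gt h).
  have inj (a b : range_space E) : At a - z *: a = At b - z *: b -> a = b.
    have [Mr [r1 _ _]] := (binv_bop s' s' (fun x => At x - z *: x) Rt).2 (And3 RtL RtR bRt).
    exact: (can_inj r1).
  apply: inj; apply: val_inj.
  have vs (a : range_space E) : \val (At a - z *: a) = \val (At a) - z *: \val a by [].
  have RtGt := RtR (Gt h).
  have -> : At (- Rt (Gt h)) - z *: - Rt (Gt h) = - Gt h.
    by rewrite linearN scalerN -opprD [X in - X]RtGt.
  rewrite vs AtV pE.
  have -> : \val (- Gt h) = - \val (Gt h) by [].
  have lE := lin_linear E; have zE : z *: E x = E (z *: E x) by rewrite (linZ lE) E_idem.
  rewrite GtE pE {}zE -(linB lE) -(linN lE).
  have -> : A (E x) - z *: E x = Gam (Qi h) - A (Gam (GG h)) + z *: Gam (GG h).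
    have -> : E x = x - Gam (GG h) by rewrite {2}dec addrK.
    rewrite linearB scalerBr opprB [z *: _ - _]addrC addrACA -Ax.
    by rewrite -!addrA; congr (_ + _); rewrite addrCA.
  by rewrite (linD lE) (linB lE) (linZ lE) !E_Gam scaler0 addr0 sub0r (linN lE).
(* The component along the range of Gam: apply GG Gp to (A - z) x = Gam (Qi h). *)
have Qh : Qi h = GG (Gp (A x)) - z *: GG h.
  have /= <- := GG1 (Qi h); rewrite -Ax.
  by rewrite !linearB !linearZ /= Gpx.
have -> : Gpt (Rt (Gt h)) = - GG (Gp (A (E x))).
  by rewrite -[Rt _]opprK -Px linearN GptE pE.
rewrite Qh opprB SE; have -> : A x = A (E x) + A (Gam (GG h)) by rewrite -linearD -dec.
by rewrite !linearD addrC.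
Qed.
End Schur.

(** * Behaviour of Q for large z *)

Section NearInfinity.
Context (R : realType).
Local Notation C := (Cplx R).
Context (H : lmodType C) (dot : {dot H for conjC}) (hH : hilbert dot) (kappa : nat).
Context (D : set C) (Q : C -> {linear H -> H}) (hQ : Nclass dot kappa D Q).
Local Notation d := (fun x y : H => dot x y).
Let dh : is_herm d := hb_h (dot_hilb hH).
Let dp : is_psd d := hb_p (dot_hilb hH).
Local Notation nH := (fnorm dot).

Lemma infinity_lim (L : {linear H -> H}) (b : R) : holomorphic_at_infinity dot D Q L -> 0 < b ->
  exists2 t : R, 0 < t & forall z, D z -> t < cn z -> forall h,
    nrm d (z *: Q z h - L h) <= b * nrm d h.
Proof.
move=> [r [F [r0 _ FQ _ hl]]] b0.
have fE x : fnorm dot x = rc (nrm d x) := fnormE dh dp x.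
have b0' : 0 < rc b :> C by rewrite -rc0 lt_rc.
have [t rt ht] := hl _ b0'; have t0 := lt_trans r0 rt.
have tE : t = rc (re t) by apply/ge0_rc/ltW.
exists (re t) => [|z Dz tz h]; first by move: t0; rewrite lt_cE re0 => /andP[].
have nz : t < `|z| by rewrite normE tE lt_rc.
have := ht z nz h; rewrite FQ //; last exact: lt_trans nz.
by rewrite !fE -rcM le_rc.
Qed.

Lemma invertible_scale (T S : {linear H -> H}) (M : R) z : z != 0 ->
  binv d d (fun x => z *: T x) S M -> boundedly_invertible nH nH T.
Proof.
move=> z0 [c1 c2 hM].
have [|S' S'E] := @linear_of _ _ _ (fun x : H => S (z *: x)).
  by move=> a x y; rewrite scalerDr scalerA mulrC -scalerA linearP.
exists S'; apply/bounded_inverseE => //; apply/binv_bop; split.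
- by move=> x; rewrite S'E c1.
- by move=> y; apply: (scalerI z0); rewrite S'E c2.
- have [M' h'] : bop d d (fun x => S (z *: x)).
    apply: (bop_comp (s := d) (t := d) (T := fun x => z *: x) (U := S)); last by exists M.
    by exists (cn z) => x; rewrite (nrmZ dh).
  by exists M' => x; rewrite S'E.
Qed.

(** For large z the operator z Q z is a perturbation of L small enough for [binv_perturb]. *)
Lemma invertible_large (L : {linear H -> H}) : holomorphic_at_infinity dot D Q L ->
  boundedly_invertible nH nH L ->
  exists t : R, forall z, D z -> t < cn z -> boundedly_invertible nH nH (Q z).
Proof.
move=> hinf [S /(bounded_inverseE _ _ dh dp dh dp) /binv_bop[c1 c2 /bop_pos[M M0 hM]]].
have b0 : 0 < (2 * (M + 1))^-1 by rewrite invr_gt0 mulr_gt0 //; lra.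
have [t t0 ht] := infinity_lim hinf b0.
exists t => z Dz tz.
have lE : lin (fun x => z *: Q z x - L x).
  move=> a x y; rewrite (lin_linear (Q z)) (lin_linear L) scalerDr opprD addrACA scalerBr.
  by rewrite !scalerA mulrC.
have Mb : M * (2 * (M + 1))^-1 <= 2^-1.
  have M1 : 0 < 2 * (M + 1) by rewrite mulr_gt0 //; lra.
  by rewrite ler_pdivrMr //; lra.
have hS0 : binv d d L S M by split.
have [S' hS'] := binv_perturb (dot_hilb hH) dh dp (lin_linear L) lE M0 hS0 (ht z Dz tz) Mb.
have z0 : z != 0 by rewrite -cn_gt0 (lt_trans t0).
apply: (@invertible_scale (Q z) S' (2 * M + 1) z z0).
case: hS' => q1 q2 q3; split=> // [x|y].
  by have := q1 x; rewrite addrC subrK.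
by have := q2 y; rewrite addrC subrK.
Qed.

Theorem regular_of_infinity : invertible_derivative_at_infinity dot D Q -> regular dot D Q.
Proof.
move=> [L hinf hL]; have [t ht] := invertible_large hinf hL.
have [u ut Du] := exists_high hH hQ (Num.max t 0).
have [u0 tu] : 0 < u /\ t < u by move: ut; rewrite gt_max => /andP[].
exists (iy u); first by rewrite Im_gt0 im_mkc.
by apply: ht; rewrite // cn_iy // ltW.
Qed.

Theorem inverse_of_minimal (K : lmodType C) (f : {hermitian K for false & conjC})
    (A : {linear K -> K}) (Gam : {linear H -> K}) (Gp : {linear K -> H}) :
  invertible_derivative_at_infinity dot D Q ->
  minimal_representation dot D Q f A Gam Gp ->
  exists2 GG : {linear H -> H}, bounded_inverse nH nH (Gp \o Gam) GG &
    inverse_representation dot D Q (range_form (coproj Gam Gp GG) f).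
Proof.
move=> hinv; have [w [Dw _] hw] := regular_of_infinity hinv.
move: hinv => [L hinf hL].
move=> [J [pJ [bA sA] [bGam adj] rep _]].
have [jh jp [k [e [pt [c c0 hc]]]]] := pontryagin_pont pJ.
set s := sf _ e in hc; have sh : is_herm s := pt_sh pt; have sp : is_psd s := hb_p (pt_hilb pt).
have i1 : bop s (jform f J) id by exists c => x; have [] := hc x.
have i2 : bop (jform f J) s id by exists c => x; have [] := hc x.
have {}bA : bop s s A.
  move/bounded_opE: bA => bA; exact: bop_comp (bop_comp i1 (bA jh jp jh jp)) i2.
have {}bGam : bop d s Gam.
  by move/bounded_opE: bGam => bG; exact: bop_comp (bG dh dp jh jp) i2.
have {}rep z : D z -> exists2 S : {linear K -> K}, rsv (fun x y => f x y) e A z S &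
    forall h, Q z h = Gp (S (Gam h)).
  move=> Dz; have [S hS QS] := rep z Dz; exists S => //.
  move/bounded_inverseE: hS => /(_ jh jp jh jp) /binv_bop[q1 q2 q3].
  by apply/binv_bop; split=> //; exact: bop_comp (bop_comp i1 q3) i2.
have bGp : bop s d Gp := bGp hH pt bGam adj.
(* With S the resolvent at z, z S Gam = A S Gam - Gam. Applying Gp along z = iu in D, the left side
   tends to L, while S Gam tends to 0 as soon as u exceeds the norm bound of A by 1/b. *)
have GL h : Gp (Gam h) = - L h.
  apply/eqP; rewrite -subr_eq0 opprK; apply/eqP/(hb_d (dot_hilb hH)).
  apply: le_anti; rewrite nrm_ge0 andbT.
  have [MA MA0 hA] := bop_pos bA; have [MG MG0 hG] := bop_pos bGp.
  apply: (@le_eps_mul _ _ _ (nrm d h + MG * (MA * nrm s (Gam h)))) => b b0; rewrite add0r.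
  have [t t0 ht] := infinity_lim hinf b0.
  have [u ut Du] := exists_high hH hQ (Num.max t (MA + b^-1)).
  have [tu bu] : t < u /\ MA + b^-1 < u by move: ut; rewrite gt_max => /andP[].
  have cu : cn (iy u) = u by rewrite cn_iy // ltW // (lt_trans t0).
  have [S [MS [q1 q2 q3]] QS] := rep _ Du.
  have h1 : nrm d (iy u *: Q (iy u) h - L h) <= b * nrm d h by apply: ht => //; rewrite cu.
  have e1 : iy u *: S (Gam h) = A (S (Gam h)) - Gam h.
    by rewrite -{3}(q2 (Gam h)) opprB addrC subrK.
  have e2 : Gp (Gam h) + L h = Gp (A (S (Gam h))) - (iy u *: Q (iy u) h - L h).
    have -> : iy u *: Q (iy u) h = Gp (A (S (Gam h))) - Gp (Gam h).
      by rewrite QS -(linZ (lin_linear Gp)) e1 (linB (lin_linear Gp)).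
    move: (Gp (A _)) (Gp (Gam h)) (L h) => p q l.
    by rewrite opprB opprB [RHS]addrC -addrA subrK addrC.
  rewrite e2; apply: le_trans (nrmB dh dp _ _) _.
  have n0 := nrm_ge0 s (S (Gam h)).
  have h2 : nrm s (S (Gam h)) <= b * nrm s (Gam h).
    have h3 : u * nrm s (S (Gam h)) <= MA * nrm s (S (Gam h)) + nrm s (Gam h).
      rewrite -{1}cu -(nrmZ sh) e1; apply: le_trans (nrmB sh sp _ _) _.
      by rewrite lerD2r.
    have bV : 0 < b^-1 by rewrite invr_gt0.
    rewrite -[leLHS](mulKf (lt0r_neq0 bV)) invrK; apply: ler_wpM2l; first exact: ltW.
    have h4 : b^-1 * nrm s (S (Gam h)) <= (u - MA) * nrm s (S (Gam h)).
      by apply: ler_wpM2r => //; lra.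
    by rewrite mulrBl in h4; lra.
  have h5 : nrm d (Gp (A (S (Gam h)))) <= MG * (MA * (b * nrm s (Gam h))).
    apply: le_trans (hG _) _; apply: ler_wpM2l => //; apply: le_trans (hA _) _.
    exact: ler_wpM2l.
  have -> : (nrm d h + MG * (MA * nrm s (Gam h))) * b =
    MG * (MA * (b * nrm s (Gam h))) + b * nrm d h by ring.
  exact: lerD.
have [Li /(bounded_inverseE _ _ dh dp dh dp) /binv_bop[l1 l2 [ML bL]]] := hL.
have [|GG GE] := @linear_of _ _ _ (fun h => - Li h).
  by move=> a x y; rewrite (lin_linear Li) opprD scalerN.
have g1 : cancel (Gp \o Gam) GG by move=> x; rewrite /= GE GL linearN opprK l1.
have g2 : cancel GG (Gp \o Gam) by move=> x; rewrite /= GL GE linearN opprK l2.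
have bG : bop d d GG by exists ML => x; rewrite GE (nrmN dh).
exists GG; first by apply/bounded_inverseE => //; apply/binv_bop.
apply: (schur_inverse hH pt bA sA bGam adj bG g1 g2 rep).
by exists w.
Qed.
End NearInfinity.

(** * From the inverse function to the function *)

Section InverseFamilies.
Context (R : realType).
Local Notation C := (Cplx R).

Definition hd (V W : lmodType C) (s : V -> V -> C) (t : W -> W -> C) (F : C -> V -> W) z
    (F' : V -> W) := forall b : R, 0 < b -> exists2 r : R, 0 < r & forall w, cn (w - z) < r ->
  forall x, nrm t (F w x - F z x - (w - z) *: F' x) <= b * cn (w - z) * nrm s x.

Section Inverse.
Context (V W : lmodType C) (s : V -> V -> C) (t : W -> W -> C).
Context (hs : is_herm s) (ps : is_psd s) (ht : is_herm t) (pt : is_psd t).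

(* S(w) - S(z) = - S(w) (T(w) - T(z)) S(z) *)
Lemma hd_inverse (T : C -> V -> W) (S : C -> {linear W -> V}) z (T' : {linear V -> W}) (M r : R) :
  0 <= M -> 0 < r ->
  (forall w, cn (w - z) < r -> [/\ cancel (T w) (S w), cancel (S w) (T w) &
    forall y, nrm s (S w y) <= M * nrm t y]) ->
  bop s t T' -> hd s t T z T' ->
  hd t s (fun w => S w) z (fun y => - S z (T' (S z y))).
Proof.
move=> M0 r0 hS /bop_pos[MT MT0 hMT] hT b b0.
have c0 : 0 < 2 * (M * M + 1) by have := mulr_ge0 M0 M0; lra.
have [r1 r10 h1] := hT (b / (2 * (M * M + 1))) (divr_gt0 b0 c0).
have [r3 r30 h3] := hT 1 ltr01.
pose q := M * (MT + 1) * M * MT * M.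
have q0 : 0 <= q by rewrite /q !mulr_ge0 // addr_ge0.
have q1 : 0 < 2 * (q + 1) by lra.
have [m [m0 mr m1 m3]] := exists_below r0 r10 r30.
have [p [p0 pm pq _]] := exists_below m0 (divr_gt0 b0 q1) m0.
exists p => // w wp y.
have wm := lt_trans wp pm.
have [w1 w2 w3] := hS w (lt_trans wm mr).
have [|z1 z2 z3] := hS z; first by rewrite subrr cn0.
have zero0 := cn_ge0 (w - z); have y0 := nrm_ge0 t y.
pose x := S z y.
have Nx : nrm s x <= M * nrm t y := z3 y.
have dS u : S w (T z (S z u)) = S w u by rewrite z2.
have diff u : S w u - S z u = - S w (T w (S z u) - T z (S z u)).
  by rewrite linearB /= w1 z2 opprB.
have TD u : nrm t (T w u - T z u) <= (MT + 1) * cn (w - z) * nrm s u.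
  have h4 := h3 w (lt_trans wm m3) u.
  have h5 := nrmDl ht pt (T w u - T z u) ((w - z) *: T' u); rewrite (nrmZ ht) in h5.
  have h6 := ler_wpM2l zero0 (hMT u).
  have -> : (MT + 1) * cn (w - z) * nrm s u = cn (w - z) * (MT * nrm s u) + 1 * cn (w - z) * nrm s u.
    by ring.
  by move: h4 h5 h6; move: (nrm t _) (nrm t _) (cn _ * _) => x1 x2 x3; lra.
(* Separates the first-order remainder of T from the change of S between z and w acting on T' x. *)
have E : S w y - S z y - (w - z) *: - S z (T' x) =
    - S w (T w x - T z x - (w - z) *: T' x) - (w - z) *: (S w (T' x) - S z (T' x)).
  rewrite diff -/x [S w (_ - (w - z) *: _)](linB (lin_linear (S w))).
  rewrite [S w (_ *: _)](linZ (lin_linear (S w))).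
  move: (S w (T w x - T z x)) (S w (T' x)) (S z (T' x)) => A1 A2 A3.
  by rewrite scalerN opprK scalerBr !opprB [RHS]addrC addrA subrK addrC.
rewrite E; apply: le_trans (nrmB hs ps _ _) _; rewrite (nrmN hs) (nrmZ hs).
have k1 : nrm s (S w (T w x - T z x - (w - z) *: T' x)) <= b / 2 * cn (w - z) * nrm t y.
  apply: le_trans (w3 _) _.
  have h4 := h1 w (lt_trans wm m1) x.
  have h5 := ler_wpM2l M0 h4.
  apply: le_trans h5 _.
  have bc : 0 <= b / (2 * (M * M + 1)) * cn (w - z) by rewrite mulr_ge0 // ltW // divr_gt0.
  have h6 := ler_wpM2l M0 (ler_wpM2l bc Nx).
  apply: le_trans h6 _.
  have -> : M * (b / (2 * (M * M + 1)) * cn (w - z) * (M * nrm t y)) =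
      b / 2 * cn (w - z) * nrm t y * (M * M / (M * M + 1)).
    by field; rewrite gt_eqF //; have := mulr_ge0 M0 M0; lra.
  rewrite -[leRHS]mulr1; apply: ler_wpM2l.
    by rewrite !mulr_ge0 ?invr_ge0 // ltW.
  by have := mulr_ge0 M0 M0; rewrite ler_pdivrMr; lra.
have k2 : nrm s (S w (T' x) - S z (T' x)) <= q * cn (w - z) * nrm t y.
  rewrite diff (nrmN hs); apply: le_trans (w3 _) _.
  have h4 := TD (S z (T' x)); have h5 := z3 (T' x); have h6 := hMT x.
  have c1 : 0 <= (MT + 1) * cn (w - z) by rewrite mulr_ge0 // addr_ge0.
  have h7 := ler_wpM2l M0 h6.
  have h8 := ler_wpM2l (mulr_ge0 M0 MT0) Nx.
  have h9 : nrm s (S z (T' x)) <= M * MT * M * nrm t y.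
    by apply: le_trans h5 _; apply: le_trans h7 _; rewrite mulrA; apply: le_trans h8 _; rewrite !mulrA.
  have h10 := ler_wpM2l M0 (le_trans h4 (ler_wpM2l c1 h9)).
  by apply: le_trans h10 _; rewrite le_eqVlt; apply/orP; left; apply/eqP; rewrite /q; ring.
have k3 : cn (w - z) * nrm s (S w (T' x) - S z (T' x)) <= cn (w - z) * (b / 2 * nrm t y).
  apply: ler_wpM2l => //; apply: le_trans k2 _; apply: ler_wpM2r => //.
  have h4 : q * cn (w - z) <= q * p by apply: ler_wpM2l => //; exact: ltW.
  rewrite ltr_pdivlMr // in pq.
  have -> : b / 2 = (b + b) / 4 by field.
  nra.
have -> : b * cn (w - z) * nrm t y = b / 2 * cn (w - z) * nrm t y + cn (w - z) * (b / 2 * nrm t y).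
  by field.
exact: lerD.
Qed.
End Inverse.
End InverseFamilies.

Lemma increment_sum (V : zmodType) (p1 p2 p3 p4 p5 p6 : V) :
  p1 + p4 + p5 - (p2 + p4 + p6) - (p3 + (p5 - p6)) = p1 - p2 - p3.
Proof.
rewrite [- (p2 + p4 + p6)]opprD [p1 + p4 + p5 + _]addrACA [- (p2 + p4)]opprD.
by rewrite [p1 + p4 + _]addrACA [p4 - p4]subrr addr0 [- (p3 + _)]opprD [LHS]addrACA [X in _ + X]subrr addr0.
Qed.

(** * Invertibility of Q and its extension to infinity *)

Section Converse.
Context (R : realType).
Local Notation C := (Cplx R).
Context (H : lmodType C) (dot : {dot H for conjC}) (hH : hilbert dot) (kappa : nat).
Context (D : set C) (Q : C -> {linear H -> H}) (hQ : Nclass dot kappa D Q).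
Local Notation d := (fun x y : H => dot x y).
Local Notation G := (upper_dom D).
Local Notation nH := (fnorm dot).
Let dh : is_herm d := hb_h (dot_hilb hH).
Let dp : is_psd d := hb_p (dot_hilb hH).
Let hd' : hilb d := dot_hilb hH.

Definition invertible (T : H -> H) := exists (S : {linear H -> H}) (M : R), binv d d T S M.

Lemma invertibleE (T : H -> H) : boundedly_invertible nH nH T <-> invertible T.
Proof.
split=> -[S hS]; exists S; first exact: (bounded_inverseE T S dh dp dh dp).1 hS.
exact: (bounded_inverseE T S dh dp dh dp).2 hS.
Qed.

(** The bounded inverse of Q z bounds its adjoint from below, and injectivity of Q z gives the range
    of the adjoint a trivial orthogonal complement, so [onto_of] applies. *)
Lemma invertible_adjoint z : D z -> invertible (Q z) -> invertible (Q z^*).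
Proof.
move=> Dz [S [M [c1 c2 hM]]]; have [Dz' ad] := N_symmetric hQ Dz.
pose M1 := `|M| + 1; have M10 : 0 < M1 by rewrite ltr_wpDl.
have hM1 x : nrm d (S x) <= M1 * nrm d x.
  apply: le_trans (hM x) _; apply: ler_wpM2r; first exact: nrm_ge0.
  by have := ler_norm M; rewrite /M1; lra.
have low x : M1^-1 * nrm d x <= nrm d (Q z^* x).
  rewrite ler_pdivrMl //; have [->|n0] := eqVneq (nrm d x) 0.
    by rewrite mulr_ge0 ?nrm_ge0 // ltW.
  have n1 : 0 < nrm d x by rewrite lt_def n0 nrm_ge0.
  rewrite -(ler_pM2r n1) -expr2 (nrm2 dp) -{2}(c2 x) -ad.
  apply: le_trans (re_le_cn _) _; apply: le_trans (cauchy_schwarz dh dp _ _) _.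
  rewrite mulrC [leRHS]mulrAC; apply: ler_wpM2r; [exact: nrm_ge0 | exact: hM1].
have [M2 hM2] := hol_bounded hH (N_holomorphic hQ) Dz'.
have M1V : 0 < M1^-1 by rewrite invr_gt0.
have onto y : exists x, Q z^* x = y.
  apply: (onto_of hd' hd' (lin_linear (Q z^*)) M1V low hM2) => w hw.
  have Qw : Q z w = 0.
    apply: (dot_ext hH) => g; rewrite (dotJ hH) -ad [dot (Q z^* g) w]hw conj0.
    exact/esym/(dot0l hH).
  by rewrite -(c1 w) Qw linear0.
have [S' hS'] := binv_of dh dp (hb_d hd') dh (lin_linear (Q z^*)) M1V low onto.
by exists S', (M1^-1^-1).
Qed.

Lemma invertible_near z : D z -> invertible (Q z) -> exists2 r : R, 0 < r &
  forall w, cn (w - z) < r -> D w /\ invertible (Q w).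
Proof.
move=> Dz [S [M hS]]; have [r0 r00 hr0] := hol_open hH (N_holomorphic hQ) Dz.
have [ML [r1 [ML0 r10 hr1]]] := hol_lip hH (N_holomorphic hQ) Dz.
pose M1 := `|M| + 1; have M10 : 0 < M1 by rewrite ltr_wpDl.
have hS1 : binv d d (Q z) S M1.
  case: hS => c1 c2 hM; split=> // x; apply: le_trans (hM x) _.
  apply: ler_wpM2r; first exact: nrm_ge0.
  by have := ler_norm M; rewrite /M1; lra.
have e0 : 0 < (2 * M1 * (ML + 1))^-1 by rewrite invr_gt0 !mulr_gt0 //; lra.
have [m [m0 mr m1 me]] := exists_below r00 r10 e0.
exists m => // w wm; split; first exact/hr0/(lt_trans wm).
have lE : lin (fun x => Q w x - Q z x).
  move=> a x y; rewrite (lin_linear (Q w)) (lin_linear (Q z)) opprD addrACA.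
  by rewrite scalerBr.
have Mb : M1 * (ML * cn (w - z)) <= 2^-1.
  have pos : 0 < 2 * M1 * (ML + 1) by rewrite !mulr_gt0 //; lra.
  have := lt_trans wm me; rewrite -[X in _ < X]div1r ltr_pdivlMr // => h1.
  have h2 := mulr_ge0 (ltW M10) (cn_ge0 (w - z)).
  have -> : M1 * (ML * cn (w - z)) = (cn (w - z) * (2 * M1 * (ML + 1))) / 2 - M1 * cn (w - z).
    by field.
  lra.
have [S' [c1 c2 hS']] := binv_perturb hd' dh dp (lin_linear (Q z)) lE (ltW M10) hS1
  (hr1 w (lt_trans wm m1)) Mb.
exists S', (2 * M1 + 1); split=> // [x|y].
  by have := c1 x; rewrite addrC subrK.
by have := c2 y; rewrite addrC subrK.
Qed.

Section Representation.
Context (K : lmodType C) (f : K -> K -> C) (k : nat) (e : 'I_k -> K).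
Context (A : {linear K -> K}) (Gam : {linear H -> K}) (Gp : {linear K -> H}).
Context (S0 G0 Gi : {linear H -> H}).
Local Notation s := (sf f e).
Hypothesis pt : pont f e.
Hypothesis bA : bop s s A.
Hypothesis sA : forall x y, f (A x) y = f x (A y).
Hypothesis bGam : bop d s Gam.
Hypothesis bGp : bop s d Gp.
Hypothesis bS0 : bop d d S0.
Hypothesis bG0 : bop d d G0.
Hypothesis bGi : bop d d Gi.
Hypothesis Gi1 : cancel G0 Gi.
Hypothesis Gi2 : cancel Gi G0.
Hypothesis rep : forall z (Qi : {linear H -> H}) (M : R), D z -> binv d d (Q z) Qi M ->
  exists2 S : {linear K -> K}, rsv f e A z S &
    forall h, - Qi h = Gp (S (Gam h)) + S0 h + z *: G0 h.
Let sh : is_herm s := pt_sh pt.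
Let sp : is_psd s := hb_p (pt_hilb pt).

(** Near a point of the resolvent set the representation bounds the inverse of Q w by a constant
    [M2] independent of w. Then Q z is a small perturbation of Q w for w close to z, hence
    invertible. *)
Lemma invertible_closed z S : D z -> rsv f e A z S -> exists2 r : R, 0 < r &
  forall w, D w -> cn (w - z) < r -> invertible (Q w) -> invertible (Q z).
Proof.
move=> Dz [MS [c1 c2 hMS]].
have [ML [r1 [ML0 r10 hr1]]] := hol_lip hH (N_holomorphic hQ) Dz.
pose M1 := `|MS| + 1; have M10 : 0 < M1 by rewrite ltr_wpDl.
have hS1 : binv s s (fun x => A x - z *: x) S M1.
  split=> // x; apply: le_trans (hMS x) _; apply: ler_wpM2r; first exact: nrm_ge0.
  by have := ler_norm MS; rewrite /M1; lra.
have [a a0 ha] := bop_pos bGam; have [b b0 hb] := bop_pos bGp.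
have [s1 s10 hs1] := bop_pos bS0; have [g g0 hg] := bop_pos bG0.
pose M2 := b * ((2 * M1 + 1) * a) + s1 + (cn z + 1) * g.
have M20 : 0 <= M2.
  have k0 : 0 <= 2 * M1 + 1 by lra.
  have z0 : 0 <= cn z + 1 by rewrite addr_ge0 // cn_ge0.
  by apply: addr_ge0; [apply: addr_ge0 => //; rewrite !mulr_ge0 | rewrite mulr_ge0].
have q0 : 0 < (2 * M2 * ML + 1)^-1 by rewrite invr_gt0 ltr_wpDl // !mulr_ge0.
have q1 : 0 < (2 * M1)^-1 by rewrite invr_gt0 mulr_gt0.
have [m [m0 mr m1 mq]] := exists_below r10 q1 q0.
exists (Num.min m 1) => [|w Dw]; first by rewrite lt_min m0 ltr01.
rewrite lt_min => /andP[wm w1] [Qi [MQ hQi]].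
have [S' [MS' [d1 d2 hMS']] hRep] := rep Dw hQi.
have Nx0 := nrm_ge0 (V := K) s.
have bS' x : nrm s (S' x) <= (2 * M1 + 1) * nrm s x.
  have lE : lin (fun x : K => (z - w) *: x).
    by move=> c x1 x2; rewrite scalerDr !scalerA mulrC.
  have hE x1 : nrm s ((z - w) *: x1) <= (2 * M1)^-1 * nrm s x1.
    by rewrite (nrmZ sh) cnBC; apply: ler_wpM2r => //; exact/ltW/(lt_trans wm).
  have Mq : M1 * (2 * M1)^-1 <= 2^-1.
    by rewrite ler_pdivrMr ?mulr_gt0 //; lra.
  have [T [e1 e2 e3]] := binv_perturb (pt_hilb pt) sh sp (lin_sub_scale z (lin_linear A)) lE
    (ltW M10) hS1 hE Mq.
  have <- : T x = S' x.
    rewrite -{1}(d2 x); rewrite -[RHS]e1; congr (T _).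
    by rewrite scalerBl addrA subrK.
  exact: e3.
have bQi h : nrm d (Qi h) <= M2 * nrm d h.
  rewrite -(nrmN dh) hRep; apply: le_trans (nrmD dh dp _ _) _.
  rewrite (nrmZ dh) [M2 * _]mulrDl; apply: lerD.
    apply: le_trans (nrmD dh dp _ _) _; rewrite mulrDl; apply: lerD => //.
    apply: le_trans (hb _) _; rewrite -mulrA; apply: ler_wpM2l => //.
    apply: le_trans (bS' _) _; rewrite -mulrA; apply: ler_wpM2l; last exact: ha.
    by have := M10; lra.
  rewrite -mulrA; apply: ler_pM => //; [exact: cn_ge0 | exact: nrm_ge0 |].
  by have := cnDl w z; lra.
have lE : lin (fun x => Q z x - Q w x).
  move=> c x y; rewrite (lin_linear (Q w)) (lin_linear (Q z)) opprD addrACA.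
  by rewrite scalerBr.
have hE x : nrm d (Q z x - Q w x) <= ML * cn (w - z) * nrm d x.
  by rewrite (nrmBC dh); exact: hr1 w (lt_trans wm mr) x.
have Mb : M2 * (ML * cn (w - z)) <= 2^-1.
  have pos : 0 < 2 * M2 * ML + 1 by rewrite ltr_wpDl // !mulr_ge0.
  have := lt_trans wm mq; rewrite -[X in _ < X]div1r ltr_pdivlMr // => h1.
  have -> : M2 * (ML * cn (w - z)) = (cn (w - z) * (2 * M2 * ML + 1)) / 2 - cn (w - z) / 2.
    by field.
  by have := cn_ge0 (w - z); lra.
have hQi2 : binv d d (Q w) Qi M2 by case: hQi.
have [S2 [k1 k2 k3]] := binv_perturb hd' dh dp (lin_linear (Q w)) lE M20 hQi2 hE Mb.
exists S2, (2 * M2 + 1); split=> // [x|y].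
  by have := k1 x; rewrite addrC subrK.
by have := k2 y; rewrite addrC subrK.
Qed.

(** Away from the isolated eigenvalues of A and singularities of Q, invertibility is open by
    [invertible_near] and closed by [invertible_closed], so [continuation] spreads it. *)
Lemma invertible_upper : (exists2 z, D z & invertible (Q z)) ->
  forall z, G z -> eigen_free A z -> invertible (Q z).
Proof.
move=> [z1 Dz1 iz1] z Gz fz.
pose O w := G w /\ eigen_free A w.
have punct w : 0 < im w -> exists2 r : R, 0 < r & forall v, v != w -> cn (v - w) < r ->
    O v /\ 0 < im v.
  move=> w0; have [r1 r10 h1] := punctured_upper hH hQ w0.
  have [r2 r20 h2] := eigen_isolated pt (lin_linear A) sA w0.
  exists (Num.min r1 r2) => [|v vw]; first by rewrite lt_min r10.
  rewrite lt_min => /andP[v1 v2]; have [Gv v0] := h1 v vw v1.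
  by split=> //; split=> //; have [] := h2 v vw v2.
have locW : locconst (fun w => O w /\ 0 < im w) (fun w => invertible (Q w)).
  move=> w [[[Dw w0] fw] _]; have [MA hA] := bA.
  have wn0 : im w != 0 by rewrite gt_eqF.
  have [S hS] := resolvent_of_injective pt (lin_linear A) hA sA wn0 fw.
  have [r1 r10 h1] := invertible_closed Dw hS.
  have [iw|niw] := pselect (invertible (Q w)).
    have [r2 r20 h2] := invertible_near Dw iw; exists r2 => // v _ vr.
    by have [_ ?] := h2 v vr.
  exists r1 => // v [[[Dv _] _] _] vr; split=> // iv.
  exact: h1 v Dv vr iv.
have start : exists2 w, G w & invertible (Q w).
  have [i0|i0|i0] := ltrgt0P (im z1).
  - by exists z1.
  - exists z1^*; last exact: invertible_adjoint.
    by split; [exact: (N_symmetric hQ Dz1).1 | rewrite imJ; lra].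
  have [r r0 hr] := invertible_near Dz1 iz1; have r2 : 0 < r / 2 by lra.
  have [|Dw iw] := hr (z1 + iy (r / 2)).
    by rewrite addrAC subrr add0r cn_iy ?(ltW r2) //; lra.
  by exists (z1 + iy (r / 2)) => //; split=> //; rewrite imD i0 add0r im_mkc.
(* The starting point may be an eigenvalue of A, so it is moved up slightly to one that is not. *)
have [w1 Gw1 iw1] := start.
have [r1 r10 h1] := punct _ Gw1.2; have [r2 r20 h2] := invertible_near Gw1.1 iw1.
have [m [m0 mr1 mr2 _]] := exists_below r10 r20 r20.
have E : w1 + iy m - w1 = iy m by rewrite addrAC subrr add0r.
have cE : cn (w1 + iy m - w1) = m by rewrite E cn_iy // ltW.
have ne : w1 + iy m != w1 by rewrite -subr_eq0 E iy_neq0.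
have [Ov v0] : O (w1 + iy m) /\ 0 < im (w1 + iy m) by apply: h1; rewrite ?cE.
have [_ iv] : D (w1 + iy m) /\ invertible (Q (w1 + iy m)) by apply: h2; rewrite cE.
exact: (continuation punct locW Ov v0 (conj Gz fz) Gz.2 iv).
Qed.

Lemma resolvent_large (MA : R) z : 0 <= MA -> (forall x, nrm s (A x) <= MA * nrm s x) ->
  2 * MA + 2 < cn z -> exists S : {linear K -> K}, binv s s (fun x => A x - z *: x) S 1.
Proof.
move=> MA0 hA zl; have z1 : 0 < cn z by lra.
have z0 : z != 0 by rewrite -cn_gt0.
have [|S SE] := @linear_of _ K K (fun x : K => (- z)^-1 *: x).
  by move=> c x y; rewrite scalerDr !scalerA mulrC.
have lT : lin (fun x : K => - z *: x) by move=> c x y; rewrite scalerDr !scalerA mulrC.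
have nz0 : - z != 0 by rewrite oppr_eq0.
have hS : binv s s (fun x : K => - z *: x) S (cn z)^-1.
  split=> x; rewrite ?SE ?scalerA ?mulVf ?mulfV ?scale1r //.
  by rewrite (nrmZ sh) cnV cnN.
have cz : 0 <= (cn z)^-1 by rewrite invr_ge0 ltW.
have hM : (cn z)^-1 * MA <= 2^-1 by rewrite ler_pdivrMl //; lra.
have [S' [c1 c2 _]] := binv_perturb (pt_hilb pt) sh sp lT (lin_linear A) cz hS hA hM.
have E x : A x - z *: x = - z *: x + A x by rewrite scaleNr addrC.
exists S'; split=> [x|y|y]; rewrite ?E //.
rewrite mul1r; have n0 := nrm_ge0 s (S' y).
have := nrmDl sh sp (z *: S' y) (A (S' y)); rewrite (nrmBC sh) E c2 (nrmZ sh) => h1.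
by have h2 := hA (S' y); nra.
Qed.

(** The right-hand side T z makes sense for all large z. There F z = - (T z)^-1 is holomorphic by
    [hd_inverse], coincides with Q on D, and z F z tends to - Gi. *)
Theorem infinity_of_inverse : (exists2 z, D z & invertible (Q z)) ->
  invertible_derivative_at_infinity dot D Q.
Proof.
move=> hinv.
have [MA MA0 hA] := bop_pos bA.
have [a a0 ha] := bop_pos bGam; have [b b0 hb] := bop_pos bGp.
have [s1 s10 hs1] := bop_pos bS0; have [g g0 hg] := bop_pos bG0.
have [Mi Mi0 hi] := bop_pos bGi.
pose c1 := b * a + s1; have c10 : 0 <= c1 by rewrite addr_ge0 // mulr_ge0.
(* Beyond r the resolvent of A has norm at most 1, so c1 bounds the part of T z other than z G0, and
   z G0 dominates that part by a factor of 2. *)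
pose r := 2 * MA + 2 + 2 * (Mi * c1).
have Mc0 : 0 <= Mi * c1 by rewrite mulr_ge0.
have r0 : 0 < r by rewrite /r; lra.
have rA z : r < cn z -> 2 * MA + 2 < cn z by rewrite /r; lra.
(* The identity is a default inside the disc of radius r. *)
have exR z : exists S : {linear K -> K}, r < cn z -> binv s s (fun x => A x - z *: x) S 1.
  have [/rA zr|zr] := ltP r (cn z); last by exists idfun.
  by have [S hS] := resolvent_large MA0 hA zr; exists S.
have [Rz hRz] := choice exR.
have exT z : exists T : {linear H -> H}, forall h, T h = Gp (Rz z (Gam h)) + S0 h + z *: G0 h.
  apply: linear_of => c x y; rewrite (lin_linear Gam) (lin_linear (Rz z)) (lin_linear Gp).
  rewrite (lin_linear S0) (lin_linear G0) !scalerDr !scalerA [z * c]mulrC.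
  by rewrite [_ + _ + (_ *: S0 _ + _)]addrACA [LHS]addrACA.
have [T hT] := choice exT.
have bE z h : r < cn z -> nrm d (Gp (Rz z (Gam h)) + S0 h) <= c1 * nrm d h.
  move=> zr; have [_ _ h3] := hRz z zr; apply: le_trans (nrmD dh dp _ _) _.
  rewrite mulrDl; apply: lerD => //; apply: le_trans (hb _) _; rewrite -mulrA.
  by apply: ler_wpM2l => //; apply: le_trans (h3 _) _; rewrite mul1r.
have exI z : exists S : {linear H -> H}, r < cn z -> binv d d (T z) S (2 * Mi / cn z).
  have [zr|zr] := ltP r (cn z); last by exists idfun.
  have z1 : 0 < cn z by exact: lt_trans r0 zr.
  have z0 : z != 0 by rewrite -cn_gt0.
  have [|S SE] := @linear_of _ _ _ (fun x : H => z^-1 *: Gi x).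
    by move=> c x y; rewrite (lin_linear Gi) scalerDr !scalerA mulrC.
  have lT : lin (fun x : H => z *: G0 x).
    by move=> c x y; rewrite (lin_linear G0) scalerDr !scalerA mulrC.
  have hS : binv d d (fun x : H => z *: G0 x) S (Mi / cn z).
    split=> x.
    - by rewrite SE (linZ (lin_linear Gi)) Gi1 scalerA mulVf // scale1r.
    - by rewrite SE (linZ (lin_linear G0)) Gi2 scalerA mulfV // scale1r.
    - rewrite SE (nrmZ dh) cnV mulrC mulrAC; apply: ler_wpM2r => //.
      by rewrite invr_ge0 ltW.
  have lE : lin (fun h => Gp (Rz z (Gam h)) + S0 h).
    move=> c x y; rewrite (lin_linear Gam) (lin_linear (Rz z)) (lin_linear Gp) (lin_linear S0).
    by rewrite scalerDr addrACA.
  have cz : 0 <= Mi / cn z by rewrite divr_ge0 // ltW.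
  have hM : Mi / cn z * c1 <= 2^-1.
    by rewrite mulrAC ler_pdivrMr //; move: zr; rewrite /r; lra.
  have [S' [q1 q2 _]] := binv_perturb hd' dh dp lT lE cz hS (fun h => bE z h zr) hM.
  have E x : T z x = z *: G0 x + (Gp (Rz z (Gam x)) + S0 x) by rewrite hT addrC.
  exists S' => _; split=> [x|y|y]; rewrite ?E //.
  have n0 := nrm_ge0 d (S' y).
  have h1 := nrmDl dh dp (z *: G0 (S' y)) (z *: G0 (S' y) - y).
  rewrite opprB [_ *: _ + (y - _)]addrC subrK (nrmZ dh) in h1.
  have h2 : nrm d (z *: G0 (S' y) - y) <= c1 * nrm d (S' y).
    rewrite -{2}(q2 y) opprD addrA subrr add0r (nrmN dh); exact: bE.
  have h3 := hi (G0 (S' y)); rewrite Gi1 in h3.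
  rewrite mulrAC ler_pdivlMr //.
  have h4 := ler_wpM2l Mi0 (le_trans h1 (lexx _)).
  have h5 : Mi * (c1 * nrm d (S' y)) <= cn z / 2 * nrm d (S' y).
    by rewrite mulrA; apply: ler_wpM2r => //; move: zr; rewrite /r; lra.
  have h6 := ler_wpM2l (ltW z1) h3.
  have h7 := ler_wpM2l Mi0 h2.
  move: h4 h5 h6 h7; rewrite mulrBr.
  move: (nrm d _) (nrm d (G0 _)) (nrm d y) (nrm d (S' y)) (cn z) => x4 x3 x2 x1 x5.
  have -> : Mi * (x5 * x3) = x5 * (Mi * x3) by ring.
  nra.
have [Ri hRi] := choice exI.
have exF z : exists F : {linear H -> H}, forall h, F h = - Ri z h.
  by apply: linear_of => c x y; rewrite (lin_linear (Ri z)) opprD scalerN.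
have [F hF] := choice exF.
have ball z : r < cn z -> exists2 p : R, 0 < p & forall w, cn (w - z) < p -> r < cn w.
  move=> zr; exists (cn z - r) => [|w]; first by lra.
  by have := cnDl z w; rewrite cnBC; lra.
(* Upper half-plane: there are no eigenvalues beyond r, so [invertible_upper] applies. Lower: take
   adjoints. Real points: approach from above and use [invertible_closed]. *)
have Qinv z : D z -> r < cn z -> invertible (Q z).
  have up w : G w -> r < cn w -> invertible (Q w).
    move=> Gw wr; apply: (invertible_upper hinv Gw) => x hx.
    have [q1 _ _] := hRz w wr.
    by rewrite -(q1 x) hx linear0.
  move=> Dz zr; have [i0|i0|i0] := ltrgt0P (im z).
  - by apply: up.
  - rewrite -[z]conjCK; apply: invertible_adjoint; first exact: (N_symmetric hQ Dz).1.
    apply: up; last by rewrite cnJ.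
    by split; [exact: (N_symmetric hQ Dz).1 | rewrite imJ; lra].
  have hr : rsv f e A z (Rz z) by exists 1; exact: hRz.
  have [p p0 hp] := invertible_closed Dz hr.
  have [q q0 hq] := hol_open hH (N_holomorphic hQ) Dz.
  have [t t0 ht] := ball z zr.
  have [m [m0 mp mq mt]] := exists_below p0 q0 t0.
  have cE : cn (z + iy m - z) = m by rewrite addrAC subrr add0r cn_iy // ltW.
  have Dw : D (z + iy m) by apply: hq; rewrite cE.
  apply: (hp (z + iy m) Dw); first by rewrite cE.
  apply: up; last by apply: ht; rewrite cE.
  by split=> //; rewrite imD i0 add0r im_mkc.
have FQ z h : D z -> r < cn z -> F z h = Q z h.
  move=> Dz zr; have [Qi [M hQi]] := Qinv z Dz zr.
  have [S [MS [k1 k2 _]] hS] := rep Dz hQi.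
  have [q1 q2 _] := hRz z zr; have [t1 t2 _] := hRi z zr; have [v1 v2 _] := hQi.
  have TQ y : T z y = - Qi y.
    rewrite hT hS; congr (Gp _ + _ + _).
    by rewrite -{2}(q2 (Gam y)) k1.
  by rewrite hF -[RHS](t1 _) TQ v1 (linN (lin_linear (Ri z))).
have [|N1 N1E] := @linear_of _ K K (fun x : K => - x).
  by move=> c x y; rewrite opprD scalerN.
have hdR z : r < cn z -> hd s s (fun w => Rz w) z (fun y => - Rz z (N1 (Rz z y))).
  move=> zr; have [p p0 hp] := ball z zr.
  apply: (@hd_inverse _ _ _ s s sh sp sh sp (fun w x => A x - w *: x) Rz z N1 1 p) => //.
  - by move=> w wp; have := hRz w (hp w wp).
  - by exists 1 => x; rewrite N1E (nrmN sh) mul1r.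
  move=> c c0; exists 1 => // w _ x; rewrite N1E.
  have -> : A x - w *: x - (A x - z *: x) - (w - z) *: - x = 0.
    rewrite scalerN opprK scalerBl opprB [A x - _ + _]addrC [z *: x - A x + _]addrA subrK.
    by rewrite addrA subrK subrr.
  by rewrite (nrm0 sh) !mulr_ge0 ?cn_ge0 ?nrm_ge0 // ltW.
have exT2 z : exists T2 : {linear H -> H},
    forall h, T2 h = Gp (- Rz z (N1 (Rz z (Gam h)))) + G0 h.
  apply: linear_of => c x y; rewrite (lin_linear Gam) (lin_linear (Rz z)) (lin_linear N1).
  rewrite (lin_linear (Rz z)) opprD -scalerN (lin_linear Gp) (lin_linear G0).
  by rewrite scalerDr addrACA.
have [T2 hT2] := choice exT2.
have hdT z : r < cn z -> hd d d (fun w => T w) z (T2 z).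
  move=> zr c c0; have ab : 0 < b * a + 1 by rewrite ltr_wpDl // mulr_ge0.
  have [p p0 hp] := hdR z zr _ (divr_gt0 c0 ab); exists p => // w wp h.
  have -> : T w h - T z h - (w - z) *: T2 z h =
      Gp (Rz w (Gam h) - Rz z (Gam h) - (w - z) *: - Rz z (N1 (Rz z (Gam h)))).
    rewrite !hT hT2 !(linB (lin_linear Gp)) (linZ (lin_linear Gp)) scalerDr.
    by rewrite [(w - z) *: G0 h]scalerBl increment_sum.
  apply: le_trans (hb _) _; apply: le_trans (ler_wpM2l b0 (hp w wp _)) _.
  have q0 : 0 <= c / (b * a + 1) * cn (w - z) by rewrite mulr_ge0 ?cn_ge0 // ltW // divr_gt0.
  apply: le_trans (ler_wpM2l b0 (ler_wpM2l q0 (ha h))) _.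
  have -> : b * (c / (b * a + 1) * cn (w - z) * (a * nrm d h)) =
    c * cn (w - z) * nrm d h * (b * a / (b * a + 1)) by field; rewrite gt_eqF.
  rewrite -[leRHS]mulr1; apply: ler_wpM2l.
    by rewrite !mulr_ge0 ?cn_ge0 ?nrm_ge0 // ltW.
  by rewrite ler_pdivrMr // mul1r lerDl.
have bT2 z : r < cn z -> bop d d (T2 z).
  move=> zr; have [_ _ h3] := hRz z zr; have bR : bop s s (Rz z) by exists 1.
  exists (b * a + g) => h; rewrite hT2; apply: le_trans (nrmD dh dp _ _) _.
  rewrite mulrDl; apply: lerD => //; apply: le_trans (hb _) _; rewrite -mulrA.
  apply: ler_wpM2l => //; rewrite (nrmN sh); apply: le_trans (h3 _) _; rewrite mul1r N1E (nrmN sh).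
  by apply: le_trans (h3 _) _; rewrite mul1r.
have rV z : r < cn z -> 2 * Mi / cn z <= 2 * Mi / r.
  move=> zr; apply: ler_wpM2l; first by rewrite mulr_ge0.
  have z1 := lt_trans r0 zr; rewrite lef_pV2 ?posrE //; exact: ltW.
have Mr0 : 0 <= 2 * Mi / r by rewrite divr_ge0 ?(ltW r0) // mulr_ge0.
have bRi z : r < cn z -> forall y, nrm d (Ri z y) <= 2 * Mi / r * nrm d y.
  move=> zr y; have [_ _ h3] := hRi z zr; apply: le_trans (h3 y) _.
  by apply: ler_wpM2r; [exact: nrm_ge0 | exact: rV].
have exD z : exists F' : {linear H -> H}, forall h, F' h = Ri z (T2 z (Ri z h)).
  apply: linear_of => c x y.
  by rewrite (lin_linear (Ri z)) (lin_linear (T2 z)) (lin_linear (Ri z)).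
have [F' hF'] := choice exD.
have lr (z : C) : (rc r < `|z|) = (r < cn z) by rewrite normE lt_rc.
have holF : holomorphic_on dot [set z | rc r < `|z|] F.
  apply/(holomorphic_onE hH) => z; rewrite /= lr => zr; split.
  - by have [p p0 hp] := ball z zr; exists p => // w /hp; rewrite /= lr.
  - by exists (2 * Mi / r) => h; rewrite hF (nrmN dh) bRi.
  exists (F' z); split; last first.
    have [M hM] := bop_comp (bop_comp (ex_intro _ _ (bRi z zr)) (bT2 z zr)) (ex_intro _ _ (bRi z zr)).
    by exists M => h; rewrite hF'.
  have [p p0 hp] := ball z zr.
  have hi2 : hd d d (fun w => Ri w) z (fun y => - Ri z (T2 z (Ri z y))).
    apply: (@hd_inverse _ _ _ d d dh dp dh dp (fun w => T w) Ri z (T2 z) (2 * Mi / r) p) => //.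
    - move=> w wp; have [t1 t2 _] := hRi w (hp w wp); split=> //; exact: bRi (hp w wp).
    - exact: bT2.
    - exact: hdT.
  move=> c c0; have [q q0 hq] := hi2 c c0; exists q => // w wq h.
  have -> : F w h - F z h - (w - z) *: F' z h =
      - (Ri w h - Ri z h - (w - z) *: - Ri z (T2 z (Ri z h))).
    by rewrite !hF hF' scalerN !opprK opprD opprB [- Ri w h + _]addrC.
  by rewrite (nrmN dh); exact: hq w wq h.
have [|L LE] := @linear_of _ _ _ (fun h => - Gi h).
  by move=> c x y; rewrite (lin_linear Gi) opprD scalerN.
exists L.
  exists (rc r), F; split=> //.
  - by rewrite -rc0 lt_rc.
  - by move=> z Dz; rewrite lr => zr h; exact: FQ.
  - apply: (proj2 (bounded_opE dh dp dh dp L)); exists Mi => h; rewrite LE (nrmN dh); exact: hi.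
  move=> c c0; have [cc0 cE] : 0 < re c /\ c = rc (re c).
    by split; [move: c0; rewrite lt_cE re0 => /andP[] | exact/ge0_rc/ltW].
  pose q := Mi * (c1 * (2 * Mi)); have q0 : 0 <= q by rewrite !mulr_ge0.
  have q1 : 0 < q / re c + r by rewrite ltr_wpDl // divr_ge0 // ltW.
  exists (rc (q / re c + r + 1)).
    by rewrite lt_rc; have := divr_ge0 q0 (ltW cc0); lra.
  move=> z; rewrite normE lt_rc => zt h.
  have qc := divr_ge0 q0 (ltW cc0).
  have zr : r < cn z by lra.
  have z1 : 0 < cn z by lra.
  rewrite !(fnormE dh dp) cE -rcM le_rc.
  have [t1 t2 h3] := hRi z zr.
  (* Apply Gi to h = T z (Ri z h): the term z G0 reproduces z F z, and what remains is of order
     1/|z| because [Ri] is. *)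
  have -> : z *: F z h - L h = Gi (Gp (Rz z (Gam (Ri z h))) + S0 (Ri z h)).
    rewrite hF LE opprK scalerN -{2}(t2 h) hT (linD (lin_linear Gi)) addrC.
    by rewrite (linZ (lin_linear Gi)) Gi1 addrK.
  apply: le_trans (hi _) _; apply: le_trans (ler_wpM2l Mi0 (bE z _ zr)) _.
  apply: le_trans (ler_wpM2l Mi0 (ler_wpM2l c10 (h3 h))) _.
  have -> : Mi * (c1 * (2 * Mi / cn z * nrm d h)) = q / cn z * nrm d h by rewrite /q; ring.
  apply: ler_wpM2r; first exact: nrm_ge0.
  rewrite ler_pdivrMr // -ler_pdivrMl // mulrC; lra.
have [|L' L'E] := @linear_of _ _ _ (fun h => - G0 h).
  by move=> c x y; rewrite (lin_linear G0) opprD scalerN.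
exists L'; apply: (proj2 (bounded_inverseE L L' dh dp dh dp)); exists g; split=> x.
- by rewrite L'E LE (linN (lin_linear G0)) opprK Gi2.
- by rewrite L'E LE (linN (lin_linear Gi)) opprK Gi1.
- by rewrite L'E (nrmN dh).
Qed.
End Representation.
End Converse.

(** * Translation of the converse to the original definitions, and assembly of the equivalence *)

Theorem infinity_of_representation (R : realType) (H : lmodType (Cplx R))
    (dot : {dot H for conjC}) (hH : hilbert dot) (kappa : nat)
    (D : set (Cplx R)) (Q : Cplx R -> {linear H -> H}) (hQ : Nclass dot kappa D Q)
    (K : lmodType (Cplx R)) (f : {hermitian K for false & conjC}) :
  inverse_representation dot D Q f -> invertible_derivative_at_infinity dot D Q.
Proof.
move=> [[z0 Dz0 iz0] [J [A [Gam [Gp [S [G [pJ [bA sA] [bGam adj] [[bS _] [bG _] [Gi hGi]] rep]]]]]]]].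
pose d (x y : H) := dot x y.
have dh : is_herm d := hb_h (dot_hilb hH); have dp : is_psd d := hb_p (dot_hilb hH).
have [jh jp [k [e [pt [c c0 hc]]]]] := pontryagin_pont pJ.
set s := sf _ e in hc; have sh : is_herm s := pt_sh pt; have sp : is_psd s := hb_p (pt_hilb pt).
have i1 : bop s (jform f J) id by exists c => x; have [] := hc x.
have i2 : bop (jform f J) s id by exists c => x; have [] := hc x.
have {}bA : bop s s A.
  move/bounded_opE: bA => bA; exact: bop_comp (bop_comp i1 (bA jh jp jh jp)) i2.
have {}bGam : bop d s Gam.
  by move/bounded_opE: bGam => bG1; exact: bop_comp (bG1 dh dp jh jp) i2.
have {}bS : bop d d S := (bounded_opE dh dp dh dp S).1 bS.
have {}bG : bop d d G := (bounded_opE dh dp dh dp G).1 bG.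
have /binv_bop[g1 g2 bGi] := (bounded_inverseE G Gi dh dp dh dp).1 hGi.
have bGp1 : bop s d Gp := bGp hH pt bGam adj.
have {}rep z (Qi : {linear H -> H}) (M : R) : D z -> binv d d (Q z) Qi M ->
    exists2 S1 : {linear K -> K}, rsv (fun x y => f x y) e A z S1 &
      forall h, - Qi h = Gp (S1 (Gam h)) + S h + z *: G h.
  move=> Dz hQi; have [|S1 hS1 hf] := rep z Qi Dz.
    by apply: (proj2 (bounded_inverseE (Q z) Qi dh dp dh dp)); exists M.
  exists S1 => //; move/bounded_inverseE: hS1 => /(_ jh jp jh jp) /binv_bop[q1 q2 q3].
  by apply/binv_bop; split=> //; exact: bop_comp (bop_comp i1 q3) i2.
apply: (infinity_of_inverse hH hQ pt bA sA bGam bGp1 bS bG bGi g1 g2 rep).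
by exists z0 => //; exact: (invertibleE hH (Q z0)).1 iz0.
Qed.

Theorem theorem3p3 (R : realType) (H : lmodType (Cplx R))
    (dot : {dot H for conjC}) (hH : hilbert dot) (kappa : nat)
    (D : set (Cplx R)) (Q : Cplx R -> {linear H -> H})
    (hQ : Nclass dot kappa D Q) :
  [/\ (* (i) *)
      invertible_derivative_at_infinity dot D Q <->
        exists (Kt : lmodType (Cplx R)) (ft : {hermitian Kt for false & conjC}),
          inverse_representation dot D Q ft,
      (* (i), continued: a minimal representation (K, A, Gam) of Q exists, and
         for each such, (I - P)K serves as the Pontryagin space above *)
      invertible_derivative_at_infinity dot D Q ->
        (exists (K : lmodType (Cplx R)) (f : {hermitian K for false & conjC})
                (A : {linear K -> K}) (Gam : {linear H -> K})
                (Gp : {linear K -> H}),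
            minimal_representation dot D Q f A Gam Gp) /\
        (forall (K : lmodType (Cplx R)) (f : {hermitian K for false & conjC})
                (A : {linear K -> K}) (Gam : {linear H -> K})
                (Gp : {linear K -> H}),
            minimal_representation dot D Q f A Gam Gp ->
            exists2 GG : {linear H -> H},
              bounded_inverse (fnorm dot) (fnorm dot) (Gp \o Gam) GG &
              inverse_representation dot D Q
                (range_form (coproj Gam Gp GG) f)) &
      (* (ii) *)
      invertible_derivative_at_infinity dot D Q -> regular dot D Q].
Proof.
have rep L : holomorphic_at_infinity dot D Q L -> _ := minimal_of_infinity hH hQ (L := L).
split=> [|hinv|hinv]; last exact (regular_of_infinity hH hQ hinv).
  split=> [hinv|[Kt [ft hr]]]; last exact (infinity_of_representation hH hQ hr).
  have [L hinf _] := hinv; have [K [f [A [Gam [Gp hm]]]]] := rep L hinf.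
  have [GG _ hr] := inverse_of_minimal hH hQ hinv hm.
  by exists (range_space (coproj Gam Gp GG)), (range_form (coproj Gam Gp GG) f).
split; first by have [L hinf _] := hinv; exact (rep L hinf).
by move=> K f A Gam Gp; exact (inverse_of_minimal hH hQ hinv).
Qed.
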